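(* Let $k$ and $N$ be positive integers and let $\chi$ be a Dirichlet character modulo $N$ with $\chi(-1)=(-1)^k$. Let $F \in M_k(\Gamma_0^{(2)}(N),\chi)$. Then $F$ is a Saito-Kurokawa lift (i.e. lies in the Maass Spezialschar of level $N$) if and only if for all $l\in\mathbb{N}$ the symmetry relation \[ \sum_{g \in \Gamma_0(N) \backslash \Delta_N(l)} \chi(g)^{-1}\,\bigl(F\vert_k \widetilde{g}^{\uparrow}\bigr) = \sum_{g \in \Gamma_0(N) \backslash \Delta_N(l)} \chi(g)^{-1}\,\bigl(F\vert_k \widetilde{g}^{\downarrow}\bigr) \qquad ( *_l) \] holds.
   Context: $\Delta_N(l)$ is the set of integral $2\times 2$ matrices $g=\left(\begin{smallmatrix} a&b\\ c&d\end{smallmatrix}\right)$ of determinant $l$ with $N\mid c$ and $(a,N)=1$; $\Gamma_0(N)=\Delta_N(1)$. For such $g$ put $\chi(g):=\overline{\chi(a)}$ (well defined on cosets $\Gamma_0(N)g$). $M_k(\Gamma_0^{(2)}(N),\chi)$ is the space of holomorphic $F$ on the Siegel upper half space $\mathbb{H}_2$ with $F\vert_k\gamma=\chi(\det D)F$ for all $\gamma=\left(\begin{smallmatrix} A&B\\ C&D\end{smallmatrix}\right)\in Sp(2,\mathbb{Z})$ with $C\equiv 0 \pmod N$, where $(F\vert_k\gamma)(Z)=\det(CZ+D)^{-k}F((AZ+B)(CZ+D)^{-1})$. For $g=\left(\begin{smallmatrix} a&b\\ c&d\end{smallmatrix}\right)$, $\widetilde g:=\det(g)^{-1/2}g\in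 SL_2(\mathbb{R})$, and for $h=\left(\begin{smallmatrix} a&b\\ c&d\end{smallmatrix}\right)\in SL_2(\mathbb{R})$ the two embeddings into $Sp(2,\mathbb{R})$ are $h^{\uparrow}=\left(\begin{smallmatrix} a&0&b&0\\0&1&0&0\\ c&0&d&0\\0&0&0&1\end{smallmatrix}\right)$ and $h^{\downarrow}=\left(\begin{smallmatrix} 1&0&0&0\\0&a&0&b\\0&0&1&0\\0&c&0&d\end{smallmatrix}\right)$. The Saito-Kurokawa lift (Ibukiyama) of a Jacobi form $\Phi$ of weight $k$, index $1$, level $N$, character $\chi$ is $c(0)f_{k,\chi}(\tau_1)+\sum_{l\ge1}V_{l,\chi}(\Phi)(\tau_1,z)e^{2\pi i l\tau_2}$, where $V_{l,\chi}(\Phi)=l^{k-1}\sum_{g\in\Gamma_0(N)\backslash\Delta_N(l)}\chi(g)^{-1}\Phi\vert_{k,1}g$ is the index-shift operator, $c(0)$ the constant term of $\Phi$ and $f_{k,\chi}$ an Eisenstein series; its image is the Maass Spezialschar of level $N$. *)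

(* Defs.v *)
From HB Require Import structures.
From mathcomp Require Import all_boot all_order all_algebra.
From mathcomp Require Import complex.
From mathcomp Require Import all_classical all_reals all_analysis.
From mathcomp.analysis.showcase Require Import summability.

Set Implicit Arguments.
Unset Strict Implicit.
Unset Printing Implicit Defensive.

Import Order.TTheory GRing.Theory Num.Theory.
Import numFieldNormedType.Exports.

Local Open Scope classical_set_scope.
Local Open Scope ring_scope.
Local Open Scope complex_scope.

(* The topology of the complex numbers, as a normed space over themselves:
   [complex R] does not get it from the generic instances on [numFieldType]. *)
#[non_forgetful_inheritance]
HB.instance Definition _ (R : realType) := NormedModule.copy R[i] R[i]^o.

Definition mxrows (T : nmodType) (m n : nat) (s : seq (seq T)) : 'M[T]_(m, n) :=
  \matrix_(i, j) nth 0 (nth [::] s i) j.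

(* e(z) = exp(2 pi i z) *)
Definition cexp2pi (R : realType) (z : R[i]) : R[i] :=
  (expR (- (2 * pi * complex.Im z)))%:C *
  (cos (2 * pi * complex.Re z) +i* sin (2 * pi * complex.Re z)).

Definition dirichlet_char (R : realType) (N : nat) (chi : int -> R[i]) : Prop :=
  [/\ chi 1 = 1,
      forall m n, chi (m * n) = chi m * chi n,
      forall m n, (m = n %[mod N])%Z -> chi m = chi n
    & forall m, (chi m != 0) = coprimez m N].

Definition Delta (N l : nat) : set 'M[int]_2 :=
  [set g | [/\ \det g = l%:Z, (N %| g 1%R 0%R)%Z & coprimez (g 0 0) N]].

Definition Gamma0 (N : nat) : set 'M[int]_2 := Delta N 1.

Definition chi_mx (R : realType) (chi : int -> R[i]) (g : 'M[int]_2) : R[i] :=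
  (chi (g 0 0))^*.

(* Gamma0(N) \ Delta_N(l), each element being a coset Gamma0(N) g. *)
Definition cosets (N l : nat) : set (set 'M[int]_2) :=
  [set [set gamma *m g | gamma in Gamma0 N] | g in Delta N l].

(* The sum of [G] over Gamma0(N) \ Delta_N(l).  There are finitely many cosets;
   [xget 0 X] is a chosen representative of the coset [X], and the choice does
   not matter when [G] is invariant under left multiplication by Gamma0(N). *)
Definition coset_sum (R : realType) (N l : nat) (G : 'M[int]_2 -> R[i]) : R[i] :=
  \sum_(X \in cosets N l) G (xget 0 X).

Definition siegel_upper (R : realType) : set 'M[R[i]]_2 :=
  [set Z | Z^T = Z /\
    forall v : 'cV[R]_2, v != 0 ->
      0 < (v^T *m map_mx (@complex.Im R) Z *m v) 0 0].

Definition siegel_mx (R : realType) (t1 z t2 : R[i]) : 'M[R[i]]_2 :=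
  mxrows 2 2 [:: [:: t1; z]; [:: z; t2]].

Definition siegel_slash (R : realType) (k : nat) (F : 'M[R[i]]_2 -> R[i])
    (gamma : 'M[R]_(2 + 2)) (Z : 'M[R[i]]_2) : R[i] :=
  let M := map_mx (real_complex R) gamma in
  let J := dlsubmx M *m Z + drsubmx M in
  (\det J) ^- k * F ((ulsubmx M *m Z + ursubmx M) *m invmx J).

Definition Sp2Z : set 'M[int]_(2 + 2) :=
  let J : 'M[int]_(2 + 2) := block_mx 0 1%:M (- 1%:M) 0 in
  [set gamma | gamma^T *m J *m gamma = J].

Definition siegel_Gamma0 (N : nat) : set 'M[int]_(2 + 2) :=
  [set gamma | Sp2Z gamma /\ forall i j, (N %| dlsubmx gamma i j)%Z].

(* Functions on the Siegel half space are total functions on matrices, of which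
   only the values on [siegel_upper] are meaningful.  Holomorphy is complex
   Frechet differentiability in the three coordinates. *)
Definition siegel_holomorphic (R : realType) (F : 'M[R[i]]_2 -> R[i]) : Prop :=
  forall t1 z t2 : R[i], siegel_upper (siegel_mx t1 z t2) ->
    differentiable
      (fun p : R[i] * R[i] * R[i] => F (siegel_mx p.1.1 p.1.2 p.2))
      (t1, z, t2).

Definition siegel_form (R : realType) (k N : nat) (chi : int -> R[i])
    (F : 'M[R[i]]_2 -> R[i]) : Prop :=
  siegel_holomorphic F /\
  forall gamma, siegel_Gamma0 N gamma -> forall Z, siegel_upper Z ->
    siegel_slash k F (map_mx intr gamma) Z = chi (\det (drsubmx gamma)) * F Z.

Definition tilde (R : realType) (g : 'M[int]_2) : 'M[R]_2 :=
  (Num.sqrt (\det g)%:~R)^-1 *: map_mx intr g.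

Definition embed_up (R : realType) (h : 'M[R]_2) : 'M[R]_(2 + 2) :=
  mxrows 4 4 [:: [:: h 0 0; 0; h 0 1; 0];
                 [:: 0;     1; 0;     0];
                 [:: h 1 0; 0; h 1 1; 0];
                 [:: 0;     0; 0;     1]].

Definition embed_down (R : realType) (h : 'M[R]_2) : 'M[R]_(2 + 2) :=
  mxrows 4 4 [:: [:: 1; 0;     0; 0];
                 [:: 0; h 0 0; 0; h 0 1];
                 [:: 0; 0;     1; 0];
                 [:: 0; h 1 0; 0; h 1 1]].

Definition symmetry_relation (R : realType) (k N : nat) (chi : int -> R[i])
    (F : 'M[R[i]]_2 -> R[i]) (l : nat) : Prop :=
  forall Z, siegel_upper Z ->
    coset_sum N l (fun g =>
      (chi_mx chi g)^-1 * siegel_slash k F (embed_up (tilde R g)) Z) =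
    coset_sum N l (fun g =>
      (chi_mx chi g)^-1 * siegel_slash k F (embed_down (tilde R g)) Z).

Definition jacobi_slash (R : realType) (k m : nat) (Phi : R[i] -> R[i] -> R[i])
    (g : 'M[int]_2) (tau z : R[i]) : R[i] :=
  let a := (g 0 0)%:~R in let b := (g 0 1)%:~R in
  let c := (g 1 0)%:~R in let d := (g 1 1)%:~R in
  let l := (\det g)%:~R in
  (c * tau + d) ^- k *
  cexp2pi (- (m%:R * l * c * z ^+ 2 / (c * tau + d))) *
  Phi ((a * tau + b) / (c * tau + d)) (l * z / (c * tau + d)).

(* Phi(tau, z) is the (unconditionally convergent) sum over n, r in Z of
   c(n, r) e(n tau / h) e(r z). *)
Definition fourier_jacobi_expansion (R : realType) (h : nat)
    (Phi : R[i] -> R[i] -> R[i]) (c : int -> int -> R[i]) : Prop :=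
  forall tau z : R[i], 0 < complex.Im tau ->
    partial_sum (fun nr : int * int =>
        c nr.1 nr.2 * cexp2pi (nr.1%:~R * tau / h%:R + nr.2%:~R * z))
      @ totally --> Phi tau z.

(* Jacobi forms of weight k and index m for Gamma0(N) |x Z^2 with character chi.
   At the cusp attached to M in SL(2, Z), Phi | M has period N in tau, so that
   its expansion runs over n / N, and the condition 4 n m - r^2 >= 0 on the
   exponents becomes N r^2 <= 4 n m. *)
Definition jacobi_form (R : realType) (k m N : nat) (chi : int -> R[i])
    (Phi : R[i] -> R[i] -> R[i]) : Prop :=
  [/\ forall tau z : R[i], 0 < complex.Im tau ->
        differentiable (fun p : R[i] * R[i] => Phi p.1 p.2) (tau, z),
      forall g, Gamma0 N g -> forall tau z : R[i], 0 < complex.Im tau ->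
        jacobi_slash k m Phi g tau z = chi (g 1 1) * Phi tau z,
      forall (la mu : int) (tau z : R[i]), 0 < complex.Im tau ->
        cexp2pi (m%:R * (la%:~R ^+ 2 * tau + 2 * la%:~R * z)) *
          Phi tau (z + la%:~R * tau + mu%:~R) = Phi tau z
    & forall M : 'M[int]_2, \det M = 1 ->
        exists c : int -> int -> R[i],
          fourier_jacobi_expansion N (jacobi_slash k m Phi M) c /\
          forall n r : int, ~~ (N%:Z * r ^+ 2 <= 4 * n * m%:Z) -> c n r = 0].

(* B_0, ..., B_n, with B_1 = -1/2. *)
Fixpoint bernoulli_seq (n : nat) : seq rat :=
  if n is n'.+1 then
    let s := bernoulli_seq n' in
    rcons s (- (n.+1%:R)^-1 * \sum_(j < n) 'C(n.+1, j)%:R * s`_j)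
  else [:: 1].

Definition bernoulli_number (n : nat) : rat := (bernoulli_seq n)`_n.

Definition bernoulli_poly (n : nat) : {poly rat} :=
  \poly_(i < n.+1) ('C(n, i)%:R * bernoulli_number (n - i)).

(* B_{k, chi} = N^(k-1) sum_{a = 1}^N chi(a) B_k(a / N), for chi modulo N,
   primitive or not. *)
Definition gen_bernoulli (R : realType) (k N : nat) (chi : int -> R[i]) : R[i] :=
  N%:R ^+ k.-1 *
  \sum_(1 <= a < N.+1) chi a%:Z * ratr (bernoulli_poly k).[a%:R / N%:R].

Definition sigma_char (R : realType) (k : nat) (chi : int -> R[i]) (n : nat) :
    R[i] :=
  \sum_(d <- divisors n) chi d%:Z * d%:R ^+ k.-1.

(* L(1 - k, chi) / 2 + sum_{n >= 1} sigma_{k-1, chi}(n) e(n tau), where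
   L(1 - k, chi) = - B_{k, chi} / k. *)
Definition eisenstein (R : realType) (k N : nat) (chi : int -> R[i])
    (tau : R[i]) : R[i] :=
  - gen_bernoulli k N chi / (2 * k%:R) +
  limn (fun n => \sum_(1 <= m < n) sigma_char k chi m * cexp2pi (m%:R * tau)).

Definition index_shift (R : realType) (k N : nat) (chi : int -> R[i]) (l : nat)
    (Phi : R[i] -> R[i] -> R[i]) (tau z : R[i]) : R[i] :=
  l%:R ^+ k.-1 *
  coset_sum N l (fun g => (chi_mx chi g)^-1 * jacobi_slash k 1 Phi g tau z).

(* [c0] stands for the constant term c(0) of [Phi]. *)
Definition sk_lift (R : realType) (k N : nat) (chi : int -> R[i]) (c0 : R[i])
    (Phi : R[i] -> R[i] -> R[i]) (t1 z t2 : R[i]) : R[i] :=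
  c0 * eisenstein k N chi t1 +
  limn (fun n => \sum_(1 <= l < n)
    index_shift k N chi l Phi t1 z * cexp2pi (l%:R * t2)).

(* The Fourier coefficients c of a Jacobi form are uniquely determined, so the
   quantification over c only serves to name the constant term c(0). *)
Definition is_sk_lift (R : realType) (k N : nat) (chi : int -> R[i])
    (F : 'M[R[i]]_2 -> R[i]) : Prop :=
  exists (Phi : R[i] -> R[i] -> R[i]) (c : int -> int -> R[i]),
    [/\ jacobi_form k 1 N chi Phi,
        fourier_jacobi_expansion 1 Phi c
      & forall t1 z t2 : R[i], siegel_upper (siegel_mx t1 z t2) ->
          F (siegel_mx t1 z t2) = sk_lift k N chi (c 0 0) Phi t1 z t2].

(* Main.v *)
(* Write F = sum a(n, r, m) e(n t1 + r z + m t2), and A(m, n, r) for a(n, r, m).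
   Representatives of Gamma0(N) \ Delta_N(l) turn the relation at l into
   W_l A(m, n, r) = W_l A(n, m, r) for all (m, n, r), where W_l is a sum over the
   divisors a of l prime to N with terms in A(m, n (l/a) / a, r / a).  Taking
   m = 1 (or n = 1) this says that the Fourier-Jacobi coefficients of F are the
   V_l of the first one, and that a(n, 0, 0) = a(0, 0, 1) sigma(n).  The constant
   term a(0, 0, 0) is then forced: at the cusp 0 the slice c_0 has exponential
   decay up to a constant, so 2^k c_0(2iy) - c_0(iy) -> 0 as y -> 0, and Abel
   summation of the divisor series evaluates the limit as a Bernoulli number.

   Conversely, for a lift, comparing expansions in t2 gives the Maass relation
   a(n, r, m) = sum over d | (n, r, m) of chi(d) d^(k-1) c(n m / d^2, r / d) as
   soon as the series of the lift converges; a leading-term estimate provides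
   points (t1, z) where it does.  The relation makes W_l A a sum over pairs (a, x)
   of divisors, on which an explicit involution exchanges n and m.

   Fourier expansions are obtained without integration: the mean over a period is
   an ultralimit of dyadic averages, and Goursat's theorem is proved for
   trapezoidal sums. *)

Require Import Defs.
From HB Require Import structures.
From mathcomp Require Import all_boot all_order all_algebra.
From mathcomp Require Import complex finmap.
From mathcomp Require Import all_classical all_reals all_analysis.
From mathcomp.analysis.showcase Require Import summability.
From mathcomp Require cyclic.
From mathcomp Require Import ring lra zify.
Set Implicit Arguments.
Unset Strict Implicit.
Unset Printing Implicit Defensive.
Import Order.TTheory GRing.Theory Num.Theory.
Import numFieldNormedType.Exports.
Local Open Scope classical_set_scope.
Local Open Scope ring_scope.
Local Open Scope complex_scope.

(** * Norm and exponential of complex numbers *)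

(** The relations for l >= 1 leave a(0, 0, 0) free, and two doublings recover it. With q = exp(-2 pi
    y), c_0(iy) is a(0, 0, 0) plus a(0, 0, 1) times the sum over m >= 1 of psi(q^m), psi(q) being
    the sum of chi(d) d^(k-1) q^d. The first doubling, g(y) = 2^k c_0(2iy) - c_0(iy), is the one
    that cancels the weight factor at the cusp 0; it turns psi into psi2(q) = 2^k psi(q^2) - psi(q),
    whose periodic factor has mean 0 even when chi is principal, so that psi2 stays regular up to q
    = 1. The second, 2 g(2y) - g(y), makes the sum over m the alternating sum of (-1)^m psi2(q^m),
    which tends to -psi2(1) / 2. In the direction from lifts to symmetry, the obstacle is that the
    definition of a lift promises no convergence: [limn] has a value in any case. Coefficients are
    therefore compared on the real translates of a single point (t, z), and the degenerate
    alternative is excluded there by a Fourier-Jacobi coefficient that vanishes on none of them. *)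

Section ComplexNorm.
Variable R : realType.
Implicit Types (z w : R[i]) (x y : R).

(* The norm [`|z|] of mathcomp is a complex number; nm is its real value. *)
Definition nm z : R := Normc.normc z.

Lemma nmE z : `|z| = (nm z)%:C.
Proof. by []. Qed.

Lemma nmP z x : `|z| = x%:C -> nm z = x.
Proof. by rewrite nmE => /complexI. Qed.

Lemma nm_def z : nm z = Num.sqrt (complex.Re z ^+ 2 + complex.Im z ^+ 2).
Proof. by apply: nmP; rewrite normc_def. Qed.

Lemma nm0 : nm 0 = 0. Proof. by apply: nmP; rewrite normr0. Qed.
Lemma nm1 : nm 1 = 1. Proof. by apply: nmP; rewrite normr1. Qed.
Lemma nm_ge0 z : 0 <= nm z. Proof. by rewrite nm_def sqrtr_ge0. Qed.
Lemma nmN z : nm (- z) = nm z. Proof. by apply: nmP; rewrite normrN. Qed.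
Lemma nmB z w : nm (z - w) = nm (w - z). Proof. by apply: nmP; rewrite distrC. Qed.
Lemma nmM z w : nm (z * w) = nm z * nm w. Proof. exact: Normc.normcM. Qed.
Lemma nmV z : nm z^-1 = (nm z)^-1. Proof. exact: Normc.normcV. Qed.
Lemma nmX z n : nm (z ^+ n) = nm z ^+ n.
Proof. by elim: n => [|n IH]; rewrite ?expr0 ?nm1// !exprS nmM IH. Qed.
Lemma nm_eq0 z : (nm z == 0) = (z == 0).
Proof. by rewrite -(inj_eq (@complexI R)) -nmE normr_eq0. Qed.
Lemma nm_gt0 z : (0 < nm z) = (z != 0).
Proof. by rewrite lt_neqAle nm_ge0 andbT eq_sym nm_eq0. Qed.
Lemma nmD z w : nm (z + w) <= nm z + nm w.
Proof. by rewrite -lecR rmorphD/= -!nmE ler_normD. Qed.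
Lemma nm_subD z w u : nm (z - u) <= nm (z - w) + nm (w - u).
Proof. by rewrite (le_trans _ (nmD _ _))//; rewrite (_ : z - w + (w - u) = z - u)//; ring. Qed.
Lemma nm_leB z w : nm z <= nm w + nm (z - w).
Proof. by rewrite (le_trans _ (nmD _ _))//; rewrite (_ : w + (z - w) = z)//; ring. Qed.
Lemma nm_real x : nm x%:C = `|x|.
Proof. by rewrite nm_def/= expr0n/= addr0 sqrtr_sqr. Qed.
Lemma nm_pos x : 0 <= x -> nm x%:C = x.
Proof. by move=> h; rewrite nm_real ger0_norm. Qed.
Lemma nm_nat n : nm n%:R = n%:R.
Proof. by rewrite -[n%:R](rmorph_nat (real_complex R)) nm_pos. Qed.
Lemma nm_sum I (s : seq I) P (f : I -> R[i]) :
  nm (\sum_(i <- s | P i) f i) <= \sum_(i <- s | P i) nm (f i).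
Proof.
elim/big_rec2: _ => [|i y z _ h]; first by rewrite nm0.
by rewrite (le_trans (nmD _ _))// lerD2l.
Qed.
Lemma nm_Re z : `|complex.Re z| <= nm z.
Proof. by rewrite nm_def -sqrtr_sqr ler_wsqrtr// lerDl sqr_ge0. Qed.
Lemma nm_Im z : `|complex.Im z| <= nm z.
Proof. by rewrite nm_def -[leLHS]sqrtr_sqr ler_wsqrtr// lerDr sqr_ge0. Qed.
Lemma nm_le_ReIm z : nm z <= `|complex.Re z| + `|complex.Im z|.
Proof.
rewrite nm_def -(@ler_sqr R) ?nnegrE ?sqrtr_ge0 ?addr_ge0//.
rewrite sqr_sqrtr ?addr_ge0 ?sqr_ge0//.
rewrite sqrrD !real_normK ?num_real// lerD2r lerDl.
by rewrite mulrn_wge0 ?mulr_ge0.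
Qed.
Lemma nm_sqr z : nm z ^+ 2 = complex.Re z ^+ 2 + complex.Im z ^+ 2.
Proof. by rewrite nm_def sqr_sqrtr ?addr_ge0 ?sqr_ge0. Qed.
Lemma ReD z w : complex.Re (z + w) = complex.Re z + complex.Re w.
Proof. by case: z w => ? ? [? ?]. Qed.
Lemma ImD z w : complex.Im (z + w) = complex.Im z + complex.Im w.
Proof. by case: z w => ? ? [? ?]. Qed.
Lemma ReN z : complex.Re (- z) = - complex.Re z.
Proof. by case: z. Qed.
Lemma ImN z : complex.Im (- z) = - complex.Im z.
Proof. by case: z. Qed.
Lemma ReM z w : complex.Re (z * w) =
  complex.Re z * complex.Re w - complex.Im z * complex.Im w.
Proof. by case: z w => ? ? [? ?]. Qed.
Lemma ImM z w : complex.Im (z * w) =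
  complex.Re z * complex.Im w + complex.Im z * complex.Re w.
Proof. by case: z w => ? ? [? ?]. Qed.
Lemma natC n : n%:R = (n%:R : R)%:C.
Proof. by rewrite rmorph_nat. Qed.
Lemma intC (n : int) : n%:~R = (n%:~R : R)%:C.
Proof. by rewrite rmorph_int. Qed.
Lemma nm_int (n : int) : nm n%:~R = `|n%:~R|.
Proof. by rewrite intC nm_real. Qed.
Lemma complexP z w : complex.Re z = complex.Re w -> complex.Im z = complex.Im w -> z = w.
Proof. by case: z w => ? ? [? ?] /= -> ->. Qed.
End ComplexNorm.

(** * Second-order bounds for the exponential *)

Section Exponential.
Variable R : realType.
Implicit Types (z w : R[i]) (x y t : R).
Local Notation e := (@cexp2pi R).

Lemma eD z w : e (z + w) = e z * e w.
Proof.
rewrite /cexp2pi ReD ImD !mulrDr opprD expRD cosD sinD.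
apply: complexP; rewrite !(ReM,ImM)/=; ring.
Qed.

Lemma e0 : e 0 = 1.
Proof.
rewrite /cexp2pi /= !mulr0 oppr0 expR0 cos0 sin0.
by apply: complexP; rewrite !(ReM,ImM)/= !(mulr0,mul0r,mulr1,addr0,subr0).
Qed.

Lemma eN z : e (- z) = (e z)^-1.
Proof.
have h : e z * e (- z) = 1 by rewrite -eD subrr e0.
have ez0 : e z != 0 by apply: contra_eq_neq h => ->; rewrite mul0r eq_sym oner_eq0.
by apply: (mulfI ez0); rewrite h divff.
Qed.

Lemma nm_e z : nm (e z) = expR (- (2 * pi * complex.Im z)).
Proof.
rewrite nmM nm_pos ?expR_ge0//.
by rewrite [X in _ * X](_ : _ = 1) ?mulr1// nm_def/= cos2Dsin2 sqrtr1.
Qed.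

Lemma e_neq0 z : e z != 0.
Proof. by rewrite -nm_gt0 nm_e expR_gt0. Qed.

Lemma e1 : e 1 = 1.
Proof.
rewrite /cexp2pi /= !mulr0 oppr0 expR0 mulr1 mulr_natl cos2pi sin2pi.
by apply: complexP; rewrite !(ReM,ImM)/= !(mulr0,mul0r,mulr1,addr0,subr0).
Qed.

Lemma eX z n : e (n%:R * z) = e z ^+ n.
Proof.
elim: n => [|n IH]; first by rewrite mul0r e0 expr0.
by rewrite -natr1 mulrDl mul1r eD IH exprSr.
Qed.

Lemma e_int (n : int) : e n%:~R = 1.
Proof.
have h (m : nat) : e m%:R = 1 by rewrite -[m%:R]mulr1 eX e1 expr1n.
case: n => m; first by rewrite -pmulrn h.
by rewrite NegzE mulrNz eN -pmulrn h invr1.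
Qed.

Lemma eB z w : e (z - w) = e z / e w.
Proof. by rewrite eD eN. Qed.

Lemma eDint z (n : int) : e (z + n%:~R) = e z.
Proof. by rewrite eD e_int mulr1. Qed.

Lemma nm_e_real x : nm (e x%:C) = 1.
Proof. by rewrite nm_e/= mulr0 oppr0 expR0. Qed.

(** Both bounds come from [1 + x <= expR x], taken at x and at -x. *)
Lemma expR_sub1 x : 0 <= expR x - 1 - x <= x ^+ 2 * expR `|x|.
Proof.
have h1 := expR_ge1Dx x; have h2 := expR_ge1Dx (- x).
have h3 : expR x - 1 <= x * expR x.
  have : expR x * (1 - x) <= expR x * expR (- x) by rewrite ler_wpM2l ?expR_ge0.
  rewrite -expRD subrr expR0; lra.
apply/andP; split; first by lra.
have h4 : expR x - 1 - x <= x * (expR x - 1) by lra.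
apply: (le_trans h4); case: (leP 0 x) => x0.
  by rewrite expr2 -mulrA ler_wpM2l// (le_trans h3)// ger0_norm.
have : 1 <= expR (- x) by rewrite -expR0 ler_expR; lra.
rewrite (_ : x * (expR x - 1) = (-x) * (1 - expR x)); last by ring.
move=> h5; apply: (@le_trans _ _ (x^+2 * 1)).
  by rewrite mulr1 -sqrrN expr2 ler_wpM2l//; lra.
by rewrite ler_wpM2l ?sqr_ge0// ltr0_norm.
Qed.

Lemma sin_mvt t : 0 < t -> exists c, sin t = t * cos c /\ 0 < c < t.
Proof.
move=> t0.
have [|c] := @MVT R sin cos 0 t t0.
  by apply/continuous_subspaceT => x; exact: continuous_sin.
rewrite sin0 !subr0 in_itv/= => ct h; exists c; split => //.
by rewrite h mulrC.
Qed.

Lemma sin_abs_le t : `|sin t| <= `|t|.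
Proof.
wlog t0 : t / 0 < t => [h|].
  case: (ltrgtP t 0) => [t0|t0|->]; last by rewrite sin0.
    by rewrite -normrN -sinN -(normrN t) h// oppr_gt0.
  exact: h.
have [c [-> _]] := sin_mvt t0.
by rewrite normrM ler_piMr// cos_max.
Qed.

(** The half-angle form reduces bounds on cos to [sin_abs_le]; at t = 2 pi x it also measures chords
    of the unit circle ([nm_e_sub1]). *)
Lemma cos_sub1 t : 1 - cos t = 2 * sin (t / 2) ^+ 2.
Proof.
have -> : cos t = cos ((t / 2) *+ 2) by congr cos; rewrite mulr2n; field.
by rewrite cos_mulr2n cos2sin2 -mulr_natl; ring.
Qed.

Lemma cos_sub1_le t : `|cos t - 1| <= t ^+ 2.
Proof.
rewrite distrC cos_sub1 normrM normr_nat normrX.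
have := sin_abs_le (t / 2); rewrite normrM (ger0_norm (_ : 0 <= 2^-1))//.
move=> h; have : `|sin (t / 2)| ^+ 2 <= (`|t| / 2) ^+ 2.
  by rewrite ler_sqr ?nnegrE// divr_ge0.
rewrite expr_div_n !real_normK ?num_real//.
have := sqr_ge0 t; lra.
Qed.

Lemma cos_sub1_le1 t : `|cos t - 1| <= `|t|.
Proof.
rewrite distrC cos_sub1 normrM normr_nat normrX.
have := sin_abs_le (t / 2); rewrite normrM (ger0_norm (_ : 0 <= 2^-1))//.
have h1 := sin_max (t / 2); have h0 := normr_ge0 (sin (t/2)).
move=> h; have : `|sin (t / 2)| ^+ 2 <= `|sin (t/2)|.
  by rewrite expr2 ler_piMl.
lra.
Qed.

Lemma sin_sub_le t : `|sin t - t| <= t ^+ 2.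
Proof.
wlog t0 : t / 0 < t => [h|].
  case: (ltrgtP t 0) => [t0|t0|->]; last by rewrite sin0 subrr normr0 expr0n.
    rewrite -normrN -(sqrrN t) (_ : - (sin t - t) = sin (- t) - (- t)).
      by rewrite h// oppr_gt0.
    by rewrite sinN; ring.
  exact: h.
have [c [-> /andP[c0 ct]]] := sin_mvt t0.
rewrite (_ : t * cos c - t = t * (cos c - 1)); last by ring.
rewrite normrM gtr0_norm// expr2 ler_wpM2l ?(ltW t0)//.
rewrite (le_trans (cos_sub1_le1 _))// gtr0_norm// ltW//.
Qed.

(** This remainder gives the differentiability of [cexp2pi] and, term by term, that of Fourier
    series. With s and t the real and imaginary parts of 2 pi i z, it splits into three pieces, from
    cos t - 1 and sin t - t, from exp s - 1 - s, and from t (exp s - 1); their bounds 2 + 1 + 1 add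
    up to the constant 4. *)
Lemma exp_taylor z : nm (e z - 1 - (2 * pi)%:C * 'i * z) <=
  4 * (2 * pi * nm z) ^+ 2 * expR (2 * pi * nm z).
Proof.
set s := - (2 * pi * complex.Im z); set t := 2 * pi * complex.Re z.
have p0 : 0 <= 2 * pi :> R by rewrite mulr_ge0 ?pi_ge0.
set u := 2 * pi * nm z.
have u0 : 0 <= u by rewrite mulr_ge0 ?nm_ge0.
have su : `|s| <= u.
  by rewrite normrN normrM ger0_norm// ler_wpM2l// nm_Im.
have tu : `|t| <= u by rewrite normrM ger0_norm// ler_wpM2l// nm_Re.
have -> : e z - 1 - (2 * pi)%:C * 'i * z =
  (expR s)%:C * ((cos t - 1) +i* (sin t - t)) + ((expR s - 1 - s)%:C
    + (0 +i* (t * (expR s - 1)))).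
  by rewrite /cexp2pi; apply: complexP; rewrite !(ReM,ImM,ReD,ImD,ReN,ImN)/= /s /t; ring.
have ES : expR s <= expR u by rewrite ler_expR (le_trans (ler_norm _)).
have EA : expR `|s| <= expR u by rewrite ler_expR.
have E1 : 1 <= expR u by rewrite -expR0 ler_expR.
have sq r : `|r| <= u -> r ^+ 2 <= u ^+ 2.
  by move=> h; rewrite -real_normK ?num_real// ler_sqr ?nnegrE.
have /andP[x1 x2] := expR_sub1 s.
apply: (le_trans (nmD _ _)).
have A : nm ((expR s)%:C * ((cos t - 1) +i* (sin t - t))) <= 2 * u ^+ 2 * expR u.
  rewrite nmM nm_pos ?expR_ge0// mulrC ler_pM ?nm_ge0 ?expR_ge0//.
  apply: (le_trans (nm_le_ReIm _)) => /=.
  have := cos_sub1_le t; have := sin_sub_le t; have := sq _ tu; lra.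
have B : nm ((expR s - 1 - s)%:C) <= u ^+ 2 * expR u.
  rewrite nm_pos// (le_trans x2)// ler_pM ?sqr_ge0 ?expR_ge0//; exact: sq.
have D : nm (0 +i* (t * (expR s - 1))) <= u ^+ 2 * expR u.
  apply: (le_trans (nm_le_ReIm _)) => /=.
  rewrite normr0 add0r normrM expr2 -mulrA ler_pM//.
  have -> : expR s - 1 = (expR s - 1 - s) + s by ring.
  have /andP[y1 y2] := expR_sub1 (- s).
  rewrite ler_norml; apply/andP; split.
    rewrite lerNl (le_trans (_ : _ <= u))//; last by rewrite ler_peMr.
    by move: su; rewrite ler_norml => /andP[]; lra.
  case: (leP 0 s) => s0.
    have h2 := expR_ge1Dx (- s).
    have : expR s * (1 - s) <= expR s * expR (- s) by rewrite ler_wpM2l ?expR_ge0.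
    rewrite -expRD subrr expR0.
    have : s * expR s <= u * expR u by rewrite ler_pM ?expR_ge0// (le_trans (ler_norm _)).
    lra.
  have : expR s <= 1 by rewrite -expR0 ler_expR ltW.
  have : 0 <= u * expR u by rewrite mulr_ge0 ?expR_ge0.
  lra.
have := nmD ((expR s - 1 - s)%:C) (0 +i* (t * (expR s - 1))).
rewrite -/u; lra.
Qed.
End Exponential.

(** * Unconditional summation *)

Section FsetSums.
Variables (I : choiceType).

Lemma fsum_split (V : zmodType) (f : I -> V) (A B : {fset I}) : fsubset A B ->
  \sum_(i <- B) f i = \sum_(i <- A) f i + \sum_(i <- [fset x in B | x \notin A]%fset) f i.
Proof.
move=> AB; rewrite (big_fsetID _ (mem A))/=; congr (_ + _).
by apply: eq_fbigl => i; rewrite !inE/= -in_fsetI (fsetIidPr AB).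
Qed.

Lemma fsum_disjU (V : zmodType) (f : I -> V) (A B : {fset I}) :
  (forall i, i \in B -> i \notin A) ->
  \sum_(i <- (A `|` B)%fset) f i = \sum_(i <- A) f i + \sum_(i <- B) f i.
Proof.
move=> h; rewrite (@fsum_split _ _ A) ?fsubsetUl//; congr (_ + _).
apply: eq_fbigl => i; rewrite !inE/=; case iB : (i \in B); first by rewrite orbT h.
by rewrite orbF andbN.
Qed.

Variable R : realType.
Implicit Types (f : I -> R[i]) (g : I -> R) (A B : {fset I}).

Lemma fsum_le_sub g A B : (forall i, 0 <= g i) -> fsubset A B ->
  \sum_(i <- A) g i <= \sum_(i <- B) g i.
Proof. by move=> g0 AB; rewrite (fsum_split _ AB) lerDl sumr_ge0. Qed.

Definition bsum g := exists M, forall A, \sum_(i <- A) g i <= M.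

Lemma bsum_sup g : (forall i, 0 <= g i) -> bsum g -> exists S, 
  (forall A, \sum_(i <- A) g i <= S) /\
  forall eps, 0 < eps -> exists A, S - eps < \sum_(i <- A) g i.
Proof.
move=> g0 [M hM]; pose E := [set \sum_(i <- A) g i | A in @setT {fset I}].
have hs : has_sup E.
  split; first by exists (\sum_(i <- fset0) g i), fset0.
  by exists M => _ [A _ <-].
exists (sup E); split=> [A|eps e0].
  by apply: sup_upper_bound => //; exists A.
by have [_ [A _ <-]] := sup_adherent e0 hs; exists A.
Qed.

Lemma bsum_tail g eps : (forall i, 0 <= g i) -> bsum g -> 0 < eps ->
  exists A, forall B, (forall i, i \in B -> i \notin A) -> \sum_(i <- B) g i <= eps.
Proof.
move=> g0 gb e0; have [S [S1 S2]] := bsum_sup g0 gb; have [A hA] := S2 _ e0.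
exists A => B AB; have := S1 (A `|` B)%fset; rewrite fsum_disjU//; lra.
Qed.

(** Convergence along the finite subsets in epsilon form; [hsum_totally] identifies it with the
    convergence along [totally] of the definition of Fourier-Jacobi expansions. *)
Definition hsum f (s : R[i]) := forall eps : R, 0 < eps -> exists A, forall B,
  fsubset A B -> nm (\sum_(i <- B) f i - s) <= eps.

Definition asum f := bsum (fun i => nm (f i)).

Lemma hsum_ext f f' s : (forall i, f i = f' i) -> hsum f s -> hsum f' s.
Proof. by move=> /funext ->. Qed.

Lemma hsum_uniq f s t : hsum f s -> hsum f t -> s = t.
Proof.
move=> fs ft; apply/eqP; rewrite -subr_eq0 -nm_eq0; apply/eqP.
apply/eqP; rewrite eq_le nm_ge0 andbT; apply/ler_addgt0Pr => e e0.
have e2 : 0 < e / 2 by rewrite divr_gt0.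
have [A hA] := fs _ e2; have [B hB] := ft _ e2.
have := hA (A `|` B)%fset (fsubsetUl _ _); have := hB (A `|` B)%fset (fsubsetUr _ _).
rewrite nmB => h1 h2; rewrite add0r nmB (le_trans (nm_subD _ (\sum_(i <- (A `|` B)%fset) f i) _))//.
lra.
Qed.

Lemma hsumD f f' s s' : hsum f s -> hsum f' s' ->
  hsum (fun i => f i + f' i) (s + s').
Proof.
move=> fs ft e e0; have e2 : 0 < e / 2 by rewrite divr_gt0.
have [A hA] := fs _ e2; have [B hB] := ft _ e2.
exists (A `|` B)%fset => D; rewrite fsubUset => /andP[/hA h1 /hB h2].
rewrite big_split/= opprD addrACA (le_trans (nmD _ _))//; lra.
Qed.

Lemma hsumZ f s c : hsum f s -> hsum (fun i => c * f i) (c * s).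
Proof.
move=> fs e e0; have c1 : 0 < nm c + 1 by rewrite ltr_wpDl ?nm_ge0.
have [A hA] := fs (e / (nm c + 1)) (divr_gt0 e0 c1).
exists A => B /hA h; rewrite -mulr_sumr -mulrBr nmM.
rewrite ler_pdivlMr// in h; apply: le_trans h.
by rewrite mulrC ler_wpM2l ?nm_ge0// lerDl.
Qed.

Lemma hsumZr f s c : hsum f s -> hsum (fun i => f i * c) (s * c).
Proof. by move=> /(hsumZ c); rewrite mulrC; apply: hsum_ext => i; rewrite mulrC. Qed.

Lemma hsumB f f' s s' : hsum f s -> hsum f' s' ->
  hsum (fun i => f i - f' i) (s - s').
Proof.
move=> h /(hsumZ (-1)) h'; have := hsumD h h'; rewrite mulN1r.
by apply: hsum_ext => i; rewrite mulN1r.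
Qed.

Lemma hsum_fin f A : (forall i, i \notin A -> f i = 0) -> hsum f (\sum_(i <- A) f i).
Proof.
move=> h e e0; exists A => B AB; rewrite -(@big_fset_incl _ _ _ _ _ _ f AB) ?subrr ?nm0 ?ltW// => i _; exact: h.
Qed.

Lemma hsum0 : hsum (fun=> 0) 0.
Proof. by have := @hsum_fin (fun=> 0) fset0 (fun _ _ => erefl); rewrite big_seq_fset0. Qed.

Lemma hsum_one f i0 : (forall i, i != i0 -> f i = 0) -> hsum f (f i0).
Proof.
move=> h; have := @hsum_fin f [fset i0]%fset; rewrite big_seq_fset1; apply => i.
by rewrite inE => /h.
Qed.

Lemma hsum_sum (T : Type) (r : seq T) (P : pred T) (F : T -> I -> R[i]) (S : T -> R[i]) :
  (forall d, P d -> hsum (F d) (S d)) ->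
  hsum (fun i => \sum_(d <- r | P d) F d i) (\sum_(d <- r | P d) S d).
Proof.
move=> h; elim: r => [|d r IH].
  by rewrite big_nil; apply: hsum_ext hsum0 => i; rewrite big_nil.
rewrite big_cons; case: ifP => Pd.
  by apply: hsum_ext (hsumD (h _ Pd) IH) => i; rewrite big_cons Pd.
by apply: hsum_ext IH => i; rewrite big_cons Pd.
Qed.

Lemma hsum_nm f s M : hsum f s -> (forall A, \sum_(i <- A) nm (f i) <= M) -> nm s <= M.
Proof.
move=> fs fM; apply/ler_addgt0Pr => e e0; have [A hA] := fs _ e0.
have := hA A (fsubset_refl _); rewrite nmB => h.
apply: (le_trans (nm_leB _ (\sum_(i <- A) f i))); rewrite lerD//.
by rewrite (le_trans (nm_sum _ _ _)).
Qed.

Lemma bsum_le g g' : (forall i, g i <= g' i) -> bsum g' -> bsum g.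
Proof.
by move=> h [M hM]; exists M => A; rewrite (le_trans _ (hM A))// ler_sum.
Qed.

Lemma bsumD g g' : bsum g -> bsum g' -> bsum (fun i => g i + g' i).
Proof. by move=> [M h] [M' h']; exists (M + M') => A; rewrite big_split lerD. Qed.

Lemma bsumZ g c : 0 <= c -> bsum g -> bsum (fun i => c * g i).
Proof. by move=> c0 [M h]; exists (c * M) => A; rewrite -mulr_sumr ler_wpM2l. Qed.

Lemma hsum_pos g : (forall i, 0 <= g i) -> bsum g -> exists S, hsum (fun i => (g i)%:C) S%:C.
Proof.
move=> g0 gb; have [S [S1 S2]] := bsum_sup g0 gb; exists S => e e0.
have [A hA] := S2 _ e0; exists A => B AB.
rewrite -rmorph_sum -rmorphB nm_real/= ler_norml.
have := S1 B; have := fsum_le_sub g0 AB; lra.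
Qed.

(** Each real component r is the difference of the nonnegative families |r| + r and |r|, whose sums
    are suprema. *)
Lemma asum_hsum f : asum f -> exists s, hsum f s.
Proof.
move=> fb.
have part (r : I -> R) : (forall i, `|r i| <= nm (f i)) ->
    exists s, hsum (fun i => (r i)%:C) s.
  move=> hr.
  have [|S hS] := @hsum_pos (fun i => `|r i|) (fun i => normr_ge0 _).
    exact: bsum_le fb.
  have h0 i : 0 <= `|r i| + r i by have := ler_norm (- r i); rewrite normrN; lra.
  have [|T hT] := @hsum_pos (fun i => `|r i| + r i) h0.
    apply: (@bsum_le _ (fun i => 2 * nm (f i))); last exact: bsumZ.
    by move=> i; have := ler_norm (r i); have := hr i; lra.
  exists (T%:C - S%:C); apply: hsum_ext (hsumB hT hS) => i.
  by rewrite -rmorphB/=; congr (_%:C); ring.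
have [s hs] := part _ (fun i => nm_Re (f i)).
have [t ht] := part _ (fun i => nm_Im (f i)).
exists (s + 'i * t); apply: hsum_ext (hsumD hs (hsumZ 'i ht)) => i.
by rewrite [RHS]complexE.
Qed.

(** Outside a suitable finite set A every finite sum has norm at most 2. Splitting a finite set by
    the sign of the real part bounds the sum of |Re| by 4; the same for |Im| gives the constant
    8. *)
Lemma hsum_asum f s : hsum f s -> asum f.
Proof.
move=> /(_ 1 ltr01)[A hA].
have D B : (forall i, i \in B -> i \notin A) -> nm (\sum_(i <- B) f i) <= 2.
  move=> AB; have := hA _ (fsubsetUl A B); have := hA _ (fsubset_refl A).
  rewrite fsum_disjU// nmB => h1 h2.
  rewrite (_ : \sum_(i <- B) _ = (s - \sum_(i <- A) f i) +
     (\sum_(i <- A) f i + \sum_(i <- B) f i - s)); last by ring.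
  by rewrite (le_trans (nmD _ _))//; lra.
have half (p : R[i] -> R) B : {morph p : x y / x + y} -> (forall z, `|p z| <= nm z) ->
    (forall i, i \in B -> i \notin A) -> \sum_(i <- B) `|p (f i)| <= 4.
  move=> pD pn AB; rewrite (big_fsetID _ (fun i => 0 <= p (f i)))/=.
  have p0 : p 0 = 0 by have /eqP := pD 0 0; rewrite addr0 -subr_eq0 opprD addrA subrr sub0r oppr_eq0 => /eqP.
  have pS (B' : {fset I}) : p (\sum_(i <- B') f i) = \sum_(i <- B') p (f i).
    exact: (big_morph p pD p0).
  have -> : \sum_(i <- [fset x in B | (0 <= p (f x))%R]%fset) `|p (f i)| =
     p (\sum_(i <- [fset x in B | (0 <= p (f x))%R]%fset) f i).
    rewrite pS; apply: eq_fbigr => i; rewrite !inE/= => /andP[_ h] _.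
    by rewrite ger0_norm.
  have -> : \sum_(i <- [fset x in B | ~~ (0 <= p (f x))%R]%fset) `|p (f i)| =
     - p (\sum_(i <- [fset x in B | ~~ (0 <= p (f x))%R]%fset) f i).
    rewrite pS -sumrN; apply: eq_fbigr => i; rewrite !inE/= => /andP[_ h] _.
    by rewrite ltr0_norm// ltNge.
  have h1 : nm (\sum_(i <- [fset x in B | (0 <= p (f x))%R]%fset) f i) <= 2.
    by apply: D => i; rewrite !inE/= => /andP[/AB].
  have h2 : nm (\sum_(i <- [fset x in B | ~~ (0 <= p (f x))%R]%fset) f i) <= 2.
    by apply: D => i; rewrite !inE/= => /andP[/AB].
  have := pn (\sum_(i <- [fset x in B | (0 <= p (f x))%R]%fset) f i).
  have := pn (\sum_(i <- [fset x in B | ~~ (0 <= p (f x))%R]%fset) f i).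
  rewrite !ler_norml => /andP[+ _] /andP[_ +]; lra.
exists (\sum_(i <- A) nm (f i) + 8) => B.
apply: (le_trans (fsum_le_sub (fun i => nm_ge0 _) (fsubsetUr A B))).
rewrite (fsum_split _ (fsubsetUl A B)) lerD2l.
set E := [fset _ | _ in _ & _]%fset.
have hE i : i \in E -> i \notin A by rewrite !inE/= => /andP[].
apply: (@le_trans _ _ (\sum_(i <- E) (`|complex.Re (f i)| + `|complex.Im (f i)|))).
  by apply: ler_sum => i _; exact: nm_le_ReIm.
rewrite big_split/=.
have := half _ _ (@ReD R) (@nm_Re R) hE; have := half _ _ (@ImD R) (@nm_Im R) hE; lra.
Qed.

End FsetSums.

(** * Reindexing and iterated sums *)

Section Reindex.
Variables (R : realType) (I J : choiceType).

Definition fset_prod (A : {fset I}) (B : {fset J}) : {fset (I * J)%type} :=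
  [fset p in [seq (i, j) | i <- A, j <- B]]%fset.

Lemma in_fset_prod A B i j : ((i, j) \in fset_prod A B) = (i \in A) && (j \in B).
Proof.
rewrite !inE/=; apply/allpairsP/andP => [[[a b]/= [aA bB [-> ->]]]//|[iA jB]].
by exists (i, j).
Qed.

Lemma big_fset_prod (V : nmodType) A B (u : I * J -> V) :
  \sum_(p <- fset_prod A B) u p = \sum_(i <- A) \sum_(j <- B) u (i, j).
Proof.
rewrite -big_allpairs.
apply: perm_big; apply: uniq_perm; rewrite ?fset_uniq//.
  by rewrite allpairs_uniq ?fset_uniq// => -[a b] [c d].
by move=> p; rewrite !inE.
Qed.

(** The maps h and h' are mutually inverse between the supports P and Q only. Restriction to a
    support, extension by 0 and permutation of indices are thus one statement. *)
Lemma hsum_reindex (P : pred I) (Q : pred J) (h : I -> J) (h' : J -> I)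
    (f : I -> R[i]) (g : J -> R[i]) s :
  (forall i, ~~ P i -> f i = 0) -> (forall j, ~~ Q j -> g j = 0) ->
  (forall i, P i -> [/\ Q (h i), h' (h i) = i & g (h i) = f i]) ->
  (forall j, Q j -> P (h' j) /\ h (h' j) = j) ->
  hsum f s -> hsum g s.
Proof.
move=> f0 g0 hP hQ fs e e0; have [A hA] := fs e e0.
exists [fset h i | i in [fset i in A | P i]]%fset => B AB.
pose B1 := [fset j in B | Q j]%fset; pose C := [fset h' j | j in B1]%fset.
have -> : \sum_(j <- B) g j = \sum_(i <- (A `|` C)%fset) f i.
  rewrite (big_fsetID _ Q)/= [X in _ + X]big1_fset ?addr0; last first.
    by move=> j; rewrite !inE/= => /andP[_ /g0].
  rewrite -(@big_fset_incl _ _ _ _ C); last 2 first.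
  - exact: fsubsetUr.
  - move=> i; rewrite inE => /orP[iA|->//] iC; apply/f0/negP => Pi.
    move/negP: iC; apply; have [Qh hh _] := hP _ Pi.
    apply/imfsetP; exists (h i); last by rewrite hh.
    rewrite !inE/= Qh andbT; apply: (fsubsetP AB); apply/imfsetP; exists i => //.
    by rewrite !inE/= iA.
  rewrite [RHS]big_imfset/=; last first.
    move=> j1 j2; rewrite !inE/= => /andP[_ Q1] /andP[_ Q2] e12.
    by rewrite -(proj2 (hQ _ Q1)) e12 (proj2 (hQ _ Q2)).
  apply: eq_fbigr => j; rewrite !inE/= => /andP[_ Qj] _.
  have [Pj hj] := hQ _ Qj; have [_ _ <-] := hP _ Pj; by rewrite hj.
exact/hA/fsubsetUl.
Qed.

Lemma bsum_inj (P : pred I) (h : I -> J) (f : I -> R) (g : J -> R) :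
  (forall j, 0 <= g j) ->
  (forall i, ~~ P i -> f i <= 0) -> (forall i, P i -> f i <= g (h i)) ->
  {in P &, injective h} -> bsum g -> bsum f.
Proof.
move=> g0 f0 fg hi [M hM]; exists M => A.
apply: (le_trans _ (hM [fset h i | i in [fset i in A | P i]]%fset)).
rewrite (big_fsetID _ P)/= [leRHS]big_imfset/=; last first.
  by move=> i1 i2; rewrite !inE/= => /andP[_ P1] /andP[_ P2]; exact: hi.
rewrite -[leRHS]addr0 lerD//.
  rewrite big_seq_cond [leRHS]big_seq_cond; apply: ler_sum => i.
  by rewrite !inE/= => /andP[/andP[_ /fg]].
rewrite big_seq_cond; apply: sumr_le0 => i.
by rewrite !inE/= => /andP[/andP[_ /f0]].
Qed.

(** A finite set K of rows is completed to a rectangle K x J1, where J1 is large enough for all rows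
    of K at once. The row errors add up, hence the tolerance d with denominator |K| + 1. *)
Lemma hsum_rows (u : I * J -> R[i]) (s : I -> R[i]) t :
  (forall i, hsum (fun j => u (i, j)) (s i)) -> hsum u t -> hsum s t.
Proof.
move=> us ut e e0; have e2 : 0 < e / 2 by rewrite divr_gt0.
have [A hA] := ut _ e2.
exists [fset p.1 | p in A]%fset => K AK.
have n1 : 0 < (size K)%:R + 1 :> R by rewrite ltr_wpDl.
pose d := e / 2 / ((size K)%:R + 1).
have d0 : 0 < d by rewrite divr_gt0.
have common (r : seq I) : exists J0 : {fset J}, forall J1, fsubset J0 J1 ->
    forall i, i \in r -> nm (\sum_(j <- J1) u (i, j) - s i) <= d.
  elim: r => [|i r [J0 IH]]; first by exists fset0.
  have [J1 h1] := us i _ d0; exists (J0 `|` J1)%fset => J2.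
  rewrite fsubUset => /andP[a b] k; rewrite inE => /orP[/eqP->|]; first exact: h1.
  exact: IH.
have [J0 hJ] := common K.
pose J1 := (J0 `|` [fset p.2 | p in A])%fset.
have AB : fsubset A (fset_prod K J1).
  apply/fsubsetP => -[i j] pA; rewrite in_fset_prod; apply/andP; split.
    by apply: (fsubsetP AK); apply/imfsetP; exists (i, j).
  by rewrite inE; apply/orP; right; apply/imfsetP; exists (i, j).
have := hA _ AB; rewrite big_fset_prod.
set S := \sum_(i <- K) _ => h.
have h' : nm (\sum_(i <- K) s i - S) <= e / 2.
  rewrite /S -sumrB (le_trans (nm_sum _ _ _))//.
  apply: (@le_trans _ _ (\sum_(i <- K) d)).
    rewrite big_seq_cond [leRHS]big_seq_cond; apply: ler_sum => i /andP[iK _].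
    by rewrite nmB hJ// fsubsetUl.
  have -> : \sum_(i <- K) d = (size K)%:R * d by rewrite big_const_seq count_predT iter_addr_0 mulr_natl.
  by rewrite /d mulrA ler_pdivrMr// mulrC ler_wpM2l ?(ltW e2)// lerDl.
by rewrite (le_trans (nm_subD _ S _))//; move: h h'; lra.
Qed.

Lemma hsum_rows_inv (u : I * J -> R[i]) (s : I -> R[i]) t :
  asum u -> (forall i, hsum (fun j => u (i, j)) (s i)) -> hsum s t -> hsum u t.
Proof.
move=> /asum_hsum[t' ut] us st.
by rewrite (hsum_uniq st (hsum_rows us ut)).
Qed.

Lemma bsum_prod (f : I -> R) (g : J -> R) : (forall i, 0 <= f i) -> (forall j, 0 <= g j) ->
  bsum f -> bsum g -> bsum (fun p : I * J => f p.1 * g p.2).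
Proof.
move=> f0 g0 [M hM] [M' hM']; exists (M * M') => A.
pose A1 := [fset p.1 | p in A]%fset; pose A2 := [fset p.2 | p in A]%fset.
have AB : fsubset A (fset_prod A1 A2).
  apply/fsubsetP => -[i j] pA; rewrite in_fset_prod.
  by apply/andP; split; apply/imfsetP; exists (i, j).
apply: (le_trans (fsum_le_sub _ AB)); first by move=> ?; rewrite mulr_ge0.
rewrite big_fset_prod/=; under eq_bigr do rewrite -mulr_sumr.
by rewrite -mulr_suml ler_pM// ?sumr_ge0.
Qed.

End Reindex.

(** Spreading f over the graph of p lets [hsum_rows] regroup a sum along the fibres of p. *)
Lemma hsum_graph (R : realType) (I J : choiceType) (p : I -> J) (f : I -> R[i]) s :
  hsum f s -> hsum (fun x : J * I => if p x.2 == x.1 then f x.2 else 0) s.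
Proof.
move=> fs; apply: (@hsum_reindex R I (J * I)%type predT (fun x => p x.2 == x.1)
  (fun i => (p i, i)) snd f _ s _ _ _ _ fs) => //=.
- by move=> j /negbTE ->.
- by move=> i _; rewrite eqxx.
- by move=> [j i]/= /eqP ->.
Qed.


(** * Geometric series *)

Section GeometricSums.
Variable R : realType.

Lemma geo_sum (q : R) n : (1 - q) * \sum_(i < n) q ^+ i = 1 - q ^+ n.
Proof.
elim: n => [|n IH]; first by rewrite big_ord0 mulr0 expr0 subrr.
by rewrite big_ord_recr/= mulrDr IH exprS; ring.
Qed.

Lemma fset_nat_bound (A : {fset nat}) : exists n, forall i, i \in A -> (i < n)%N.
Proof.
exists (\max_(i <- A) i).+1 => i iA; rewrite ltnS.
by rewrite (big_fsetD1 i)//= leq_maxl.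
Qed.

Definition fset_lt (n : nat) : {fset nat} := [fset i in iota 0 n]%fset.

Lemma in_fset_lt n i : (i \in fset_lt n) = (i < n)%N.
Proof. by rewrite !inE/= mem_iota. Qed.

Lemma big_fset_lt (V : zmodType) n (f : nat -> V) :
  \sum_(i <- fset_lt n) f i = \sum_(i < n) f i.
Proof.
rewrite -(big_mkord predT) /index_iota subn0.
apply: perm_big; apply: uniq_perm; rewrite ?fset_uniq ?iota_uniq// => i.
by rewrite in_fset_lt mem_iota.
Qed.

Lemma bsum_geo_nat (q : R) : 0 <= q < 1 -> bsum (fun n : nat => q ^+ n).
Proof.
move=> /andP[q0 q1]; have d0 : 0 < 1 - q by lra.
exists (1 - q)^-1 => A; have [n hn] := fset_nat_bound A.
apply: (@le_trans _ _ (\sum_(i <- fset_lt n) q ^+ i)).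
  apply: fsum_le_sub => [i|]; first exact: exprn_ge0.
  by apply/fsubsetP => i /hn; rewrite in_fset_lt.
rewrite big_fset_lt -[leRHS]mul1r ler_pdivlMr// mulrC geo_sum.
by rewrite lerBlDr lerDl exprn_ge0.
Qed.

Lemma bsum_geo_int (q : R) : 0 <= q < 1 -> bsum (fun n : int => q ^+ `|n|%N).
Proof.
move=> q01; have q0 : 0 <= q by case/andP: q01.
have h := bsum_geo_nat q01.
pose f1 (n : int) := if (0 <= n)%R then q ^+ `|n|%N else 0.
pose f2 (n : int) := if (0 <= n)%R then 0 else q ^+ `|n|%N.
have b1 : bsum f1.
  apply: (@bsum_inj _ _ _ (fun n : int => (0 <= n)%R) (fun n => `|n|%N) _ _ _ _ _ _ h).
  - by move=> j; exact: exprn_ge0.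
  - by move=> i /negbTE; rewrite /f1 => ->.
  - by move=> i h0; rewrite /f1 h0.
  - by move=> i j; rewrite -!topredE/=; lia.
have b2 : bsum f2.
  apply: (@bsum_inj _ _ _ (fun n : int => ~~ (0 <= n)%R) (fun n => `|n|%N) _ _ _ _ _ _ h).
  - by move=> j; exact: exprn_ge0.
  - by move=> i; rewrite negbK /f2 => ->.
  - by move=> i /negbTE; rewrite /f2 => ->.
  - by move=> i j; rewrite -!topredE/=; lia.
apply: bsum_le (bsumD b1 b2) => n; rewrite /f1 /f2; case: ifP => _; lra.
Qed.

Lemma hsum_nat_cvg (f : nat -> R[i]) s : hsum f s -> forall eps, 0 < eps ->
  exists n0, forall n, (n0 <= n)%N -> nm (\sum_(i < n) f i - s) <= eps.
Proof.
move=> fs e e0; have [A hA] := fs _ e0; have [n0 hn] := fset_nat_bound A.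
exists n0 => n n0n; rewrite -big_fset_lt; apply: hA.
by apply/fsubsetP => i /hn h; rewrite in_fset_lt (leq_trans h).
Qed.

End GeometricSums.

(** * Means of periodic functions *)

Section MeanFunctional.
Variable R : realType.
Local Notation e := (@cexp2pi R).
Implicit Types (phi psi : R -> R[i]).

(** Along an ultrafilter every bounded sequence converges, so that the mean [Lam] is defined and
    linear on all bounded functions. *)
Lemma exists_ultra : exists U : set_system nat, UltraFilter U /\ \oo `<=` U.
Proof. exact: ultraFilterLemma. Qed.

Definition ultra : set_system nat := projT1 (cid exists_ultra).

#[global] Instance ultra_ultra : UltraFilter ultra.
Proof. exact: (projT2 (cid exists_ultra)).1. Qed.

Lemma ultra_oo (P : set nat) : (exists n0, forall n, (n0 <= n)%N -> P n) -> ultra P.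
Proof.
move=> [n0 h]; apply: (projT2 (cid exists_ultra)).2.
by exists n0 => // n; exact: h.
Qed.

Lemma ultra_ex (P : set nat) : ultra P -> exists n, P n.
Proof. by move=> UP; have [n] := filter_ex UP; exists n. Qed.

(** The limit is the supremum of the x lying below r j for ultra-many j. Beyond it the ultrafilter
    must contain the complementary set, which gives the upper estimate. *)
Lemma ultra_lim_real (r : nat -> R) M : (forall j, `|r j| <= M) ->
  exists s, forall eps, 0 < eps -> ultra [set j | `|r j - s| <= eps].
Proof.
move=> rM; pose E := [set x | ultra [set j | x <= r j]].
have hs : has_sup E.
  split.
    exists (- M); apply: ultra_oo; exists 0%N => n _ /=.
    by have := rM n; rewrite ler_norml => /andP[].
  exists M => x /ultra_ex[n /= xr]; rewrite (le_trans xr)//.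
  by have := rM n; rewrite ler_norml => /andP[].
exists (sup E) => eps e0.
have [x Ex xs] := sup_adherent e0 hs.
have h2 : ultra [set j | r j < sup E + eps].
  have [|] := in_ultra_setVsetC [set j | sup E + eps <= r j] ultra_ultra.
    move=> h; have := sup_upper_bound hs h; lra.
  by apply: filterS => j /=; move/negP; rewrite -ltNge.
apply: filterS (filterI Ex h2) => j/= [a b].
by rewrite ler_norml; lra.
Qed.

Lemma ultra_lim (u : nat -> R[i]) M : (forall j, nm (u j) <= M) ->
  exists s, forall eps, 0 < eps -> ultra [set j | nm (u j - s) <= eps].
Proof.
move=> uM.
have [s hs] := @ultra_lim_real (fun j => complex.Re (u j)) M (fun j => le_trans (nm_Re _) (uM j)).
have [t ht] := @ultra_lim_real (fun j => complex.Im (u j)) M (fun j => le_trans (nm_Im _) (uM j)).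
exists (s +i* t) => eps e0; have e2 : 0 < eps / 2 by rewrite divr_gt0.
apply: filterS (filterI (hs _ e2) (ht _ e2)) => j/= [a b].
apply: (le_trans (nm_le_ReIm _)); rewrite ReD ImD ReN ImN/=; lra.
Qed.

Definition avg (j : nat) phi : R[i] :=
  (2 ^ j)%:R^-1 * \sum_(i < 2 ^ j) phi (i%:R / (2 ^ j)%:R).

Definition bnd phi := exists B, forall x, nm (phi x) <= B.

(* The mean of phi over [0, 1], as an ultralimit of dyadic averages. *)
Definition Lam phi : R[i] :=
  xget 0 [set s | forall eps, 0 < eps -> ultra [set j | nm (avg j phi - s) <= eps]].

Lemma pow2_neq0 j : (2 ^ j)%:R != 0 :> R[i].
Proof. by rewrite pnatr_eq0 expn_eq0. Qed.

Lemma avg_le j phi B : (forall x, nm (phi x) <= B) -> nm (avg j phi) <= B.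
Proof.
move=> h; rewrite nmM nmV nm_nat mulrC ler_pdivrMr ?ltr0n ?expn_gt0//.
rewrite (le_trans (nm_sum _ _ _))//.
apply: (@le_trans _ _ (\sum_(i < 2 ^ j) B)); first exact: ler_sum.
by rewrite sumr_const card_ord mulr_natr.
Qed.

Lemma avgD j phi psi : avg j (fun x => phi x + psi x) = avg j phi + avg j psi.
Proof. by rewrite /avg big_split mulrDr. Qed.

Lemma avgZ j c phi : avg j (fun x => c * phi x) = c * avg j phi.
Proof. by rewrite /avg -mulr_sumr mulrCA. Qed.

Lemma LamP phi : bnd phi ->
  forall eps, 0 < eps -> ultra [set j | nm (avg j phi - Lam phi) <= eps].
Proof.
move=> [B hB]; rewrite /Lam; case: xgetP => [s _ //|h].
have [s hs] := @ultra_lim (fun j => avg j phi) B (fun j => avg_le j hB).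
by have := h s.
Qed.

Lemma Lam_uniq phi s : bnd phi ->
  (forall eps, 0 < eps -> ultra [set j | nm (avg j phi - s) <= eps]) -> Lam phi = s.
Proof.
move=> hb h; apply/eqP; rewrite -subr_eq0 -nm_eq0 eq_le nm_ge0 andbT.
apply/ler_addgt0Pr => eps e0; have e2 : 0 < eps / 2 by rewrite divr_gt0.
have [j /= [h1 h2]] := ultra_ex (filterI (h _ e2) (LamP hb e2)).
rewrite add0r (le_trans (nm_subD _ (avg j phi) _))// nmB; lra.
Qed.

Lemma Lam_le phi B : (forall x, nm (phi x) <= B) -> nm (Lam phi) <= B.
Proof.
move=> h; apply/ler_addgt0Pr => eps e0.
have [|j /= h2] := ultra_ex (@LamP phi _ _ e0); first by exists B.
rewrite (le_trans (nm_leB _ (avg j phi)))// lerD ?avg_le// nmB//.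
Qed.

Lemma bndD phi psi : bnd phi -> bnd psi -> bnd (fun x => phi x + psi x).
Proof. by move=> [B h] [B' h']; exists (B + B') => x; rewrite (le_trans (nmD _ _))// lerD. Qed.

Lemma bndZ c phi : bnd phi -> bnd (fun x => c * phi x).
Proof. by move=> [B h]; exists (nm c * B) => x; rewrite nmM ler_wpM2l ?nm_ge0. Qed.

Lemma bndM phi psi : bnd phi -> bnd psi -> bnd (fun x => phi x * psi x).
Proof. by move=> [B h] [B' h']; exists (B * B') => x; rewrite nmM ler_pM ?nm_ge0. Qed.

Lemma LamD phi psi : bnd phi -> bnd psi ->
  Lam (fun x => phi x + psi x) = Lam phi + Lam psi.
Proof.
move=> h1 h2; apply: Lam_uniq; first exact: bndD.
move=> eps e0; have e2 : 0 < eps / 2 by rewrite divr_gt0.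
apply: filterS (filterI (LamP h1 e2) (LamP h2 e2)) => j/= [a b].
rewrite avgD opprD addrACA (le_trans (nmD _ _))//; lra.
Qed.

Lemma LamZ c phi : bnd phi -> Lam (fun x => c * phi x) = c * Lam phi.
Proof.
move=> h; apply: Lam_uniq; first exact: bndZ.
move=> eps e0; have c1 : 0 < nm c + 1 by rewrite ltr_wpDl ?nm_ge0.
apply: filterS (LamP h (divr_gt0 e0 c1)) => j/= a.
rewrite avgZ -mulrBr nmM; rewrite ler_pdivlMr// in a; apply: le_trans a.
by rewrite mulrC ler_wpM2l ?nm_ge0// lerDl.
Qed.

Lemma LamB phi psi : bnd phi -> bnd psi ->
  Lam (fun x => phi x - psi x) = Lam phi - Lam psi.
Proof.
move=> h1 h2; rewrite -[- Lam psi]mulN1r -LamZ// -LamD//; last exact: bndZ.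
by congr Lam; apply: funext => x; rewrite mulN1r.
Qed.

Lemma Lam0 : Lam (fun=> 0) = 0.
Proof.
by apply/eqP; rewrite -nm_eq0 eq_le nm_ge0 andbT Lam_le// => x; rewrite nm0.
Qed.

Lemma bnd0 : bnd (fun=> 0).
Proof. by exists 0 => x; rewrite nm0. Qed.

Lemma bnd_sum (T : Type) (r : seq T) (F : T -> R -> R[i]) : (forall i, bnd (F i)) ->
  bnd (fun x => \sum_(i <- r) F i x).
Proof.
move=> h; elim: r => [|i r IH].
  by rewrite (_ : (fun _ => _) = fun=> 0); [exact: bnd0|apply: funext => x; rewrite big_nil].
rewrite (_ : (fun _ => _) = fun x => F i x + \sum_(i <- r) F i x); first exact: bndD.
by apply: funext => x; rewrite big_cons.
Qed.

Lemma Lam_sum (T : Type) (r : seq T) (F : T -> R -> R[i]) : (forall i, bnd (F i)) ->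
  Lam (fun x => \sum_(i <- r) F i x) = \sum_(i <- r) Lam (F i).
Proof.
move=> h; elim: r => [|i r IH].
  by rewrite big_nil -[RHS]Lam0; congr Lam; apply: funext => x; rewrite big_nil.
rewrite big_cons -IH -LamD//; last exact: bnd_sum.
by congr Lam; apply: funext => x; rewrite big_cons.
Qed.

Definition ek (n : int) (x : R) : R[i] := e (n%:~R * x%:C).

Lemma nm_ek n x : nm (ek n x) = 1.
Proof. by rewrite /ek intC -rmorphM nm_e_real. Qed.

Lemma bnd_ek n : bnd (ek n).
Proof. by exists 1 => x; rewrite nm_ek. Qed.

Lemma ekD m n x : ek (m + n) x = ek m x * ek n x.
Proof. by rewrite /ek rmorphD/= mulrDl eD. Qed.

Lemma ek0 x : ek 0 x = 1.
Proof. by rewrite /ek mul0r e0. Qed.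

Lemma e_real_neq1 (t : R) : t != 0 -> `|t| < 1 -> e t%:C != 1.
Proof.
move=> t0 t1; apply/negP => /eqP /(congr1 (@complex.Re R)).
rewrite /cexp2pi /= mulr0 oppr0 expR0 mul1r mul0r subr0 => h.
have := cos_sub1 (2 * pi * t); rewrite h subrr => /esym/eqP.
rewrite mulf_eq0 pnatr_eq0/= sqrf_eq0 (_ : 2 * pi * t / 2 = pi * t); last by field.
apply/negP.
wlog tp : t t0 t1 {h} / 0 < t => [hw|].
  case: (ltrgtP t 0) t0 => // tt _; last by apply: hw => //; rewrite gt_eqF.
  by rewrite -oppr_eq0 -sinN -mulrN hw ?normrN ?oppr_eq0 ?oppr_gt0// lt_eqF.
rewrite gt_eqF// sin_gt0_pi// mulr_gt0 ?pi_gt0//=.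
by rewrite gtr_pMr ?pi_gt0//; move: t1; rewrite gtr0_norm.
Qed.

(** The average is a geometric sum over the powers of a root of unity z, and z != 1 as soon as 2^j >
    |n|. Dyadic averages of characters are thus eventually exact. *)
Lemma avg_ek n j : n != 0 -> (`|n| < 2 ^ j)%N -> avg j (ek n) = 0.
Proof.
move=> n0 nj; rewrite /avg.
set z := e (n%:~R / (2 ^ j)%:R).
have zi (i : nat) : ek n (i%:R / (2 ^ j)%:R) = z ^+ i.
  rewrite -eX /ek; congr e.
  by rewrite rmorphM/= fmorphV/= -!natC; ring.
under eq_bigr do rewrite zi.
have zK : z ^+ (2 ^ j) = 1.
  by rewrite -eX mulrCA divff ?mulr1 ?e_int ?pow2_neq0.
have z1 : z - 1 != 0.
  rewrite subr_eq0 /z intC natC -fmorphV -rmorphM; apply: e_real_neq1.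
    by rewrite mulf_neq0 ?invr_eq0 ?intr_eq0 ?pnatr_eq0 ?expn_eq0.
  rewrite normrM normfV normr_nat ltr_pdivrMr ?ltr0n ?expn_gt0// mul1r.
  by rewrite -intr_norm -abszE -pmulrn ltr_nat.
suff -> : \sum_(i < 2 ^ j) z ^+ i = 0 by rewrite mulr0.
by apply: (mulfI z1); rewrite mulr0 -subrX1 zK subrr.
Qed.

Lemma Lam_ek n : Lam (ek n) = (n == 0)%:R.
Proof.
apply: Lam_uniq; first exact: bnd_ek.
move=> eps e0; case: eqP => [->|/eqP n0].
  apply: ultra_oo; exists 0%N => j _ /=; rewrite /avg.
  under eq_bigr do rewrite ek0.
  by rewrite sumr_const card_ord mulVf ?pow2_neq0// subrr nm0 ltW.
apply: ultra_oo; exists `|n|%N => j nj /=.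
by rewrite avg_ek ?subrr ?nm0 ?ltW// (leq_ltn_trans nj)// ltn_expl.
Qed.

Lemma hsum_tail (I : choiceType) (f : I -> R[i]) s (A : {fset I}) eps : hsum f s ->
  (forall B : {fset I}, (forall i, i \in B -> i \notin A) -> \sum_(i <- B) nm (f i) <= eps) ->
  nm (s - \sum_(i <- A) f i) <= eps.
Proof.
move=> fs h; apply/ler_addgt0Pr => d d0; have [A1 hA] := fs _ d0.
have := hA _ (fsubsetUr A A1); rewrite (fsum_split _ (fsubsetUl A A1)).
set E := [fset _ | _ in _ & _]%fset => h1.
have h2 : nm (\sum_(i <- E) f i) <= eps.
  by rewrite (le_trans (nm_sum _ _ _))// h// => i; rewrite !inE/= => /andP[].
rewrite nmB in h1.
rewrite (_ : s - _ = (s - (\sum_(i <- A) f i + \sum_(i <- E) f i)) + \sum_(i <- E) f i).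
  by rewrite (le_trans (nmD _ _))//; lra.
by ring.
Qed.

(* A Fourier coefficient of an absolutely convergent series, the frequencies
   [nu i] being allowed to repeat. *)
Lemma Lam_coef (I : choiceType) (b : I -> R[i]) (nu : I -> int) (g : R -> R[i]) n0 :
  asum b -> (forall x, hsum (fun i => b i * ek (nu i) x) (g x)) ->
  bnd g /\ hsum (fun i => if nu i == n0 then b i else 0) (Lam (fun x => g x * ek (- n0) x)).
Proof.
move=> ba bg.
have gb : bnd g.
  have [M hM] := ba; exists M => x; apply: (hsum_nm (bg x)) => A.
  by under eq_bigr do rewrite nmM nm_ek mulr1.
split=> //.
have ga : asum (fun i => if nu i == n0 then b i else 0).
  by apply: bsum_le ba => i; case: ifP => // _; rewrite nm0 nm_ge0.
have [s hs] := asum_hsum ga; suff -> : Lam (fun x => g x * ek (- n0) x) = s by [].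
apply/eqP; rewrite -subr_eq0 -nm_eq0 eq_le nm_ge0 andbT.
apply/ler_addgt0Pr => eps e0; have e2 : 0 < eps / 2 by rewrite divr_gt0.
rewrite add0r; have [A hA] := bsum_tail (fun i => nm_ge0 _) ba e2.
set S := \sum_(i <- A) (if nu i == n0 then b i else 0).
have h1 : nm (s - S) <= eps / 2.
  apply: hsum_tail hs _ => B /hA; apply: le_trans; apply: ler_sum => i _.
  by case: ifP => // _; rewrite nm0 nm_ge0.
have bF i : bnd (fun x => b i * ek (nu i - n0) x) by apply: bndZ; exact: bnd_ek.
have h2 : Lam (fun x => \sum_(i <- A) b i * ek (nu i - n0) x) = S.
  rewrite Lam_sum//; apply: eq_bigr => i _; rewrite LamZ ?Lam_ek ?subr_eq0; last exact: bnd_ek.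
  by case: eqP => _; rewrite ?mulr1 ?mulr0.
have h3 : nm (Lam (fun x => g x * ek (- n0) x) - S) <= eps / 2.
  rewrite -h2 -LamB; [|by apply: bndM => //; exact: bnd_ek|exact: bnd_sum].
  apply: Lam_le => x.
  rewrite (_ : _ - _ = (g x - \sum_(i <- A) b i * ek (nu i) x) * ek (- n0) x).
    rewrite nmM nm_ek mulr1; apply: hsum_tail (bg x) _ => B /hA; apply: le_trans.
    by apply: ler_sum => i _; rewrite nmM nm_ek mulr1.
  rewrite mulrBl mulr_suml; congr (_ - _); apply: eq_bigr => i _.
  by rewrite ekD mulrA.
rewrite (le_trans (nm_subD _ S _))// [nm (S - s)]nmB; lra.
Qed.

End MeanFunctional.

(** * Goursat's theorem and Fourier expansions *)

Section Differentiability.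
Variable R : realType.
Local Notation C := R[i].
Implicit Types (f : C -> C) (z w : C).

Lemma posC (eps : C) : 0 < eps -> eps = (complex.Re eps)%:C /\ 0 < complex.Re eps.
Proof.
by rewrite ltcE/= => /andP[/eqP h1 h2]; split => //; apply: complexP => //=; rewrite h1.
Qed.

Lemma nbhs_nm (z : C) (P : set C) :
  nbhs z P <-> exists d : R, 0 < d /\ forall w, nm (w - z) < d -> P w.
Proof.
split=> [/nbhs_ballP[eps /= e0 h]|[d [d0 h]]].
  have [-> e1] := posC e0; exists (complex.Re eps); split=> // w wz; apply: h.
  rewrite /ball/= /ball_ [eps](posC e0).1 distrC nmE ltcR//.
apply/nbhs_ballP; exists d%:C => /=; first by rewrite ltcR.
by move=> w; rewrite /ball/= /ball_ distrC nmE ltcR => /h.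
Qed.

Lemma differentiable_epsdelta f z : differentiable f z -> exists d, forall eps : R, 0 < eps ->
  exists del : R, 0 < del /\ forall h, nm h < del -> nm (f (z + h) - f z - d * h) <= eps * nm h.
Proof.
move=> df; exists ('d f z 1) => eps e0.
have /diff_locallyP[_ /eqaddoP] := df; move=> /(_ eps%:C); rewrite ltcR => /(_ e0).
move=> /nbhs_nm[d [d0 hd]]; exists d; split => // h hh.
have E : 'd f z h = 'd f z 1 * h.
  by rewrite -[in LHS](mulr1 h) -[h * 1]/(h *: (1 : C)) linearZ/= mulrC.
have H : `|f (h + z) - (f z + 'd f z h)| <= eps%:C * `|h| by apply: hd; rewrite subr0.
by rewrite -E -lecR rmorphM/= -!nmE [z + h]addrC -addrA -opprD.
Qed.

Definition lin2 (d1 d2 : C) (p : C * C) : C := d1 * p.1 + d2 * p.2.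

Lemma lin2_linear d1 d2 : linear (lin2 d1 d2).
Proof.
move=> a [u1 u2] [v1 v2]; rewrite /lin2/= -[a *: _]/(a * _) -![a *: _]/(a * _); ring.
Qed.

HB.instance Definition _ d1 d2 := GRing.isLinear.Build C (C * C)%type C _ (lin2 d1 d2) (lin2_linear d1 d2).

(** A quadratic remainder is little-o of the increment. Functions of one variable reach this
    criterion through the diagonal t |-> (t, t). *)
Lemma differentiable_quad (f : C * C -> C) (p : C * C) (d1 d2 : C) (c r : R) : 0 < r ->
  (forall h1 h2, nm h1 < r -> nm h2 < r ->
    nm (f (p.1 + h1, p.2 + h2) - f p - (d1 * h1 + d2 * h2)) <= c * (nm h1 + nm h2) ^+ 2) ->
  differentiable f p.
Proof.
move=> r0 H.
have lc : continuous (lin2 d1 d2).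
  move=> q; apply: cvgD; apply: cvgMl_tmp; [exact: cvg_fst|exact: cvg_snd].
have U := @diff_unique C (C * C)%type C f (lin2 d1 d2) p lc.
(* The premise of [U], extracted from its type: the remainder is little-o. The bound del <= ep / (4
   (|c| + 1)) brings 4 |c| m^2 below ep m. *)
have E : ltac:(match type of U with ?A -> _ => exact A end).
  apply/eqaddoP => eps e0; have [-> e1] := posC e0; set ep := complex.Re eps in e1 *.
  pose del := Num.min r (ep / (4 * (`|c| + 1))).
  have c1 : 0 < 4 * (`|c| + 1) by rewrite mulr_gt0// ltr_wpDl.
  have del0 : 0 < del by rewrite lt_min r0/= divr_gt0.
  apply/nbhs_ballP; exists del%:C => /=; first by rewrite ltcR.
  move=> -[h1 h2] [/=]; rewrite /ball/= /ball_ !sub0r !normrN !nmE !ltcR => l1 l2.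
  have [a1 b1] : nm h1 < r /\ nm h1 < ep / (4 * (`|c| + 1)).
    by move: l1; rewrite lt_min => /andP[].
  have [a2 b2] : nm h2 < r /\ nm h2 < ep / (4 * (`|c| + 1)).
    by move: l2; rewrite lt_min => /andP[].
  have := H _ _ a1 a2.
  rewrite [X in _ -> (nm X)%:C <= _](_ : _ =
    f (p.1 + h1, p.2 + h2) - f p - (d1 * h1 + d2 * h2)); last first.
    rewrite -[LHS]/(f ((h1, h2) + p) - (f p + lin2 d1 d2 (h1, h2))).
    have -> : (h1, h2) + p = (p.1 + h1, p.2 + h2) by rewrite [LHS]addrC; case: (p).
    by rewrite /lin2/= opprD addrA.
  set X := _ - _ - _ => hX.
  set m := Num.max (nm h1) (nm h2).
  have -> : `|((h1, h2) : C * C)| = m%:C.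
    by rewrite prod_normE/= !nmE /m /Num.max /Order.max ltcR; case: ifP.
  rewrite -rmorphM lecR.
  have m1 : nm h1 <= m by rewrite le_max lexx.
  have m2 : nm h2 <= m by rewrite le_max lexx orbT.
  have m0 : 0 <= m by rewrite (le_trans (nm_ge0 h1)).
  have mb : m < ep / (4 * (`|c| + 1)) by rewrite gt_max b1.
  have s2 : (nm h1 + nm h2) ^+ 2 <= 4 * m ^+ 2.
    rewrite (_ : 4 * m ^+ 2 = (2 * m) ^+ 2); last by ring.
    rewrite ler_sqr ?nnegrE ?addr_ge0 ?nm_ge0 ?mulr_ge0//; lra.
  apply: (le_trans hX); apply: (@le_trans _ _ ((`|c| + 1) * (4 * m ^+ 2))).
    apply: (@le_trans _ _ ((`|c| + 1) * (nm h1 + nm h2) ^+ 2)).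
      by rewrite ler_wpM2r ?sqr_ge0//; have := ler_norm c; lra.
    by rewrite ler_wpM2l// addr_ge0.
  rewrite ltr_pdivlMr// in mb.
  rewrite (_ : (`|c| + 1) * (4 * m ^+ 2) = m * (4 * (`|c| + 1)) * m); last by ring.
  by rewrite ler_wpM2r// ltW.
by apply/diff_locallyP; rewrite (U E).
Qed.

Lemma differentiable_e z : differentiable (@cexp2pi R) z.
Proof.
have -> : @cexp2pi R = (fun p : C * C => cexp2pi p.1) \o (fun t : C => (t, t)) by [].
apply: differentiable_comp; first exact: differentiable_pair.
pose c := 4 * (2 * pi) ^+ 2 * expR (2 * pi) * nm (cexp2pi z) : R.
apply: (@differentiable_quad _ _ (cexp2pi z * ((2 * pi)%:C * 'i)) 0 c 1) => //= h1 h2 l1 _.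
rewrite (_ : _ - _ = cexp2pi z * (cexp2pi h1 - 1 - (2 * pi)%:C * 'i * h1)); last first.
  by rewrite eD; ring.
rewrite nmM /c mulrC [leRHS]mulrAC ler_wpM2r ?nm_ge0//.
apply: (le_trans (exp_taylor _)); rewrite exprMn mulrA mulrAC.
have p0 : 0 <= 2 * pi :> R by rewrite mulr_ge0 ?pi_ge0.
rewrite ler_pM ?mulr_ge0 ?sqr_ge0 ?expR_ge0 ?nm_ge0 ?pi_ge0//.
  apply: ler_wpM2l; first by rewrite mulr_ge0 ?sqr_ge0.
  by rewrite ler_expR ler_piMr// ltW.
by rewrite ler_sqr ?nnegrE ?addr_ge0 ?nm_ge0// lerDl nm_ge0.
Qed.

Lemma diffC_cst (c w : C) : differentiable (fun _ : C => c) w.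
Proof. exact: (@differentiable_cst C C C c w). Qed.

Lemma diffC_id (w : C) : differentiable (fun z : C => z) w.
Proof.
have E : (fun z : C => z) = ( *:%R (1 : C)) by apply: funext => z; rewrite scale1r.
by rewrite E.
Qed.

Lemma diffC_mul (f g : C -> C) (w : C) : differentiable f w -> differentiable g w ->
  differentiable (fun z : C => f z * g z) w.
Proof. exact: (@differentiableM C C f g w). Qed.

Lemma diffC_comp (f g : C -> C) (w : C) : differentiable f w -> differentiable g (f w) ->
  differentiable (fun z : C => g (f z)) w.
Proof. exact: (@differentiable_comp C C C C f g w). Qed.

Lemma diffC_scale (c w : C) : differentiable (fun u : C => c * u) w.
Proof. exact: (diffC_mul (diffC_cst c w) (diffC_id w)). Qed.

End Differentiability.

(** * Goursat's theorem for trapezoidal sums *)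

Section Goursat.
Variable R : realType.
Local Notation C := R[i].
Implicit Types (f g : C -> C) (p v z : C).

(** The trapezoidal sum with 2^m steps for the integral of f along the segment from p to p + v.
    Defining it by halving makes the subdivision of a rectangle into four ([bdryS]) an algebraic
    identity. *)
Fixpoint trap f m p v : C :=
  if m is m'.+1 then trap f m' p (v / 2) + trap f m' (p + v / 2) (v / 2)
  else (f p + f (p + v)) / 2 * v.

Lemma trapB f g m p v : trap (fun z => f z - g z) m p v = trap f m p v - trap g m p v.
Proof. by elim: m p v => [|m IH] p v /=; [ring|rewrite !IH; ring]. Qed.

(** The trapezoidal rule is exact on affine functions, so that their sum around a rectangle is 0 at
    every level m and not merely in the limit. *)
Lemma trap_affine a b m p v :
  trap (fun z => a + b * z) m p v = a * v + b * ((p + v) ^+ 2 - p ^+ 2) / 2.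
Proof.
elim: m p v => [|m IH] p v /=; first by field.
by rewrite !IH (_ : p + v / 2 + v / 2 = p + v); field.
Qed.

Lemma trap_le f m p v (B : R) :
  (forall s : R, 0 <= s <= 1 -> nm (f (p + s%:C * v)) <= B) -> nm (trap f m p v) <= B * nm v.
Proof.
elim: m p v => [|m IH] p v h /=.
  rewrite nmM ler_wpM2r ?nm_ge0// nmM nmV nm_nat ler_pdivrMr//.
  apply: (le_trans (nmD _ _)); have := h 0; have := h 1; rewrite mul0r mul1r addr0 !lexx ler01/=.
  by move=> /(_ isT) + /(_ isT); lra.
have v2 : nm (v / 2) = nm v / 2 by rewrite nmM nmV nm_nat.
have two : (2 : C) = (2 : R)%:C by rewrite natC.
have h1 : nm (trap f m p (v / 2)) <= B * (nm v / 2).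
  rewrite -v2; apply: IH => s /andP[s0 s1].
  rewrite (_ : s%:C * (v / 2) = (s / 2)%:C * v); first by apply: h; lra.
  by rewrite rmorphM/= fmorphV/= -two; field.
have h2 : nm (trap f m (p + v / 2) (v / 2)) <= B * (nm v / 2).
  rewrite -v2; apply: IH => s /andP[s0 s1].
  rewrite (_ : p + v / 2 + s%:C * (v / 2) = p + ((1 + s) / 2)%:C * v); first by apply: h; lra.
  by rewrite rmorphM/= fmorphV/= rmorphD/= -two; field.
by apply: (le_trans (nmD _ _)); lra.
Qed.

Definition bdry f m z (w h : R) : C :=
  trap f m z w%:C + trap f m (z + w%:C) ('i * h%:C)
  - trap f m (z + 'i * h%:C) w%:C - trap f m z ('i * h%:C).

Lemma half_real (w : R) : (w / 2)%:C = w%:C / 2.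
Proof. by rewrite rmorphM/= fmorphV/= natC. Qed.

Lemma bdryS f m z w h : bdry f m.+1 z w h =
  bdry f m z (w / 2) (h / 2) + bdry f m (z + (w / 2)%:C) (w / 2) (h / 2)
  + bdry f m (z + 'i * (h / 2)%:C) (w / 2) (h / 2)
  + bdry f m (z + (w / 2)%:C + 'i * (h / 2)%:C) (w / 2) (h / 2).
Proof.
rewrite /bdry/= !half_real; set W := w%:C; set H := 'i * h%:C.
rewrite (_ : 'i * (h%:C / 2) = H / 2); last by rewrite /H mulrA.
rewrite (_ : z + W / 2 + W / 2 = z + W); last by field.
rewrite (_ : z + H / 2 + H / 2 = z + H); last by field.
rewrite (_ : z + W / 2 + H / 2 + W / 2 = z + W + H / 2); last by field.
rewrite (_ : z + H / 2 + W / 2 = z + W / 2 + H / 2); last by ring.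
rewrite (_ : z + W / 2 + H / 2 + H / 2 = z + H + W / 2); last by field.
ring.
Qed.

Lemma bdryB f g m z w h : bdry (fun z => f z - g z) m z w h = bdry f m z w h - bdry g m z w h.
Proof. rewrite /bdry !trapB; ring. Qed.

Lemma bdry_affine a b m z w h : bdry (fun z => a + b * z) m z w h = 0.
Proof. by rewrite /bdry !trap_affine; field. Qed.

Lemma bdry_le f m z w h B : 0 <= w -> 0 <= h ->
  (forall x y, 0 <= x <= w -> 0 <= y <= h -> nm (f (z + (x +i* y))) <= B) ->
  nm (bdry f m z w h) <= B * (2 * (w + h)).
Proof.
move=> w0 h0 H.
have nw : nm w%:C = w by rewrite nm_pos.
have nh : nm ('i * h%:C) = h.
  by rewrite nmM nm_pos// nm_def/= expr0n expr1n add0r sqrtr1 mul1r.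
have pt (x y : R) : x%:C + 'i * y%:C = x +i* y.
  by apply: complexP; rewrite !(ReD,ImD,ReM,ImM)/=; ring.
have sw s : 0 <= s <= 1 -> 0 <= s * w <= w.
  by move=> /andP[s0 s1]; rewrite mulr_ge0//= ler_piMl.
have sh s : 0 <= s <= 1 -> 0 <= s * h <= h.
  by move=> /andP[s0 s1]; rewrite mulr_ge0//= ler_piMl.
have t1 : nm (trap f m z w%:C) <= B * w.
  rewrite -[X in _ <= _ * X]nw; apply: trap_le => s s01.
  rewrite (_ : z + s%:C * w%:C = z + ((s * w) +i* 0)).
    by apply: H; rewrite ?lexx ?sw.
  by rewrite -pt rmorphM rmorph0/=; ring.
have t2 : nm (trap f m (z + w%:C) ('i * h%:C)) <= B * h.
  rewrite -[X in _ <= _ * X]nh; apply: trap_le => s s01.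
  rewrite (_ : z + w%:C + s%:C * ('i * h%:C) = z + (w +i* (s * h))).
    by apply: H; rewrite ?lexx ?sh ?w0.
  by rewrite -pt rmorphM/=; ring.
have t3 : nm (trap f m (z + 'i * h%:C) w%:C) <= B * w.
  rewrite -[X in _ <= _ * X]nw; apply: trap_le => s s01.
  rewrite (_ : z + 'i * h%:C + s%:C * w%:C = z + ((s * w) +i* h)).
    by apply: H; rewrite ?lexx ?sw ?h0.
  by rewrite -pt rmorphM/=; ring.
have t4 : nm (trap f m z ('i * h%:C)) <= B * h.
  rewrite -[X in _ <= _ * X]nh; apply: trap_le => s s01.
  rewrite (_ : z + s%:C * ('i * h%:C) = z + (0 +i* (s * h))).
    by apply: H; rewrite ?lexx ?sh.
  by rewrite -pt rmorphM rmorph0/=; ring.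
rewrite /bdry; have n1 := nmD (trap f m z w%:C) (trap f m (z + w%:C) ('i * h%:C)).
have n2 := nmD (trap f m z w%:C + trap f m (z + w%:C) ('i * h%:C)) (- trap f m (z + 'i * h%:C) w%:C).
rewrite nmN in n2; apply: (le_trans (nmD _ _)); rewrite nmN; lra.
Qed.

(** Failure for infinitely many m, which is the form that passes to one of four quarters: four
    eventual bounds would combine into one. *)
Definition bad f z w h (eps : R) :=
  forall M, exists m, (M <= m)%N /\ eps < nm (bdry f m z w h).

Lemma nm_sum4 (a b c d : C) (eps : R) : nm d <= eps / 4 -> nm c <= eps / 4 ->
  nm b <= eps / 4 -> nm a <= eps / 4 -> nm (a + b + c + d) <= eps.
Proof.
move=> hd hc hb ha.
have := nmD a b; have := nmD (a + b) c; have := nmD (a + b + c) d; lra.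
Qed.

Lemma bad_quarter f z w h eps : 0 < w -> 0 < h -> bad f z w h eps ->
  exists z', [/\ bad f z' (w / 2) (h / 2) (eps / 4),
    complex.Re z <= complex.Re z' <= complex.Re z + w / 2
    & complex.Im z <= complex.Im z' <= complex.Im z + h / 2].
Proof.
move=> w0 h0 hb; apply: contrapT => H.
have w2 : 0 < w / 2 by lra. have h2 : 0 < h / 2 by lra.
have good z' : complex.Re z <= complex.Re z' <= complex.Re z + w / 2 ->
    complex.Im z <= complex.Im z' <= complex.Im z + h / 2 ->
    exists M, forall m, (M <= m)%N -> nm (bdry f m z' (w / 2) (h / 2)) <= eps / 4.
  move=> a b; apply: contrapT => nex; apply: H; exists z'; split=> // M.
  apply: contrapT => nm'; apply: nex; exists M => m Mm; rewrite leNgt; apply/negP => lt.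
  by apply: nm'; exists m.
have [||M1 h1] := good z; [lra|lra|].
have [||M2 h2'] := good (z + (w / 2)%:C); [rewrite ReD/=; lra|rewrite ImD/=; lra|].
have [||M3 h3] := good (z + 'i * (h / 2)%:C).
- by rewrite ReD ReM/=; lra.
- by rewrite ImD ImM/=; lra.
have [||M4 h4] := good (z + (w / 2)%:C + 'i * (h / 2)%:C).
- by rewrite !ReD ReM/=; lra.
- by rewrite !ImD ImM/=; lra.
have [[|m] [Mm lt]] := hb (M1 + M2 + M3 + M4).+1; first by [].
move: lt; rewrite bdryS ltNge => /negP; apply.
apply: nm_sum4; [apply: h4|apply: h3|apply: h2'|apply: h1]; rewrite -ltnS (leq_trans _ Mm)// ltnS ?leq_addl//; clear; lia.
Qed.

(** Nested bad rectangles shrink to a point p. On the n-th one f differs from its affine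
    approximation at p by at most eta (w + h) / 2^n, and the perimeter is 2 (w + h) / 2^n. With eta
    = eps / (4 (w + h)^2) the boundary sum is at most half of the value eps / 4^n that it
    exceeds. *)
Lemma goursat f z w h : 0 < w -> 0 < h ->
  (forall x y, 0 <= x <= w -> 0 <= y <= h -> differentiable f (z + (x +i* y))) ->
  forall eps, 0 < eps -> exists M, forall m, (M <= m)%N -> nm (bdry f m z w h) <= eps.
Proof.
move=> w0 h0 df eps e0; apply: contrapT => nex.
pose P n z' := bad f z' (w / 2 ^+ n) (h / 2 ^+ n) (eps / 4 ^+ n).
have P0 : P 0%N z.
  rewrite /P !expr0 !divr1 => M; apply: contrapT => nm'; apply: nex; exists M => m Mm.
  by rewrite leNgt; apply/negP => lt; apply: nm'; exists m.
have pos n : 0 < w / 2 ^+ n /\ 0 < h / 2 ^+ n by rewrite !divr_gt0 ?exprn_gt0.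
have stepP (n : nat) (z1 : C) : exists z2, P n z1 -> [/\ P n.+1 z2,
    complex.Re z1 <= complex.Re z2 <= complex.Re z1 + w / 2 ^+ n / 2
    & complex.Im z1 <= complex.Im z2 <= complex.Im z1 + h / 2 ^+ n / 2].
  have [Pn|nP] := pselect (P n z1); last by exists z1 => /nP.
  have [wn hn] := pos n; have [z2 [a b c]] := bad_quarter wn hn Pn.
  exists z2 => _; split=> //; move: a; rewrite /P !exprSr.
  by rewrite !invfM !mulrA.
have [F hF] := choice (fun nz : nat * C => stepP nz.1 nz.2).
pose zs := fix zs n := if n is n'.+1 then F (n', zs n') else z.
have Pz n : P n (zs n) by elim: n => [//|n IH]; have [] := hF (n, zs n) IH.
have st n := hF (n, zs n) (Pz n).
have mono (u : nat -> R) (W : R) : 0 < W ->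
    (forall n, u n <= u n.+1 <= u n + W / 2 ^+ n / 2) ->
    exists l, forall n, u n <= l <= u n + W / 2 ^+ n.
  move=> W0 hu.
  have up n m : u n <= u (n + m)%N.
    by elim: m => [|m IH]; rewrite ?addn0// addnS (le_trans IH)//; have /andP[] := hu (n + m)%N.
  have down n m : u (n + m)%N + W / 2 ^+ (n + m) <= u n + W / 2 ^+ n.
    elim: m => [|m IH]; rewrite ?addn0// addnS; apply: le_trans IH.
    have /andP[_] := hu (n + m)%N; rewrite exprS invfM; set X := _ ^-1; lra.
  have Wp n : 0 < W / 2 ^+ n by rewrite divr_gt0 ?exprn_gt0.
  have cross n m : u n <= u m + W / 2 ^+ m.
    case: (leqP n m) => [nm'|/ltnW nm'].
      by have := up n (m - n)%N; rewrite subnKC//; have := Wp m; lra.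
    by have := down m (n - m)%N; rewrite subnKC//; have := Wp n; lra.
  pose E := [set u n | n in [set: nat]].
  have hs : has_sup E.
    split; first by exists (u 0%N), 0%N.
    by exists (u 0%N + W / 2 ^+ 0) => _ [n _ <-].
  exists (sup E) => n; apply/andP; split.
    by apply: sup_upper_bound => //; exists n.
  by apply: ge_sup; [case: hs|move=> _ [m _ <-]].
have [px hx] := mono (fun n => complex.Re (zs n)) w w0 (fun n => let: And3 _ a _ := st n in a).
have [py hy] := mono (fun n => complex.Im (zs n)) h h0 (fun n => let: And3 _ _ a := st n in a).
pose p := px +i* py.
have [d hd] : exists d, forall ep : R, 0 < ep -> exists del : R, 0 < del /\
    forall k, nm k < del -> nm (f (p + k) - f p - d * k) <= ep * nm k.
  apply: differentiable_epsdelta.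
  have := hx 0%N; have := hy 0%N; rewrite /= !expr0 !divr1 => hy0 hx0.
  have := df (px - complex.Re z) (py - complex.Im z).
  rewrite (_ : z + _ = p); last by apply: complexP; rewrite !(ReD,ImD)/=; ring.
  by apply; lra.
pose W := w + h; have W0 : 0 < W by rewrite addr_gt0.
have W2 : 0 < 4 * W ^+ 2 by rewrite mulr_gt0 ?exprn_gt0.
pose eta := eps / (4 * W ^+ 2); have eta0 : 0 < eta by rewrite divr_gt0.
have [del [del0 hdel]] := hd _ eta0.
have [n hn] : exists n, W / 2 ^+ n < del.
  have [n hn] : exists n : nat, W / del < n%:R.
    by exists (Num.bound (W / del)); rewrite archi_boundP// divr_ge0 ?ltW.
  exists n; rewrite ltr_pdivrMr ?exprn_gt0// mulrC -ltr_pdivrMr// (lt_le_trans hn)//.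
  by rewrite -natrX ler_nat ltnW// ltn_expl.
have [wn hn'] := pos n; set wn_ := w / 2 ^+ n in wn *; set hn_ := h / 2 ^+ n in hn' *.
have WE : W / 2 ^+ n = wn_ + hn_ by rewrite /W mulrDl.
have [m [_]] := Pz n 0%N; rewrite -/wn_ -/hn_ ltNge => /negP; apply.
pose g (q : C) := f q - ((f p - d * p) + d * q).
have -> : bdry f m (zs n) wn_ hn_ = bdry g m (zs n) wn_ hn_.
  by rewrite bdryB bdry_affine subr0.
apply: (@le_trans _ _ (eta * (wn_ + hn_) * (2 * (wn_ + hn_)))).
  apply: bdry_le; [exact: ltW|exact: ltW|] => x y /andP[x0 x1] /andP[y0 y1].
  set q := zs n + _; have dq : nm (q - p) <= wn_ + hn_.
    apply: (le_trans (nm_le_ReIm _)); rewrite /q !(ReD,ImD,ReN,ImN)/=.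
    have /andP[a1 a2] := hx n; have /andP[b1 b2] := hy n.
    rewrite -/wn_ in a2; rewrite -/hn_ in b2.
    by apply: lerD; rewrite ler_norml; apply/andP; split; lra.
  have := hdel (q - p); rewrite (le_lt_trans dq) -?WE// => /(_ isT).
  rewrite (_ : p + (q - p) = q); last by ring.
  rewrite (_ : f q - f p - d * (q - p) = g q); last by rewrite /g; ring.
  by move=> hh; apply: (le_trans hh); rewrite ler_wpM2l// ?WE// ltW.
rewrite -WE /eta.
have -> : 4 ^+ n = (2 ^+ n) ^+ 2 :> R by rewrite -exprM mulnC exprM; congr (_ ^+ _); ring.
set N2 := 2 ^+ n; have N0 : N2 != 0 :> R by rewrite expf_neq0.
have Wn : W != 0 by rewrite gt_eqF.
rewrite (_ : _ * _ = eps / N2 ^+ 2 / 2); last by field; rewrite N0 Wn.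
have : 0 < eps / N2 ^+ 2 by rewrite divr_gt0// exprn_gt0// exprn_gt0.
lra.
Qed.

End Goursat.

(** * Fourier coefficients on a strip and Bessel's inequality *)

Section FourierSeries.
Variable R : realType.
Local Notation C := R[i].
Local Notation e := (@cexp2pi R).
Implicit Types (f g : C -> C).

Lemma trap_sum f m p v : trap f m p v = \sum_(0 <= i < 2 ^ m)
  (f (p + i%:R * (v / (2 ^ m)%:R)) + f (p + i.+1%:R * (v / (2 ^ m)%:R))) / 2 * (v / (2 ^ m)%:R).
Proof.
elim: m p v => [|m IH] p v.
  by rewrite expn0 big_nat1 divr1 mul0r addr0 mul1r.
rewrite /= !IH expnS mul2n -addnn [RHS](@big_cat_nat _ _ _ (2 ^ m)) ?leq_addr//=.
have E : v / (2 ^ m + 2 ^ m)%:R = v / 2 / (2 ^ m)%:R.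
  by rewrite addnn -mul2n natrM invfM mulrA.
rewrite E; congr (_ + _).
rewrite -[X in _ = \sum_(X <= _ < _) _]add0n big_addn addnK; apply: eq_bigr => i _.
set w := v / 2 / _; have W : (2 ^ m)%:R * w = v / 2 by rewrite mulrC divfK ?pow2_neq0.
congr ((f _ + f _) / 2 * _).
  by rewrite natrD mulrDl W; ring.
by rewrite -addSn natrD mulrDl W; ring.
Qed.

(** The trapezoidal and the left-endpoint sums differ by a telescoping sum, which periodicity closes
    up. *)
Lemma trap_avg f m p : f (p + 1) = f p -> trap f m p 1 = avg m (fun x => f (p + x%:C)).
Proof.
move=> per; rewrite trap_sum mul1r /avg -(big_mkord predT (fun i => f (p + (i%:R / (2 ^ m)%:R)%:C))).
rewrite mulr_sumr; set K := (2 ^ m)%N; set a := fun i : nat => f (p + i%:R * K%:R^-1).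
have K0 : K%:R != 0 :> C by exact: pow2_neq0.
have tel : \sum_(0 <= i < K) (a i.+1 - a i) = 0.
  by rewrite telescope_sumr// /a divff// mul0r addr0 per subrr.
apply/eqP; rewrite -subr_eq0 -sumrB.
have -> : \sum_(0 <= i < K) ((f (p + i%:R * K%:R^-1) + f (p + i.+1%:R * K%:R^-1)) / 2 * K%:R^-1 -
     K%:R^-1 * f (p + (i%:R / K%:R)%:C)) = \sum_(0 <= i < K) (K%:R^-1 / 2) * (a i.+1 - a i).
  apply: eq_bigr => i _; rewrite rmorphM/= fmorphV/= -!natC -/(a i) -/(a i.+1); field.
  exact: K0.
by rewrite -mulr_sumr tel mulr0.
Qed.

Definition strip_hol f (lo hi B : R) := forall z : C, lo <= complex.Im z <= hi ->
  [/\ f (z + 1) = f z, differentiable f z & nm (f z) <= B].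

(* The n-th Fourier coefficient of f, independent of the height y where it is
   taken as long as f is holomorphic and periodic in the strip (coef_indep). *)
Definition coef f y (n : int) : C := Lam (fun x => f (x +i* y) * e (- (n%:~R * (x +i* y)))).

Lemma Im_intM (n : int) (z : C) : complex.Im (n%:~R * z) = n%:~R * complex.Im z.
Proof. by rewrite intC ImM/= mul0r addr0. Qed.

Lemma nm_eint (n : int) (z : C) : nm (e (n%:~R * z)) = expR (- (2 * pi * (n%:~R * complex.Im z))).
Proof. by rewrite nm_e Im_intM. Qed.

Lemma nm_eintN (n : int) (z : C) : nm (e (- (n%:~R * z))) = expR (2 * pi * (n%:~R * complex.Im z)).
Proof. by rewrite nm_e ImN Im_intM mulrN opprK. Qed.

Lemma coef_bnd f y n B : (forall x, nm (f (x +i* y)) <= B) ->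
  bnd (fun x => f (x +i* y) * e (- (n%:~R * (x +i* y)))).
Proof.
move=> h; exists (B * expR (2 * pi * (n%:~R * y))) => x.
by rewrite nmM nm_eintN ler_wpM2r ?expR_ge0.
Qed.

Lemma coef_le f y n B : (forall x, nm (f (x +i* y)) <= B) ->
  nm (coef f y n) <= B * expR (2 * pi * (n%:~R * y)).
Proof.
by move=> h; apply: Lam_le => x; rewrite nmM nm_eintN ler_wpM2r ?expR_ge0.
Qed.

(** Goursat's theorem is applied to a rectangle of width 1. Its vertical sides cancel at every level
    by periodicity, and its horizontal sides are dyadic averages by [trap_avg]. *)
Lemma coef_indep f y1 y2 B n : y1 < y2 -> strip_hol f y1 y2 B -> coef f y1 n = coef f y2 n.
Proof.
move=> y12 hf; pose g (z : C) := f z * e (- (n%:~R * z)).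
have b1 : bnd (fun x => g (x +i* y1)).
  by apply: (@coef_bnd f y1 n B) => x; have [] := hf (x +i* y1); rewrite //= lexx ltW.
have b2 : bnd (fun x => g (x +i* y2)).
  by apply: (@coef_bnd f y2 n B) => x; have [] := hf (x +i* y2); rewrite //= lexx andbT ltW.
apply/eqP; rewrite -subr_eq0 /coef -LamB//; apply/eqP.
apply: Lam_uniq; first by apply: bndD => //; have := bndZ (-1) b2;
  rewrite (_ : (fun _ => -1 * _) = (fun x => - g (x +i* y2)))//; apply: funext => x; rewrite mulN1r.
have gper z : y1 <= complex.Im z <= y2 -> g (z + 1) = g z.
  move=> hz; have [p _ _] := hf _ hz; rewrite /g p; congr (_ * _).
  by rewrite mulrDr mulr1 opprD -mulrNz eDint.
have gdiff z : y1 <= complex.Im z <= y2 -> differentiable g z.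
  move=> hz; have [_ d _] := hf _ hz; apply: (@differentiableM _ _ f _ z d).
  have -> : (fun z : C => e (- (n%:~R * z))) = e \o ((fun z => - n%:~R * z)).
    by apply: funext => w /=; rewrite mulNr.
  apply: differentiable_comp; last exact: differentiable_e.
  have E : (fun z : C => - n%:~R * z) = ( *:%R (- n%:~R : C)) by [].
  by rewrite E.
have h0 : 0 < y2 - y1 by rewrite subr_gt0.
move=> eps e0; apply: ultra_oo.
have [|M hM] := @goursat R g (0 +i* y1) 1 (y2 - y1) ltr01 h0 _ eps e0.
  move=> x y x01 y01; apply: gdiff; rewrite ImD/=.
  by move: y01 => /andP[a b]; rewrite lerDl a addrC -lerBrDr.
exists M => m /hM; rewrite /bdry /=.
have e2 : (0 +i* y1) + 'i * (y2 - y1)%:C = 0 +i* y2.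
  by apply: complexP; rewrite !(ReD,ImD,ReM,ImM)/=; ring.
have pt (x y : R) : (0 +i* y) + x%:C = x +i* y.
  by apply: complexP; rewrite !(ReD,ImD)/=; ring.
have vert : trap g m ((0 +i* y1) + 1%:C) ('i * (y2 - y1)%:C) = trap g m (0 +i* y1) ('i * (y2 - y1)%:C).
  rewrite !trap_sum; set v := _ / _.
  have vE : v = 'i * ((y2 - y1) / (2 ^ m)%:R)%:C.
    by rewrite /v rmorphM/= fmorphV/= natC mulrA.
  have K0 : 0 < (2 ^ m)%:R :> R by rewrite ltr0n expn_gt0.
  have gp i : (i <= 2 ^ m)%N -> g ((0 +i* y1) + 1%:C + i%:R * v) = g ((0 +i* y1) + i%:R * v).
    move=> im; rewrite addrAC gper// vE !(ImD,ImM) natC/=.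
    rewrite !(mul0r,mulr0,subr0,addr0,add0r,mul1r,sub0r,oppr0).
    have i0 : 0 <= i%:R * ((y2 - y1) / (2 ^ m)%:R) by rewrite mulr_ge0// divr_ge0// ltW.
    have i1 : i%:R * ((y2 - y1) / (2 ^ m)%:R) <= y2 - y1.
      rewrite mulrCA ler_piMr ?(ltW h0)// ler_pdivrMr// mul1r ler_nat//.
    by rewrite lerDl i0 addrC -lerBrDr.
  rewrite big_nat_cond [RHS]big_nat_cond; apply: eq_bigr => i /andP[/andP[_ iK] _].
  by rewrite !gp// ltnW.
have one : 1%:C = 1 :> C by [].
rewrite e2 vert [_ + _ - trap g m (0 +i* y2) _]addrAC addrK.
rewrite one trap_avg; last by rewrite gper//= lexx ltW.
rewrite trap_avg; last by rewrite gper//= lexx andbT ltW.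
rewrite (_ : (fun x => g ((0 +i* y1) + x%:C)) = fun x => g (x +i* y1)); last by apply: funext => x; rewrite pt.
rewrite (_ : (fun x => g ((0 +i* y2) + x%:C)) = fun x => g (x +i* y2)); last by apply: funext => x; rewrite pt.
move=> h; rewrite subr0 /=.
rewrite (_ : avg m _ = avg m (fun x => g (x +i* y1)) - avg m (fun x => g (x +i* y2)))//.
by rewrite -[- avg _ _]mulN1r -avgZ -avgD; congr avg; apply: funext => x; rewrite mulN1r.
Qed.

(** The double-angle formula and the mean value theorem give sin u = u cos c cos(u / 2), and both
    cosines are at least cos(pi / 4), whose square is 1/2. *)
Lemma sin_ge_half (u : R) : 0 <= u <= pi / 2 -> u / 2 <= sin u.
Proof.
move=> /andP[]; rewrite le_eqVlt => /orP[/eqP <-|u0 u1]; first by rewrite sin0 mul0r.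
have p0 := pi_gt0 R; have u2 : 0 < u / 2 by lra.
have [c [hs /andP[c0 c1]]] := sin_mvt u2.
have q : cos (pi / 4) ^+ 2 = 1 / 2 :> R.
  have := cos_mulr2n (pi / 4 : R); rewrite (_ : (pi / 4) *+ 2 = pi / 2 :> R); last by rewrite mulr2n; field.
  by rewrite cos_pihalf -mulr_natl; lra.
have q0 : 0 <= cos (pi / 4) :> R by apply: cos_ge0_pihalf; lra.
have mon (v : R) : 0 < v < pi / 4 -> cos (pi / 4) <= cos v.
  move=> hv; rewrite ltW// ltr_cos ?in_itv/=; lra.
have mc : cos (pi / 4) <= cos c by apply: mon; lra.
have mu : cos (pi / 4) <= cos (u / 2).
  move: u1; rewrite le_eqVlt => /orP[/eqP ->|u1]; last by apply: mon; lra.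
  by rewrite (_ : pi / 2 / 2 = pi / 4 :> R)//; field.
have -> : sin u = 2 * (sin (u / 2) * cos (u / 2)).
  have E : u = (u / 2) *+ 2 by rewrite mulr2n -splitr.
  by rewrite [in LHS]E sin_mulr2n -mulr_natl [cos _ * _]mulrC.
rewrite hs.
have h1 : cos (pi / 4) * cos (pi / 4) <= cos c * cos (u / 2) by rewrite ler_pM.
rewrite -expr2 q in h1.
have : u / 2 * (1 / 2) <= u / 2 * (cos c * cos (u / 2)) by rewrite ler_wpM2l// ltW.
lra.
Qed.

Lemma nm_e_sub1 (t : R) : nm (e t%:C - 1) = 2 * `|sin (pi * t)|.
Proof.
apply/eqP; rewrite -(@eqrXn2 _ 2)// ?nm_ge0 ?mulr_ge0//; apply/eqP.
rewrite nm_sqr exprMn real_normK ?num_real// /cexp2pi !(ReD,ImD,ReM,ImM,ReN,ImN)/=.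
rewrite !(mulr0,oppr0,expR0,mul1r,mul0r,subr0,addr0).
have h := cos_sub1 (2 * pi * t); rewrite (_ : 2 * pi * t / 2 = pi * t) in h; last by field.
have h2 := cos2Dsin2 (2 * pi * t).
rewrite (_ : sin (pi * t) ^+ 2 = (1 - cos (2 * pi * t)) / 2); last by rewrite h; field.
nra.
Qed.

(** Chords control distances modulo 1. This bounds the denominator in the quotient of [fourier], and
    it detects integers in [e_frac_eq1]. *)
Lemma nm_e_sub1_ge (t : R) : `|t| <= 2^-1 -> `|t| <= nm (e t%:C - 1).
Proof.
move=> ht; rewrite nm_e_sub1.
have p1 := pi_ge2 R.
have -> : `|sin (pi * t)| = `|sin (pi * `|t|)|.
  by case: (leP 0 t) => t0; [rewrite (ger0_norm t0)|rewrite (ltr0_norm t0) mulrN sinN normrN].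
have := @sin_ge_half (pi * `|t|); have t0 := normr_ge0 t.
have a0 : 0 <= pi * `|t| by rewrite mulr_ge0// pi_ge0.
have a1 : pi * `|t| <= pi * 2^-1 by rewrite ler_wpM2l// pi_ge0.
rewrite a0 a1 => /(_ isT) h.
have : 2 * `|t| <= pi * `|t| by rewrite ler_wpM2r.
have := ler_norm (sin (pi * `|t|)); lra.
Qed.

Lemma Lam_conj phi : bnd phi -> Lam (fun x : R => conjc (phi x)) = conjc (Lam phi).
Proof.
have nmJ (z : C) : nm (conjc z) = nm z by rewrite !nm_def; case: z => a b /=; rewrite sqrrN.
move=> hb; apply: Lam_uniq; first by have [B h] := hb; exists B => x; rewrite nmJ.
move=> eps e0; apply: filterS (LamP hb e0) => j/=.
rewrite (_ : avg j (fun x => conjc (phi x)) = conjc (avg j phi)) -?rmorphB ?nmJ//.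
by rewrite /avg rmorphM rmorph_sum/= fmorphV/= rmorph_nat.
Qed.

Lemma Lam_Re_ge0 phi : bnd phi -> (forall x : R, 0 <= complex.Re (phi x)) -> 0 <= complex.Re (Lam phi).
Proof.
move=> hb h; apply/ler_addgt0Pr => eps e0.
have [j /= hj] := ultra_ex (LamP hb e0).
have := nm_Re (avg j phi - Lam phi); rewrite ReD ReN.
suff : 0 <= complex.Re (avg j phi) by rewrite ler_norml => h1 /andP[h2 h3]; lra.
rewrite /avg natC -fmorphV/= ReM/= mul0r subr0 mulr_ge0 ?invr_ge0//.
elim/big_ind: _ => [//|x y hx hy|i _]; last exact: h.
by rewrite ReD addr_ge0.
Qed.

Lemma ek_conj n (x : R) : conjc (ek n x) = ek (- n) x.
Proof.
rewrite /ek /cexp2pi; apply: complexP; rewrite !intC !rmorphN/= /conjc/=.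
  by rewrite !(mul0r,mulr0,subr0,addr0,add0r,oppr0,mulrN,mulNr,cosN,sinN).
by rewrite !(mul0r,mulr0,subr0,addr0,add0r,oppr0,mulrN,mulNr,cosN,sinN).
Qed.

Lemma conjcM (z w : C) : conjc (z * w) = conjc z * conjc w.
Proof. exact: rmorphM. Qed.

Lemma ekN_conj n (x : R) : conjc (ek (- n) x) = ek n x.
Proof. by rewrite ek_conj opprK. Qed.

Definition fcoef (phi : R -> C) (n : int) : C := Lam (fun x => phi x * ek (- n) x).

(** The mean of |phi - S|^2 is nonnegative, S being the partial Fourier sum over A. The use made of
    it is that the Fourier coefficients of a bounded function tend to 0. *)
Lemma bessel phi B (A : {fset int}) : (forall x, nm (phi x) <= B) ->
  \sum_(n <- A) nm (fcoef phi n) ^+ 2 <= B ^+ 2.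
Proof.
move=> hB; have b0 : bnd phi by exists B.
have bc : bnd (fun x => conjc (phi x)).
  by exists B => x; apply: le_trans (hB x); rewrite !nm_def; case: (phi x) => a b /=; rewrite sqrrN.
pose S x := \sum_(n <- A) fcoef phi n * ek n x.
have bS : bnd S by apply: bnd_sum => n; apply: bndZ; exact: bnd_ek.
have bD : bnd (fun x => phi x - S x).
  apply: bndD => //; have := bndZ (-1) bS; rewrite (_ : (fun _ => -1 * _) = (fun x => - S x))//.
  by apply: funext => x; rewrite mulN1r.
have bm n (psi : R -> C) : bnd psi -> bnd (fun x => psi x * ek n x).
  by move=> h; apply: bndM => //; exact: bnd_ek.
have bcv n : bnd (fun x => fcoef phi n * ek n x * conjc (phi x)).
  by apply: bndM => //; apply: bndZ; exact: bnd_ek.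
(* Arranged so that the last sum has mean 0, phi - S being orthogonal to [ek n] for n in A. *)
have E1 x : (phi x - S x) * conjc (phi x - S x) = phi x * conjc (phi x) -
   (\sum_(n <- A) fcoef phi n * ek n x * conjc (phi x)) -
   \sum_(n <- A) conjc (fcoef phi n) * ((phi x - S x) * ek (- n) x).
  have Sc : conjc (S x) = \sum_(n <- A) conjc (fcoef phi n) * ek (- n) x.
    by rewrite rmorph_sum; apply: eq_bigr => n _; rewrite rmorphM/=; congr (_ * _); exact: ek_conj.
  rewrite rmorphB/= -mulr_suml -/(S x).
  rewrite (_ : \sum_(n <- A) _ = (phi x - S x) * conjc (S x)).
    by ring.
  by rewrite Sc mulr_sumr; apply: eq_bigr => n _; ring.
have bP : bnd (fun x => (phi x - S x) * conjc (phi x - S x)).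
  apply: bndM => //; have [B' h'] := bD; exists B' => x.
  by apply: le_trans (h' x); rewrite !nm_def; case: (phi x - S x) => a b /=; rewrite sqrrN.
have := Lam_Re_ge0 bP.
have -> : (fun x => (phi x - S x) * conjc (phi x - S x)) = (fun x => phi x * conjc (phi x) -
   (\sum_(n <- A) fcoef phi n * ek n x * conjc (phi x)) -
   \sum_(n <- A) conjc (fcoef phi n) * ((phi x - S x) * ek (- n) x)) by apply: funext.
have bpp : bnd (fun x => phi x * conjc (phi x)) by exact: bndM.
have bs1 : bnd (fun x => \sum_(n <- A) fcoef phi n * ek n x * conjc (phi x)) by exact: bnd_sum.
have bs2' n : bnd (fun x => conjc (fcoef phi n) * ((phi x - S x) * ek (- n) x)) by apply: bndZ; exact: bm.
have bs2 : bnd (fun x => \sum_(n <- A) conjc (fcoef phi n) * ((phi x - S x) * ek (- n) x)) by exact: bnd_sum.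
have bB u v : bnd u -> bnd v -> bnd (fun x : R => u x - v x).
  move=> hu hv; apply: bndD => //; have := bndZ (-1) hv; rewrite (_ : (fun _ => -1 * _) = (fun x => - v x))//.
  by apply: funext => x; rewrite mulN1r.
rewrite LamB//; last exact: bB.
rewrite LamB// !Lam_sum//.
have -> : \sum_(n <- A) Lam (fun x => conjc (fcoef phi n) * ((phi x - S x) * ek (- n) x)) = 0.
  rewrite big_seq big1// => n nA; rewrite LamZ; last exact: bm.
  rewrite (_ : Lam _ = 0) ?mulr0//.
  rewrite (_ : (fun x => (phi x - S x) * ek (- n) x) = fun x => phi x * ek (- n) x - S x * ek (- n) x); last first.
    by apply: funext => x; rewrite mulrBl.
  rewrite LamB; [|exact: bm|exact: bm].
  rewrite -/(fcoef phi n) (_ : Lam _ = fcoef phi n) ?subrr//.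
  rewrite (_ : (fun x => _) = (fun x => \sum_(k <- A) fcoef phi k * ek (k - n) x)); last first.
    apply: funext => x; rewrite /S mulr_suml; apply: eq_bigr => k _; by rewrite ekD mulrA.
  rewrite Lam_sum; last by move=> k; apply: bndZ; exact: bnd_ek.
  rewrite (big_fsetD1 n)//= LamZ ?Lam_ek ?subrr ?eqxx ?mulr1; last exact: bnd_ek.
  rewrite big1_fset ?addr0// => k; rewrite !inE => /andP[kn _] _.
  by rewrite LamZ ?Lam_ek ?subr_eq0 ?(negbTE kn) ?mulr0//; exact: bnd_ek.
have -> : \sum_(n <- A) Lam (fun x => fcoef phi n * ek n x * conjc (phi x)) =
    \sum_(n <- A) (nm (fcoef phi n) ^+ 2)%:C.
  apply: eq_bigr => n _.
  rewrite (_ : (fun x => _) = (fun x => fcoef phi n * conjc (phi x * ek (- n) x))); last first.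
    by apply: funext => x; rewrite conjcM ekN_conj; ring.
  have b1 : bnd (fun x => phi x * ek (- n) x) by exact: bm.
  rewrite LamZ; last by have [B' h'] := b1; exists B' => x; apply: le_trans (h' x);
    rewrite !nm_def; case: (phi x * ek (- n) x) => a b /=; rewrite sqrrN.
  by rewrite Lam_conj// -/(fcoef phi n) -sqr_normc nmE rmorphXn.
have -> : \sum_(n <- A) (nm (fcoef phi n) ^+ 2)%:C = (\sum_(n <- A) nm (fcoef phi n) ^+ 2)%:C.
  by rewrite rmorph_sum.
rewrite subr0 ReD ReN/= => h.
have : nm (Lam (fun x => phi x * conjc (phi x))) <= B ^+ 2.
  apply: Lam_le => x; rewrite nmM expr2 ler_pM ?nm_ge0//.
  by apply: le_trans (hB x); rewrite !nm_def; case: (phi x) => a b /=; rewrite sqrrN.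
have := nm_Re (Lam (fun x => phi x * conjc (phi x))); rewrite ler_norml => /andP[_ h2] h3.
have : 0 <= complex.Re (Lam (fun x => phi x * conjc (phi x))) - \sum_(n <- A) nm (fcoef phi n) ^+ 2.
  apply: h => x; rewrite ReM; case: (phi x - S x) => a b /=.
  by rewrite mulrN opprK -!expr2 addr_ge0 ?sqr_ge0.
lra.
Qed.

End FourierSeries.

(** * Convergence of Fourier series *)

Section FourierInversion.
Variable R : realType.
Local Notation C := R[i].
Local Notation e := (@cexp2pi R).
Implicit Types (f g : C -> C).

Definition aint (n : int) : R := `|n|%N%:R.

Lemma aintE n : aint n = `|n%:~R : R|.
Proof. by rewrite /aint -intr_norm -abszE -pmulrn. Qed.

Lemma aint_ge0 n : 0 <= aint n.
Proof. by rewrite ler0n. Qed.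

Lemma expR_geo (d : R) n : expR (- (d * aint n)) = expR (- d) ^+ `|n|%N.
Proof. by rewrite -expRM_natl; congr expR; rewrite mulrN mulrC. Qed.

Lemma bsum_expR (d : R) : 0 < d -> bsum (fun n : int => expR (- (d * aint n))).
Proof.
move=> d0; apply: (@bsum_le _ _ _ (fun n : int => expR (- d) ^+ `|n|%N)).
  by move=> n; rewrite expR_geo.
by apply: bsum_geo_int; rewrite expR_ge0/= expR_lt1 oppr_lt0.
Qed.

Lemma bsum_expR0 (d B : R) : 0 < d -> bsum (fun n : int => `|B| * expR (- (d * aint n))).
Proof. by move=> d0; apply: bsumZ => //; exact: bsum_expR. Qed.

(** The coefficient is computed at height y - d for n >= 0 and at y + d for n < 0; either shift
    gains the factor exp(-2 pi d |n|). *)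
Lemma coef_decay f y (d B : R) n : 0 < d -> strip_hol f (y - d) (y + d) B ->
  nm (coef f y n) <= B * expR (2 * pi * (n%:~R * y)) * expR (- (2 * pi * d * aint n)).
Proof.
move=> d0 hf; rewrite -mulrA -expRD.
case: (leP 0 n) => n0.
  have -> : coef f y n = coef f (y - d) n.
    apply/esym; apply: (@coef_indep _ f (y - d) y B); first by rewrite ltrBlDr ltrDl.
    by move=> z /andP[h1 h2]; apply: hf; rewrite h1 (le_trans h2)// lerDl ltW.
  apply: le_trans (@coef_le _ f (y - d) n B _) _.
    by move=> x; have [] // := hf (x +i* (y - d)); rewrite /= lexx/=; lra.
  rewrite aintE ger0_norm ?ler0z//.
  by rewrite (_ : 2 * pi * (n%:~R * (y - d)) = 2 * pi * (n%:~R * y) - 2 * pi * d * n%:~R)//; ring.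
have -> : coef f y n = coef f (y + d) n.
  apply: (@coef_indep _ f y (y + d) B); first by rewrite ltrDl.
  by move=> z /andP[h1 h2]; apply: hf; rewrite h2 andbT (le_trans _ h1)// lerBlDr lerDl ltW.
apply: le_trans (@coef_le _ f (y + d) n B _) _.
  by move=> x; have [] // := hf (x +i* (y + d)); rewrite /= lexx andbT; lra.
rewrite aintE ltr0_norm ?ltrz0//.
by rewrite (_ : 2 * pi * (n%:~R * (y + d)) = 2 * pi * (n%:~R * y) - 2 * pi * d * - n%:~R)//; ring.
Qed.

Lemma strip_per f lo hi B (k : int) z : strip_hol f lo hi B -> lo <= complex.Im z <= hi ->
  f (z + k%:~R) = f z.
Proof.
move=> hf.
have nat_case (m : nat) w : lo <= complex.Im w <= hi -> f (w + m%:R) = f w.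
  elim: m w => [|m IH] w hw; first by rewrite addr0.
  have hw' : lo <= complex.Im (w + m%:R) <= hi by rewrite ImD natC/= addr0.
  by rewrite -natr1 addrA; have [-> _ _] := hf _ hw'; exact: IH.
case: k => m hz; first by rewrite -pmulrn nat_case.
rewrite NegzE mulrNz -pmulrn -[in RHS](subrK m.+1%:R z) nat_case//.
by rewrite ImD ImN natC/= oppr0 addr0.
Qed.

Lemma coef_fcoef f y n x0 B : (forall x, nm (f (x +i* y)) <= B) ->
  coef f y n * e (n%:~R * (x0 +i* y)) = fcoef (fun x => f (x +i* y)) n * ek n x0.
Proof.
move=> hB; have E x : (x +i* y) = x%:C + 'i * y%:C.
  by apply: complexP; rewrite !(ReD,ImD,ReM,ImM)/=; ring.
rewrite /coef (_ : (fun x => _) = fun x => e (- (n%:~R * ('i * y%:C))) * (f (x +i* y) * ek (- n) x)); last first.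
  apply: funext => x; rewrite {2}E mulrDr opprD eD /ek rmorphN mulNr.
  by ring.
rewrite LamZ; last by apply: bndM; [exists B|exact: bnd_ek].
rewrite E mulrDr eD eN -/(ek n x0) -/(fcoef _ _); field.
exact: e_neq0.
Qed.

Lemma frac_half (t : R) : exists k : int, `|t - k%:~R| <= 2^-1.
Proof.
exists (Num.floor (t + 2^-1)).
have /andP[h1 h2] := floor_itv (t + 2^-1); rewrite ler_norml; move: h1 h2.
rewrite intrD/=; lra.
Qed.

(** The integers from 1 - n to n, an asymmetric range of 2n elements over which the sum in [fourier]
    telescopes to A(-n) - A(n). *)
Definition zrange (n : nat) : {fset int} := [fset (i%:Z - n%:Z + 1)%R | i in fset_lt n.*2]%fset.

Lemma in_zrange n (k : int) : (`|k|%N < n)%N -> k \in zrange n.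
Proof.
move=> h; apply/imfsetP; exists (absz (k + n%:Z - 1)%R); last by lia.
by rewrite in_fset_lt; lia.
Qed.

Lemma big_zrange (a : int -> C) n :
  \sum_(k <- zrange n) a k = \sum_(i < n.*2) a (i%:Z - n%:Z + 1).
Proof.
rewrite big_imfset/=; last by move=> i j _ _ /addIr /addIr [].
by rewrite big_fset_lt.
Qed.

(** Summability follows from [coef_decay], and only the value of the sum is at stake. The
    coefficients of the bounded quotient g satisfy a first-order recursion, by which the partial
    sums differ from f0 by A(-n) - A(n); Bessel's inequality for g makes both terms small. *)
Theorem fourier f y (d B : R) x0 : 0 < d -> strip_hol f (y - d) (y + d) B ->
  hsum (fun n => coef f y n * e (n%:~R * (x0 +i* y))) (f (x0 +i* y)).
Proof.
move=> d0 hf; pose phi x := f (x +i* y); pose f0 := phi x0.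
have yin x : y - d <= complex.Im (x +i* y) <= y + d by rewrite /= gerBl lerDl ltW.
have fB x : nm (phi x) <= B by have [] := hf _ (yin x).
have B0 : 0 <= B by rewrite (le_trans _ (fB 0))// nm_ge0.
pose a n := fcoef phi n * ek n x0.
have aE n : coef f y n * e (n%:~R * (x0 +i* y)) = a n by rewrite (coef_fcoef n x0 fB).
have asa : asum a.
  have p0 : 0 < 2 * pi * d by rewrite !mulr_gt0 ?pi_gt0.
  apply: bsum_le (bsum_expR0 B p0) => n.
  rewrite -aE nmM nm_eint; apply: (@le_trans _ _ (B * expR (2 * pi * (n%:~R * y)) *
     expR (- (2 * pi * d * aint n)) * expR (- (2 * pi * (n%:~R * y))))).
    by rewrite ler_wpM2r ?expR_ge0//; exact: coef_decay.
  rewrite ger0_norm// [expR (- (2 * pi * (n%:~R * y)))]expRN; set X := expR (2 * pi * (n%:~R * y)); set Y := expR (- _).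
  have X0 : X != 0 by rewrite gt_eqF// expR_gt0.
  by rewrite le_eqVlt; apply/orP; left; apply/eqP; field.
apply: (@hsum_ext _ _ a); first by move=> n; rewrite aE.
rewrite -/(phi x0) -/f0; have [s hs] := asum_hsum asa; suff <- : s = f0 by [].
(* Chernoff's proof: divide phi - f0 by ek 1 - ek 1 x0. *)
pose den x := ek 1 x - ek 1 x0; pose g x := if den x == 0 then 0 else (phi x - f0) / den x.
have denE x : den x = ek 1 x0 * (e (x - x0)%:C - 1).
  by rewrite mulrBr mulr1 /den /ek !mul1r -eD; congr (e _ - _); rewrite rmorphB/=; ring.
have phi_per x k : `|x - x0 - k%:~R| <= 2^-1 ->
    [/\ phi x = f (x0 +i* y + (x - x0 - k%:~R)%:C) & `|x - x0 - k%:~R| <= nm (den x)].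
  move=> hk; split.
    have h : y - d <= complex.Im (x0 +i* y + (x - x0 - k%:~R)%:C) <= y + d.
      by rewrite ImD/= addr0; exact: (yin x0).
    rewrite -(strip_per k hf h) /phi; congr f.
    by rewrite intC; apply: complexP; rewrite !(ReD,ImD)/=; ring.
  rewrite denE nmM nm_ek mul1r.
  rewrite (_ : e (x - x0)%:C = e (x - x0 - k%:~R)%:C); first exact: nm_e_sub1_ge.
  by rewrite -[RHS](eDint _ k); congr e; rewrite intC -rmorphD/= subrK.
have gE x : phi x - f0 = den x * g x.
  rewrite /g; case: eqP => [d0'|/eqP dn0]; last by rewrite mulrC divfK.
  have [k hk] := frac_half (x - x0); have [h1 h2] := phi_per x k hk.
  rewrite d0' nm0 normr_le0 in h2.
  by rewrite mulr0 h1 (eqP h2) rmorph0 addr0 subrr.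
have [D [del [del0 hdel]]] : exists D, exists del : R, 0 < del /\ forall t : R, `|t| < del ->
    nm (f (x0 +i* y + t%:C) - f0) <= D * `|t|.
  have [_ df _] := hf _ (yin x0); have [D /(_ 1 ltr01)[del [del0 h]]] := differentiable_epsdelta df.
  exists (nm D + 1), del; split=> // t ht; have := h t%:C; rewrite nm_real => /(_ ht) h1.
  rewrite (le_trans (nm_leB _ (D * t%:C)))// mulrDl mul1r nmM nm_real lerD2l.
  by rewrite mul1r in h1.
(* After reduction of x - x0 modulo 1, the derivative at x0 controls g when |t| < del; otherwise the
   denominator is at least del. *)
have gB : exists G, forall x, nm (g x) <= G.
  exists (`|D| + 2 * B / del) => x.
  have p1 : 0 <= 2 * B / del by rewrite divr_ge0 ?mulr_ge0// ltW.
  rewrite /g; case: eqP => [_|/eqP dn0]; first by rewrite nm0 addr_ge0.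
  have [k hk] := frac_half (x - x0); have [h1 h2] := phi_per x k hk.
  set t := x - x0 - k%:~R in h1 h2 *.
  have dp : 0 < nm (den x) by rewrite nm_gt0.
  rewrite nmM nmV ler_pdivrMr//; case: (ltP `|t| del) => ht.
    rewrite h1 (le_trans (hdel _ ht))//.
    apply: (@le_trans _ _ (`|D| * nm (den x))).
      by rewrite (le_trans (ler_wpM2r (normr_ge0 t) (ler_norm D)))// ler_wpM2l.
    by rewrite ler_wpM2r ?nm_ge0// lerDl.
  apply: (@le_trans _ _ (2 * B)).
    by rewrite (le_trans (nmD _ _))// nmN; have := fB x; have := fB x0; rewrite -/f0; lra.
  apply: (@le_trans _ _ (2 * B / del * nm (den x))); last by rewrite ler_wpM2r ?nm_ge0// lerDr.
  rewrite mulrAC ler_pdivlMr// ler_wpM2l ?mulr_ge0//.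
  exact: le_trans ht h2.
have [G hG] := gB.
have bg : bnd g by exists G.
have bphi : bnd phi by exists B.
pose A n := fcoef g n * ek (n + 1) x0.
have rec n : a n - (if n == 0 then f0 else 0) = A (n - 1) - A n.
  have bgk m : bnd (fun x => g x * ek m x) by apply: bndM => //; exact: bnd_ek.
  have bpk m : bnd (fun x => phi x * ek m x) by apply: bndM => //; exact: bnd_ek.
  have bk m : bnd (fun x => f0 * ek m x : C) by apply: bndZ; exact: bnd_ek.
  have : Lam (fun x => phi x * ek (- n) x - f0 * ek (- n) x) =
      Lam (fun x => g x * ek (- (n - 1)) x - ek 1 x0 * (g x * ek (- n) x)).
    congr Lam; apply: funext => x; rewrite -mulrBl gE /den opprB addrC ekD; ring.
  rewrite LamB// LamZ; last exact: bnd_ek.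
  rewrite LamB//; last by apply: bndZ.
  rewrite LamZ// Lam_ek oppr_eq0 -!/(fcoef _ _) => E.
  rewrite /A /a subrK ekD.
  have -> : (if n == 0 then f0 else 0) = f0 * (n == 0)%:R * ek n x0.
    by case: eqP => [->|_]; rewrite ?ek0 ?mulr1 ?mulr0 ?mul0r.
  rewrite -mulrBl E; ring.
have tel n : (0 < n)%N -> \sum_(k <- zrange n) a k - f0 = A (- n%:Z) - A n%:Z.
  move=> n0; have -> : f0 = \sum_(k <- zrange n) (if k == 0 then f0 else 0).
    rewrite (big_fsetD1 0)/=; last by rewrite in_zrange.
    by rewrite big1_fset ?addr0// => k; rewrite !inE => /andP[/negbTE ->].
  rewrite -sumrB; under eq_bigr do rewrite rec.
  rewrite big_zrange.
  pose u (i : nat) := A (i%:Z - n%:Z).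
  rewrite (eq_bigr (fun i : 'I_n.*2 => - (u i.+1 - u i))); last first.
    by move=> i _; rewrite /u opprB addrK; congr (A _ - A _); lia.
  rewrite sumrN -(big_mkord predT (fun i => u i.+1 - u i)) telescope_sumr// opprB /u.
  by congr (A _ - A _); lia.
apply/eqP; rewrite -subr_eq0 -nm_eq0 eq_le nm_ge0 andbT.
apply/ler_addgt0Pr => eps e0; rewrite add0r.
have e4 : 0 < eps / 3 by rewrite divr_gt0.
have [E hE] := hs _ e4.
have bes : bsum (fun n : int => nm (fcoef g n) ^+ 2) by exists (G ^+ 2) => A'; exact: bessel.
have [T hT] := bsum_tail (fun n => sqr_ge0 _) bes (exprn_gt0 2 e4).
pose bd (U : {fset int}) := (\max_(k <- U) `|k|%N).
have bdP (U : {fset int}) k : k \in U -> (`|k| <= bd U)%N.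
  by move=> kU; rewrite /bd (big_fsetD1 k)//= leq_maxl.
pose n := (bd E + bd T).+1.
have small k : (bd T < `|k|)%N -> nm (A k) <= eps / 3.
  move=> hk; rewrite /A nmM nm_ek mulr1.
  have := hT [fset k]%fset; rewrite big_seq_fset1 => H.
  rewrite -(@ler_sqr R) ?nnegrE ?nm_ge0 ?(ltW e4)//; apply: H => i; rewrite inE => /eqP ->.
  by apply/negP => /bdP; rewrite leqNgt hk.
have h1 : nm (\sum_(k <- zrange n) a k - s) <= eps / 3.
  by apply: hE; apply/fsubsetP => k /bdP h; apply: in_zrange; rewrite /n; lia.
have h2 := tel n isT.
have h3 : nm (A (- n%:Z)) <= eps / 3 by apply: small; rewrite /n; lia.
have h4 : nm (A n%:Z) <= eps / 3 by apply: small; rewrite /n; lia.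
rewrite (le_trans (nm_subD _ (\sum_(k <- zrange n) a k) _))// nmB h2.
have := nmD (A (- n%:Z)) (- A n%:Z); rewrite nmN; lra.
Qed.

End FourierInversion.

(** * Termwise differentiation and means of series *)

Section SeriesDifferentiable.
Variable R : realType.
Local Notation C := R[i].
Local Notation e := (@cexp2pi R).

Lemma expR_ge_sqr (x : R) : 0 <= x -> x ^+ 2 <= 2 * expR x.
Proof. by move=> x0; have := @expR_ge1Dxn R x 1 x0; rewrite -[2`!%:R]/(2 : R); lra. Qed.

(** The remainder of each term is bounded by [exp_taylor]. Increments below d / 4 give |l| <= N d /
    2, so that one half of the weight exp(2 pi d N) absorbs exp(2 pi |l|) and the other half absorbs
    the factor N^2; the constant is 32 = 4 * 8. *)
Lemma series_differentiable (I : choiceType) (b : I -> C) (n r : I -> int)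
    (f : C * C -> C) (t z : C) (d : R) : 0 < d ->
  bsum (fun i => nm (b i * e ((n i)%:~R * t + (r i)%:~R * z)) *
                 expR (2 * pi * d * (aint R (n i) + aint R (r i)))) ->
  (forall h1 h2, nm h1 < d -> nm h2 < d ->
    hsum (fun i => b i * e ((n i)%:~R * (t + h1) + (r i)%:~R * (z + h2))) (f (t + h1, z + h2))) ->
  differentiable f (t, z).
Proof.
move=> d0 hb hf; have p0 : 0 < pi :> R := pi_gt0 R.
pose be i := b i * e ((n i)%:~R * t + (r i)%:~R * z).
pose N i := aint R (n i) + aint R (r i).
have N0 i : 0 <= N i by rewrite addr_ge0 ?aint_ge0.
have nN i : nm ((n i)%:~R : C) <= N i by rewrite nm_int -aintE lerDl aint_ge0.
have rN i : nm ((r i)%:~R : C) <= N i by rewrite nm_int -aintE lerDr aint_ge0.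
have x0 i : 0 <= pi * d * N i by rewrite mulr_ge0 ?N0// mulr_ge0 ?ltW.
have E2 i : expR (2 * pi * d * N i) = expR (pi * d * N i) * expR (pi * d * N i).
  by rewrite -expRD; congr expR; ring.
have E1 i : 1 <= expR (pi * d * N i) by rewrite -expR0 ler_expR.
pose c := (2 * pi)%:C * 'i : C.
have nc : nm c = 2 * pi.
  by rewrite nmM nm_pos ?mulr_ge0 ?ltW// nm_def/= expr0n expr1n add0r sqrtr1 mulr1.
have lin_sum (u : I -> int) : (forall i, nm ((u i)%:~R : C) <= N i) ->
    exists s, hsum (fun i => be i * (c * (u i)%:~R)) s.
  move=> hu; apply: asum_hsum; apply: (bsum_le _ (bsumZ (_ : 0 <= 2 / d) hb)); last by rewrite divr_ge0 ?ltW.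
  move=> i; rewrite -/(be i) -/(N i) nmM [nm (c * _)]nmM nc.
  rewrite (_ : 2 / d * _ = nm (be i) * (2 / d * expR (2 * pi * d * N i))); last by ring.
  rewrite ler_wpM2l ?nm_ge0// E2 mulrA.
  apply: (@le_trans _ _ (2 / d * expR (pi * d * N i))); last first.
    by rewrite ler_peMr// mulr_ge0 ?expR_ge0// divr_ge0 ?ltW.
  have h1 := expR_ge1Dx (pi * d * N i).
  apply: (@le_trans _ _ (2 / d * (pi * d * N i))).
    rewrite (_ : 2 / d * (pi * d * N i) = 2 * pi * N i); last by field; rewrite gt_eqF.
    by rewrite ler_wpM2l// mulr_ge0 ?ltW.
  by rewrite ler_wpM2l ?divr_ge0 ?ltW//; lra.
have [d1 hd1] := lin_sum n nN; have [d2 hd2] := lin_sum r rN.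
have [M hM] := hb.
have d4 : 0 < d / 4 by lra.
apply: (@differentiable_quad _ _ _ d1 d2 (32 / d ^+ 2 * M) (d / 4) d4) => /= h1 h2 l1 l2.
pose H := nm h1 + nm h2; have H0 : 0 <= H by rewrite addr_ge0 ?nm_ge0.
have Hd : H <= d / 2 by rewrite /H; lra.
have S1 := hf h1 h2 (lt_trans l1 _) (lt_trans l2 _).
have {}S1 : hsum (fun i => b i * e ((n i)%:~R * (t + h1) + (r i)%:~R * (z + h2))) (f (t + h1, z + h2)).
  by apply: S1; lra.
have S0 : hsum be (f (t, z)) by have := hf 0 0; rewrite !addr0 nm0; apply.
have S2 := hsumB (hsumB S1 S0) (hsumD (hsumZr h1 hd1) (hsumZr h2 hd2)).
apply: (hsum_nm S2) => A.
apply: (@le_trans _ _ (\sum_(i <- A) (32 / d ^+ 2 * (nm (be i) * expR (2 * pi * d * N i))) * H ^+ 2)).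
  apply: ler_sum => i _; pose l := (n i)%:~R * h1 + (r i)%:~R * h2.
  rewrite (_ : _ - _ = be i * (e l - 1 - c * l)); last first.
    rewrite (_ : _ + (r i)%:~R * (z + h2) = (n i)%:~R * t + (r i)%:~R * z + l); last by rewrite /l; ring.
    by rewrite eD /be /l; ring.
  have lN : nm l <= N i * H.
    rewrite (le_trans (nmD _ _))// !nmM mulrDr lerD// ler_wpM2r ?nm_ge0//.
  rewrite nmM (_ : 32 / d ^+ 2 * _ * _ = nm (be i) * (32 / d ^+ 2 * expR (2 * pi * d * N i) * H ^+ 2)); last by ring.
  rewrite ler_wpM2l ?nm_ge0//; apply: (le_trans (exp_taylor _)).
  have L0 : 0 <= 2 * pi * nm l by rewrite mulr_ge0 ?nm_ge0// mulr_ge0 ?ltW.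
  have LL : 2 * pi * nm l <= 2 * pi * (N i * H) by rewrite ler_wpM2l// mulr_ge0 ?ltW.
  apply: (@le_trans _ _ (4 * (2 * pi * (N i * H)) ^+ 2 * expR (2 * pi * (N i * H)))).
    apply: ler_pM; [by rewrite mulr_ge0 ?sqr_ge0|exact: expR_ge0| |by rewrite ler_expR].
    by rewrite ler_wpM2l// ler_sqr ?nnegrE// (le_trans L0).
  have HH : 2 * pi * (N i * H) <= pi * d * N i.
    rewrite (_ : 2 * pi * (N i * H) = 2 * pi * N i * H); last by ring.
    rewrite (_ : pi * d * N i = 2 * pi * N i * (d / 2)); last by field.
    by rewrite ler_wpM2l// mulr_ge0 ?N0// mulr_ge0 ?ltW.
  have sq := expR_ge_sqr (x0 i).
  have dd : d != 0 by rewrite gt_eqF.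
  have sq2 : (2 * pi * N i) ^+ 2 <= 8 / d ^+ 2 * expR (pi * d * N i).
    rewrite (_ : (2 * pi * N i) ^+ 2 = 4 / d ^+ 2 * (pi * d * N i) ^+ 2); last by field.
    rewrite (_ : 8 / d ^+ 2 * _ = 4 / d ^+ 2 * (2 * expR (pi * d * N i))); last by field.
    by rewrite ler_wpM2l// divr_ge0// sqr_ge0.
  rewrite E2 (_ : 32 / d ^+ 2 * (expR (pi * d * N i) * expR (pi * d * N i)) * H ^+ 2 =
     (4 * (8 / d ^+ 2 * expR (pi * d * N i) * H ^+ 2)) * expR (pi * d * N i)); last by ring.
  apply: ler_pM; [by rewrite mulr_ge0 ?sqr_ge0|exact: expR_ge0| |by rewrite ler_expR].
  rewrite ler_wpM2l//.
  by rewrite mulrA exprMn ler_wpM2r ?sqr_ge0.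
rewrite -mulr_suml -mulr_sumr ler_wpM2r ?sqr_ge0// ler_wpM2l ?divr_ge0 ?sqr_ge0//; exact: hM.
Qed.

(** Under the majorant M the tails of the series are small uniformly in x, and the mean is bounded
    by the supremum. *)
Lemma Lam_hsum (I : choiceType) (c : I -> R -> C) (g : R -> C) (M : I -> R) :
  bsum M -> (forall i x, nm (c i x) <= M i) -> (forall x, hsum (fun i => c i x) (g x)) ->
  hsum (fun i => Lam (c i)) (Lam g).
Proof.
move=> Mb cM cg.
have M0 i : 0 <= M i by rewrite (le_trans _ (cM i 0))// nm_ge0.
have bc i : bnd (c i) by exists (M i).
have bg : bnd g.
  have [B hB] := Mb; exists B => x; apply: (hsum_nm (cg x)) => A.
  by apply: le_trans (hB A); apply: ler_sum.
move=> eps e0; have [A hA] := bsum_tail M0 Mb e0.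
exists A => B AB; rewrite -Lam_sum// nmB -LamB//; last exact: bnd_sum.
apply: Lam_le => x; apply: hsum_tail (cg x) _ => D hD.
apply: (@le_trans _ _ (\sum_(i <- D) M i)); first exact: ler_sum.
apply: hA => i /hD; apply: contra; exact: (fsubsetP AB).
Qed.

Lemma coef_indep_sym f y1 y2 lo hi B n : strip_hol f lo hi B ->
  lo <= y1 <= hi -> lo <= y2 <= hi -> @coef R f y1 n = coef f y2 n.
Proof.
move=> hf h1 h2; case: (ltrgtP y1 y2) => [y12|y21|->//].
  apply: (@coef_indep _ f y1 y2 B) => // z /andP[a b]; apply: hf.
  by case/andP: h1 => h1 _; case/andP: h2 => _ h2; rewrite (le_trans h1 a) (le_trans b h2).
apply/esym/(@coef_indep _ f y2 y1 B) => // z /andP[a b]; apply: hf.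
by case/andP: h1 => _ h1; case/andP: h2 => h2 _; rewrite (le_trans h2 a) (le_trans b h1).
Qed.

(* A mean of periodic holomorphic functions is holomorphic, being the sum of a
   Fourier series. *)
Lemma Lam_differentiable (G : R -> C -> C) (f : C -> C) (v d B : R) (w : C) : 0 < d ->
  (forall p, strip_hol (G p) (v - d) (v + d) B) ->
  (forall w, v - d <= complex.Im w <= v + d -> f w = Lam (fun p => G p w)) ->
  complex.Im w = v -> differentiable f w.
Proof.
move=> d0 hG hf wv; have p0 : 0 < pi :> R := pi_gt0 R.
have vin : v - d <= v <= v + d by rewrite gerBl lerDl ltW.
have B0 : 0 <= B by have [//|_ _ h] := hG 0 (0 +i* v) _; rewrite (le_trans _ h)// nm_ge0.
pose bn n := Lam (fun p => coef (G p) v n).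
have bcoef n : bnd (fun p => coef (G p) v n).
  by eexists => p; apply: (coef_decay n d0 (hG p)).
have dec p n (w' : C) : v - d / 2 <= complex.Im w' <= v + d / 2 ->
    nm (coef (G p) v n * e (n%:~R * w')) <= B * expR (- (pi * d * aint R n)).
  move=> hw; rewrite nmM nm_eint.
  apply: (@le_trans _ _ (B * expR (2 * pi * (n%:~R * v)) * expR (- (2 * pi * d * aint R n)) *
     expR (- (2 * pi * (n%:~R * complex.Im w'))))).
    by rewrite ler_wpM2r ?expR_ge0//; apply: coef_decay.
  rewrite -!mulrA ler_wpM2l// -!expRD ler_expR aintE.
  have : n%:~R * (v - complex.Im w') <= `|n%:~R : R| * (d / 2).
    rewrite (le_trans (ler_norm _))// normrM ler_wpM2l// ler_norml; lra.
  move=> h; have := ler_wpM2l (ltW p0) h; set x := `|_|; nra.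
have ser (w' : C) : v - d / 2 <= complex.Im w' <= v + d / 2 ->
    hsum (fun n => bn n * e (n%:~R * w')) (f w').
  move=> hw; have hw' : v - d <= complex.Im w' <= v + d by lra.
  rewrite hf//; have pd : 0 < pi * d by rewrite mulr_gt0.
  apply: (@hsum_ext _ _ (fun n => Lam (fun p => coef (G p) v n * e (n%:~R * w')))).
    move=> n; rewrite /bn [RHS]mulrC -LamZ//; by congr Lam; apply: funext => p; rewrite mulrC.
  apply: (Lam_hsum (bsum_expR0 B pd)).
    by move=> n p; rewrite ger0_norm// dec.
  move=> p; have d2 : 0 < d / 2 by lra.
  have sub : strip_hol (G p) (complex.Im w' - d / 2) (complex.Im w' + d / 2) B.
    by move=> z hz; apply: hG; lra.
  have := fourier (complex.Re w') d2 sub.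
  rewrite (_ : complex.Re w' +i* complex.Im w' = w'); last by case: (w').
  by apply: hsum_ext => n; rewrite (coef_indep_sym n (hG p) hw' vin).
have -> : f = (fun q : C * C => f q.1) \o (fun t : C => (t, t)) by [].
apply: differentiable_comp; first exact: differentiable_pair.
have d4 : 0 < d / 4 by lra.
have pd2 : 0 < pi * d / 2 by rewrite divr_gt0// mulr_gt0.
apply: (@series_differentiable int bn id (fun=> 0) (fun q : C * C => f q.1) w w (d / 4)) => //.
  apply: (bsum_le _ (bsum_expR0 B pd2)) => n.
  rewrite mul0r addr0 (_ : aint R 0 = 0) ?addr0; last by rewrite aintE normr0.
  have hw : v - d / 2 <= complex.Im w <= v + d / 2 by rewrite wv; lra.
  have : nm (bn n * e (n%:~R * w)) <= B * expR (- (pi * d * aint R n)).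
    rewrite /bn mulrC -LamZ//; apply: Lam_le => p; rewrite mulrC; exact: dec.
  move=> h; rewrite ger0_norm//; apply: (le_trans (ler_wpM2r (expR_ge0 _) h)).
  rewrite -[leLHS]mulrA -expRD ler_wpM2l// ler_expR; have := aint_ge0 R n; set x := aint R n => x0.
  have := mulr_ge0 (mulr_ge0 (ltW p0) (ltW d0)) x0; lra.
move=> h1 h2 l1 l2 /=.
have hw : v - d / 2 <= complex.Im (w + h1) <= v + d / 2.
  rewrite ImD wv; have := nm_Im h1; rewrite ler_norml; lra.
by apply: hsum_ext (ser _ hw) => n; rewrite mul0r addr0.
Qed.

End SeriesDifferentiable.

(** * Fourier expansion in three variables on the tube domain *)

Section TubeExpansion.
Variable R : realType.
Local Notation C := R[i].
Local Notation e := (@cexp2pi R).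

(** Sylvester's criterion for the imaginary part of [t1 z; z t2]; [siegel_upperE] identifies the
    domain with the Siegel half space. *)
Definition dom (t1 z t2 : C) :=
  0 < complex.Im t1 /\ complex.Im z ^+ 2 < complex.Im t1 * complex.Im t2.

Lemma Im_natM (h : nat) (u : C) : complex.Im (h%:R * u) = h%:R * complex.Im u.
Proof. by rewrite natC ImM/= mul0r addr0. Qed.

(** The first coordinate moves K times as far as the others, K being the period of t1 in the
    application. S collects the first-order losses in y1 y2 - v^2, and d <= D / (2 S) leaves at
    least half of the slack D. *)
Lemma dom_box (K y1 v y2 : R) : 1 <= K -> 0 < y1 -> v ^+ 2 < y1 * y2 ->
  exists d, [/\ 0 < d, 0 < y1 - K * d & forall v', v - d <= v' <= v + d ->
    v' ^+ 2 < (y1 - K * d) * (y2 - d)].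
Proof.
move=> K1 y10 h; have y20 : 0 < y2.
  by rewrite -(pmulr_rgt0 _ y10) (le_lt_trans _ h)// sqr_ge0.
pose S := y1 + K * y2 + 2 * `|v| + 1.
have K0 : 0 < K by lra.
have S0 : 0 < S by have := mulr_gt0 K0 y20; have := normr_ge0 v; rewrite /S; lra.
pose D := y1 * y2 - v ^+ 2; have D0 : 0 < D by rewrite subr_gt0.
pose d := Num.min (Num.min 1 (y1 / (2 * K))) (D / (2 * S)).
have d0 : 0 < d.
  by rewrite !lt_min ltr01/= !divr_gt0 ?mulr_gt0.
have d1 : d <= 1 by rewrite !ge_min lexx.
have d2 : d * (2 * K) <= y1 by rewrite -ler_pdivlMr ?mulr_gt0// !ge_min lexx orbT.
have d3 : d * (2 * S) <= D by rewrite -ler_pdivlMr ?mulr_gt0// !ge_min lexx orbT.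
have pK : 0 < y1 - K * d by nra.
exists d; split=> // v' hv'.
have n0 := normr_ge0 v.
have nv' : `|v'| <= `|v| + d.
  have := ler_norm v; have := ler_norm (- v); rewrite normrN => a b.
  by rewrite ler_norml; lra.
have sq : v' ^+ 2 <= (`|v| + d) ^+ 2.
  by rewrite -real_normK ?num_real// ler_sqr ?nnegrE//; lra.
have vv : `|v| ^+ 2 = v ^+ 2 by rewrite real_normK ?num_real.
apply: (le_lt_trans sq).
have dd : d * d <= d by rewrite ler_piMl// ltW.
have Kdd : 0 <= K * d * d by rewrite !mulr_ge0 ?ltW.
have : d * (2 * S) = 2 * (d * y1 + d * (K * y2) + 2 * (d * `|v|) + d) by rewrite /S; ring.
have : 0 < d * y1 by rewrite mulr_gt0.
have : 0 < d * (K * y2) by rewrite !mulr_gt0.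
have : 0 <= d * `|v| by rewrite mulr_ge0// ltW.
have -> : (`|v| + d) ^+ 2 = v ^+ 2 + 2 * (d * `|v|) + d * d by rewrite -vv; ring.
have -> : (y1 - K * d) * (y2 - d) = y1 * y2 - d * (K * y2) - d * y1 + K * d * d by ring.
rewrite /D in d3 *; lra.
Qed.

Variables (h : nat) (G : C -> C -> C -> C).
Hypothesis h0 : (0 < h)%N.
Hypothesis Gper1 : forall t1 z t2, dom t1 z t2 -> G (t1 + h%:R) z t2 = G t1 z t2.
Hypothesis Gper2 : forall t1 z t2, dom t1 z t2 -> G t1 (z + 1) t2 = G t1 z t2.
Hypothesis Gper3 : forall t1 z t2, dom t1 z t2 -> G t1 z (t2 + 1) = G t1 z t2.
Hypothesis Gd1 : forall t1 z t2, dom t1 z t2 -> differentiable (fun t : C => G t z t2) t1.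
Hypothesis Gd2 : forall t1 z t2, dom t1 z t2 -> differentiable (fun w : C => G t1 w t2) z.
Hypothesis Gd3 : forall t1 z t2, dom t1 z t2 -> differentiable (fun t : C => G t1 z t) t2.
Hypothesis Gbd : forall a1 b1 v w a3 b3 : R, 0 < a1 ->
  (forall y, v <= y <= w -> y ^+ 2 < a1 * a3) -> exists B, forall t1 z t2,
  a1 <= complex.Im t1 <= b1 -> v <= complex.Im z <= w -> a3 <= complex.Im t2 <= b3 ->
  nm (G t1 z t2) <= B.

Lemma hR0 : 0 < h%:R :> R. Proof. by rewrite ltr0n. Qed.
Lemma hC0 : h%:R != 0 :> C. Proof. by rewrite pnatr_eq0 -lt0n. Qed.

Lemma box_dom (a1 b1 v w a3 b3 : R) : 0 < a1 ->
  (forall y, v <= y <= w -> y ^+ 2 < a1 * a3) -> forall t1 z t2,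
  a1 <= complex.Im t1 <= b1 -> v <= complex.Im z <= w -> a3 <= complex.Im t2 <= b3 ->
  dom t1 z t2.
Proof.
move=> a10 hb t1 z t2 /andP[h1 _] h2 /andP[h3 _]; have hz := hb _ h2.
have a30 : 0 < a3 by rewrite -(pmulr_rgt0 _ a10) (le_lt_trans _ hz)// sqr_ge0.
split; first exact: lt_le_trans h1.
by rewrite (lt_le_trans hz)// ler_pM// ltW.
Qed.

(** An admissible height for t2 above (t1, z), exceeding the boundary value (Im z)^2 / Im t1 by 1 /
    Im t1. By [c3E] the coefficient does not depend on it. *)
Definition eta (t1 z : C) : R := (complex.Im z ^+ 2 + 1) / complex.Im t1.
(** The variables are expanded in the order t2, z, t1 ([c3], [c2], [acoef]). Each coefficient is a
    mean of holomorphic periodic functions, hence again holomorphic in the remaining variables by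
    [Lam_differentiable]. The period h of t1 becomes 1 through t1 = h u. *)
Definition c3 (m : int) (t1 z : C) : C := coef (G t1 z) (eta t1 z) m.

Lemma c3_strip (t1 z : C) (lo hi : R) : 0 < complex.Im t1 -> complex.Im z ^+ 2 < complex.Im t1 * lo ->
  exists B, strip_hol (G t1 z) lo hi B.
Proof.
move=> y0 hz; have hb y : complex.Im z <= y <= complex.Im z -> y ^+ 2 < complex.Im t1 * lo.
  by move=> /le_anti <-.
have [B hB] := @Gbd (complex.Im t1) (complex.Im t1) (complex.Im z) (complex.Im z) lo hi y0 hb.
exists B => t ht; have dt : dom t1 z t.
  by apply: (box_dom (b1 := complex.Im t1) (b3 := hi) y0 hb); rewrite ?lexx.
split; [exact: Gper3|exact: Gd3|by apply: hB => //; rewrite lexx].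
Qed.

Lemma eta_dom (t1 z : C) : 0 < complex.Im t1 -> complex.Im z ^+ 2 < complex.Im t1 * eta t1 z.
Proof. by move=> y0; rewrite /eta mulrC divfK ?gt_eqF// ltrDl. Qed.

Lemma c3E m (t1 z : C) (y : R) : 0 < complex.Im t1 -> complex.Im z ^+ 2 < complex.Im t1 * y ->
  coef (G t1 z) y m = c3 m t1 z.
Proof.
move=> y0 hy; pose lo := Num.min y (eta t1 z); pose hi := Num.max y (eta t1 z).
have [|B hB] := @c3_strip t1 z lo hi y0.
  by rewrite /lo /Num.min; case: ifP => _ //; exact: eta_dom.
by apply: (coef_indep_sym m hB); rewrite ?ge_min ?le_max lexx ?orbT.
Qed.

Lemma c3_sum (t1 z t2 : C) : dom t1 z t2 -> hsum (fun m => c3 m t1 z * e (m%:~R * t2)) (G t1 z t2).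
Proof.
move=> [y0 hz]; pose d := (complex.Im t1 * complex.Im t2 - complex.Im z ^+ 2) / (2 * complex.Im t1).
have d0 : 0 < d by rewrite divr_gt0 ?mulr_gt0// subr_gt0.
have [|B hB] := @c3_strip t1 z (complex.Im t2 - d) (complex.Im t2 + d) y0.
  rewrite mulrBr (_ : complex.Im t1 * d = (complex.Im t1 * complex.Im t2 - complex.Im z ^+ 2) / 2).
    by lra.
  by rewrite /d; field; rewrite gt_eqF.
have := fourier (complex.Re t2) d0 hB.
rewrite (_ : complex.Re t2 +i* complex.Im t2 = t2); last by case: (t2).
by apply: hsum_ext => m; rewrite c3E.
Qed.

Lemma c3_bound (a1 b1 v w y B : R) m : 0 < a1 -> (forall v', v <= v' <= w -> v' ^+ 2 < a1 * y) ->
  (forall t1 z t2, a1 <= complex.Im t1 <= b1 -> v <= complex.Im z <= w -> y <= complex.Im t2 <= y ->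
     nm (G t1 z t2) <= B) ->
  forall t1 z, a1 <= complex.Im t1 <= b1 -> v <= complex.Im z <= w ->
  nm (c3 m t1 z) <= B * expR (2 * pi * (m%:~R * y)).
Proof.
move=> a10 hv hB t1 z ht hz.
have [y0 hy] : dom t1 z (0 +i* y) by apply: (box_dom a10 hv ht hz (b3 := y)); rewrite /= lexx.
by rewrite -(@c3E m _ _ y)//; apply: coef_le => x; apply: hB => //=; rewrite lexx.
Qed.

Lemma box_at (y1 v y2 : R) : 0 < y1 -> v ^+ 2 < y1 * y2 -> exists d B, [/\ 0 < d, 0 < y1 - h%:R * d,
  (forall v', v - d <= v' <= v + d -> v' ^+ 2 < (y1 - h%:R * d) * (y2 - d)) &
  forall t1 z t2, y1 - h%:R * d <= complex.Im t1 <= y1 + h%:R * d ->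
    v - d <= complex.Im z <= v + d -> y2 - d <= complex.Im t2 <= y2 + d -> nm (G t1 z t2) <= B].
Proof.
move=> y10 hv; have K1 : 1 <= h%:R :> R by rewrite ler1n.
have [d [d0 p hd]] := dom_box K1 y10 hv.
have [B hB] := @Gbd _ (y1 + h%:R * d) _ _ _ (y2 + d) p hd.
by exists d, B.
Qed.

Lemma c3_per1 m (t1 z : C) : 0 < complex.Im t1 -> c3 m (t1 + h%:R) z = c3 m t1 z.
Proof.
move=> y0; have Ih : complex.Im (t1 + h%:R) = complex.Im t1 by rewrite ImD natC/= addr0.
rewrite /c3 /coef; have -> : eta (t1 + h%:R) z = eta t1 z by rewrite /eta Ih.
congr Lam; apply: funext => x; rewrite Gper1//; split => //=; exact: eta_dom.
Qed.

Lemma c3_per2 m (t1 z : C) : 0 < complex.Im t1 -> c3 m t1 (z + 1) = c3 m t1 z.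
Proof.
move=> y0; have Ih : complex.Im (z + 1) = complex.Im z by rewrite ImD/= addr0.
rewrite /c3 /coef; have -> : eta t1 (z + 1) = eta t1 z by rewrite /eta Ih.
congr Lam; apply: funext => x; rewrite Gper2//; split => //=; exact: eta_dom.
Qed.

Lemma differentiable_cmul (f : C -> C) (c w : C) : differentiable f w ->
  differentiable (fun z : C => f z * c) w.
Proof. by move=> df; exact: (diffC_mul df (diffC_cst c w)). Qed.

Lemma differentiable_hcomp (f : C -> C) (w : C) : differentiable f (h%:R * w) ->
  differentiable (fun u : C => f (h%:R * u)) w.
Proof.
by move=> df; exact: (diffC_comp (diffC_scale h%:R w) df).
Qed.

Lemma c3_d2 m (t1 z : C) : 0 < complex.Im t1 -> differentiable (c3 m t1) z.
Proof.
move=> y0; set v := complex.Im z; set y2 := eta t1 z.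
have [d [B [d0 p hd hB]]] := box_at y0 (eta_dom z y0); rewrite -/v -/y2 in hd hB.
have hd1 : 0 <= h%:R * d by rewrite mulr_ge0 ?ltW ?hR0.
pose Gp (p : R) (w : C) := G t1 w (p +i* y2) * e (- (m%:~R * (p +i* y2))).
have t1in : complex.Im t1 - h%:R * d <= complex.Im t1 <= complex.Im t1 + h%:R * d.
  by rewrite gerBl lerDl hd1.
have yin (p' : R) : y2 - d <= complex.Im (p' +i* y2) <= y2 + d by rewrite /= gerBl lerDl ltW.
apply: (@Lam_differentiable R Gp (c3 m t1) v d (B * expR (2 * pi * (m%:~R * y2))) z d0) => //.
  move=> p' w hw; have dw : dom t1 w (p' +i* y2) := box_dom p hd t1in hw (yin p').
  split; first by rewrite /Gp Gper2.
    by apply: (@differentiable_cmul (fun w => G t1 w (p' +i* y2))); exact: Gd2.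
  by rewrite /Gp nmM nm_eintN ler_wpM2r ?expR_ge0// hB.
move=> w hw; have [_ dw] : dom t1 w (0 +i* y2) := box_dom p hd t1in hw (yin 0).
by rewrite -(@c3E m t1 w y2 y0 dw).
Qed.

Lemma Im_hin (u : C) (y1 d : R) : y1 / h%:R - d <= complex.Im u <= y1 / h%:R + d ->
  y1 - h%:R * d <= complex.Im (h%:R * u) <= y1 + h%:R * d.
Proof.
rewrite Im_natM => /andP[a b]; have p := hR0; have hn : h%:R != 0 :> R by rewrite gt_eqF.
rewrite (_ : y1 - _ = h%:R * (y1 / h%:R - d)); last by field.
rewrite (_ : y1 + _ = h%:R * (y1 / h%:R + d)); last by field.
by rewrite !ler_wpM2l// ltW.
Qed.

Lemma c3_d1 m (u z : C) : 0 < complex.Im u -> differentiable (fun u : C => c3 m (h%:R * u) z) u.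
Proof.
move=> u0; have y0 : 0 < complex.Im (h%:R * u) by rewrite Im_natM mulr_gt0 ?hR0.
set v := complex.Im z; set y2 := eta (h%:R * u) z.
have [d [B [d0 p hd hB]]] := box_at y0 (eta_dom z y0); rewrite -/v -/y2 in hd hB.
pose Gp (p : R) (w : C) := G (h%:R * w) z (p +i* y2) * e (- (m%:~R * (p +i* y2))).
have zin : v - d <= complex.Im z <= v + d by rewrite gerBl lerDl ltW.
have yin (p' : R) : y2 - d <= complex.Im (p' +i* y2) <= y2 + d by rewrite /= gerBl lerDl ltW.
have uE : complex.Im u = complex.Im (h%:R * u) / h%:R.
  by rewrite Im_natM mulrAC divff ?mul1r// gt_eqF// hR0.
apply: (@Lam_differentiable R Gp (fun u => c3 m (h%:R * u) z) (complex.Im (h%:R * u) / h%:R) d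
   (B * expR (2 * pi * (m%:~R * y2))) u d0) => //.
  move=> p' w /Im_hin hw; have dw : dom (h%:R * w) z (p' +i* y2) := box_dom p hd hw zin (yin p').
  split; first by rewrite /Gp mulrDr mulr1 Gper1.
    apply: (@differentiable_cmul (fun w => G (h%:R * w) z (p' +i* y2))).
    by apply: (@differentiable_hcomp (fun w => G w z (p' +i* y2))); exact: Gd1.
  by rewrite /Gp nmM nm_eintN ler_wpM2r ?expR_ge0// hB.
move=> w /Im_hin hw; have [dw1 dw] : dom (h%:R * w) z (0 +i* y2) := box_dom p hd hw zin (yin 0).
by rewrite -(@c3E m (h%:R * w) z y2 dw1 dw).
Qed.

Definition c2 (m r : int) (t1 : C) : C := coef (c3 m t1) 0 r.

Lemma c3_box_bound (a1 b1 v w : R) m : 0 < a1 -> exists B, forall t1 z,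
  a1 <= complex.Im t1 <= b1 -> v <= complex.Im z <= w -> nm (c3 m t1 z) <= B.
Proof.
move=> a10; pose y := ((`|v| + `|w|) ^+ 2 + 1) / a1.
have hy v' : v <= v' <= w -> v' ^+ 2 < a1 * y.
  move=> hv; rewrite /y mulrC divfK ?gt_eqF//.
  have : v' ^+ 2 <= (`|v| + `|w|) ^+ 2.
    rewrite -real_normK ?num_real// ler_sqr ?nnegrE ?addr_ge0// ler_norml.
    have := ler_norm w; have := ler_norm (- v); rewrite normrN.
    have := normr_ge0 v; have := normr_ge0 w; lra.
  lra.
have [B hB] := @Gbd _ b1 v w _ y a10 hy.
exists (B * expR (2 * pi * (m%:~R * y))); exact: (c3_bound m a10 hy hB).
Qed.

Lemma c2_strip m (t1 : C) (lo hi : R) : 0 < complex.Im t1 -> exists B, strip_hol (c3 m t1) lo hi B.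
Proof.
move=> y0; have [B hB] := @c3_box_bound (complex.Im t1) (complex.Im t1) lo hi m y0.
exists B => z hz; split; [exact: c3_per2|exact: c3_d2|by apply: hB => //; rewrite lexx].
Qed.

Lemma c2E m r (t1 : C) (v : R) : 0 < complex.Im t1 -> coef (c3 m t1) v r = c2 m r t1.
Proof.
move=> y0; have [B hB] := @c2_strip m t1 (Num.min v 0) (Num.max v 0) y0.
by apply: (coef_indep_sym r hB); rewrite ?ge_min ?le_max lexx ?orbT.
Qed.

Lemma c2_sum m (t1 z : C) : 0 < complex.Im t1 -> hsum (fun r => c2 m r t1 * e (r%:~R * z)) (c3 m t1 z).
Proof.
move=> y0; have [B hB] := @c2_strip m t1 (complex.Im z - 1) (complex.Im z + 1) y0.
have := fourier (complex.Re z) ltr01 hB.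
rewrite (_ : complex.Re z +i* complex.Im z = z); last by case: (z).
by apply: hsum_ext => r; rewrite c2E.
Qed.

Lemma c2_per m r (t1 : C) : 0 < complex.Im t1 -> c2 m r (t1 + h%:R) = c2 m r t1.
Proof. by move=> y0; rewrite /c2 /coef; congr Lam; apply: funext => x; rewrite c3_per1. Qed.

Lemma c2_d m r (u : C) : 0 < complex.Im u -> differentiable (fun u : C => c2 m r (h%:R * u)) u.
Proof.
move=> u0; set y := complex.Im u; pose d := y / 2; have d0 : 0 < d by rewrite divr_gt0.
have lo0 : 0 < h%:R * (y - d) by rewrite mulr_gt0 ?hR0// /d; lra.
have [B hB] := @c3_box_bound _ (h%:R * (y + d)) 0 0 m lo0.
pose Gp (p : R) (w : C) := c3 m (h%:R * w) (p +i* 0) * e (- (r%:~R * (p +i* 0))).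
apply: (@Lam_differentiable R Gp (fun u => c2 m r (h%:R * u)) y d (B * expR (2 * pi * (r%:~R * 0))) u d0) => //.
move=> p w hw; have w0 : 0 < complex.Im w by move: hw; rewrite /d; lra.
have y0 : 0 < complex.Im (h%:R * w) by rewrite Im_natM mulr_gt0 ?hR0.
split; first by rewrite /Gp mulrDr mulr1 c3_per1.
  by apply: (@differentiable_cmul (fun w => c3 m (h%:R * w) (p +i* 0))); exact: c3_d1.
rewrite /Gp nmM nm_eintN ler_wpM2r ?expR_ge0// hB//= ?lexx// Im_natM.
by case/andP: hw => a b; rewrite !ler_wpM2l.
Qed.

Definition acoef (n r m : int) : C := coef (fun u => c2 m r (h%:R * u)) 1 n.

Lemma c2_bound m r (t1 : C) (v B : R) : 0 < complex.Im t1 -> (forall x, nm (c3 m t1 (x +i* v)) <= B) ->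
  nm (c2 m r t1) <= B * expR (2 * pi * (r%:~R * v)).
Proof. by move=> y0 hB; rewrite -(@c2E m r t1 v y0); exact: coef_le. Qed.

Lemma a_strip m r (lo hi : R) : 0 < lo -> exists B, strip_hol (fun u => c2 m r (h%:R * u)) lo hi B.
Proof.
move=> lo0; have l0 : 0 < h%:R * lo by rewrite mulr_gt0 ?hR0.
have [B hB] := @c3_box_bound _ (h%:R * hi) 0 0 m l0.
exists (B * expR (2 * pi * (r%:~R * 0))) => u hu.
have u0 : 0 < complex.Im u by case/andP: hu => a _; exact: lt_le_trans a.
have y0 : 0 < complex.Im (h%:R * u) by rewrite Im_natM mulr_gt0 ?hR0.
split; first by rewrite mulrDr mulr1 c2_per.
  exact: c2_d.
apply: c2_bound => // x; apply: hB; rewrite /= ?lexx// Im_natM.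
by case/andP: hu => a b; rewrite !ler_wpM2l.
Qed.

Lemma aE n r m (y : R) : 0 < y -> coef (fun u => c2 m r (h%:R * u)) y n = acoef n r m.
Proof.
move=> y0; have [|B hB] := @a_strip m r (Num.min y 1) (Num.max y 1).
  by rewrite lt_min y0 ltr01.
by apply: (coef_indep_sym n hB); rewrite ?ge_min ?le_max lexx ?orbT.
Qed.

Lemma a_sum m r (t1 : C) : 0 < complex.Im t1 ->
  hsum (fun n => acoef n r m * e (n%:~R * t1 / h%:R)) (c2 m r t1).
Proof.
move=> y0; set u := t1 / h%:R; have hu : h%:R * u = t1 by rewrite mulrC divfK ?hC0.
have u0 : 0 < complex.Im u by rewrite -(pmulr_rgt0 _ hR0) -Im_natM hu.
have [|B hB] := @a_strip m r (complex.Im u - complex.Im u / 2) (complex.Im u + complex.Im u / 2); first by lra.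
have u2 : 0 < complex.Im u / 2 by lra.
have := fourier (complex.Re u) u2 hB.
rewrite (_ : complex.Re u +i* complex.Im u = u); last by case: (u).
rewrite hu; apply: hsum_ext => n; rewrite aE//.
by congr (_ * e _); rewrite /u mulrA.
Qed.

Lemma a_bound (y1 v y2 B : R) n r m : 0 < y1 -> v ^+ 2 < y1 * y2 ->
  (forall t1 z t2, complex.Im t1 = y1 -> complex.Im z = v -> complex.Im t2 = y2 -> nm (G t1 z t2) <= B) ->
  nm (acoef n r m) <= B * expR (2 * pi * (n%:~R * y1 / h%:R + r%:~R * v + m%:~R * y2)).
Proof.
move=> y10 hv hB; have u0 : 0 < y1 / h%:R by rewrite divr_gt0 ?hR0.
rewrite -(@aE n r m _ u0).
have b3 t1 z : complex.Im t1 = y1 -> complex.Im z = v -> nm (c3 m t1 z) <= B * expR (2 * pi * (m%:~R * y2)).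
  move=> e1 e2; rewrite -(@c3E m t1 z y2) ?e1 ?e2//; apply: coef_le => x; exact: hB.
have b2 t1 : complex.Im t1 = y1 ->
    nm (c2 m r t1) <= B * expR (2 * pi * (m%:~R * y2)) * expR (2 * pi * (r%:~R * v)).
  by move=> e1; apply: c2_bound; rewrite ?e1// => x; exact: b3.
have := @coef_le R (fun u => c2 m r (h%:R * u)) (y1 / h%:R) n
   (B * expR (2 * pi * (m%:~R * y2)) * expR (2 * pi * (r%:~R * v))).
move=> H; apply: le_trans (H _) _.
  by move=> x; apply: b2; rewrite Im_natM/= mulrC divfK// gt_eqF// hR0.
rewrite -!mulrA -!expRD le_eqVlt; apply/orP; left; apply/eqP; congr (_ * expR _).
by ring.
Qed.

(** The imaginary parts are moved by d against the signs of n, r and m (by h d for the first), to a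
    corner of the box on which G is bounded; each index k gains exp(-2 pi d |k|). *)
Lemma a_decay (y1 v y2 : R) : 0 < y1 -> v ^+ 2 < y1 * y2 -> exists d B : R, 0 < d /\ forall n r m,
  nm (acoef n r m) <= B * expR (2 * pi * (n%:~R * y1 / h%:R + r%:~R * v + m%:~R * y2))
    * expR (- (2 * pi * d * (aint R n + aint R r + aint R m))).
Proof.
move=> y10 hv; have [d [B [d0 p hd hB]]] := box_at y10 hv.
exists d, B; split=> // n r m.
pose s (k : int) : R := if (0 <= k)%R then - d else d.
have sE k : k%:~R * s k = - (d * aint R k).
  rewrite aintE /s; case: (leP 0 k) => k0; first by rewrite ger0_norm ?ler0z//; ring.
  by rewrite ltr0_norm ?ltrz0//; ring.
have sin k : - d <= s k <= d by rewrite /s; case: ifP => _; lra.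
have hd1 : 0 <= h%:R * d by rewrite mulr_ge0 ?ltW ?hR0.
have hs : y1 - h%:R * d <= y1 + h%:R * s n <= y1 + h%:R * d.
  by rewrite -mulrN !lerD2l !ler_wpM2l//; case/andP: (sin n).
have [dm1 dm2] : dom (0 +i* (y1 + h%:R * s n)) (0 +i* (v + s r)) (0 +i* (y2 + s m)).
  apply: (box_dom p hd (b1 := y1 + h%:R * d) (b3 := y2 + d)) => //=.
  - by have := sin r; lra.
  - by have := sin m; lra.
rewrite /= in dm1 dm2.
apply: (le_trans (@a_bound _ _ _ B n r m dm1 dm2 _)).
  move=> t1 z t2 e1 e2 e3; apply: hB; rewrite ?e1 ?e2 ?e3//.
    by have := sin r; lra.
  by have := sin m; lra.
rewrite -[leRHS]mulrA -expRD le_eqVlt; apply/orP; left; apply/eqP; congr (_ * expR _).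
rewrite (_ : n%:~R * (y1 + h%:R * s n) / h%:R = n%:~R * y1 / h%:R + n%:~R * s n); last first.
  by field; rewrite gt_eqF// hR0.
by rewrite !mulrDr !sE; ring.
Qed.

End TubeExpansion.

(** * Multiple Fourier series and uniqueness of coefficients *)

Section ExpansionPackage.
Variable R : realType.
Local Notation C := R[i].
Local Notation e := (@cexp2pi R).

Definition decays (h : nat) (a : int -> int -> int -> C) := forall y1 v y2 : R,
  0 < y1 -> v ^+ 2 < y1 * y2 -> exists d B : R, 0 < d /\ forall n r m,
  nm (a n r m) <= B * expR (2 * pi * (n%:~R * y1 / h%:R + r%:~R * v + m%:~R * y2))
    * expR (- (2 * pi * d * (aint R n + aint R r + aint R m))).

Definition fj (h : nat) (n r : int) (t z : C) : C := e (n%:~R * t / h%:R + r%:~R * z).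

Lemma Im_divn (z : C) (h : nat) : complex.Im (z / h%:R) = complex.Im z / h%:R.
Proof. by rewrite natC -fmorphV ImM/= mulr0 add0r. Qed.

Lemma nm_fj h n r t z : nm (fj h n r t z) =
  expR (- (2 * pi * (n%:~R * complex.Im t / h%:R + r%:~R * complex.Im z))).
Proof.
by rewrite nm_e ImD Im_divn !Im_intM.
Qed.

(** For h = 0 the translation is trivial while [ek n x] is not, whence the alternative. *)
Lemma fj_shift h n r t z x : fj h n r (t + h%:R * x%:C) z = fj h n r t z * ek n x \/ h = 0%N.
Proof.
case: h => [|h]; [by right|left]; rewrite /fj /ek -eD; congr e.
by field; rewrite -[1]/(1%:R) -natrD pnatr_eq0.
Qed.

Lemma fj_shift2 h n r t z x : fj h n r t (z + x%:C) = fj h n r t z * ek r x.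
Proof. by rewrite /fj /ek -eD; congr e; ring. Qed.

Lemma decays_asum2 h a m t z : decays h a -> 0 < complex.Im t -> exists d, 0 < d /\
  bsum (fun p : int * int => nm (a p.1 p.2 m * fj h p.1 p.2 t z) *
     expR (2 * pi * d * (aint R p.1 + aint R p.2))).
Proof.
move=> dec y0; pose y2 := (complex.Im z ^+ 2 + 1) / complex.Im t.
have hy : complex.Im z ^+ 2 < complex.Im t * y2 by rewrite /y2 mulrC divfK ?gt_eqF// ltrDl.
have [d [B [d0 H]]] := dec _ _ _ y0 hy.
have p0 : 0 < pi :> R := pi_gt0 R.
exists (d / 2); split; first by rewrite divr_gt0.
pose K := `|B| * expR (2 * pi * (m%:~R * y2)).
have pd : 0 < pi * d by rewrite mulr_gt0.
apply: (@bsum_le _ _ _ (fun p : int * int => K * (expR (- (pi * d * aint R p.1)) * expR (- (pi * d * aint R p.2))))).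
  move=> [n r]/=; rewrite nmM nm_fj.
  set E := expR (- _); have E0 : 0 < E := expR_gt0 _.
  set W := expR (2 * pi * (d / 2) * _); have W0 : 0 < W := expR_gt0 _.
  apply: (@le_trans _ _ (`|B| * expR (2 * pi * (n%:~R * complex.Im t / h%:R + r%:~R * complex.Im z + m%:~R * y2))
    * expR (- (2 * pi * d * (aint R n + aint R r + aint R m))) * E * W)).
    rewrite ler_wpM2r ?(ltW W0)// ler_wpM2r ?(ltW E0)// (le_trans (H n r m))//.
    by rewrite !ler_wpM2r ?expR_ge0// ler_norm.
  rewrite /K /E /W -!mulrA ler_wpM2l// -!expRD ler_expR.
  have := aint_ge0 R m; set A := aint R m => A0.
  have : 0 <= 2 * pi * d * A by rewrite !mulr_ge0// ?ltW.
  lra.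
apply: bsumZ; first by rewrite mulr_ge0 ?expR_ge0.
by apply: (@bsum_prod R int int (fun n => expR (- (pi * d * aint R n))) (fun n => expR (- (pi * d * aint R n))));
   [move=> n; exact: expR_ge0|move=> n; exact: expR_ge0|exact: bsum_expR|exact: bsum_expR].
Qed.

Lemma decays_asum2' h a m t z : decays h a -> 0 < complex.Im t ->
  asum (fun p : int * int => a p.1 p.2 m * fj h p.1 p.2 t z).
Proof.
move=> dec y0; have [d [d0 H]] := decays_asum2 m z dec y0; apply: bsum_le H => p.
rewrite ler_peMr ?nm_ge0// -expR0 ler_expR.
by rewrite mulr_ge0 ?addr_ge0 ?aint_ge0// !mulr_ge0 ?pi_ge0// ltW.
Qed.

Lemma decays_asum3 h a t1 z t2 : decays h a -> dom t1 z t2 ->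
  asum (fun T : int * (int * int) => a T.2.1 T.2.2 T.1 * fj h T.2.1 T.2.2 t1 z * e (T.1%:~R * t2)).
Proof.
move=> dec [y0 hy]; have [d [B [d0 H]]] := dec _ _ _ y0 hy.
have p0 : 0 < pi :> R := pi_gt0 R.
have pd : 0 < 2 * pi * d by rewrite !mulr_gt0.
pose g (n : int) := expR (- (2 * pi * d * aint R n)).
have g0 n : 0 <= g n by exact: expR_ge0.
apply: (@bsum_le _ _ _ (fun T : int * (int * int) => `|B| * (g T.1 * (g T.2.1 * g T.2.2)))).
  move=> [m [n r]]/=; rewrite nmM nmM nm_fj nm_eint.
  set E := expR (- (2 * pi * (_ + _))); set E' := expR (- (2 * pi * (m%:~R * _))).
  apply: (@le_trans _ _ (`|B| * expR (2 * pi * (n%:~R * complex.Im t1 / h%:R + r%:~R * complex.Im z + m%:~R * complex.Im t2))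
    * expR (- (2 * pi * d * (aint R n + aint R r + aint R m))) * E * E')).
    rewrite ler_wpM2r ?expR_ge0// ler_wpM2r ?expR_ge0// (le_trans (H n r m))//.
    by rewrite !ler_wpM2r ?expR_ge0// ler_norm.
  rewrite /E /E' /g -!mulrA ler_wpM2l// -!expRD ler_expR; lra.
apply: bsumZ => //.
have b1 : bsum g by exact: bsum_expR.
have b2 := @bsum_prod R int int g g g0 g0 b1 b1.
by apply: (@bsum_prod R int (int * int)%type g (fun p => g p.1 * g p.2)) => // p; rewrite mulr_ge0.
Qed.

Definition tube_expansion h (G : C -> C -> C -> C) (a : int -> int -> int -> C)
    (c : int -> C -> C -> C) :=
  [/\ decays h a,
      forall t1 z t2, dom t1 z t2 -> hsum (fun m => c m t1 z * e (m%:~R * t2)) (G t1 z t2)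
    & forall m t1 z, 0 < complex.Im t1 ->
        hsum (fun p : int * int => a p.1 p.2 m * fj h p.1 p.2 t1 z) (c m t1 z)].

Lemma expansion_total h G a c t1 z t2 : tube_expansion h G a c -> dom t1 z t2 ->
  hsum (fun T : int * (int * int) => a T.2.1 T.2.2 T.1 * fj h T.2.1 T.2.2 t1 z * e (T.1%:~R * t2))
    (G t1 z t2).
Proof.
move=> [dec h1 h2] dm.
apply: (hsum_rows_inv (decays_asum3 dec dm) (s := fun m => c m t1 z * e (m%:~R * t2))).
  by move=> m /=; apply: hsumZr; apply: h2; case: dm.
exact: h1.
Qed.

Lemma tube_expansionP (h : nat) (G : C -> C -> C -> C) : (0 < h)%N ->
  (forall t1 z t2, dom t1 z t2 -> G (t1 + h%:R) z t2 = G t1 z t2) ->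
  (forall t1 z t2, dom t1 z t2 -> G t1 (z + 1) t2 = G t1 z t2) ->
  (forall t1 z t2, dom t1 z t2 -> G t1 z (t2 + 1) = G t1 z t2) ->
  (forall t1 z t2, dom t1 z t2 -> differentiable (fun t : C => G t z t2) t1) ->
  (forall t1 z t2, dom t1 z t2 -> differentiable (fun w : C => G t1 w t2) z) ->
  (forall t1 z t2, dom t1 z t2 -> differentiable (fun t : C => G t1 z t) t2) ->
  (forall a1 b1 v w a3 b3 : R, 0 < a1 ->
    (forall y, v <= y <= w -> y ^+ 2 < a1 * a3) -> exists B, forall t1 z t2,
    a1 <= complex.Im t1 <= b1 -> v <= complex.Im z <= w -> a3 <= complex.Im t2 <= b3 ->
    nm (G t1 z t2) <= B) ->
  exists a c, tube_expansion h G a c.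
Proof.
move=> h0 p1 p2 p3 d1 d2 d3 bd.
exists (acoef h G), (c3 G).
have dec : decays h (acoef h G).
  by move=> y1 v y2 y10 hv; exact: (a_decay h0 p1 p2 p3 d1 d2 d3 bd y10 hv).
split=> //.
  by move=> t1 z t2; exact: (c3_sum p3 d3 bd).
move=> m t1 z y0.
pose u (q : int * int) := acoef h G q.2 q.1 m * fj h q.2 q.1 t1 z.
have au : asum u.
  apply: (@bsum_inj _ _ _ predT (fun q : int * int => (q.2, q.1)) _ _ _ _ _ _ (decays_asum2' m z dec y0)) => //=.
    by move=> p; exact: nm_ge0.
  by move=> [x1 x2] [x3 x4] _ _ /= [-> ->].
have hu : hsum u (c3 G m t1 z).
  apply: (hsum_rows_inv au (s := fun r => c2 G m r t1 * e (r%:~R * z))).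
    move=> r; have := hsumZr (e (r%:~R * z)) (a_sum h0 p1 p2 p3 d1 d2 d3 bd m r y0).
    by apply: hsum_ext => n; rewrite /u /fj/= eD mulrA.
  exact: (c2_sum h0 p2 p3 d2 d3 bd).
apply: (@hsum_reindex R _ _ predT predT (fun q : int * int => (q.2, q.1)) (fun q => (q.2, q.1)) u _ _ _ _ _ _ hu) => //.
  by move=> [r n] _.
by move=> [r n] _.
Qed.

Lemma hsum_uniq1 (p : int -> C) : (forall x : R, hsum (fun m => p m * ek m x) 0) -> forall m, p m = 0.
Proof.
move=> H m.
have pa : asum p by have := hsum_asum (H 0); apply: bsum_le => i; rewrite nmM nm_ek mulr1.
have [_] := @Lam_coef R int p id (fun=> 0) m pa H.
rewrite (_ : (fun x => 0 * _) = fun=> 0); last by apply: funext => x; rewrite mul0r.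
rewrite Lam0 => h; have := @hsum_one int R (fun i => if i == m then p i else 0) m.
rewrite eqxx => h'; apply: (hsum_uniq (h' _) h) => i /negbTE ->//.
Qed.

Lemma hsum_uniq1' (p q : int -> C) (s : R -> C) : (forall x : R, hsum (fun m => p m * ek m x) (s x)) ->
  (forall x : R, hsum (fun m => q m * ek m x) (s x)) -> forall m, p m = q m.
Proof.
move=> hp hq m; apply/eqP; rewrite -subr_eq0; apply/eqP.
apply: (@hsum_uniq1 (fun m => p m - q m)) => x; have := hsumB (hp x) (hq x); rewrite subrr.
by apply: hsum_ext => i; rewrite mulrBl.
Qed.

(** The mean against [ek (- n)] isolates one fibre of the frequency map. Applied to one variable
    after another, it proves uniqueness directly for sums over pairs and triples. *)
Lemma hsum_uniq_fiber (I : choiceType) (nu : I -> int) (D : I -> C) :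
  (forall x : R, hsum (fun i => D i * ek (nu i) x) 0) ->
  forall n, hsum (fun i => if nu i == n then D i else 0) 0.
Proof.
move=> H n.
have pa : asum D by have := hsum_asum (H 0); apply: bsum_le => i; rewrite nmM nm_ek mulr1.
have [_] := @Lam_coef R I D nu (fun=> 0) n pa H.
rewrite (_ : (fun x => 0 * _) = fun=> 0); last by apply: funext => x; rewrite mul0r.
by rewrite Lam0.
Qed.

Lemma hsum_uniq2 (D : int * int -> C) :
  (forall x1 x2 : R, hsum (fun p => D p * (ek p.1 x1 * ek p.2 x2)) 0) -> forall p, D p = 0.
Proof.
move=> H [n r].
have H2 x1 : hsum (fun p : int * int => if p.2 == r then D p * ek p.1 x1 else 0) 0.
  apply: (@hsum_uniq_fiber _ snd (fun p => D p * ek p.1 x1)) => x2.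
  by apply: hsum_ext (H x1 x2) => p; rewrite mulrA.
have H1 : hsum (fun p : int * int => if p.1 == n then (if p.2 == r then D p else 0) else 0) 0.
  apply: (@hsum_uniq_fiber _ fst (fun p => if p.2 == r then D p else 0)) => x1.
  by apply: hsum_ext (H2 x1) => p; case: ifP => _ //; rewrite mul0r.
have := @hsum_one _ R (fun p : int * int => if p.1 == n then (if p.2 == r then D p else 0) else 0) (n, r).
rewrite /= !eqxx => h; apply: (hsum_uniq (h _) H1) => -[n' r']/=.
by rewrite xpair_eqE; case: (n' == n); case: (r' == r).
Qed.

Lemma hsum_uniq3 (D : int * (int * int) -> C) :
  (forall x1 x2 x3 : R, hsum (fun T => D T * (ek T.2.1 x1 * ek T.2.2 x2 * ek T.1 x3)) 0) ->
  forall T, D T = 0.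
Proof.
move=> H [m q].
have H3 x1 x2 : hsum (fun T : int * (int * int) => if T.1 == m then D T * (ek T.2.1 x1 * ek T.2.2 x2) else 0) 0.
  apply: (@hsum_uniq_fiber _ fst (fun T => D T * (ek T.2.1 x1 * ek T.2.2 x2))) => x3.
  by apply: hsum_ext (H x1 x2 x3) => T; rewrite mulrA.
apply: (@hsum_uniq2 (fun p => D (m, p))) => x1 x2.
apply: (@hsum_reindex R _ _ (fun T : int * (int * int) => T.1 == m) predT snd (pair m) _ _ _ _ _ _ _ (H3 x1 x2)) => //=.
- by move=> T /negbTE ->.
- by move=> [m' p]/= /eqP ->; rewrite eqxx.
Qed.

End ExpansionPackage.

(** * Action on the Siegel half space *)

Section TwoByTwo.

Lemma ord2 (i : 'I_2) : i = 0 \/ i = 1.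
Proof. by case: i => [[|[|//]] hi]; [left|right]; apply/val_inj. Qed.

Lemma mx2P (T : Type) (A B : 'M[T]_2) : A 0 0 = B 0 0 -> A 0 1 = B 0 1 -> A 1 0 = B 1 0 ->
  A 1 1 = B 1 1 -> A = B.
Proof.
by move=> h1 h2 h3 h4; apply/matrixP => i j; case: (ord2 i) => ->; case: (ord2 j) => ->.
Qed.

Lemma sum2 (V : nmodType) (f : 'I_2 -> V) : \sum_i f i = f 0 + f 1.
Proof. by rewrite big_ord_recl big_ord1; congr (_ + f _); apply: val_inj. Qed.

Variable K : comNzRingType.

Lemma mul2E n (A : 'M[K]_(n, 2)) m (B : 'M[K]_(2, m)) i j :
  (A *m B) i j = A i 0 * B 0 j + A i 1 * B 1 j.
Proof. by rewrite mxE sum2. Qed.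

Lemma det2 (A : 'M[K]_2) : \det A = A 0 0 * A 1 1 - A 0 1 * A 1 0.
Proof.
rewrite (expand_det_row _ 0) sum2 /cofactor !det_mx11 !mxE.
have -> : lift 0 0 = 1 :> 'I_2 by apply: val_inj.
have -> : lift 1 0 = 0 :> 'I_2 by apply: val_inj.
by rewrite /= expr0 expr1; ring.
Qed.

Definition mk2 (a b c d : K) : 'M[K]_2 := mxrows 2 2 [:: [:: a; b]; [:: c; d]].

Lemma mk2E a b c d : (mk2 a b c d 0 0 = a) * (mk2 a b c d 0 1 = b) *
  (mk2 a b c d 1 0 = c) * (mk2 a b c d 1 1 = d).
Proof. by do ! split; rewrite mxE. Qed.

Lemma mk2_eta (A : 'M[K]_2) : A = mk2 (A 0 0) (A 0 1) (A 1 0) (A 1 1).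
Proof. by apply: mx2P; rewrite mk2E. Qed.

Lemma mk2M a b c d a' b' c' d' : mk2 a b c d *m mk2 a' b' c' d' =
  mk2 (a * a' + b * c') (a * b' + b * d') (c * a' + d * c') (c * b' + d * d').
Proof. by apply: mx2P; rewrite mul2E !mk2E. Qed.

Lemma mk2D a b c d a' b' c' d' : mk2 a b c d + mk2 a' b' c' d' = mk2 (a + a') (b + b') (c + c') (d + d').
Proof. by apply: mx2P; rewrite mxE !mk2E. Qed.

Lemma mk2T a b c d : (mk2 a b c d)^T = mk2 a c b d.
Proof. by apply: mx2P; rewrite mxE !mk2E. Qed.

Lemma det_mk2 a b c d : \det (mk2 a b c d) = a * d - b * c.
Proof. by rewrite det2 !mk2E. Qed.

Lemma mk2_1 : 1%:M = mk2 1 0 0 1.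
Proof. by apply: mx2P; rewrite mxE mk2E. Qed.

End TwoByTwo.

(** * The Siegel half space and the two embeddings *)

Section SiegelAction.
Variable R : realType.
Local Notation C := R[i].

Lemma siegel_mxE (t1 z t2 : C) : siegel_mx t1 z t2 = mk2 t1 z z t2.
Proof. by []. Qed.

Lemma siegel_upperE (t1 z t2 : C) : siegel_upper (siegel_mx t1 z t2) <-> dom t1 z t2.
Proof.
have form (v : 'cV[R]_2) : (v^T *m map_mx (@complex.Im R) (siegel_mx t1 z t2) *m v) 0 0 =
    complex.Im t1 * v 0 0 ^+ 2 + 2 * complex.Im z * (v 0 0 * v 1 0) + complex.Im t2 * v 1 0 ^+ 2.
  by rewrite !mul2E !mxE/=; ring.
rewrite /siegel_upper /dom/=; split=> [[_ h]|[y0 hv]].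
  have y0 : 0 < complex.Im t1.
    have := h (\col_i (if i == 0 then 1 else 0)); rewrite form !mxE/=.
    rewrite !(expr1n, mulr1, expr0n, mulr0, addr0, mul1r) /=; apply.
    by apply/eqP => /matrixP /(_ 0 0); rewrite !mxE/= => /eqP; rewrite oner_eq0.
  (* On this vector the quadratic form equals Im t1 times the determinant of the imaginary part. *)
  split=> //; have := h (\col_i (if i == 0 then - complex.Im z else complex.Im t1)).
  rewrite form !mxE/= => /(_ _).
  have h1 : \col_i (if i == 0 then - complex.Im z else complex.Im t1) != 0 :> 'cV[R]_2.
    by apply/eqP => /matrixP /(_ 1 0); rewrite !mxE/= => /eqP; rewrite gt_eqF.
  move=> /(_ h1); rewrite (_ : _ + _ = complex.Im t1 * (complex.Im t1 * complex.Im t2 - complex.Im z ^+ 2)).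
    by rewrite pmulr_rgt0// subr_gt0.
  by ring.
split; first by rewrite siegel_mxE mk2T.
move=> v v0; rewrite form; set a : R := v 0 0; set b : R := v 1 0.
rewrite -(pmulr_rgt0 _ y0).
rewrite [X in 0 < X](_ : _ = (complex.Im t1 * a + complex.Im z * b) ^+ 2 +
   (complex.Im t1 * complex.Im t2 - complex.Im z ^+ 2) * b ^+ 2); last by ring.
have p0 : 0 < complex.Im t1 * complex.Im t2 - complex.Im z ^+ 2 by rewrite subr_gt0.
have [b0|b0] := eqVneq b 0; last first.
  by rewrite ltr_wpDl ?sqr_ge0// mulr_gt0// lt_neqAle sqr_ge0 eq_sym sqrf_eq0 b0.
rewrite b0 !mulr0 addr0 expr0n mulr0 addr0 lt_neqAle sqr_ge0 andbT eq_sym sqrf_eq0 mulf_neq0//.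
  by rewrite gt_eqF.
apply: contraNneq v0 => a0; apply/eqP/matrixP => i j; rewrite mxE (ord1 j).
by case: (ord2 i) => ->.
Qed.

Implicit Type F : 'M[C]_2 -> C.

Lemma slash_eval k F (M : 'M[R]_(2 + 2)) (Z W : 'M[C]_2) :
  let M' := map_mx (real_complex R) M in let J := dlsubmx M' *m Z + drsubmx M' in
  \det J != 0 -> W *m J = ulsubmx M' *m Z + ursubmx M' ->
  siegel_slash k F M Z = (\det J) ^- k * F W.
Proof.
by move=> M' J J0 h; rewrite /siegel_slash -/M' -/J -h mulmxK// unitmxE unitfE.
Qed.

Lemma map_real_int m n (A : 'M[int]_(m, n)) :
  map_mx (real_complex R) (map_mx intr A) = map_mx (intr : int -> C) A.
Proof. by apply/matrixP => i j; rewrite !mxE; exact: rmorph_int. Qed.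

Lemma slash_block k F (A B D E : 'M[int]_2) (Z W : 'M[C]_2) :
  let J := map_mx intr D *m Z + map_mx intr E in
  \det J != 0 -> W *m J = map_mx intr A *m Z + map_mx intr B ->
  siegel_slash k F (map_mx intr (block_mx A B D E)) Z = (\det J) ^- k * F W.
Proof.
move=> J J0 h; have := @slash_eval k F (map_mx intr (block_mx A B D E)) Z W.
by rewrite /= map_real_int map_block_mx block_mxKdl block_mxKdr block_mxKul block_mxKur; apply.
Qed.

Lemma up_eval k F (h : 'M[R]_2) (t1 z t2 : C) : \det h = 1 ->
  let a := (h 0 0)%:C in let b := (h 0 1)%:C in let c := (h 1 0)%:C in let d := (h 1 1)%:C in
  let j := c * t1 + d in j != 0 ->
  siegel_slash k F (embed_up h) (siegel_mx t1 z t2) =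
    j ^- k * F (siegel_mx ((a * t1 + b) / j) (z / j) (t2 - c * z ^+ 2 / j)).
Proof.
move=> hdet a b c d j j0.
have ad : a * d - b * c = 1 by rewrite /a /b /c /d -!rmorphM -rmorphB -det2 hdet.
have h1 : dlsubmx (map_mx (real_complex R) (embed_up h)) = mk2 c 0 0 0.
  by apply: mx2P; rewrite mk2E !mxE/= ?mxE//=.
have h2 : drsubmx (map_mx (real_complex R) (embed_up h)) = mk2 d 0 0 1.
  by apply: mx2P; rewrite mk2E !mxE/= ?mxE//=.
have h3 : ulsubmx (map_mx (real_complex R) (embed_up h)) = mk2 a 0 0 1.
  by apply: mx2P; rewrite mk2E !mxE/= ?mxE//=.
have h4 : ursubmx (map_mx (real_complex R) (embed_up h)) = mk2 b 0 0 0.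
  by apply: mx2P; rewrite mk2E !mxE/= ?mxE//=.
have hJ : \det (mk2 c 0 0 0 *m siegel_mx t1 z t2 + mk2 d 0 0 1) = j.
  by rewrite siegel_mxE mk2M mk2D det_mk2 /j; ring.
rewrite (@slash_eval k F (embed_up h) _ (siegel_mx ((a * t1 + b) / j) (z / j) (t2 - c * z ^+ 2 / j)));
  rewrite /= ?h1 ?h2 ?h3 ?h4 ?hJ//.
rewrite !siegel_mxE !mk2M !mk2D !mk2M.
congr mk2; rewrite ?(mulr0, mul0r, addr0, add0r, mulr1, mul1r).
- by rewrite /j; field.
- rewrite (_ : _ + z / j = z * (c * (a * t1 + b) + 1) / j); last by ring.
  rewrite (_ : c * (a * t1 + b) + 1 = a * j); first by field.
  by rewrite -ad /j; ring.
- by rewrite -/j divfK.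
- by field.
Qed.

Lemma down_eval k F (h : 'M[R]_2) (t1 z t2 : C) : \det h = 1 ->
  let a := (h 0 0)%:C in let b := (h 0 1)%:C in let c := (h 1 0)%:C in let d := (h 1 1)%:C in
  let j := c * t2 + d in j != 0 ->
  siegel_slash k F (embed_down h) (siegel_mx t1 z t2) =
    j ^- k * F (siegel_mx (t1 - c * z ^+ 2 / j) (z / j) ((a * t2 + b) / j)).
Proof.
move=> hdet a b c d j j0.
have ad : a * d - b * c = 1 by rewrite /a /b /c /d -!rmorphM -rmorphB -det2 hdet.
have h1 : dlsubmx (map_mx (real_complex R) (embed_down h)) = mk2 0 0 0 c.
  by apply: mx2P; rewrite mk2E !mxE/= ?mxE//=.
have h2 : drsubmx (map_mx (real_complex R) (embed_down h)) = mk2 1 0 0 d.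
  by apply: mx2P; rewrite mk2E !mxE/= ?mxE//=.
have h3 : ulsubmx (map_mx (real_complex R) (embed_down h)) = mk2 1 0 0 a.
  by apply: mx2P; rewrite mk2E !mxE/= ?mxE//=.
have h4 : ursubmx (map_mx (real_complex R) (embed_down h)) = mk2 0 0 0 b.
  by apply: mx2P; rewrite mk2E !mxE/= ?mxE//=.
have hJ : \det (mk2 0 0 0 c *m siegel_mx t1 z t2 + mk2 1 0 0 d) = j.
  by rewrite siegel_mxE mk2M mk2D det_mk2 /j; ring.
rewrite (@slash_eval k F (embed_down h) _ (siegel_mx (t1 - c * z ^+ 2 / j) (z / j) ((a * t2 + b) / j)));
  rewrite /= ?h1 ?h2 ?h3 ?h4 ?hJ//.
rewrite !siegel_mxE !mk2M !mk2D !mk2M.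
congr mk2; rewrite ?(mulr0, mul0r, addr0, add0r, mulr1, mul1r).
- by field.
- by rewrite -/j divfK.
- rewrite (_ : z / j + _ = z * (c * (a * t2 + b) + 1) / j); last by ring.
  rewrite (_ : c * (a * t2 + b) + 1 = a * j); first by field.
  by rewrite -ad /j; ring.
- by rewrite /j; field.
Qed.

Lemma Sp2Z_block (A B D E : 'M[int]_2) : A^T *m D = D^T *m A -> B^T *m E = E^T *m B ->
  A^T *m E - D^T *m B = 1%:M -> Sp2Z (block_mx A B D E).
Proof.
move=> h1 h2 h3; rewrite /Sp2Z/= tr_block_mx !mulmx_block.
rewrite !(mulmx0, mul0mx, mulmx1, mul1mx, mulmxN, mulNmx, add0r, addr0).
have h4 : E^T *m A - B^T *m D = 1%:M by rewrite -[LHS]trmxK linearB/= !trmx_mul !trmxK h3 trmx1.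
congr block_mx.
- by rewrite h1 addrC subrr.
- by rewrite addrC.
- by rewrite -h4 opprB addrC.
- by rewrite h2 addrC subrr.
Qed.

Lemma Sp2ZM (g1 g2 : 'M[int]_(2 + 2)) : Sp2Z g1 -> Sp2Z g2 -> Sp2Z (g1 *m g2).
Proof.
rewrite /Sp2Z/=; set J := block_mx _ _ _ _ => h1 h2.
have -> : (g1 *m g2)^T *m J *m (g1 *m g2) = g2^T *m (g1^T *m J *m g1) *m g2.
  by rewrite trmx_mul !mulmxA.
by rewrite h1.
Qed.

Lemma ReV (z : C) : complex.Re z^-1 = complex.Re z / (complex.Re z ^+ 2 + complex.Im z ^+ 2).
Proof. by case: z. Qed.

Lemma ImV (z : C) : complex.Im z^-1 = - complex.Im z / (complex.Re z ^+ 2 + complex.Im z ^+ 2).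
Proof. by case: z => a b /=; rewrite mulNr. Qed.

Lemma j_neq0 (c d : R) (t : C) : 0 < complex.Im t -> (c != 0) || (d != 0) -> c%:C * t + d%:C != 0.
Proof.
move=> y0 cd; apply/eqP => h; have hi := congr1 (@complex.Im R) h; have hr := congr1 (@complex.Re R) h.
move: hi hr; rewrite !(ImD,ReD,ImM,ReM)/= !(mul0r, mulr0, addr0, subr0, add0r) => /eqP.
rewrite mulf_eq0 (gt_eqF y0) orbF => /eqP c0; rewrite c0 mul0r add0r => d0.
by move: cd; rewrite c0 d0 eqxx.
Qed.

Lemma dom_up (a b c d : R) (t1 z t2 : C) : a * d - b * c = 1 -> dom t1 z t2 ->
  let j := c%:C * t1 + d%:C in
  dom ((a%:C * t1 + b%:C) / j) (z / j) (t2 - c%:C * z ^+ 2 / j).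
Proof.
move=> ad [y0 hv] j.
have cd : (c != 0) || (d != 0).
  apply: contraPT ad; rewrite negb_or !negbK => /andP[/eqP -> /eqP ->].
  by rewrite !mulr0 subr0 => /esym/eqP; rewrite oner_eq0.
have j0 := j_neq0 y0 cd; rewrite -/j in j0.
clear cd; move: j0; rewrite /j; clear j.
case: t1 y0 hv => x y; case: z => u v; case: t2 => s w /= y0 hv; set j := _ + d%:C => j0.
pose X := c * x + d; pose Y := c * y; pose q := X ^+ 2 + Y ^+ 2.
have rj : complex.Re j = X by rewrite /j !(ReD,ReM)/= /X; ring.
have ij : complex.Im j = Y by rewrite /j !(ImD,ImM)/= /Y; ring.
have q0 : 0 < q by rewrite /q -rj -ij -nm_sqr exprn_gt0// nm_gt0.
have qn : q != 0 by rewrite gt_eqF.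
have i1 : complex.Im ((a%:C * (x +i* y) + b%:C) / j) = y / q.
  rewrite ImM ReV ImV rj ij -/q !(ImD,ReD,ImM,ReM)/=.
  rewrite -[y in RHS]mul1r -ad /X /Y; field; exact: qn.
have i2 : complex.Im ((u +i* v) / j) = (v * X - u * Y) / q.
  by rewrite ImM ReV ImV rj ij -/q/=; field; exact: qn.
have i3 : complex.Im ((s +i* w) - c%:C * (u +i* v) ^+ 2 / j) =
    w - c * (2 * u * v * X - (u ^+ 2 - v ^+ 2) * Y) / q.
  rewrite ImD ImN [in LHS]ImM ReV ImV rj ij -/q expr2 !(ImM,ReM)/=.
  by field; exact: qn.
rewrite /dom i1 i2 i3; split; first by rewrite divr_gt0.
rewrite -subr_gt0 (_ : _ - _ = (y * w - v ^+ 2) / q); first by rewrite divr_gt0// subr_gt0.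
apply: (mulIf qn); apply: (mulIf qn); rewrite divfK//.
rewrite (_ : (y / q * _ - _) * q * q = y * (w * q - c * (2 * u * v * X - (u ^+ 2 - v ^+ 2) * Y)) -
   (v * X - u * Y) ^+ 2); last by field.
by rewrite /q /Y; ring.
Qed.

End SiegelAction.

(** * The cocycle relation for the slash action *)

Section SiegelCocycle.
Variable R : realType.
Local Notation C := R[i].
Implicit Types (g : 'M[R]_(2 + 2)) (Z W : 'M[C]_2) (F : 'M[C]_2 -> C).

Definition sj g Z : 'M[C]_2 := let M := map_mx (real_complex R) g in dlsubmx M *m Z + drsubmx M.
Definition sact g Z : 'M[C]_2 :=
  let M := map_mx (real_complex R) g in (ulsubmx M *m Z + ursubmx M) *m invmx (sj g Z).

Lemma slashE k F g Z : siegel_slash k F g Z = (\det (sj g Z)) ^- k * F (sact g Z).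
Proof. by []. Qed.

Lemma unit_det (A : 'M[C]_2) : (A \in unitmx) = (\det A != 0).
Proof. by rewrite unitmxE unitfE. Qed.

Lemma mk2B (T : comNzRingType) (a b c d a' b' c' d' : T) :
  mk2 a b c d - mk2 a' b' c' d' = mk2 (a - a') (b - b') (c - c') (d - d').
Proof. by apply: mx2P; rewrite !mxE. Qed.

Lemma mulmx_sub (T : comNzRingType) (P Q : 'M[T]_(2 + 2)) :
  (ulsubmx (P *m Q) = ulsubmx P *m ulsubmx Q + ursubmx P *m dlsubmx Q) *
  (ursubmx (P *m Q) = ulsubmx P *m ursubmx Q + ursubmx P *m drsubmx Q) *
  (dlsubmx (P *m Q) = dlsubmx P *m ulsubmx Q + drsubmx P *m dlsubmx Q) *
  (drsubmx (P *m Q) = dlsubmx P *m ursubmx Q + drsubmx P *m drsubmx Q).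
Proof.
rewrite -[P in P *m Q]submxK -[Q in _ *m Q]submxK mulmx_block.
by do ! split; rewrite ?block_mxKul ?block_mxKur ?block_mxKdl ?block_mxKdr.
Qed.

Lemma sjM g1 g2 Z : \det (sj g2 Z) != 0 -> sj (g1 *m g2) Z = sj g1 (sact g2 Z) *m sj g2 Z.
Proof.
rewrite -unit_det => u; rewrite {1}/sj map_mxM !mulmx_sub/=.
rewrite [in RHS]/sj mulmxDl /sact mulmxA mulmxKV// /sj.
by rewrite !mulmxDr !mulmxDl !mulmxA !addrA; congr (_ + _); rewrite addrAC.
Qed.

Lemma sactM g1 g2 Z : \det (sj g2 Z) != 0 -> \det (sj g1 (sact g2 Z)) != 0 ->
  sact (g1 *m g2) Z = sact g1 (sact g2 Z).
Proof.
move=> u2 u1; rewrite [in RHS]/sact; set M1 := map_mx _ g1.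
rewrite [LHS]/sact sjM// map_mxM !mulmx_sub/= -/M1.
have /= [v1 v2] : sj g1 (sact g2 Z) \in unitmx /\ sj g2 Z \in unitmx by rewrite !unit_det.
have hI : invmx (sj g1 (sact g2 Z) *m sj g2 Z) = invmx (sj g2 Z) *m invmx (sj g1 (sact g2 Z)).
  have v3 : sj g1 (sact g2 Z) *m sj g2 Z \in unitmx by rewrite unitmx_mul v1 v2.
  by apply: (can_inj (mulKmx v3)); rewrite (mulmxV v3) -mulmxA (mulKVmx v2) (mulmxV v1).
rewrite hI [LHS]mulmxA; congr (_ *m _).
set M2 := map_mx _ g2.
rewrite [in RHS]mulmxA -[ursubmx M1 in RHS](mulmxK v2) -mulmxDl; congr (_ *m _).
rewrite /sj -/M2 !mulmxDr !mulmxDl !mulmxA !addrA; congr (_ + _); by rewrite addrAC.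
Qed.

Lemma slash_slash k F g1 g2 Z : \det (sj g2 Z) != 0 -> \det (sj (g1 *m g2) Z) != 0 ->
  siegel_slash k (siegel_slash k F g1) g2 Z = siegel_slash k F (g1 *m g2) Z.
Proof.
move=> u2; rewrite sjM// det_mulmx mulf_eq0 negb_or => /andP[u1 _].
by rewrite !slashE sjM// sactM// det_mulmx exprMn invfM mulrA [_ ^- k * _ ^- k in LHS]mulrC.
Qed.

Lemma sact_eq g Z W : \det (sj g Z) != 0 ->
  W *m sj g Z = ulsubmx (map_mx (real_complex R) g) *m Z + ursubmx (map_mx (real_complex R) g) ->
  sact g Z = W.
Proof. by move=> u h; rewrite /sact -h mulmxK// unit_det. Qed.

Lemma sj_block (A B D E : 'M[int]_2) Z :
  sj (map_mx intr (block_mx A B D E)) Z = map_mx intr D *m Z + map_mx intr E.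
Proof. by rewrite /sj map_real_int map_block_mx block_mxKdl block_mxKdr. Qed.

Lemma sact_block (A B D E : 'M[int]_2) Z W :
  \det (map_mx intr D *m Z + map_mx intr E) != 0 ->
  W *m (map_mx intr D *m Z + map_mx intr E) = map_mx intr A *m Z + map_mx intr B ->
  sact (map_mx intr (block_mx A B D E)) Z = W.
Proof.
move=> u h; apply: sact_eq; rewrite sj_block//.
by rewrite map_real_int map_block_mx block_mxKul block_mxKur h.
Qed.

Definition upZ (M : 'M[int]_2) : 'M[int]_(2 + 2) :=
  block_mx (mk2 (M 0 0) 0 0 1) (mk2 (M 0 1) 0 0 0) (mk2 (M 1 0) 0 0 0) (mk2 (M 1 1) 0 0 1).

Lemma embed_up_int (M : 'M[int]_2) : embed_up (map_mx intr M) = map_mx intr (upZ M) :> 'M[R]_(2 + 2).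
Proof.
rewrite -[LHS]submxK map_block_mx; congr block_mx;
  by apply: mx2P; rewrite [RHS]mxE mk2E !mxE/= ?mxE.
Qed.

Lemma mk2_map (a b c d : int) : map_mx intr (mk2 a b c d) = mk2 a%:~R b%:~R c%:~R d%:~R :> 'M[C]_2.
Proof. by apply: mx2P; rewrite mxE !mk2E. Qed.

End SiegelCocycle.

(** * Transformation laws of F *)

Section FormLaws.
Variables (R : realType) (k N : nat) (chi : int -> R[i]) (F : 'M[R[i]]_2 -> R[i]).
Local Notation C := R[i].
Hypothesis hN : (0 < N)%N.
Hypothesis hchi : dirichlet_char N chi.
Hypothesis hpar : chi (-1) = (-1) ^+ k.
Hypothesis hF : siegel_form k N chi F.

Definition F3 (t1 z t2 : C) : C := F (siegel_mx t1 z t2).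

Lemma chi_1mod (x y : int) : x = 1 + N%:Z * y -> chi x = 1.
Proof.
by case: hchi => h1 _ hp _ ->; rewrite -h1; apply: hp; rewrite addrC mulrC modzMDl.
Qed.

Lemma siegel_law (A B D E : 'M[int]_2) (t1 z t2 w1 w w2 : C) :
  siegel_Gamma0 N (block_mx A B D E) -> dom t1 z t2 ->
  \det (map_mx intr D *m siegel_mx t1 z t2 + map_mx intr E) != 0 ->
  siegel_mx w1 w w2 *m (map_mx intr D *m siegel_mx t1 z t2 + map_mx intr E) =
    map_mx intr A *m siegel_mx t1 z t2 + map_mx intr B ->
  (\det (map_mx intr D *m siegel_mx t1 z t2 + map_mx intr E)) ^- k * F3 w1 w w2 =
    chi (\det E) * F3 t1 z t2.
Proof.
move=> hg dm J0 h; rewrite -(slash_block k F J0 h).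
by rewrite hF.2// ?block_mxKdr//; apply/siegel_upperE.
Qed.

Lemma F3_trans (s1 s2 s3 : int) t1 z t2 : dom t1 z t2 ->
  F3 (t1 + s1%:~R) (z + s2%:~R) (t2 + s3%:~R) = F3 t1 z t2.
Proof.
move=> dm; have := @siegel_law 1%:M (mk2 s1 s2 s2 s3) 0 1%:M t1 z t2
  (t1 + s1%:~R) (z + s2%:~R) (t2 + s3%:~R).
rewrite !map_mx1 map_mx0 mul0mx add0r !det1 (_ : chi 1 = 1) ?mul1r ?expr1n ?invr1; last by case: hchi.
rewrite ?mul1r; apply; [|by []|exact: oner_neq0|].
  split; first by apply: Sp2Z_block; rewrite ?trmx1 ?trmx0 ?mul0mx ?mulmx0 ?mul1mx ?mulmx1 ?mk2T ?subr0.
  by move=> i j; rewrite block_mxKdl mxE dvdz0.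
by rewrite mulmx1 mul1mx mk2_map !siegel_mxE mk2D.
Qed.

(** The block-diagonal matrix with A = [p q; r s] has E = d [s -r; -q p], the inverse transpose of
    A, because d^2 = 1. The condition on chi(-1) gives d^(-k) = chi(d), so that both factors cancel
    for d = -1 as well; this is the case behind [F3_swap]. *)
Lemma F3_unimod (p q r s : int) t1 z t2 : p * s - q * r = 1 \/ p * s - q * r = -1 -> dom t1 z t2 ->
  F3 (p%:~R ^+ 2 * t1 + 2 * (p%:~R * q%:~R) * z + q%:~R ^+ 2 * t2)
     (p%:~R * r%:~R * t1 + (p%:~R * s%:~R + q%:~R * r%:~R) * z + q%:~R * s%:~R * t2)
     (r%:~R ^+ 2 * t1 + 2 * (r%:~R * s%:~R) * z + s%:~R ^+ 2 * t2) = F3 t1 z t2.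
Proof.
move=> hd dm; set w1 : C := _ ^+ 2 * t1 + _ + _; set w : C := (X in F3 _ X _); set w2 : C := (X in F3 _ _ X).
pose d := p * s - q * r; have dd : d * d = 1 by rewrite /d; case: hd => ->.
have ddC : d%:~R * d%:~R = 1 :> C by rewrite -intrM dd.
have kk : (d%:~R ^- k : C) = chi d.
  case: hchi => h1 _ _ _; rewrite /d; case: hd => ->; first by rewrite h1 expr1n invr1.
  by rewrite hpar rmorphN1 -exprVn invrN1.
pose E := mk2 (d * s) (- (d * r)) (- (d * q)) (d * p).
have dE : \det E = d by rewrite det_mk2 -[RHS]mul1r -dd /d; ring.
have := @siegel_law (mk2 p q r s) 0 0 E t1 z t2 w1 w w2.
rewrite map_mx0 mul0mx add0r !addr0 det_map_mx dE kk.
have c0 : chi d != 0.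
  case: hchi => _ _ _ ->; rewrite /d; case: hd => ->; rewrite /coprimez ?gcd1z//.
  by rewrite gcdNz gcd1z.
move=> H; apply: (mulfI c0); apply: H => //.
- split; first apply: Sp2Z_block; rewrite ?trmx0 ?mul0mx ?mulmx0 ?subr0//.
    rewrite mk2T mk2M mk2_1; congr mk2; try by ring.
      by rewrite -[RHS]dd /d; ring.
    by rewrite -[RHS]dd /d; ring.
  by move=> i j; rewrite block_mxKdl mxE dvdz0.
- rewrite /= intr_eq0; apply/eqP => d00; by move: dd; rewrite d00 mulr0 => /eqP; rewrite eq_sym oner_eq0.
- rewrite !mk2_map !siegel_mxE !mk2M /w1 /w /w2 !(rmorphM, rmorphN)/=.
  have hp : p%:~R * s%:~R - q%:~R * r%:~R = d%:~R :> C by rewrite /d rmorphB !rmorphM.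
  have e1 (x y : C) : x = d%:~R * d%:~R * y -> x = y by rewrite ddC mul1r.
  by congr mk2; apply: e1; rewrite -hp; ring.
Qed.

Lemma F3_swap t1 z t2 : dom t1 z t2 -> F3 t2 z t1 = F3 t1 z t2.
Proof.
move=> dm; rewrite -(@F3_unimod 0 1 1 0 _ _ _ _ dm); last by right.
by congr F3; rewrite ?(mulr0z, mulr1z); ring.
Qed.

Lemma F3_heis (la : int) t1 z t2 : dom t1 z t2 ->
  F3 t1 (z + la%:~R * t1) (t2 + 2 * la%:~R * z + la%:~R ^+ 2 * t1) = F3 t1 z t2.
Proof.
move=> dm; rewrite -(@F3_unimod 1 0 la 1 _ _ _ _ dm); last by left; ring.
by congr F3; rewrite ?(mulr0z, mulr1z); ring.
Qed.

(* F slashed with the upward embedding of M, in coordinates. *)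
Definition GM (M : 'M[int]_2) (t1 z t2 : C) : C :=
  let j := (M 1 0)%:~R * t1 + (M 1 1)%:~R in
  j ^- k * F3 (((M 0 0)%:~R * t1 + (M 0 1)%:~R) / j) (z / j) (t2 - (M 1 0)%:~R * z ^+ 2 / j).

Section AtCusp.
Variable M : 'M[int]_2.
Hypothesis hM : \det M = 1.
Local Notation a := (M 0 0). Local Notation b := (M 0 1).
Local Notation c := (M 1 0). Local Notation d := (M 1 1).

Lemma M_det : a * d = 1 + b * c.
Proof. by move: hM; rewrite det2 => h; rewrite -[X in X + _]h; ring. Qed.

Lemma intr_real (x : int) : x%:~R = (x%:~R : R)%:C.
Proof. by rewrite rmorph_int. Qed.

Lemma M_detR : a%:~R * d%:~R - b%:~R * c%:~R = 1 :> R.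
Proof. by rewrite -!intrM -intrB M_det addrK. Qed.

Lemma M_j0 (t : C) : 0 < complex.Im t -> c%:~R * t + d%:~R != 0.
Proof.
move=> y0; rewrite !intr_real; apply: j_neq0 => //.
apply: contraPT M_detR; rewrite negb_or !negbK => /andP[/eqP -> /eqP ->].
by rewrite !mulr0 subr0 => /esym/eqP; rewrite oner_eq0.
Qed.

Lemma M_dom (t1 z t2 : C) : dom t1 z t2 -> let j := c%:~R * t1 + d%:~R in
  dom ((a%:~R * t1 + b%:~R) / j) (z / j) (t2 - c%:~R * z ^+ 2 / j).
Proof. by move=> dm; rewrite /= !intr_real; apply: dom_up => //; exact: M_detR. Qed.

Lemma sj_up (t1 z t2 : C) : sj (map_mx intr (upZ M)) (siegel_mx t1 z t2) =
  mk2 (c%:~R * t1 + d%:~R) (c%:~R * z) 0 1.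
Proof.
rewrite sj_block !mk2_map siegel_mxE mk2M mk2D; congr mk2; rewrite ?(mulr0z, mulr1z); ring.
Qed.

Lemma det_sj_up (t1 z t2 : C) :
  \det (sj (map_mx intr (upZ M)) (siegel_mx t1 z t2)) = c%:~R * t1 + d%:~R.
Proof. by rewrite sj_up det_mk2 mulr1 mulr0 subr0. Qed.

Lemma sact_up (t1 z t2 : C) : 0 < complex.Im t1 -> let j := c%:~R * t1 + d%:~R in
  sact (map_mx intr (upZ M)) (siegel_mx t1 z t2) =
  siegel_mx ((a%:~R * t1 + b%:~R) / j) (z / j) (t2 - c%:~R * z ^+ 2 / j).
Proof.
move=> y0; have j0 := M_j0 y0; cbv zeta; set j : C := c%:~R * t1 + d%:~R in j0 *.
have ad1 : a%:~R * d%:~R - b%:~R * c%:~R = 1 :> C by rewrite -!intrM -intrB M_det addrK.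
have hJ := sj_up t1 z t2; rewrite sj_block in hJ.
apply: sact_block; rewrite hJ; first by rewrite det_mk2 mulr1 mulr0 subr0.
rewrite !mk2_map !siegel_mxE !mk2M mk2D -/j.
congr mk2; rewrite ?(mulr0z, mulr1z).
- by rewrite mulr0 mul0r !addr0 divfK.
- rewrite (_ : _ + z / j * 1 = z * (c%:~R * (a%:~R * t1 + b%:~R) + 1) / j); last by ring.
  rewrite (_ : c%:~R * (a%:~R * t1 + b%:~R) + 1 = a%:~R * j); first by field.
  transitivity (c%:~R * (a%:~R * t1 + b%:~R) + (a%:~R * d%:~R - b%:~R * c%:~R)); first by rewrite ad1.
  by rewrite /j; ring.
- by rewrite mulr0 addr0 divfK// mul0r mul1r add0r addr0.
- by field.
Qed.

Lemma GM_slash t1 z t2 : 0 < complex.Im t1 ->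
  siegel_slash k F (map_mx intr (upZ M)) (siegel_mx t1 z t2) = GM M t1 z t2.
Proof.
move=> y0; rewrite -embed_up_int.
have := @up_eval R k F (map_mx intr M) t1 z t2.
rewrite !mxE -!intr_real/= => ->//; last exact: M_j0.
by rewrite det_map_mx hM.
Qed.

Definition conjM (de : 'M[int]_(2 + 2)) : 'M[int]_(2 + 2) :=
  upZ M *m de *m upZ (mk2 d (- b) (- c) a).

Lemma Sp2Z_up (g : 'M[int]_2) : \det g = 1 -> Sp2Z (upZ g).
Proof.
rewrite det2 => hg; apply: Sp2Z_block; rewrite !mk2T !mk2M; first by congr mk2; ring.
  by congr mk2; ring.
rewrite mk2B mk2_1; congr mk2; try by ring.
by rewrite -[RHS]hg; ring.
Qed.

Lemma up_inv : upZ (mk2 d (- b) (- c) a) *m upZ M = 1%:M.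
Proof.
have h0 : d * a - b * c = 1 by rewrite mulrC M_det addrK.
rewrite /upZ !mk2E mulmx_block !mk2M !mk2D.
have -> : 1%:M = block_mx (mk2 1 0 0 1) (mk2 0 0 0 0) (mk2 0 0 0 0) (mk2 1 0 0 1) :> 'M[int]_(2 + 2).
  rewrite -mk2_1 -[LHS]submxK; congr block_mx; apply: mx2P; rewrite ?mk2E !mxE//=.
by congr block_mx; congr mk2; try ring; rewrite -[RHS]h0; ring.
Qed.

(** Since ga M = M de for the conjugate ga = M de M^(-1), slashing F | M with de is the same as
    slashing F | ga with M, and the law of F applies to ga. *)
Lemma GM_inv (A' B' D' E' : 'M[int]_2) t1 z t2 w1 w w2 :
  let ga := conjM (block_mx A' B' D' E') in
  Sp2Z (block_mx A' B' D' E') ->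
  (forall i j, (N %| dlsubmx ga i j)%Z) -> chi (\det (drsubmx ga)) = 1 ->
  dom t1 z t2 -> dom w1 w w2 ->
  let J := map_mx intr D' *m siegel_mx t1 z t2 + map_mx intr E' in \det J = 1 ->
  siegel_mx w1 w w2 *m J = map_mx intr A' *m siegel_mx t1 z t2 + map_mx intr B' ->
  GM M w1 w w2 = GM M t1 z t2.
Proof.
move=> ga0 spd hdl hE dm dw J hJ hW.
have [y0 _] := dm; have [v0 _] := dw.
have hg : siegel_Gamma0 N ga0.
  split=> //; apply: Sp2ZM; last first.
    by apply: Sp2Z_up; rewrite det_mk2 mulrNN mulrC M_det addrK.
  by apply: Sp2ZM => //; exact: Sp2Z_up.
have comm : ga0 *m upZ M = upZ M *m block_mx A' B' D' E'.
  by rewrite /ga0 /conjM -mulmxA up_inv mulmx1.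
set Z := siegel_mx t1 z t2.
pose ga : 'M[R]_(2 + 2) := map_mx intr ga0.
pose de : 'M[R]_(2 + 2) := map_mx intr (block_mx A' B' D' E').
pose up : 'M[R]_(2 + 2) := map_mx intr (upZ M).
have cm : ga *m up = up *m de by rewrite -!map_mxM comm.
have sd : sj de Z = J by rewrite /de sj_block.
have sde : \det (sj de Z) != 0 by rewrite sd hJ oner_neq0.
have ad : sact de Z = siegel_mx w1 w w2 by apply: sact_block; rewrite ?hJ ?oner_neq0.
have n1 : \det (sj (up *m de) Z) != 0.
  by rewrite sjM// det_mulmx sd hJ mulr1 ad det_sj_up M_j0.
have n2 : \det (sj up Z) != 0 by rewrite det_sj_up M_j0.
have L : siegel_slash k (siegel_slash k F up) de Z = GM M w1 w w2.
  by rewrite slashE sd hJ expr1n invr1 mul1r ad GM_slash.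
have n3 : \det (sj (ga *m up) Z) != 0 by rewrite cm.
rewrite -L (slash_slash k F sde n1) -cm -(slash_slash k F n2 n3) slashE (sact_up _ _ y0).
rewrite /= hF.2//; last by apply/siegel_upperE; exact: M_dom.
by rewrite det_sj_up hE mul1r.
Qed.

(** After conjugation by M the lower left block has the single possibly nonzero entry -c^2 s, for a
    translation of t1 by s. Hence the period N in t1, while z and t2 keep the period 1. *)
Lemma GM_trans (s1 s2 s3 : int) t1 z t2 : dom t1 z t2 ->
  GM M (t1 + (N%:Z * s1)%:~R) (z + s2%:~R) (t2 + s3%:~R) = GM M t1 z t2.
Proof.
move=> dm; set S1 : int := N%:Z * s1.
apply: (@GM_inv 1%:M (mk2 S1 s2 s2 s3) 0 1%:M) => //.
- by apply: Sp2Z_block; rewrite ?trmx1 ?trmx0 ?mul0mx ?mulmx0 ?mul1mx ?mulmx1 ?mk2T ?subr0.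
- move=> i j; rewrite /conjM !mulmx_sub !block_mxKdl !block_mxKdr !block_mxKul !block_mxKur.
  rewrite !(mulmx1, mulmx0, mul0mx, mul1mx, addr0, add0r) !mk2M !mk2D !mk2M !mk2D !mk2E.
  case: (ord2 i) => ->; case: (ord2 j) => ->; rewrite mk2E.
  + by rewrite (_ : _ + _ = N%:Z * (- c * c * s1)) ?dvdz_mulr// /S1; ring.
  + by rewrite (_ : _ + _ = 0) ?dvdz0//; ring.
  + by rewrite (_ : _ + _ = 0) ?dvdz0//; ring.
  + by rewrite (_ : _ + _ = 0) ?dvdz0//; ring.
- apply: (@chi_1mod _ (c * s1 * a)).
  rewrite /conjM !mulmx_sub !block_mxKdl !block_mxKdr !block_mxKul !block_mxKur.
  rewrite !(mulmx1, mulmx0, mul0mx, mul1mx, addr0, add0r) !mk2M !mk2D !mk2M !mk2D det_mk2 !mk2E.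
  have h0 : a * d - b * c = 1 by rewrite M_det addrK.
  by transitivity (a * d - b * c + N%:Z * (c * s1 * a)); [rewrite /S1; ring|rewrite h0].
- by case: dm => y0 hv; rewrite /dom !ImD !(intr_real) /= !addr0.
- by rewrite map_mx0 mul0mx add0r map_mx1 det1.
- by rewrite map_mx0 mul0mx add0r map_mx1 mulmx1 mul1mx mk2_map !siegel_mxE mk2D.
Qed.

End AtCusp.
End FormLaws.

(** * Expansions at the cusps and the Koecher principle *)

Section CuspExpansion.
Variables (R : realType) (k N : nat) (chi : int -> R[i]) (F : 'M[R[i]]_2 -> R[i]).
Local Notation C := R[i].
Hypothesis hN : (0 < N)%N.
Hypothesis hchi : dirichlet_char N chi.
Hypothesis hpar : chi (-1) = (-1) ^+ k.
Hypothesis hF : siegel_form k N chi F.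
Lemma GM1 t1 z t2 : GM k F 1%:M t1 z t2 = F3 F t1 z t2.
Proof.
by rewrite /GM !mxE/= !(mulr0z, mulr1z, mul0r, add0r, expr1n, invr1, mul1r, subr0, addr0, mulr1).
Qed.

Lemma GM_Gamma0 (g : 'M[int]_2) t1 z t2 : Gamma0 N g -> dom t1 z t2 ->
  GM k F g t1 z t2 = chi (g 1 1) * F3 F t1 z t2.
Proof.
move=> [hg hc _] dm; have [y0 _] := dm; rewrite -(GM_slash k F hg)//.
have hd := M_det hg.
rewrite hF.2//; last by apply/siegel_upperE.
  by rewrite block_mxKdr det_mk2 mulr1 mulr0 subr0.
split; first (apply: Sp2Z_block; rewrite !mk2T !mk2M).
- by congr mk2; ring.
- by congr mk2; ring.
- rewrite mk2B mk2_1; congr mk2; try by ring.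
  by rewrite hd; ring.
move=> i j; rewrite block_mxKdl; case: (ord2 i) => ->; case: (ord2 j) => ->; rewrite mk2E ?dvdz0//.
Qed.

Section Cusp.
Variable M : 'M[int]_2.
Hypothesis hM : \det M = 1.
Local Notation a := (M 0 0). Local Notation b := (M 0 1).
Local Notation c := (M 1 0). Local Notation d := (M 1 1).

Lemma dom_unimod (p q r s : int) (t1 z t2 : C) : p * s - q * r = 1 -> dom t1 z t2 ->
  dom (p%:~R ^+ 2 * t1 + 2 * (p%:~R * q%:~R) * z + q%:~R ^+ 2 * t2)
     (p%:~R * r%:~R * t1 + (p%:~R * s%:~R + q%:~R * r%:~R) * z + q%:~R * s%:~R * t2)
     (r%:~R ^+ 2 * t1 + 2 * (r%:~R * s%:~R) * z + s%:~R ^+ 2 * t2).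
Proof.
move=> hd [y0 hv].
have hdR : p%:~R * s%:~R - q%:~R * r%:~R = 1 :> R by rewrite -!intrM -intrB hd.
have cM (x : R) (w : C) : complex.Im (x%:C * w) = x * complex.Im w by rewrite ImM/= mul0r addr0.
rewrite /dom !(intr_real) -!(rmorphXn (real_complex R)) -!(rmorphM (real_complex R)).
rewrite -!(rmorphD (real_complex R)) -(rmorph_nat (real_complex R)) -!(rmorphM (real_complex R)).
rewrite !ImD !cM; set P : R := p%:~R in hdR *; set Q : R := q%:~R in hdR *; set U : R := r%:~R in hdR *.
set S : R := s%:~R in hdR *.
set y1 := complex.Im t1 in y0 hv *; set v := complex.Im z in hv *; set y2 := complex.Im t2 in hv *.
split.
  have : 0 < y1 * (P ^+ 2 * y1 + 2 * (P * Q) * v + Q ^+ 2 * y2); last by rewrite pmulr_rgt0.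
  have -> : y1 * (P ^+ 2 * y1 + 2 * (P * Q) * v + Q ^+ 2 * y2) =
     (P * y1 + Q * v) ^+ 2 + Q ^+ 2 * (y1 * y2 - v ^+ 2) by ring.
  have w0 : 0 < y1 * y2 - v ^+ 2 by rewrite subr_gt0.
  have [Q0|Q0] := eqVneq Q 0.
    rewrite Q0 mul0r expr0n mul0r !addr0 lt_neqAle sqr_ge0 andbT eq_sym sqrf_eq0.
    apply: mulf_neq0; last by rewrite gt_eqF.
    by apply/eqP => P0; move: hdR; rewrite Q0 P0 !mul0r subr0 => /esym/eqP; rewrite oner_eq0.
  by rewrite ltr_wpDl ?sqr_ge0// mulr_gt0// lt_neqAle sqr_ge0 eq_sym sqrf_eq0 Q0.
rewrite -subr_gt0 (_ : _ - _ = (P * S - Q * U) ^+ 2 * (y1 * y2 - v ^+ 2)); last by ring.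
by rewrite hdR expr1n mul1r subr_gt0.
Qed.

(** Congruence to 1 modulo N survives conjugation by an arbitrary M: the lower left block of the
    conjugate is 0 and the determinant of its last block is 1, both modulo N. *)
Lemma GM_unip (x1 x2 x3 x4 u1 u2 u3 u4 : int) t1 z t2 :
  u1 = 1 + N%:Z * x1 -> u2 = N%:Z * x2 -> u3 = N%:Z * x3 -> u4 = 1 + N%:Z * x4 ->
  u1 * u4 - u2 * u3 = 1 -> dom t1 z t2 ->
  GM k F M (u1%:~R ^+ 2 * t1 + 2 * (u1%:~R * u2%:~R) * z + u2%:~R ^+ 2 * t2)
     (u1%:~R * u3%:~R * t1 + (u1%:~R * u4%:~R + u2%:~R * u3%:~R) * z + u2%:~R * u4%:~R * t2)
     (u3%:~R ^+ 2 * t1 + 2 * (u3%:~R * u4%:~R) * z + u4%:~R ^+ 2 * t2) = GM k F M t1 z t2.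
Proof.
move=> e1 e2 e3 e4 hd dm.
have huC : u1%:~R * u4%:~R - u2%:~R * u3%:~R = 1 :> C by rewrite -!intrM -intrB hd.
apply: (@GM_inv _ k N chi F hF M hM (mk2 u1 u2 u3 u4) 0 0 (mk2 u4 (- u3) (- u2) u1)).
- apply: Sp2Z_block; rewrite ?trmx0 ?mul0mx ?mulmx0 ?subr0//.
  rewrite mk2T mk2M mk2_1; congr mk2; try by ring.
    by rewrite -[RHS]hd; ring.
  by rewrite -[RHS]hd; ring.
- move=> i j; rewrite /conjM !mulmx_sub !block_mxKdl !block_mxKdr !block_mxKul !block_mxKur.
  rewrite !(mulmx1, mulmx0, mul0mx, mul1mx, addr0, add0r) !mk2M !mk2D !mk2E.
  case: (ord2 i) => ->; case: (ord2 j) => ->; rewrite mk2E.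
  + by rewrite (_ : _ + _ = N%:Z * (c * d * (x1 - x4))) ?dvdz_mulr// e1 e4; ring.
  + by rewrite (_ : _ + _ = N%:Z * (c * x2)) ?dvdz_mulr// e2; ring.
  + by rewrite (_ : _ + _ = N%:Z * (c * x2)) ?dvdz_mulr// e2; ring.
  + by rewrite (_ : _ + _ = 0) ?dvdz0//; ring.
- apply: (@chi_1mod _ _ _ hchi _ (- (b * c * (x1 * (2 + N%:Z * x1))))).
  rewrite /conjM !mulmx_sub !block_mxKdl !block_mxKdr !block_mxKul !block_mxKur.
  rewrite !(mulmx1, mulmx0, mul0mx, mul1mx, addr0, add0r) !mk2M !mk2D det_mk2 !mk2E.
  transitivity (a * d * (u1 * u4 - u2 * u3) - b * c * u1 * u1); first by ring.
  by rewrite hd M_det// e1; ring.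
- by [].
- by apply: dom_unimod.
- by rewrite map_mx0 mul0mx add0r mk2_map det_mk2 !mulrNz -[RHS]huC; ring.
- rewrite !map_mx0 mul0mx add0r addr0 !mk2_map !siegel_mxE !mk2M !mulrNz.
  have h1 (x y : C) : x = (u1%:~R * u4%:~R - u2%:~R * u3%:~R) * y -> x = y by rewrite huC mul1r.
  by congr mk2; apply: h1; ring.
Qed.

Section Differentiable.
Variable W : normedModType C.
Implicit Types f g : W -> C.

Lemma dfD f g (w : W) : differentiable f w -> differentiable g w -> differentiable (fun x => f x + g x) w.
Proof. exact: (@differentiableD C W C f g w). Qed.

Lemma dfN f (w : W) : differentiable f w -> differentiable (fun x => - f x) w.
Proof. exact: (@differentiableN C W C f w). Qed.

Lemma dfM f g (w : W) : differentiable f w -> differentiable g w -> differentiable (fun x => f x * g x) w.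
Proof. exact: (@differentiableM C W f g w). Qed.

Lemma dfV f (w : W) : differentiable f w -> f w != 0 -> differentiable (fun x => (f x)^-1) w.
Proof. exact: (@differentiableV C W f w). Qed.

Lemma dfC (x0 : C) (w : W) : differentiable (fun _ : W => x0) w.
Proof. exact: (@differentiable_cst C W C x0 w). Qed.

Lemma dfX n f (w : W) : differentiable f w -> differentiable (fun x => f x ^+ n) w.
Proof.
move=> df; elim: n => [|n IH]; first exact: dfC.
have -> : (fun x => f x ^+ n.+1) = (fun x => f x * f x ^+ n) by apply: funext => x; rewrite exprS.
exact: dfM.
Qed.

End Differentiable.

Lemma df1 (p : C * C * C) : differentiable (fun q : C * C * C => q.1.1) p.
Proof.
apply: (@differentiable_comp C (C * C * C)%type (C * C)%type C fst fst).
  by apply: linear_differentiable => x; exact: cvg_fst.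
by apply: linear_differentiable => x; exact: cvg_fst.
Qed.

Lemma df2 (p : C * C * C) : differentiable (fun q : C * C * C => q.1.2) p.
Proof.
apply: (@differentiable_comp C (C * C * C)%type (C * C)%type C fst snd).
  by apply: linear_differentiable => x; exact: cvg_fst.
by apply: linear_differentiable => x; exact: cvg_snd.
Qed.

Lemma df3 (p : C * C * C) : differentiable (fun q : C * C * C => q.2) p.
Proof. by apply: linear_differentiable => x; exact: cvg_snd. Qed.

Lemma GM_diff t1 z t2 : dom t1 z t2 ->
  differentiable (fun p : C * C * C => GM k F M p.1.1 p.1.2 p.2) (t1, z, t2).
Proof.
move=> dm; have [y0 _] := dm; set p0 := (t1, z, t2).
have dj : differentiable (fun p : C * C * C => c%:~R * p.1.1 + d%:~R) p0.
  by apply: dfD; [apply: dfM; [exact: dfC|exact: df1]|exact: dfC].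
have j0 : c%:~R * p0.1.1 + d%:~R != 0 := M_j0 hM y0.
have dv : differentiable (fun p : C * C * C => (c%:~R * p.1.1 + d%:~R)^-1) p0 := dfV dj j0.
apply: dfM.
  apply: dfV; first exact: dfX.
  by rewrite expf_neq0.
have d1 : differentiable (fun p : C * C * C => (a%:~R * p.1.1 + b%:~R) / (c%:~R * p.1.1 + d%:~R)) p0.
  by apply: dfM dv; apply: dfD; [apply: dfM; [exact: dfC|exact: df1]|exact: dfC].
have d2 : differentiable (fun p : C * C * C => p.1.2 / (c%:~R * p.1.1 + d%:~R)) p0.
  by apply: dfM dv; exact: df2.
have d3 : differentiable (fun p : C * C * C => p.2 - c%:~R * p.1.2 ^+ 2 / (c%:~R * p.1.1 + d%:~R)) p0.
  apply: dfD; first exact: df3.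
  apply: dfN; apply: dfM dv; apply: dfM; first exact: dfC.
  apply: dfX; exact: df2.
have dp := differentiable_pair (differentiable_pair d1 d2) d3.
have dF := hF.1 _ _ _ (iffRL (siegel_upperE _ _ _) (M_dom hM dm)).
exact: (differentiable_comp dp dF).
Qed.

Lemma GM_diff1 t1 z t2 : dom t1 z t2 -> differentiable (fun t : C => GM k F M t z t2) t1.
Proof.
move=> dm; have h : differentiable (fun t : C => (t, z, t2)) t1.
  by apply: differentiable_pair; [apply: differentiable_pair; [exact: diffC_id|exact: diffC_cst]|exact: diffC_cst].
exact: (differentiable_comp h (GM_diff dm)).
Qed.

Lemma GM_diff2 t1 z t2 : dom t1 z t2 -> differentiable (fun t : C => GM k F M t1 t t2) z.
Proof.
move=> dm; have h : differentiable (fun t : C => (t1, t, t2)) z.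
  by apply: differentiable_pair; [apply: differentiable_pair; [exact: diffC_cst|exact: diffC_id]|exact: diffC_cst].
exact: (differentiable_comp h (GM_diff dm)).
Qed.

Lemma GM_diff3 t1 z t2 : dom t1 z t2 -> differentiable (fun t : C => GM k F M t1 z t) t2.
Proof.
move=> dm; have h : differentiable (fun t : C => (t1, z, t)) t2.
  by apply: differentiable_pair; [apply: differentiable_pair; [exact: diffC_cst|exact: diffC_cst]|exact: diffC_id].
exact: (differentiable_comp h (GM_diff dm)).
Qed.

End Cusp.
End CuspExpansion.

(** * Uniqueness of coefficients on the Siegel half space *)

Section TubeCoefficients.
Variable R : realType.
Local Notation C := R[i].
Local Notation e := (@cexp2pi R).

Definition fj3 h (T : int * (int * int)) (t1 z t2 : C) : C := fj h T.2.1 T.2.2 t1 z * e (T.1%:~R * t2).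

Lemma fj3_shift h T t1 z t2 (x1 x2 x3 : R) : (0 < h)%N ->
  fj3 h T (t1 + h%:R * x1%:C) (z + x2%:C) (t2 + x3%:C) =
  fj3 h T t1 z t2 * (ek T.2.1 x1 * ek T.2.2 x2 * ek T.1 x3).
Proof.
move=> h0; rewrite /fj3 fj_shift2; have [->|hh] := fj_shift h T.2.1 T.2.2 t1 z x1; last by rewrite hh in h0.
by rewrite mulrDr eD -[e (T.1%:~R * x3%:C)]/(ek T.1 x3); ring.
Qed.

Lemma fj3_neq0 h T t1 z t2 : fj3 h T t1 z t2 != 0.
Proof. by rewrite /fj3 mulf_neq0 ?e_neq0. Qed.

Lemma dom_shift (t1 z t2 : C) (x1 x2 x3 : R) (h : nat) : dom t1 z t2 ->
  dom (t1 + h%:R * x1%:C) (z + x2%:C) (t2 + x3%:C).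
Proof. by rewrite /dom !ImD Im_natM /= mulr0 !addr0. Qed.

Lemma dom_inhab : exists t1 z t2 : C, dom t1 z t2.
Proof. by exists (0 +i* 1), 0, (0 +i* 1); rewrite /dom/= expr0n mulr1. Qed.

Lemma mul_subl (x y f w : C) : x * (f * w) - y * (f * w) = (x - y) * f * w.
Proof. by ring. Qed.

Lemma coef_uniq3 h (G : C -> C -> C -> C) (a b : int * (int * int) -> C) : (0 < h)%N ->
  (forall t1 z t2, dom t1 z t2 -> hsum (fun T => a T * fj3 h T t1 z t2) (G t1 z t2)) ->
  (forall t1 z t2, dom t1 z t2 -> hsum (fun T => b T * fj3 h T t1 z t2) (G t1 z t2)) ->
  forall T, a T = b T.
Proof.
have [t1 [z [t2 dm0]]] := dom_inhab; move=> h0 ha hb T; apply/eqP; rewrite -subr_eq0.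
suff : (a T - b T) * fj3 h T t1 z t2 = 0.
  by move/eqP; rewrite mulf_eq0 (negbTE (fj3_neq0 _ _ _ _ _)) orbF.
apply: (@hsum_uniq3 R (fun T => (a T - b T) * fj3 h T t1 z t2)) => x1 x2 x3.
have dm := dom_shift x1 x2 x3 h dm0.
have := hsumB (ha _ _ _ dm) (hb _ _ _ dm); rewrite subrr.
by apply: hsum_ext => T'; rewrite (fj3_shift _ _ _ _ _ _ _ h0); exact: mul_subl.
Qed.

Lemma expansion_fj3 h G a c t1 z t2 : tube_expansion h G a c -> dom t1 z t2 ->
  hsum (fun T : int * (int * int) => a T.2.1 T.2.2 T.1 * fj3 h T t1 z t2) (G t1 z t2).
Proof. by move=> te dm; apply: hsum_ext (expansion_total te dm) => T; rewrite /fj3 mulrA. Qed.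

Lemma exp_decay_eq0 (x : C) (B d : R) : 0 < d ->
  (forall i : nat, nm x <= B * expR (- (d * i%:R))) -> x = 0.
Proof.
move=> d0 hx; apply/eqP; rewrite -nm_eq0; apply/eqP/le_anti; rewrite nm_ge0 andbT.
have B0 : 0 <= B by have := hx 0%N; rewrite mulr0 oppr0 expR0 mulr1; exact: le_trans (nm_ge0 _).
rewrite leNgt; apply/negP => x0.
have [i hi] : exists i : nat, B / (nm x * d) < i%:R.
  by exists (Num.truncn (B / (nm x * d))).+1; exact: truncnS_gt.
have := hx i; rewrite expRN -ler_pdivrMr ?invr_gt0 ?expR_gt0// invrK => h.
have h1 : 1 + d * i%:R <= expR (d * i%:R) by exact: expR_ge1Dx.
have h2 : nm x * (1 + d * i%:R) <= B by apply: le_trans h; rewrite ler_wpM2l// ltW.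
move: hi; rewrite ltr_pdivrMr ?mulr_gt0// => hi; rewrite mulrDr mulr1 in h2.
have e1 : i%:R * (nm x * d) = nm x * (d * i%:R) :> R by ring.
by rewrite e1 in hi; lra.
Qed.

End TubeCoefficients.

(** * Boundedness, expansion and the Koecher principle at a cusp *)

Section CuspCoefficients.
Variables (R : realType) (k N : nat) (chi : int -> R[i]) (F : 'M[R[i]]_2 -> R[i]).
Local Notation C := R[i].
Local Notation e := (@cexp2pi R).
Hypothesis hN : (0 < N)%N.
Hypothesis hchi : dirichlet_char N chi.
Hypothesis hF : siegel_form k N chi F.
Variable M : 'M[int]_2.
Hypothesis hM : \det M = 1.

Definition cx (p : R * R) : C := p.1 +i* p.2.

Lemma cx_near (p q : R * R) (d : R) : `|p.1 - q.1| < d / 2 -> `|p.2 - q.2| < d / 2 ->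
  nm (cx p - cx q) < d.
Proof.
move=> h1 h2; apply: (le_lt_trans (nm_le_ReIm _)); rewrite ReD ImD ReN ImN /cx/=; lra.
Qed.

Lemma GM_bounded (a1 b1 v w a3 b3 : R) : 0 < a1 ->
  (forall y, v <= y <= w -> y ^+ 2 < a1 * a3) -> exists B, forall t1 z t2,
  a1 <= complex.Im t1 <= b1 -> v <= complex.Im z <= w -> a3 <= complex.Im t2 <= b3 ->
  nm (GM k F M t1 z t2) <= B.
Proof.
move=> a10 hbox.
have dbox (t1 z t2 : C) : a1 <= complex.Im t1 -> v <= complex.Im z <= w -> a3 <= complex.Im t2 -> dom t1 z t2.
  move=> h1 h2 h3; have h4 := hbox _ h2.
  have a30 : 0 < a3 by rewrite -(pmulr_rgt0 _ a10) (le_lt_trans _ h4)// sqr_ge0.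
  split; first exact: lt_le_trans h1.
  by apply: (lt_le_trans h4); apply: ler_pM => //; exact: ltW.
pose K : set ((R * R) * (R * R) * (R * R)) :=
  ((`[0, N%:R] `*` `[a1, b1]) `*` (`[0, 1] `*` `[v, w])) `*` (`[0, 1] `*` `[a3, b3]).
have cK : compact K.
  by do ! apply: compact_setX; exact: segment_compact.
pose f (q : (R * R) * (R * R) * (R * R)) : C := GM k F M (cx q.1.1) (cx q.1.2) (cx q.2).
have fc q : K q -> \forall q' \near q, nm (f q' - f q) < 1.
  case: q => [[[x1 y1] [x2 y2]] [x3 y3]] [[[_ /= h1] [_ /= h2]] [_ /= h3]].
  rewrite !in_itv/= in h1 h2 h3; case/andP: h1 => h1 _; case/andP: h3 => h3 _.
  have dm : dom (cx (x1, y1)) (cx (x2, y2)) (cx (x3, y3)) by exact: dbox.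
  have cG := differentiable_continuous (GM_diff hF hM dm).
  have : nbhs (f ((x1, y1), (x2, y2), (x3, y3))) [set u | nm (u - f ((x1, y1), (x2, y2), (x3, y3))) < 1].
    by apply/nbhs_nm; exists 1.
  move=> /cG /nbhs_ballP[eps0 /= /posC[-> e0]] hS.
  set eps := complex.Re eps0 in e0 hS.
  apply/nbhs_ballP; exists (eps / 2) => /=; first by rewrite divr_gt0.
  move=> [[[x1' y1'] [x2' y2']] [x3' y3']] [[[/= b1' c1] [/= b2 c2]] [/= b3' c3]].
  rewrite /ball/= in b1' c1 b2 c2 b3' c3.
  apply: (hS (cx (x1', y1'), cx (x2', y2'), cx (x3', y3'))).
  split; first split; rewrite /ball/= nmE ltcR; apply: cx_near => //=.
have [B0 [_ hB0]] : \forall B \near +oo, K `<=` (fun q => nm (f q) <= B).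
  apply: (iffLR (compact_near_coveringP K) cK R (nbhs +oo) (fun B q => nm (f q) <= B)) => q Kq.
  have hn := fc q Kq; exists ([set q' | nm (f q' - f q) < 1], [set B | nm (f q) + 1 < B]).
    by split=> //=; apply: nbhs_pinfty_gt; rewrite num_real.
  move=> [q' B] /= [h1 h2].
  by apply: (le_trans (nm_leB _ (f q))); lra.
exists (B0 + 1) => t1 z t2 h1 h2 h3.
have dm : dom t1 z t2 by apply: dbox => //; [case/andP: h1|case/andP: h3].
have N0 : 0 < N%:R :> R by rewrite ltr0n.
have fl (x : R) : 0 <= x - (Num.floor x)%:~R <= 1.
  by rewrite subr_ge0 Num.Theory.floor_le/= lerBlDr addrC ltW// -intrD1 Num.Theory.floorD1_gt.
pose s1 := Num.floor (complex.Re t1 / N%:R); pose s2 := Num.floor (complex.Re z).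
pose s3 := Num.floor (complex.Re t2).
rewrite -(GM_trans hchi hF hM (- s1) (- s2) (- s3) dm).
have -> : t1 + (N%:Z * - s1)%:~R = cx (complex.Re t1 - N%:R * s1%:~R, complex.Im t1).
  apply: complexP; rewrite ?ReD ?ImD (intr_real R (N%:Z * - s1)) /=; last by rewrite addr0.
  by rewrite mulrN mulrNz intrM -pmulrn.
have -> : z + (- s2)%:~R = cx (complex.Re z - s2%:~R, complex.Im z).
  apply: complexP; rewrite ?ReD ?ImD (intr_real R (- s2)) /=; last by rewrite addr0.
  by rewrite mulrNz.
have -> : t2 + (- s3)%:~R = cx (complex.Re t2 - s3%:~R, complex.Im t2).
  apply: complexP; rewrite ?ReD ?ImD (intr_real R (- s3)) /=; last by rewrite addr0.
  by rewrite mulrNz.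
apply: (hB0 (B0 + 1) _ ((complex.Re t1 - N%:R * s1%:~R, complex.Im t1),
  (complex.Re z - s2%:~R, complex.Im z), (complex.Re t2 - s3%:~R, complex.Im t2))); first by rewrite ltrDl.
have e1 : complex.Re t1 - N%:R * s1%:~R = N%:R * (complex.Re t1 / N%:R - s1%:~R).
  by field; exact: lt0r_neq0.
have /andP[f1 f2] := fl (complex.Re t1 / N%:R).
split; first split; split => /=; rewrite ?in_itv//=; try exact: fl.
rewrite e1 -[X in _ && (_ <= X)]mulr1 ler_pM2l// f2 andbT.
by rewrite mulr_ge0// ltW.
Qed.

Lemma GM_expansion : exists a c, tube_expansion N (GM k F M) a c.
Proof.
apply: tube_expansionP; first exact: hN.
- move=> t1 z t2 dm; have := GM_trans hchi hF hM 1 0 0 dm.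
  by rewrite mulr1 !mulr0z !addr0.
- move=> t1 z t2 dm; have := GM_trans hchi hF hM 0 1 0 dm.
  by rewrite mulr0 !mulr0z !addr0.
- move=> t1 z t2 dm; have := GM_trans hchi hF hM 0 0 1 dm.
  by rewrite mulr0 !mulr0z !addr0.
- by move=> t1 z t2 dm; exact: (GM_diff1 hF hM dm).
- by move=> t1 z t2 dm; exact: (GM_diff2 hF hM dm).
- by move=> t1 z t2 dm; exact: (GM_diff3 hF hM dm).
- exact: GM_bounded.
Qed.

Variables (a : int -> int -> int -> C) (c : int -> C -> C -> C).
Hypothesis te : tube_expansion N (GM k F M) a c.

(* The action of the matrices [u1 u2; u3 u4] congruent to 1 modulo N on the
   quadratic forms indexing the coefficients at the cusp of M; exponents are
   triples (m, (n, r)), with n counted in multiples of 1/N. *)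
Definition psi (u1 u2 u3 u4 x2 : int) (T : int * (int * int)) : int * (int * int) :=
  let: (m, (n, r)) := T in
  (N%:Z * x2 ^+ 2 * n + u2 * u4 * r + u4 ^+ 2 * m,
   (u1 ^+ 2 * n + N%:Z * u1 * u3 * r + N%:Z * u3 ^+ 2 * m,
    2 * u1 * x2 * n + (u1 * u4 + u2 * u3) * r + 2 * u3 * u4 * m)).

Lemma psiK u1 u2 u3 u4 x2 x3 : u2 = N%:Z * x2 -> u3 = N%:Z * x3 -> u1 * u4 - u2 * u3 = 1 ->
  cancel (psi u1 u2 u3 u4 x2) (psi u4 (- u2) (- u3) u1 (- x2)).
Proof.
move=> e2 e3 hd [m [n r]]; rewrite /psi; congr (_, (_, _)).
- transitivity ((u1 * u4 - u2 * u3) ^+ 2 * m); last by rewrite hd; ring.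
  by rewrite e2 e3; ring.
- transitivity ((u1 * u4 - u2 * u3) ^+ 2 * n); last by rewrite hd; ring.
  by rewrite e2 e3; ring.
- transitivity ((u1 * u4 - u2 * u3) ^+ 2 * r); last by rewrite hd; ring.
  by rewrite e2 e3; ring.
Qed.

Lemma coef_inv (x1 x2 x3 x4 u1 u2 u3 u4 : int) T :
  u1 = 1 + N%:Z * x1 -> u2 = N%:Z * x2 -> u3 = N%:Z * x3 -> u4 = 1 + N%:Z * x4 ->
  u1 * u4 - u2 * u3 = 1 ->
  let T' := psi u1 u2 u3 u4 x2 T in a T'.2.1 T'.2.2 T'.1 = a T.2.1 T.2.2 T.1.
Proof.
move=> e1 e2 e3 e4 hd T'.
have N0 : N%:R != 0 :> C by rewrite pnatr_eq0 -lt0n.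
have hd' : u4 * u1 - - u2 * - u3 = 1 by rewrite -[RHS]hd; ring.
have e2' : - u2 = N%:Z * - x2 by rewrite e2 mulrN.
have e3' : - u3 = N%:Z * - x3 by rewrite e3 mulrN.
have K1 := psiK e2 e3 hd; have := psiK e2' e3' hd'; rewrite !opprK => K2.
pose ps := psi u1 u2 u3 u4 x2; pose ps' := psi u4 (- u2) (- u3) u1 (- x2).
pose A (S : int * (int * int)) := a S.2.1 S.2.2 S.1.
have H : forall S, A S = A (ps' S).
  apply: (@coef_uniq3 R N (GM k F M)) => //.
    by move=> t1 z t2 dm; exact: expansion_fj3 te dm.
  move=> t1 z t2 dm; rewrite -(GM_unip hchi hF hM e1 e2 e3 e4 hd dm).
  have dm' := dom_unimod hd dm.
  have h := expansion_fj3 te dm'; have K1' S : ps' (ps S) = S := K1 S.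
  apply: (@hsum_reindex R _ _ predT predT ps ps' _ _ _ _ _ _ _ h) => //.
  - move=> [m [n r]] _; split=> //; rewrite K1'; congr (_ * _).
    rewrite /fj3 /fj -!eD; congr e; rewrite /ps/= !(intrD, intrM).
    have -> : N%:Z%:~R = N%:R :> C by rewrite pmulrn.
    rewrite e2 e3 !intrM; have -> : N%:Z%:~R = N%:R :> C by rewrite pmulrn.
    by rewrite !expr2 ?intrM; field.
by have := H T'; rewrite /ps' /T' /A K1 => <-.
Qed.

(** For m > 0 the vector (2m, -r) completes the square; for m = 0 the form with p = 1 is affine in
    q, and q of size n + 1 with the sign opposite to r makes it negative. *)
Lemma indefinite_witness (n r m : int) :
  ~~ [&& 0 <= n, 0 <= m & N%:Z * r ^+ 2 <= 4 * n * m] ->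
  exists p q : int, p ^+ 2 * n + N%:Z * (p * q * r + q ^+ 2 * m) < 0.
Proof.
have N1 : 0 < N%:Z by [].
rewrite !negb_and -!ltNge => h.
have [m0|m0] := ltP m 0; first by exists 0, 1; nia.
have [n0|n0] := ltP n 0; first by exists 1, 0; nia.
move: h; rewrite ltNge n0 ltNge m0 /= => h.
have [mp|mn] := ltP 0 m.
  exists (2 * m), (- r).
  rewrite (_ : _ + _ = m * (4 * n * m - N%:Z * r ^+ 2)); last by ring.
  by rewrite pmulr_rlt0// subr_lt0.
have mz : m = 0 by apply/le_anti; rewrite mn m0.
subst m; rewrite mulr0 in h.
have [r0|r0] := ltP 0 r.
  exists 1, (- (n + 1)).
  have : n + 1 <= N%:Z * r * (n + 1) by rewrite ler_peMl//; nia.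
  by nia.
have r1 : r < 0 by rewrite lt_neqAle r0 andbT; apply/eqP => rz; move: h; rewrite rz expr0n mulr0 ltxx.
exists 1, (n + 1).
have : n + 1 <= N%:Z * (- r) * (n + 1) by rewrite ler_peMl//; nia.
by nia.
Qed.

(** The matrices 1 + N j [-pq p^2; -q^2 pq] are unipotent, fix (p, q) and preserve the coefficients.
    Along the orbit n' + N m' is quadratic in j with leading coefficient N^2 (p^2 + q^2) Q < 0, and
    j = |A0| + |L| + 1 + i makes it at most -i. The decay at (y1, v, y2) = (1, 0, 1) then bounds the
    coefficient by B exp(-(2 pi / N) i) for every natural number i. *)
Lemma koecher (n r m : int) : ~~ [&& 0 <= n, 0 <= m & N%:Z * r ^+ 2 <= 4 * n * m] -> a n r m = 0.
Proof.
move=> /indefinite_witness[p [q]]; set Q := (X in X < 0) => hQ.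
have [dec _ _] := te.
have /(_ _)/(_ _)[] := dec 1 0 1; rewrite ?expr0n ?mulr1// => d [B [d0 hB]].
have N0 : 0 < N%:R :> R by rewrite ltr0n.
pose A0 : int := n + N%:Z * m.
pose L : int := - 2 * N%:Z * p * q * n - N%:Z ^+ 2 * q ^+ 2 * r + N%:Z ^+ 2 * p ^+ 2 * r +
  2 * N%:Z ^+ 2 * p * q * m.
apply: (@exp_decay_eq0 _ _ B (2 * pi / N%:R)); first by rewrite divr_gt0 ?mulr_gt0 ?pi_gt0.
move=> i; pose j : int := `|A0| + `|L| + 1 + i%:Z.
have := @coef_inv (- (j * p * q)) (j * p ^+ 2) (- (j * q ^+ 2)) (j * p * q)
  (1 - N%:Z * j * p * q) (N%:Z * j * p ^+ 2) (- (N%:Z * j * q ^+ 2)) (1 + N%:Z * j * p * q) (m, (n, r)).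
set T' := psi _ _ _ _ _ _ => H.
have {}H : a T'.2.1 T'.2.2 T'.1 = a n r m by apply: H; ring.
have hT : T'.2.1 + N%:Z * T'.1 = A0 + L * j + N%:Z ^+ 2 * (p ^+ 2 + q ^+ 2) * Q * j ^+ 2.
  by rewrite /T' /psi /A0 /L /Q; cbv [fst snd]; ring.
have hneg : T'.2.1 + N%:Z * T'.1 <= - i%:Z.
  rewrite hT; have p0 : 1 <= p ^+ 2 + q ^+ 2.
    rewrite -gtz0_ge1 lt_neqAle addr_ge0 ?sqr_ge0// andbT eq_sym paddr_eq0 ?sqr_ge0// !sqrf_eq0.
    by apply/andP => -[/eqP p00 /eqP q00]; move: hQ; rewrite /Q p00 q00 !expr0n /= !mul0r mulr0 addr0 ltxx.
  have N1 : 1 <= N%:Z by [].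
  have P1 : 1 <= N%:Z ^+ 2 * (p ^+ 2 + q ^+ 2).
    by rewrite -gtz0_ge1 mulr_gt0 ?exprn_gt0//; rewrite gtz0_ge1.
  have j1 : 1 <= j by rewrite /j; lia.
  have aux1 (P S J : int) : 1 <= P -> S < 0 -> 1 <= J -> P * S * J ^+ 2 <= - (J ^+ 2).
    move=> h1 h2 h3; have h4 : P * S <= -1 by nia.
    have h5 : 0 <= J ^+ 2 by exact: sqr_ge0.
    by move: (P * S) (J ^+ 2) h4 h5 => X Y h4 h5; nia.
  have c2 := aux1 _ _ _ P1 hQ j1.
  have aux2 (A Y J : int) : 1 <= J -> J = `|A| + `|Y| + 1 + i%:Z -> A + Y * J - J ^+ 2 <= - i%:Z.
    move=> h1 h2; have h3 : Y * J <= `|Y| * J by rewrite ler_wpM2r ?ler_norm//; lia.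
    have h4 : J ^+ 2 = (`|A| + 1 + i%:Z) * J + `|Y| * J by rewrite [in RHS]h2 [in LHS]h2; ring.
    have h5 : `|A| + i%:Z <= (`|A| + 1 + i%:Z) * J.
      have h6 : 0 <= `|A| by exact: normr_ge0.
      apply: (@le_trans _ _ ((`|A| + 1 + i%:Z) * 1)); first by rewrite mulr1; lia.
      by rewrite ler_wpM2l//; lia.
    have := ler_norm A; lia.
  have := aux2 A0 L j j1 erefl; lia.
rewrite -H; apply: (le_trans (hB _ _ _)); set E := expR (- _).
have B0 : 0 <= B.
  have := le_trans (nm_ge0 _) (hB 0 0 0).
  by rewrite !pmulr_lge0 ?expR_gt0.
have E1 : E <= 1.
  rewrite /E -expR0 ler_expR oppr_le0 mulr_ge0//; last by rewrite !addr_ge0// ler0n.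
  by rewrite mulr_ge0 ?mulr_ge0 ?pi_ge0//; exact: ltW.
apply: (le_trans (ler_piMr _ E1)); first by rewrite mulr_ge0 ?expR_ge0.
rewrite ler_wpM2l// ler_expR.
have hR : (T'.2.1)%:~R + N%:R * (T'.1)%:~R <= - i%:R :> R.
  by rewrite -[N%:R]/(N%:Z%:~R) -intrM -intrD -[i%:R]/(i%:Z%:~R) -mulrNz ler_int.
rewrite mulr1 mulr0 addr0 mulr1.
rewrite (_ : 2 * pi * _ = 2 * pi / N%:R * ((T'.2.1)%:~R + N%:R * (T'.1)%:~R)); last first.
  by field; exact: lt0r_neq0.
by rewrite -mulrN ler_wpM2l//; apply: divr_ge0; [rewrite mulr_ge0 ?pi_ge0|exact: ltW].
Qed.

End CuspCoefficients.

(** * Hecke sums and their effect on coefficients *)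

Section Character.
Variables (R : realType) (N : nat) (chi : int -> R[i]).
Local Notation C := R[i].
Hypothesis hN : (0 < N)%N.
Hypothesis hchi : dirichlet_char N chi.

Lemma chi1 : chi 1 = 1. Proof. by case: hchi. Qed.
Lemma chiM m n : chi (m * n) = chi m * chi n. Proof. by case: hchi. Qed.

Lemma chi_mod (m n q : int) : m = n + N%:Z * q -> chi m = chi n.
Proof. by case: hchi => _ _ hp _ ->; apply: hp; rewrite addrC mulrC modzMDl. Qed.

Lemma chi_eq0 m : (chi m == 0) = ~~ coprimez m N.
Proof. by case: hchi => _ _ _ <-; rewrite negbK. Qed.

(** By Euler's theorem [chi m] is a root of unity. *)
Lemma nm_chi m : coprimez m N -> nm (chi m) = 1.
Proof.
move=> cm; pose x := `|(m %% N)%Z|%N.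
have xm : x%:Z = (m %% N)%Z by rewrite /x gez0_abs// modz_ge0// -lt0n.
have -> : chi m = chi x%:Z.
  apply: (@chi_mod _ _ (m %/ N)%Z); rewrite xm [LHS](divz_eq m N) addrC mulrC//.
have cx : coprime x N.
  by move: cm; rewrite /coprimez -gcdz_modl -xm => /eqP [h]; rewrite /coprime; exact/eqP.
have := cyclic.Euler_exp_totient cx => he.
have h1 : chi (x ^ totient N)%N%:Z = 1.
  rewrite -chi1; case: hchi => _ _ hp _; apply: hp.
  by apply/eqP; rewrite -[1]/(1%N%:Z) !modz_nat he.
have h2 n : chi (x ^ n)%N%:Z = chi x%:Z ^+ n.
  by elim: n => [|n IH]; rewrite ?expn0 ?chi1// expnS PoszM chiM IH exprS.
rewrite h2 in h1; have := congr1 (@nm R) h1; rewrite nmX nm1 => h3.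
by apply/eqP; rewrite -(@pexpr_eq1 R _ (totient N)) ?nm_ge0 ?totient_gt0// h3.
Qed.

(** The conjugate in [chi_mx] and the inverse in the sums undo each other, at the value 0 too since
    0^-1 = 0. *)
Lemma chi_conj_inv m : ((chi m)^*)^-1 = chi m.
Proof.
have [cm|cm] := boolP (coprimez m N).
  have h := nm_chi cm; have c0 : chi m != 0 by rewrite chi_eq0 cm.
  apply: (mulfI (_ : (chi m)^* != 0)); first by rewrite fmorph_eq0.
  rewrite mulfV ?fmorph_eq0// mulrC; apply: complexP.
    by rewrite ReM /= ; have := nm_sqr (chi m); rewrite h expr1n; case: (chi m) => a b /= ->; ring.
  by rewrite ImM/=; case: (chi m) => a b /=; ring.
have /eqP -> : chi m == 0 by rewrite chi_eq0.
by rewrite rmorph0 invr0.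
Qed.

End Character.

(** * Representatives of the cosets of Gamma0(N) in Delta_N(l) *)

Section Cosets.
Variable N : nat.
Hypothesis hN : (0 < N)%N.

Lemma Gamma0M (g h : 'M[int]_2) l : Gamma0 N g -> Delta N l h -> Delta N l (g *m h).
Proof.
move=> [d1 c1 a1] [d2 c2 a2]; split; first by rewrite det_mulmx d1 d2 mul1r.
  by rewrite mul2E; apply: rpredD; [exact: dvdz_mulr|exact: dvdz_mull].
rewrite mul2E /coprimez gcdzC -gcdz_modr.
have /dvdzP[q ->] := c2.
rewrite addrC mulrA modzMDl gcdz_modr gcdzC -/(coprimez _ _).
by rewrite coprimezMl a1.
Qed.

Lemma Gamma0V (g : 'M[int]_2) : Gamma0 N g ->
  let g' := mk2 (g 1 1) (- g 0 1) (- g 1 0) (g 0 0) in Gamma0 N g' /\ g' *m g = 1%:M.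
Proof.
move=> [d1 c1 a1] /=; have hd : g 0 0 * g 1 1 - g 0 1 * g 1 0 = 1 by rewrite -det2.
split; last first.
  rewrite [g in X in _ *m X]mk2_eta mk2M mk2_1; congr mk2; try ring; rewrite -[RHS]hd; ring.
split; first by rewrite det_mk2 -[RHS]hd; ring.
  by rewrite mk2E rpredN.
rewrite mk2E; apply/coprimezP; have /dvdzP[q e] := c1.
by exists (g 0 0, - g 0 1 * q) => /=; rewrite -[RHS]hd e; ring.
Qed.

Lemma coset_eq (g h gam : 'M[int]_2) : Gamma0 N gam -> gam *m g = h ->
  [set ga *m g | ga in Gamma0 N] = [set ga *m h | ga in Gamma0 N].
Proof.
move=> hg e; have [hg' e'] := Gamma0V hg.
set g' := mk2 _ _ _ _ in hg' e'.
apply/seteqP; split => x [ga hga <-].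
  exists (ga *m g'); first exact: Gamma0M.
  by rewrite -e mulmxA -(mulmxA ga) e' mulmx1.
by exists (ga *m gam); [exact: Gamma0M|rewrite -e mulmxA].
Qed.

Lemma gcdz_witness (p r : int) : (p != 0) || (r != 0) -> exists x y u v D : int,
  [/\ 0 < D, p = u * D, r = v * D & x * u + y * v = 1].
Proof.
move=> pr; pose D := gcdz p r.
have D0 : 0 < D by rewrite lt_neqAle eq_sym gcdz_eq0 negb_and pr.
have /dvdzP[u hu] := dvdz_gcdl p r; have /dvdzP[v hv] := dvdz_gcdr p r.
have [x [y hxy]] := Bezoutz p r.
exists x, y, u, v, D; split=> //.
rewrite -/D in hu hv hxy; clearbody D.
by apply: (mulIf (lt0r_neq0 D0)); rewrite mul1r -[RHS]hxy hu hv; ring.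
Qed.

Definition creps l : seq (nat * nat) :=
  [seq (a, b) | a <- [seq a <- divisors l | coprime a N], b <- iota 0 (l %/ a)].
Definition crep l (p : nat * nat) : 'M[int]_2 := mk2 p.1%:Z p.2%:Z 0 (l %/ p.1)%N%:Z.

Lemma mem_creps l a b : (0 < l)%N -> ((a, b) \in creps l) =
  [&& (a %| l)%N, coprime a N & (b < l %/ a)%N].
Proof.
move=> l0; apply/allpairsPdep/and3P => [[x [y [+ + [-> ->]]]]|[h1 h2 h3]].
  by rewrite mem_filter mem_iota -dvdn_divisors// => /andP[-> ->] /=.
by exists a, b; rewrite mem_filter mem_iota -dvdn_divisors// h1 h2.
Qed.

Lemma creps_uniq l : uniq (creps l).
Proof.
apply: allpairs_uniq_dep.
- by rewrite filter_uniq// divisors_uniq.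
- by move=> x _; exact: iota_uniq.
- by move=> [x y] [x' y'] _ _ /= [-> ->].
Qed.

Lemma crep_Delta l a b : (0 < l)%N -> (a, b) \in creps l -> Delta N l (crep l (a, b)).
Proof.
move=> l0; rewrite mem_creps// => /and3P[h1 h2 _]; split.
- by rewrite det_mk2 mulr0 subr0 -PoszM mulnC divnK.
- by rewrite mk2E dvdz0.
- by rewrite mk2E.
Qed.

(** Bezout for the first column (D u, D v) gives the matrix [x y; -v u], which clears v. As D is
    prime to N, N divides v and the matrix lies in Gamma0(N). Subtracting t times its second row
    from its first reduces the upper right entry modulo d. *)
Lemma crep_ex l g : (0 < l)%N -> Delta N l g ->
  exists gam p, [/\ Gamma0 N gam, p \in creps l & gam *m g = crep l p].
Proof.
move=> l0 [hd hc ha].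
have hd' : g 0 0 * g 1 1 - g 0 1 * g 1 0 = l%:Z by rewrite -det2.
have pr : (g 0 0 != 0) || (g 1 0 != 0).
  apply: contraPT hd'; rewrite negb_or !negbK => /andP[/eqP -> /eqP ->].
  by rewrite mul0r mulr0 subr0 => h; move: l0; rewrite -ltz_nat -h.
have [x [y [u [v [D [D0 hu hv hxy]]]]]] := gcdz_witness pr.
have hl : D * (u * g 1 1 - g 0 1 * v) = l%:Z by rewrite -[RHS]hd' hu hv; ring.
pose a := `|D|%N. have aD : a%:Z = D by rewrite /a gez0_abs// ltW.
pose dz : int := u * g 1 1 - g 0 1 * v.
pose d := `|dz|%N.
have d0 : 0 < u * g 1 1 - g 0 1 * v by rewrite -(pmulr_rgt0 _ D0) hl.
have dd : d%:Z = u * g 1 1 - g 0 1 * v by rewrite /d gez0_abs// /dz ltW.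
have ad : (a * d)%N = l by apply/eqP; rewrite -eqz_nat PoszM aD dd hl.
have a0 : (0 < a)%N by rewrite -ltz_nat aD.
have lad : (l %/ a)%N = d by rewrite -ad mulKn.
have cDN : coprimez D N.
  by move: ha; rewrite hu coprimezMl => /andP[].
have hvN : (N %| v)%Z.
  by move: hc; rewrite hv Gauss_dvdzl// /coprimez gcdzC.
have hxN : coprimez x N.
  by apply/coprimezP; have /dvdzP[q e] := hvN; exists (u, y * q) => /=; rewrite -[RHS]hxy e; ring.
pose b0 := x * g 0 1 + y * g 1 1.
pose t := (b0 %/ d)%Z; pose b := `|(b0 %% d)%Z|%N.
have d00 : (0 < d)%N by rewrite -ltz_nat dd.
have bb : b%:Z = (b0 %% d)%Z by rewrite /b gez0_abs// modz_ge0// -lt0n.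
have bt : b0 = t * d%:Z + b%:Z by rewrite bb -divz_eq.
exists (mk2 (x + t * v) (y - t * u) (- v) u), (a, b); split.
- split; first by rewrite det_mk2 -[RHS]hxy; ring.
    by rewrite mk2E rpredN.
  rewrite mk2E; apply/coprimezP; have /dvdzP[q e] := hvN.
  by exists (u, (y - t * u) * q) => /=; rewrite -[RHS]hxy e; ring.
- rewrite mem_creps// -ad dvdn_mulr// mulKn//; apply/and3P; split=> //.
  by rewrite -ltz_nat bb ltz_pmod.
- rewrite [g in LHS]mk2_eta mk2M /crep /= lad; congr mk2.
  + by transitivity ((x * u + y * v) * D); [rewrite hu hv; ring|rewrite hxy mul1r].
  + by rewrite (_ : b%:Z = b0 - t * d%:Z); [rewrite /b0 dd; ring|rewrite bt; ring].
  + by rewrite hu hv; ring.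
  + by rewrite dd; ring.
Qed.

Lemma crep_inj l a b a' b' gam : (0 < l)%N -> (a, b) \in creps l -> (a', b') \in creps l ->
  Gamma0 N gam -> gam *m crep l (a, b) = crep l (a', b') -> (a, b) = (a', b').
Proof.
move=> l0; rewrite !mem_creps// => /and3P[h1 _ h2] /and3P[h1' _ h2'] [hd _ _].
have a0 : (0 < a)%N by rewrite (dvdn_gt0 l0).
have a0' : (0 < a')%N by rewrite (dvdn_gt0 l0).
rewrite det2 in hd; rewrite [gam in LHS]mk2_eta mk2M /crep/= => e.
have := congr1 (fun M : 'M[int]_2 => M 0 0) e; have := congr1 (fun M : 'M[int]_2 => M 0 1) e.
have := congr1 (fun M : 'M[int]_2 => M 1 0) e; have := congr1 (fun M : 'M[int]_2 => M 1 1) e.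
rewrite !mk2E !mulr0 !addr0 => e4 /eqP; rewrite mulf_eq0 eqz_nat (gtn_eqF a0) orbF => /eqP e3 e2 e1.
rewrite e3 mulr0 subr0 in hd; rewrite e3 mul0r add0r in e4.
have x0 : 0 < gam 0 0 by rewrite -(pmulr_lgt0 _ (_ : 0 < a%:Z)) ?e1.
have x1 : gam 0 0 = 1.
  have w0 : 0 < gam 1 1 by rewrite -(pmulr_rgt0 _ x0) hd.
  by move: (gam 0 0 : int) (gam 1 1 : int) x0 w0 hd => X W; nia.
have ea : a = a' by move: e1; rewrite x1 mul1r => -[].
subst a'; congr (_, _).
have [y hq] : exists y : int, b%:Z + y * (l %/ a)%N%:Z = b'%:Z.
  by exists (gam 0 1); rewrite -e2 x1 mul1r.
move: (l %/ a)%N h2 h2' hq => d h2 h2' hq.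
have y0 : y = 0 by nia.
 move: hq; rewrite y0 mul0r addr0; lia.
Qed.

(** Left invariance of G trades the chosen representative [xget 0 X] for an upper triangular one. *)
Lemma coset_sumE (R : realType) l (G : 'M[int]_2 -> R[i]) : (0 < l)%N ->
  (forall gam g, Gamma0 N gam -> Delta N l g -> G (gam *m g) = G g) ->
  coset_sum N l G = \sum_(a <- divisors l | coprime a N) \sum_(b < l %/ a) G (crep l (a, b : nat)).
Proof.
move=> l0 hG; pose cl (g : 'M[int]_2) := [set gam *m g | gam in Gamma0 N].
have G1 : Gamma0 N 1%:M by split; rewrite ?det1// mxE/= ?dvdz0// /coprimez gcd1z.
have -> : coset_sum N l G = \sum_(X \in (fun p => cl (crep l p)) @` [set` creps l]) G (xget 0 X).
  rewrite /coset_sum; have -> // : cosets N l = (fun p => cl (crep l p)) @` [set` creps l].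
  apply/seteqP; split => X [].
    move=> g hg <-; have [gam [p [h1 h2 h3]]] := crep_ex l0 hg.
    by exists p => //; rewrite /cl -(coset_eq h1 h3).
  by move=> [a b] hp <-; exists (crep l (a, b)) => //; exact: crep_Delta.
rewrite fsbig_image; last first.
  move=> [a b] [a' b'] /set_mem h1 /set_mem h2 e; apply/esym.
  have [gam hg e'] : cl (crep l (a, b)) (crep l (a', b')).
    by rewrite e; exists 1%:M => //; rewrite mul1mx.
  exact/esym/(crep_inj l0 h1 h2 hg e').
rewrite -fsbig_seq ?creps_uniq// big_allpairs_dep/= big_filter.
rewrite big_seq_cond [RHS]big_seq_cond; apply: eq_bigr => a /andP[adiv acop].
rewrite -[iota 0 _]/(iota 0 (l %/ a)) -[X in iota 0 X]subn0 -/(index_iota 0 _) big_mkord.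
apply: eq_bigr => b _.
have hm : (a, b : nat) \in creps l by rewrite mem_creps// acop ltn_ord dvdn_divisors// adiv.
have [gam hg <-] : cl (crep l (a, b : nat)) (xget 0 (cl (crep l (a, b : nat)))).
  by apply: xgetPex; exists (crep l (a, b : nat)), 1%:M => //; rewrite mul1mx.
by rewrite hG//; exact: crep_Delta.
Qed.

End Cosets.

(** * Hecke sums on Fourier expansions *)

Section HeckeOperator.
Variables (R : realType) (k N : nat) (chi : int -> R[i]).
Local Notation C := R[i].
Local Notation e := (@cexp2pi R).
Hypothesis hN : (0 < N)%N.
Hypothesis hchi : dirichlet_char N chi.
Implicit Types (H : C -> C -> C -> C) (g : 'M[int]_2).

(** The slash with the upward embedding of g / s, for s^2 = det g, written with the integral entries
    of g: the normalisation remains as s in front of z, and its k-th power is put into H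
    ([slash_up_HG]). *)
Definition HG H (s : C) g (t1 z t2 : C) : C :=
  let j := (g 1 0)%:~R * t1 + (g 1 1)%:~R in
  j ^- k * H (((g 0 0)%:~R * t1 + (g 0 1)%:~R) / j) (s * z / j) (t2 - (g 1 0)%:~R * z ^+ 2 / j).

(* The Hecke sum over Gamma0(N) \ Delta_N(l), on the representatives [a b; 0 l/a];
   the factor sqrt l of the normalised matrices is put into z. *)
Definition Op (l : nat) H (t1 z t2 : C) : C :=
  \sum_(a <- divisors l | coprime a N) \sum_(b < l %/ a)
    chi a%:Z * ((l %/ a)%:R ^- k * H ((a%:R * t1 + b%:R) / (l %/ a)%:R) (a%:R * z) t2).

Lemma Delta_j0 l g (t : C) : (0 < l)%N -> Delta N l g -> 0 < complex.Im t ->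
  (g 1 0)%:~R * t + (g 1 1)%:~R != 0 :> C.
Proof.
move=> l0 [hd _ _] y0; rewrite !intr_real; apply: j_neq0 => //.
rewrite !intr_eq0; apply: contraPT hd; rewrite negb_or !negbK => /andP[/eqP h1 /eqP h2].
by rewrite det2 h1 h2 !mulr0 subr0 => h; move: l0; rewrite -ltz_nat -h.
Qed.

(** D is the domain where the law of H holds: [dom] for Siegel forms, the half plane in t1 for
    Jacobi forms. Both uses share this cocycle computation. *)
Lemma HG_mul (D : C -> C -> C -> Prop) H (s : C) l gam g (t1 z t2 : C) : (0 < l)%N ->
  s ^+ 2 = l%:R -> Gamma0 N gam -> Delta N l g -> 0 < complex.Im t1 ->
  (forall t1 z t2, D t1 z t2 -> 0 < complex.Im t1) ->
  (forall t1 z t2, D t1 z t2 -> HG H 1 gam t1 z t2 = chi (gam 1 1) * H t1 z t2) ->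
  (let j := (g 1 0)%:~R * t1 + (g 1 1)%:~R in
   D (((g 0 0)%:~R * t1 + (g 0 1)%:~R) / j) (s * z / j) (t2 - (g 1 0)%:~R * z ^+ 2 / j)) ->
  HG H s (gam *m g) t1 z t2 = chi (gam 1 1) * HG H s g t1 z t2.
Proof.
move=> l0 hs hgam hg y0 hD law /= hdom.
have y1 := hD _ _ _ hdom; have := law _ _ _ hdom.
have jg := Delta_j0 l0 hg y0; have jgam := Delta_j0 (isT : (0 < 1)%N) hgam y1.
have gd : (g 0 0)%:~R * (g 1 1)%:~R - (g 0 1)%:~R * (g 1 0)%:~R = s ^+ 2 :> C.
  by rewrite hs -!intrM -intrB -det2; case: hg => -> _ _; rewrite pmulrn.
rewrite /HG !mul2E !intrD !intrM mul1r; clear y0 y1 hD law hdom hg hgam.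
move: ((g 0 0)%:~R : C) ((g 0 1)%:~R : C) ((g 1 0)%:~R : C) ((g 1 1)%:~R : C) jg gd jgam => a b c d jg gd.
move: ((gam 0 0)%:~R : C) ((gam 0 1)%:~R : C) ((gam 1 0)%:~R : C) ((gam 1 1)%:~R : C) => a' b' c' d' jgam.
set j : C := c * t1 + d in jg jgam *; set jj : C := c' * ((a * t1 + b) / j) + d' in jgam *.
have hj : (c' * a + d' * c) * t1 + (c' * b + d' * d) = jj * j by rewrite /jj /j; field.
move=> law; rewrite hj [RHS]mulrCA -law.
rewrite exprMn invfM mulrA [_ * (_ ^- k)]mulrC.
rewrite [RHS]mulrA; congr (_ * _); congr (H _ _ _).
- rewrite (_ : _ + _ = (a' * (a * t1 + b) / j + b') * j); first by field; rewrite ?jg ?jgam.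
  by transitivity (a' * (a * t1 + b) + b' * j); [rewrite /j; ring|field].
- by field; rewrite jgam.
have e1 : (c' * a + d' * c) / (jj * j) = c / j + c' * s ^+ 2 / (j ^+ 2 * jj).
  apply: (mulIf (_ : jj * j ^+ 2 != 0)); first by rewrite mulf_neq0// expf_neq0.
  rewrite (_ : _ / _ * _ = (c' * a + d' * c) * j); last by field; rewrite ?jg ?jgam.
  rewrite (_ : (_ + _) * (jj * j ^+ 2) = c * (jj * j) + c' * s ^+ 2); last by field; rewrite ?jg ?jgam.
  by rewrite -hj -gd /j; ring.
rewrite mulrAC e1; field; rewrite ?jg ?jgam//.
Qed.

(** det gam = 1 and N | gam 1 0 give chi(gam 0 0) chi(gam 1 1) = 1, so that the character of the law
    cancels the one in the weight and the summand depends on the coset only. *)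
Lemma chi_rep gam g l : Gamma0 N gam -> Delta N l g ->
  (chi_mx chi (gam *m g))^-1 * chi (gam 1 1) = (chi_mx chi g)^-1.
Proof.
move=> [hd hc _] [_ hc' _]; rewrite /chi_mx !(chi_conj_inv hN hchi) mul2E.
have /dvdzP[q e1] := hc; have /dvdzP[q' e2] := hc'.
rewrite (@chi_mod _ _ _ hchi _ (gam 0 0 * g 0 0) (gam 0 1 * q')); last by rewrite e2; ring.
rewrite -(chiM hchi) mulrAC (chiM hchi).
rewrite (@chi_1mod _ _ _ hchi _ (gam 0 1 * q)) ?mul1r//.
by move: hd; rewrite det2 e1 => h; transitivity (gam 0 0 * gam 1 1 - gam 0 1 * (q * N%:Z) + N%:Z * (gam 0 1 * q)); [ring|rewrite h].
Qed.

(** At the argument s z the representative with first entry a sees s (s z) / (l / a) = a z, so that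
    the square root of l disappears. *)
Lemma coset_sum_Op (D : C -> C -> C -> Prop) H (s : C) l (t1 z t2 : C) : (0 < l)%N ->
  s ^+ 2 = l%:R -> 0 < complex.Im t1 ->
  (forall t1 z t2, D t1 z t2 -> 0 < complex.Im t1) ->
  (forall gam t1 z t2, Gamma0 N gam -> D t1 z t2 -> HG H 1 gam t1 z t2 = chi (gam 1 1) * H t1 z t2) ->
  (forall g, Delta N l g -> let j := (g 1 0)%:~R * t1 + (g 1 1)%:~R in
   D (((g 0 0)%:~R * t1 + (g 0 1)%:~R) / j) (s * (s * z) / j) (t2 - (g 1 0)%:~R * (s * z) ^+ 2 / j)) ->
  coset_sum N l (fun g => (chi_mx chi g)^-1 * HG H s g t1 (s * z) t2) = Op l H t1 z t2.
Proof.
move=> l0 hs y0 hD law hdom; rewrite coset_sumE//; last first.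
  move=> gam g hgam hg.
  rewrite (HG_mul l0 hs hgam hg y0 hD (fun t1 z t2 => law gam t1 z t2 hgam) (hdom g hg)).
  by rewrite mulrA (chi_rep hgam hg).
rewrite /Op big_seq_cond [RHS]big_seq_cond; apply: eq_bigr => a /andP[adiv acop].
have al : (a %| l)%N by rewrite dvdn_divisors.
have a0 : (0 < a)%N by exact: dvdn_gt0 al.
have d0 : (l %/ a)%:R != 0 :> C by rewrite pnatr_eq0 -lt0n divn_gt0// dvdn_leq.
apply: eq_bigr => b _; rewrite /chi_mx (chi_conj_inv hN hchi) /crep /HG /= !mk2E.
rewrite !mul0r add0r subr0; congr (_ * (_ * H _ _ _)).
apply: (mulIf d0); rewrite divfK// mulrA -expr2 hs mulrAC -natrM mulnC divnK//.
Qed.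

(** The representative of n / d modulo 1 of absolute value at most 1/2 is r / d or (r - d) / d, and
    the chord bound [nm_e_sub1_ge] forces it to be 0. *)
Lemma e_frac_eq1 (n : int) (d : nat) : (0 < d)%N -> e (n%:~R / d%:R) = 1 -> (d%:Z %| n)%Z.
Proof.
move=> d0; have dR : 0 < d%:R :> R by rewrite ltr0n.
have dC : d%:R != 0 :> C by rewrite pnatr_eq0 -lt0n.
pose r := (n %% d%:Z)%Z; have r0 : 0 <= r by rewrite modz_ge0// -lt0n.
have rd : r < d%:Z by rewrite ltz_pmod.
have key (x : int) : (`|x|%N <= d)%N -> e ((x%:~R / d%:R : R) / 2)%:C = 1 -> x = 0.
  move=> xd h; have : `|x%:~R / d%:R / 2 : R| <= 0.
    rewrite -(nm0 R) -(subrr (1 : C)) -{1}h; apply: nm_e_sub1_ge.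
    rewrite !normrM !normfV !normr_nat ler_pdivrMr// mulVf// ler_pdivrMr// mul1r.
    by rewrite -intr_norm -abszE -pmulrn ler_nat.
  rewrite normr_le0 !mulf_eq0 !invr_eq0 !pnatr_eq0 orbF => /orP[|/eqP hd]; last by rewrite hd in d0.
  by rewrite intr_eq0 => /eqP.
rewrite {1}(divz_eq n d) -/r intrD intrM mulrDl -pmulrn mulfK// addrC eDint => h.
have hrC (x : int) : ((2 * x)%:~R / d%:R : R)/2 = (x%:~R / d%:R) by rewrite intrM; field; exact: lt0r_neq0.
have [h2|h2] := leP (2 * r) d%:Z.
  apply/dvdz_mod0P; have : 2 * r = 0; last by lia.
  apply: key; first by lia.
  by rewrite hrC rmorphM/= fmorphV/= rmorph_int rmorph_nat.
exfalso; have : 2 * (r - d%:Z) = 0; last by lia.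
apply: key; first by lia.
rewrite hrC rmorphM/= fmorphV/= rmorph_int rmorph_nat intrB mulrBl -pmulrn mulfV//.
by rewrite eB h e1 divr1.
Qed.

Lemma sum_e_frac (n : int) (d : nat) : (0 < d)%N ->
  \sum_(b < d) e (n%:~R * b%:R / d%:R) = if (d%:Z %| n)%Z then d%:R else 0.
Proof.
move=> d0; have dC : d%:R != 0 :> C by rewrite pnatr_eq0 -lt0n.
have h (b : nat) : e (n%:~R * b%:R / d%:R) = e (n%:~R / d%:R) ^+ b.
  by rewrite -eX; congr e; ring.
case: ifPn => [/dvdzP[q hq]|hd].
  rewrite (eq_bigr (fun=> 1)); first by rewrite sumr_const card_ord.
  move=> b _; rewrite h hq intrM -pmulrn mulfK// e_int expr1n//.
rewrite (eq_bigr (fun b : 'I_d => e (n%:~R / d%:R) ^+ b)); last by move=> b _; exact: h.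
have q1 : e (n%:~R / d%:R) - 1 != 0.
  by rewrite subr_eq0; apply: contraNneq hd; exact: e_frac_eq1.
apply: (mulfI q1); rewrite mulr0 -subrX1 -eX mulrC divfK// e_int; exact: subrr.
Qed.

Definition Wterm (a d : nat) (A : int * (int * int) -> C) (T : int * (int * int)) : C :=
  if (a%:Z %| T.2.1)%Z && (a%:Z %| T.2.2)%Z then
    d%:R * A (T.1, ((T.2.1 %/ a%:Z)%Z * d%:Z, (T.2.2 %/ a%:Z)%Z)) else 0.

(* The effect of Op on coefficients; T = (m, (n, r)). *)
Definition W (l : nat) (A : int * (int * int) -> C) (T : int * (int * int)) : C :=
  \sum_(a <- divisors l | coprime a N) chi a%:Z * ((l %/ a)%:R ^- k * Wterm a (l %/ a) A T).

(** The sum over b selects the exponents n divisible by d and multiplies them by d. For n = d q the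
    resulting exponents are a q and a r, whence the divisibility conditions in [Wterm]. *)
Lemma Wterm_expansion H (A : int * (int * int) -> C) (a d : nat) (t1 z t2 : C) :
  (0 < a)%N -> (0 < d)%N ->
  (forall b : nat, (b < d)%N -> hsum (fun T => A T * fj3 1 T ((a%:R * t1 + b%:R) / d%:R) (a%:R * z) t2)
     (H ((a%:R * t1 + b%:R) / d%:R) (a%:R * z) t2)) ->
  hsum (fun T => Wterm a d A T * fj3 1 T t1 z t2)
    (\sum_(b < d) H ((a%:R * t1 + b%:R) / d%:R) (a%:R * z) t2).
Proof.
move=> a0 d0 hA; have dC : d%:R != 0 :> C by rewrite pnatr_eq0 -lt0n.
have dZ : d%:Z != 0 by rewrite -lt0n. have aZ : a%:Z != 0 by rewrite -lt0n.
have := @hsum_sum _ _ _ (index_enum 'I_d) xpredT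
  (fun (b : 'I_d) T => A T * fj3 1 T ((a%:R * t1 + b%:R) / d%:R) (a%:R * z) t2) _ (fun b _ => hA b (ltn_ord b)).
set f := (fun i => _) => hf.
have fE T : f T = if (d%:Z %| T.2.1)%Z then
    d%:R * A T * fj3 1 T (a%:R * t1 / d%:R) (a%:R * z) t2 else 0.
  rewrite /f -mulr_sumr; have -> : \sum_(b < d) fj3 1 T ((a%:R * t1 + b%:R) / d%:R) (a%:R * z) t2 =
     (\sum_(b < d) e ((T.2.1)%:~R * b%:R / d%:R)) * fj3 1 T (a%:R * t1 / d%:R) (a%:R * z) t2.
    rewrite mulr_suml; apply: eq_bigr => b _; rewrite /fj3 /fj [RHS]mulrA -[in RHS]eD; congr (_ * _); congr cexp2pi.
    by rewrite !divr1; ring.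
  by rewrite sum_e_frac//; case: ifP => _; rewrite ?mul0r ?mulr0//; ring.
pose P (T : int * (int * int)) := (d%:Z %| T.2.1)%Z.
pose Q (T : int * (int * int)) := (a%:Z %| T.2.1)%Z && (a%:Z %| T.2.2)%Z.
pose h (T : int * (int * int)) := (T.1, ((T.2.1 %/ d%:Z)%Z * a%:Z, T.2.2 * a%:Z)).
pose h' (T : int * (int * int)) := (T.1, ((T.2.1 %/ a%:Z)%Z * d%:Z, (T.2.2 %/ a%:Z)%Z)).
apply: (@hsum_reindex R _ _ P Q h h' f _ _ _ _ _ _ hf).
- by move=> T /negbTE hP; rewrite fE -/(P T) hP.
- by move=> T /negbTE hQ; rewrite /Wterm -/(Q T) hQ mul0r.
- move=> [m [n r]] hP; have /dvdzP[q hq] : (d%:Z %| n)%Z by exact: hP.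
  have hn : (n %/ d%:Z)%Z = q by rewrite hq mulzK.
  split.
  + by rewrite /Q /h/= !dvdz_mull.
  + by rewrite /h /h' /= !mulzK// hn -hq.
  + rewrite fE -/(P _) hP /Wterm /h/= !dvdz_mull//= !mulzK// hn -hq; congr (_ * _).
    rewrite /fj3 /fj/= hq; congr (_ * _); congr cexp2pi; rewrite !divr1 !intrM -!pmulrn.
    by field.
- move=> [m [n r]] /andP[/= /dvdzP[q hq] /dvdzP[q' hq']].
  by rewrite /P /h /h'/= hq hq' !mulzK// dvdz_mull.
Qed.

Lemma Op_expansion H (A : int * (int * int) -> C) (l : nat) (t1 z t2 : C) : (0 < l)%N ->
  (forall a b : nat, (a %| l)%N -> (b < l %/ a)%N ->
     hsum (fun T => A T * fj3 1 T ((a%:R * t1 + b%:R) / (l %/ a)%:R) (a%:R * z) t2)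
     (H ((a%:R * t1 + b%:R) / (l %/ a)%:R) (a%:R * z) t2)) ->
  hsum (fun T => W l A T * fj3 1 T t1 z t2) (Op l H t1 z t2).
Proof.
move=> l0 hA; rewrite /Op big_seq_cond.
have h : forall a, (a \in divisors l) && coprime a N ->
   hsum (fun T => chi a%:Z * ((l %/ a)%:R ^- k * Wterm a (l %/ a) A T) * fj3 1 T t1 z t2)
   (\sum_(b < l %/ a)
    chi a%:Z * ((l %/ a)%:R ^- k * H ((a%:R * t1 + b%:R) / (l %/ a)%:R) (a%:R * z) t2)).
  move=> a /andP[]; rewrite -dvdn_divisors// => al _.
  have a0 : (0 < a)%N by exact: dvdn_gt0 al.
  have d0 : (0 < l %/ a)%N by rewrite divn_gt0// dvdn_leq.
  rewrite -mulr_sumr -mulr_sumr.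
  have := hsumZ (chi a%:Z) (hsumZ ((l %/ a)%:R ^- k) (Wterm_expansion a0 d0 (fun b => hA a b al))).
  by apply: hsum_ext => T; rewrite !mulrA.
have := hsum_sum (divisors l) h; apply: hsum_ext => T.
by rewrite /W [in RHS]big_seq_cond mulr_suml.
Qed.

End HeckeOperator.

Section PartialSums.
Variables (R : realType) (I : choiceType).
Local Notation C := R[i].

Lemma partial_sumE (f : I -> C) (A : {fset I}) : partial_sum f A = \sum_(i <- A) f i.
Proof. by rewrite /partial_sum big_seq_fsetE. Qed.

Lemma hsum_totally (f : I -> C) (s : C) : hsum f s <-> partial_sum f @ totally --> s.
Proof.
split=> [hf P /nbhs_nm[d [d0 hP]]|hf eps e0].
  have d2 : 0 < d / 2 by rewrite divr_gt0.
  have [A hA] := hf (d / 2) d2.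
  exists A => // B AB; apply: hP; rewrite partial_sumE.
  by apply: le_lt_trans (hA B AB) _; rewrite ltr_pdivrMr// ltr_pMr// ltr1n.
have : nbhs s [set w | nm (w - s) < eps] by apply/nbhs_nm; exists eps.
move=> /hf [A _ hA]; exists A => B AB; have := hA B AB.
by rewrite /= partial_sumE => /ltW.
Qed.

End PartialSums.

Section CosetSums.
Variables (R : realType) (N : nat).

Lemma coset_sum_ext l (G G' : 'M[int]_2 -> R[i]) : (0 < N)%N ->
  (forall g, Delta N l g -> G g = G' g) -> coset_sum N l G = coset_sum N l G'.
Proof.
move=> hN h; apply: eq_fsbigr => X /set_mem [g hg <-]; apply: h.
have G1 : Gamma0 N 1%:M by split; rewrite ?det1// mxE/= ?dvdz0// /coprimez gcd1z.
set X' := [set _ | _ in _].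
have : X' (xget 0 X') by apply: xgetPex; exists g, 1%:M => //; rewrite mul1mx.
by move=> [gam hgam <-]; exact: Gamma0M.
Qed.

End CosetSums.

(** * Coefficients of F and the symmetry relation *)

Section FormCoefficients.
Variables (R : realType) (k N : nat) (chi : int -> R[i]) (F : 'M[R[i]]_2 -> R[i]).
Local Notation C := R[i].
Local Notation e := (@cexp2pi R).
Hypothesis hN : (0 < N)%N.
Hypothesis hchi : dirichlet_char N chi.
Hypothesis hpar : chi (-1) = (-1) ^+ k.
Hypothesis hF : siegel_form k N chi F.

Lemma det1M : \det (1%:M : 'M[int]_2) = 1. Proof. exact: det1. Qed.

Lemma GM1E : GM k F 1%:M = F3 F.
Proof. by apply: funext => t1; apply: funext => z; apply: funext => t2; exact: GM1. Qed.

Lemma F3_expansion : exists a c, tube_expansion 1 (F3 F) a c.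
Proof.
apply: tube_expansionP; first by [].
- move=> t1 z t2 dm; have := F3_trans hchi hF 1 0 0 dm.
  by rewrite !mulr0z !addr0.
- move=> t1 z t2 dm; have := F3_trans hchi hF 0 1 0 dm.
  by rewrite !mulr0z !addr0.
- move=> t1 z t2 dm; have := F3_trans hchi hF 0 0 1 dm.
  by rewrite !mulr0z !addr0.
- by rewrite -GM1E => t1 z t2 dm; exact: (GM_diff1 hF det1M dm).
- by rewrite -GM1E => t1 z t2 dm; exact: (GM_diff2 hF det1M dm).
- by rewrite -GM1E => t1 z t2 dm; exact: (GM_diff3 hF det1M dm).
- rewrite -GM1E; exact: (GM_bounded hN hchi hF det1M).
Qed.

Variables (a : int -> int -> int -> C) (c : int -> C -> C -> C).
Hypothesis te : tube_expansion 1 (F3 F) a c.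

Definition A3 (T : int * (int * int)) : C := a T.2.1 T.2.2 T.1.

Lemma A3_hsum t1 z t2 : dom t1 z t2 -> hsum (fun T => A3 T * fj3 1 T t1 z t2) (F3 F t1 z t2).
Proof. by move=> dm; exact: (expansion_fj3 te dm). Qed.

Lemma dom_swap (t1 z t2 : C) : dom t1 z t2 -> dom t2 z t1.
Proof.
move=> [y1 hv]; split; last by rewrite mulrC.
by rewrite -(pmulr_rgt0 _ y1); exact: le_lt_trans (sqr_ge0 _) hv.
Qed.

Definition swap3 (T : int * (int * int)) : int * (int * int) := (T.2.1, (T.1, T.2.2)).

Lemma fj3_swap T t1 z t2 : fj3 1 (swap3 T) t1 z t2 = fj3 1 T t2 z t1 :> C.
Proof. by rewrite /fj3 /fj /= -!eD !divr1; congr e; ring. Qed.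

Lemma hsum_swap (f : int * (int * int) -> C) t1 z t2 s :
  hsum (fun T => f T * fj3 1 T t1 z t2) s -> hsum (fun T => f (swap3 T) * fj3 1 T t2 z t1) s.
Proof.
move=> h; apply: (@hsum_reindex R _ _ predT predT swap3 swap3 _ _ _ _ _ _ _ h) => //.
  by move=> [m [n r]] _; split => //; rewrite -fj3_swap.
by move=> [m [n r]] _.
Qed.

Lemma A3_swap T : A3 (swap3 T) = A3 T.
Proof.
apply: (@coef_uniq3 R 1 (F3 F) (fun T => A3 (swap3 T)) A3) => // t1 z t2 dm; last exact: A3_hsum.
by rewrite -(F3_swap hchi hpar hF dm); apply: hsum_swap; apply: A3_hsum; exact: dom_swap.
Qed.

(** [koecher] concerns exponents n / N. The expansion of F with integral exponents is the same
    series, supported on the multiples of N. *)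
Lemma F3_koecher n r m : ~~ [&& 0 <= n, 0 <= m & r ^+ 2 <= 4 * n * m] -> a n r m = 0.
Proof.
have [b [cN teN]] := GM_expansion hN hchi hF det1M; rewrite GM1E in teN.
have NZ : N%:Z != 0 by rewrite -lt0n.
have N0 : N%:R != 0 :> C by rewrite pnatr_eq0 -lt0n.
pose A' (T : int * (int * int)) := if (N%:Z %| T.2.1)%Z then A3 (T.1, ((T.2.1 %/ N%:Z)%Z, T.2.2)) else 0.
have E T : A' T = b T.2.1 T.2.2 T.1.
  apply: (@coef_uniq3 R N (F3 F) A' (fun T => b T.2.1 T.2.2 T.1)) => // t1 z t2 dm.
    apply: (@hsum_reindex R _ _ predT (fun T => (N%:Z %| T.2.1)%Z)
      (fun T => (T.1, (T.2.1 * N%:Z, T.2.2))) (fun T => (T.1, ((T.2.1 %/ N%:Z)%Z, T.2.2)))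
      _ _ _ _ _ _ _ (A3_hsum dm)) => //=.
    - by move=> S /negbTE h; rewrite /A' h mul0r.
    - move=> [m' [n' r']] _ /=; rewrite /A' /= dvdz_mull//= mulzK//; split => //; congr (_ * _).
      by rewrite /fj3 /fj /= intrM divr1 -pmulrn; congr (_ * _); congr cexp2pi; congr (_ + _); field.
    - by move=> [m' [n' r']] /= /divzK ->.
  exact: expansion_fj3 teN dm.
have := E (m, (n * N%:Z, r)); rewrite /A' /= dvdz_mull// mulzK// /A3 /= => -> h.
have -> // := koecher hN hchi hF det1M (c := cN) _ _.
  by rewrite GM1E.
apply: contraNN h => /and3P[h1 h2 h3].
have Np : 0 < N%:Z by [].
rewrite (pmulr_lge0 _ Np) in h1; rewrite h1 h2 /=.
by rewrite -(ler_pM2l Np) (le_trans h3)// le_eqVlt; apply/orP; left; apply/eqP; ring.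
Qed.

Lemma slash_up_HG l g t1 z t2 : (0 < l)%N -> Delta N l g -> dom t1 z t2 ->
  let s := (Num.sqrt (l%:R : R))%:C in
  siegel_slash k F (embed_up (tilde R g)) (siegel_mx t1 z t2) =
    HG k (fun t1 z t2 => s ^+ k * F3 F t1 z t2) s g t1 z t2.
Proof.
move=> l0 hg dm s; have [y0 _] := dm; have [hd _ _] := hg.
have lR : 0 < l%:R :> R by rewrite ltr0n.
have sR0 : Num.sqrt (l%:R : R) != 0 by rewrite gt_eqF// sqrtr_gt0.
have s0 : s != 0 by rewrite /s -(rmorph0 (real_complex R)) (inj_eq (fmorph_inj _)).
have ss : Num.sqrt (l%:R : R) ^+ 2 = l%:R by rewrite sqr_sqrtr// ltW.
have j0 := Delta_j0 l0 hg y0.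
have hE i j : (tilde R g i j)%:C = (g i j)%:~R / s.
  by rewrite /tilde hd !mxE rmorphM/= fmorphV/= rmorph_int mulrC -pmulrn.
have dt : \det (tilde R g) = 1.
  rewrite /tilde detZ det_map_mx hd/= -pmulrn exprVn ss mulVf//.
  by rewrite gt_eqF.
have := @up_eval R k F (tilde R g) t1 z t2 dt; cbv zeta; rewrite !hE => ->; last first.
  by rewrite mulrAC -mulrDl mulf_neq0// invr_eq0.
rewrite /HG; set j := _ + _ in j0 *.
rewrite (_ : (g 1 0)%:~R / s * t1 + (g 1 1)%:~R / s = j / s); last by rewrite /j; field.
rewrite -exprVn invf_div expr_div_n mulrAC mulrA mulrAC [RHS]mulrCA -!mulrA; congr (_ * (_ * _)).
rewrite /F3; congr (F (siegel_mx _ _ _)); field; rewrite ?j0 ?s0//.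
Qed.

(** Exchanging t1 and t2 interchanges the two embeddings and fixes F, so that the symmetry relation
    says that one Hecke sum is symmetric in t1 and t2. *)
Lemma slash_down_up (h : 'M[R]_2) t1 z t2 : \det h = 1 -> dom t1 z t2 ->
  siegel_slash k F (embed_down h) (siegel_mx t1 z t2) =
  siegel_slash k F (embed_up h) (siegel_mx t2 z t1).
Proof.
move=> hd dm; have dm' := dom_swap dm; have [y0 _] := dm'.
have ad : h 0 0 * h 1 1 - h 0 1 * h 1 0 = 1 by rewrite -det2.
have j0 : (h 1 0)%:C * t2 + (h 1 1)%:C != 0.
  apply: j_neq0 => //; apply: contraPT ad; rewrite negb_or !negbK => /andP[/eqP -> /eqP ->].
  by rewrite !mulr0 subr0 => /esym/eqP; rewrite oner_eq0.
rewrite down_eval// up_eval//; congr (_ * _).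
by rewrite -[LHS](F3_swap hchi hpar hF (dom_swap (dom_up ad dm'))).
Qed.

Lemma dom_Delta l g (t1 z t2 : C) (s : R) : (0 < l)%N -> Delta N l g -> s ^+ 2 = l%:R -> dom t1 z t2 ->
  let j := (g 1 0)%:~R * t1 + (g 1 1)%:~R in
  dom (((g 0 0)%:~R * t1 + (g 0 1)%:~R) / j) (s%:C * z / j) (t2 - (g 1 0)%:~R * z ^+ 2 / j).
Proof.
move=> l0 hg ss dm j; have [y0 _] := dm; have j0 := Delta_j0 l0 hg y0.
have s0 : s != 0 by apply/eqP => h; move: ss; rewrite h expr0n => /esym/eqP; rewrite pnatr_eq0 -leqn0 leqNgt l0.
have sC : s%:C != 0 by rewrite -(rmorph0 (real_complex R)) (inj_eq (fmorph_inj _)).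
have ad : (g 0 0)%:~R / s * ((g 1 1)%:~R / s) - (g 0 1)%:~R / s * ((g 1 0)%:~R / s) = 1 :> R.
  have hd : (g 0 0)%:~R * (g 1 1)%:~R - (g 0 1)%:~R * (g 1 0)%:~R = s ^+ 2 :> R.
    by rewrite ss -!intrM -intrB -det2; case: hg => -> _ _; rewrite pmulrn.
  by transitivity (((g 0 0)%:~R * (g 1 1)%:~R - (g 0 1)%:~R * (g 1 0)%:~R) / s ^+ 2); [field|rewrite hd divff// expf_neq0].
have := dom_up ad dm; rewrite !(rmorphM (real_complex R)) !(fmorphV (real_complex R)) !(rmorph_int (real_complex R)) /=.
have -> : (g 1 0)%:~R / s%:C * t1 + (g 1 1)%:~R / s%:C = j / s%:C by rewrite /j; field.
by congr dom; field; rewrite ?j0 ?sC.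
Qed.

Lemma law_scaled (x : C) gam t1 z t2 : Gamma0 N gam -> dom t1 z t2 ->
  HG k (fun t1 z t2 => x * F3 F t1 z t2) 1 gam t1 z t2 = chi (gam 1 1) * (x * F3 F t1 z t2).
Proof.
move=> hg dm; rewrite mulrCA -(GM_Gamma0 hF hg dm) /HG /GM mulrCA.
by rewrite mul1r.
Qed.

Lemma Op_scale (x : C) l H t1 z t2 :
  Op k N chi l (fun t1 z t2 => x * H t1 z t2) t1 z t2 = x * Op k N chi l H t1 z t2.
Proof.
rewrite /Op mulr_sumr; apply: eq_bigr => b _; rewrite mulr_sumr; apply: eq_bigr => d _.
by ring.
Qed.

Lemma symmetry_Op l : (0 < l)%N -> let s := (Num.sqrt (l%:R : R))%:C in
  symmetry_relation k N chi F l <->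
  forall t1 z t2 : C, dom t1 (s * z) t2 ->
    Op k N chi l (F3 F) t1 z t2 = Op k N chi l (F3 F) t2 z t1.
Proof.
move=> l0 s; have lR : 0 < l%:R :> R by rewrite ltr0n.
have sR0 : Num.sqrt (l%:R : R) != 0 by rewrite gt_eqF// sqrtr_gt0.
have ssR : Num.sqrt (l%:R : R) ^+ 2 = l%:R by rewrite sqr_sqrtr// ltW.
have s0 : s != 0 by rewrite /s -(rmorph0 (real_complex R)) (inj_eq (fmorph_inj _)).
have ss : s ^+ 2 = l%:R by rewrite /s -rmorphXn ssR rmorph_nat.
have up t1 z t2 : dom t1 (s * z) t2 ->
    coset_sum N l (fun g => (chi_mx chi g)^-1 *
      siegel_slash k F (embed_up (tilde R g)) (siegel_mx t1 (s * z) t2)) =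
    s ^+ k * Op k N chi l (F3 F) t1 z t2.
  move=> dm; rewrite -Op_scale.
  rewrite -(@coset_sum_Op R k N chi hN hchi (@dom R) _ s l t1 z t2 l0 ss).
  - by apply: coset_sum_ext => // g hg; rewrite (slash_up_HG l0 hg dm).
  - by case: dm.
  - by move=> ? ? ? [].
  - by move=> *; exact: law_scaled.
  - by move=> g hg; exact: (dom_Delta l0 hg ssR dm).
have down t1 z t2 : dom t1 (s * z) t2 ->
    coset_sum N l (fun g => (chi_mx chi g)^-1 *
      siegel_slash k F (embed_down (tilde R g)) (siegel_mx t1 (s * z) t2)) =
    s ^+ k * Op k N chi l (F3 F) t2 z t1.
  move=> dm; rewrite -up; last exact: dom_swap.
  apply: coset_sum_ext => // g [hd _ _]; rewrite slash_down_up//.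
  by rewrite /tilde detZ det_map_mx hd/= -pmulrn exprVn ssR mulVf// gt_eqF.
split=> [h t1 z t2 dm|h Z].
  have := h (siegel_mx t1 (s * z) t2) (iffRL (siegel_upperE _ _ _) dm).
  by rewrite up// down// => /(mulfI (expf_neq0 k s0)).
move=> hZ; have hZ' := hZ; case: hZ' => hT _.
have e1 : Z = siegel_mx (Z 0 0) (s * (Z 0 1 / s)) (Z 1 1).
  rewrite siegel_mxE mulrC divfK//; apply: mx2P; rewrite mk2E//.
  by rewrite -[in LHS]hT mxE.
rewrite e1 in hZ *; have dm := iffLR (siegel_upperE _ _ _) hZ.
by rewrite up// down// h.
Qed.

End FormCoefficients.

(** * Comparison of coefficients on the translates of one point *)

Section CoefficientUniqueness.
Variable R : realType.
Local Notation C := R[i].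
Local Notation e := (@cexp2pi R).

(** Only real translates of one point enter, so that the comparison also serves for the Hecke sums,
    whose expansion is established where l (Im z)^2 < Im t1 Im t2. *)
Lemma coef_uniq3_at h (g : R -> R -> R -> C) (a b : int * (int * int) -> C) (t1 z t2 : C) : (0 < h)%N ->
  (forall x1 x2 x3 : R, hsum (fun T => a T * fj3 h T (t1 + h%:R * x1%:C) (z + x2%:C) (t2 + x3%:C)) (g x1 x2 x3)) ->
  (forall x1 x2 x3 : R, hsum (fun T => b T * fj3 h T (t1 + h%:R * x1%:C) (z + x2%:C) (t2 + x3%:C)) (g x1 x2 x3)) ->
  forall T, a T = b T.
Proof.
move=> h0 ha hb T; apply/eqP; rewrite -subr_eq0.
suff : (a T - b T) * fj3 h T t1 z t2 = 0.
  by move/eqP; rewrite mulf_eq0 (negbTE (fj3_neq0 _ _ _ _ _)) orbF.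
apply: (@hsum_uniq3 R (fun T => (a T - b T) * fj3 h T t1 z t2)) => x1 x2 x3.
have := hsumB (ha x1 x2 x3) (hb x1 x2 x3); rewrite subrr.
by apply: hsum_ext => T'; rewrite (fj3_shift _ _ _ _ _ _ _ h0); exact: mul_subl.
Qed.

Lemma coef_uniq2_at (g : R -> R -> C) (a b : int * int -> C) (t z : C) :
  (forall x1 x2 : R, hsum (fun p => a p * fj 1 p.1 p.2 (t + x1%:C) (z + x2%:C)) (g x1 x2)) ->
  (forall x1 x2 : R, hsum (fun p => b p * fj 1 p.1 p.2 (t + x1%:C) (z + x2%:C)) (g x1 x2)) ->
  forall p, a p = b p.
Proof.
move=> ha hb p; apply/eqP; rewrite -subr_eq0.
suff : (a p - b p) * fj 1 p.1 p.2 t z = 0.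
  by move/eqP; rewrite mulf_eq0 (negbTE (e_neq0 _)) orbF.
apply: (@hsum_uniq2 R (fun p => (a p - b p) * fj 1 p.1 p.2 t z)) => x1 x2.
have := hsumB (ha x1 x2) (hb x1 x2); rewrite subrr.
apply: hsum_ext => q; rewrite fj_shift2 -[x1%:C]mul1r.
have [->|//] := @fj_shift R 1 q.1 q.2 t z x1.
by rewrite -![fj _ _ _ _ _ * _ * _]mulrA; exact: mul_subl.
Qed.

Lemma coef_uniq1_at (g : R -> C) (p q : int -> C) (t : C) :
  (forall x : R, hsum (fun m => p m * e (m%:~R * (t + x%:C))) (g x)) ->
  (forall x : R, hsum (fun m => q m * e (m%:~R * (t + x%:C))) (g x)) ->
  forall m, p m = q m.
Proof.
move=> hp hq m; apply: (mulIf (e_neq0 (m%:~R * t))).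
apply: (@hsum_uniq1' R (fun m => p m * e (m%:~R * t)) (fun m => q m * e (m%:~R * t)) g) => x.
  by apply: hsum_ext (hp x) => n; rewrite mulrDr eD mulrA.
by apply: hsum_ext (hq x) => n; rewrite mulrDr eD mulrA.
Qed.

Lemma dom_ex (t1 z : C) : 0 < complex.Im t1 -> exists t2, dom t1 z t2.
Proof.
move=> y0; exists (0 +i* ((complex.Im z ^+ 2 + 1) / complex.Im t1)); split=> //=.
by rewrite mulrC divfK ?gt_eqF// ltrDl.
Qed.

Lemma dom_shift3 (t1 z t2 : C) (x : R) : dom t1 z t2 -> dom t1 z (t2 + x%:C).
Proof. by rewrite /dom ImD /= addr0. Qed.

End CoefficientUniqueness.

(** * Fourier-Jacobi coefficients and lifts *)

Section JacobiCoefficients.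
Variables (R : realType) (k N : nat) (chi : int -> R[i]) (F : 'M[R[i]]_2 -> R[i]).
Local Notation C := R[i].
Local Notation e := (@cexp2pi R).
Hypothesis hN : (0 < N)%N.
Hypothesis hchi : dirichlet_char N chi.
Hypothesis hpar : chi (-1) = (-1) ^+ k.
Hypothesis hF : siegel_form k N chi F.
Variables (a : int -> int -> int -> C) (c : int -> C -> C -> C).
Hypothesis te : tube_expansion 1 (F3 F) a c.
Local Notation A := (A3 a).

Lemma Op_F3_hsum l t1 z t2 : (0 < l)%N -> dom t1 ((Num.sqrt (l%:R : R))%:C * z) t2 ->
  hsum (fun T => W k N chi l A T * fj3 1 T t1 z t2) (Op k N chi l (F3 F) t1 z t2).
Proof.
move=> l0 [y0 hv]; apply: Op_expansion => // x b xl _; apply: (A3_hsum te).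
have x0 : (0 < x)%N by exact: dvdn_gt0 xl.
have d0 : (0 < l %/ x)%N by rewrite divn_gt0// dvdn_leq.
have xR : 0 < x%:R :> R by rewrite ltr0n. have dR : 0 < (l %/ x)%:R :> R by rewrite ltr0n.
have lR : 0 <= l%:R :> R by rewrite ler0n.
have e1 : complex.Im ((x%:R * t1 + b%:R) / (l %/ x)%:R) = x%:R * complex.Im t1 / (l %/ x)%:R.
  by rewrite Im_divn ImD Im_natM natC/= addr0.
rewrite /dom e1 Im_natM; split; first by rewrite divr_gt0 ?mulr_gt0.
move: hv; rewrite ImM/= mul0r addr0 exprMn sqr_sqrtr// => hv.
have e2 : l%:R = x%:R * (l %/ x)%:R :> R by rewrite -natrM mulnC divnK.
rewrite -(ltr_pM2r dR) (_ : x%:R * complex.Im t1 / (l %/ x)%:R * complex.Im t2 * (l %/ x)%:R =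
  x%:R * (complex.Im t1 * complex.Im t2)); last by field; exact: lt0r_neq0.
rewrite exprMn (_ : x%:R ^+ 2 * complex.Im z ^+ 2 * (l %/ x)%:R = x%:R * (l%:R * complex.Im z ^+ 2)); last by rewrite e2; ring.
by rewrite ltr_pM2l.
Qed.

Lemma symmetry_W l : (0 < l)%N -> symmetry_relation k N chi F l <->
  forall T, W k N chi l A (swap3 T) = W k N chi l A T.
Proof.
move=> l0; apply: (iff_trans (symmetry_Op hN hchi hpar hF l0)).
set s := (_%:C); split=> [h T|h t1 z t2 dm].
  have [t2 dm] := @dom_ex R 'i 0 (ltr01 : 0 < complex.Im ('i : C)).
  have dmx x1 x2 x3 : dom ('i + 1%:R * x1%:C) (s * (0 + x2%:C)) (t2 + x3%:C).
    have := dom_shift x1 (Num.sqrt (l%:R : R) * x2) x3 1 dm.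
    by rewrite add0r add0r rmorphM.
  apply: (@coef_uniq3_at R 1 (fun x1 x2 x3 => Op k N chi l (F3 F) ('i + 1%:R * x1%:C) (0 + x2%:C) (t2 + x3%:C))
    (fun T => W k N chi l A (swap3 T)) (W k N chi l A) 'i 0 t2) => // x1 x2 x3.
    by rewrite h//; apply: hsum_swap; apply: Op_F3_hsum => //; exact: dom_swap.
  exact: Op_F3_hsum.
have h1 := Op_F3_hsum l0 dm; have h2 := hsum_swap (Op_F3_hsum l0 (dom_swap dm)).
by apply: (hsum_uniq h1); apply: hsum_ext h2 => T; rewrite h.
Qed.

Section Slice.
Variable M : 'M[int]_2.
Hypothesis hM : \det M = 1.
Variables (aM : int -> int -> int -> C) (cM : int -> C -> C -> C).
Hypothesis teM : tube_expansion N (GM k F M) aM cM.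

Lemma GM_slice m t1 z : 0 < complex.Im t1 -> let j := (M 1 0)%:~R * t1 + (M 1 1)%:~R in
  cM m t1 z = j ^- k * e (- (m%:~R * ((M 1 0)%:~R * z ^+ 2 / j))) *
    c m (((M 0 0)%:~R * t1 + (M 0 1)%:~R) / j) (z / j).
Proof.
move=> y0 j; have [t2 dm] := dom_ex z y0.
have [_ h _] := te; have [_ hM' _] := teM.
apply: (@coef_uniq1_at R (fun x => GM k F M t1 z (t2 + x%:C)) (fun m => cM m t1 z)
   (fun m => j ^- k * e (- (m%:~R * ((M 1 0)%:~R * z ^+ 2 / j))) *
    c m (((M 0 0)%:~R * t1 + (M 0 1)%:~R) / j) (z / j)) t2) => x.
  by apply: hM'; exact: dom_shift3.
have := hsumZ (j ^- k) (h _ _ _ (M_dom hM (dom_shift3 x dm))).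
apply: hsum_ext => n; rewrite -/j; set w := (M 1 0)%:~R * z ^+ 2 / j.
have -> : e (n%:~R * (t2 + x%:C - w)) = e (n%:~R * (t2 + x%:C)) * e (- (n%:~R * w)).
  by rewrite -eD; congr cexp2pi; ring.
by move: (e _) (e _) => E1 E2; ring.
Qed.

Lemma slice1_slash t1 z : 0 < complex.Im t1 -> cM 1 t1 z = jacobi_slash k 1 (c 1) M t1 z.
Proof.
by move=> y0; rewrite GM_slice// /jacobi_slash hM !mul1r.
Qed.

End Slice.

Lemma c_Gamma0 m g t1 z : Gamma0 N g -> 0 < complex.Im t1 ->
  let j := (g 1 0)%:~R * t1 + (g 1 1)%:~R in
  j ^- k * e (- (m%:~R * ((g 1 0)%:~R * z ^+ 2 / j))) *
    c m (((g 0 0)%:~R * t1 + (g 0 1)%:~R) / j) (z / j) = chi (g 1 1) * c m t1 z.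
Proof.
move=> hg y0 j; have hd : \det g = 1 by case: hg.
have [aM [cM teM]] := GM_expansion hN hchi hF hd.
rewrite -(GM_slice hd teM m z y0); have [t2 dm] := dom_ex z y0.
have [_ h _] := te; have [_ hM' _] := teM.
apply: (@coef_uniq1_at R (fun x => GM k F g t1 z (t2 + x%:C)) (fun m => cM m t1 z)
   (fun m => chi (g 1 1) * c m t1 z) t2) => x.
  by apply: hM'; exact: dom_shift3.
rewrite (GM_Gamma0 hF hg (dom_shift3 x dm)).
have := hsumZ (chi (g 1 1)) (h _ _ _ (dom_shift3 x dm)).
by apply: hsum_ext => n; rewrite mulrA.
Qed.

Lemma c_elliptic m (la mu : int) t1 z : 0 < complex.Im t1 ->
  e (m%:~R * (la%:~R ^+ 2 * t1 + 2 * la%:~R * z)) * c m t1 (z + la%:~R * t1 + mu%:~R) = c m t1 z.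
Proof.
move=> y0; have [t2 dm] := dom_ex z y0; have [_ h _] := te.
apply: (@coef_uniq1_at R (fun x => F3 F t1 z (t2 + x%:C))
   (fun m => e (m%:~R * (la%:~R ^+ 2 * t1 + 2 * la%:~R * z)) * c m t1 (z + la%:~R * t1 + mu%:~R))
   (fun m => c m t1 z) t2) => x; last by apply: h; exact: dom_shift3.
have dmx := dom_shift3 x dm.
have dm2 : dom t1 (z + la%:~R * t1) (t2 + x%:C + 2 * la%:~R * z + la%:~R ^+ 2 * t1).
  have := @dom_unimod R 1 0 la 1 t1 z (t2 + x%:C) _ dmx.
  rewrite (_ : 1 * 1 - 0 * la = 1); last by ring.
  move=> /(_ erefl); congr dom; rewrite ?(mulr0z, mulr1z); ring.
have dm3 : dom t1 (z + la%:~R * t1 + mu%:~R) (t2 + x%:C + 2 * la%:~R * z + la%:~R ^+ 2 * t1).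
  by move: dm2; rewrite /dom [complex.Im (_ + mu%:~R)]ImD (intr_real R mu) [complex.Im (_%:C)]/= addr0.
have E : F3 F t1 z (t2 + x%:C) =
   F3 F t1 (z + la%:~R * t1 + mu%:~R) (t2 + x%:C + 2 * la%:~R * z + la%:~R ^+ 2 * t1).
  rewrite -(F3_heis hchi hpar hF la dmx).
  by have := F3_trans hchi hF 0 mu 0 dm2; rewrite !mulr0z !addr0 => ->.
rewrite E; apply: hsum_ext (h _ _ _ dm3) => n.
have -> : e (n%:~R * (t2 + x%:C + 2 * la%:~R * z + la%:~R ^+ 2 * t1)) =
    e (n%:~R * (la%:~R ^+ 2 * t1 + 2 * la%:~R * z)) * e (n%:~R * (t2 + x%:C)).
  by rewrite -eD; congr cexp2pi; ring.
by rewrite mulrCA mulrA.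
Qed.

Lemma c_diff m (t z : C) : 0 < complex.Im t ->
  differentiable (fun p : C * C => c m p.1 p.2) (t, z).
Proof.
move=> y0; have [dec _ hc] := te; have [d [d0 hb]] := decays_asum2 m z dec y0.
pose d' := Num.min d (complex.Im t).
have d'0 : 0 < d' by rewrite lt_min d0.
have nd : d' <= d by rewrite ge_min lexx.
have p0 : 0 < pi :> R := pi_gt0 R.
apply: (@series_differentiable R _ (fun p : int * int => a p.1 p.2 m) fst snd (fun p => c m p.1 p.2) t z d') => //.
  apply: bsum_le hb => p; rewrite /fj divr1 ler_wpM2l ?nm_ge0// ler_expR.
  by rewrite ler_wpM2r ?addr_ge0 ?aint_ge0// ler_wpM2l// mulr_ge0// ltW.
move=> h1 h2 n1 _; have y1 : 0 < complex.Im (t + h1).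
  have := nm_Im h1; have : d' <= complex.Im t by rewrite ge_min lexx orbT.
  by rewrite ImD; have := ler_norm (- complex.Im h1); rewrite normrN; lra.
by have := hc m (t + h1) (z + h2) y1; apply: hsum_ext => p; rewrite /fj divr1.
Qed.

(** The condition at each cusp is the Koecher principle for [GM k F M], whose slice of index 1 is
    [c 1] slashed with M. *)
Lemma c1_jacobi_form : jacobi_form k 1 N chi (c 1).
Proof.
split.
- by move=> tau z y0; exact: c_diff.
- move=> g hg tau z y0; have := c_Gamma0 1 z hg y0; cbv zeta => <-.
  by rewrite /jacobi_slash; case: hg => -> _ _; rewrite !mul1r.
- by move=> la mu tau z y0; have := c_elliptic 1 la mu z y0.
- move=> M hM; have [aM [cM teM]] := GM_expansion hN hchi hF hM.
  exists (fun n r => aM n r 1); split.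
    move=> tau z y0; apply/hsum_totally; rewrite -(slice1_slash hM teM z y0).
    by have [_ _ h] := teM; exact: h.
  move=> n r hnr; apply: (koecher hN hchi hF hM teM).
  by rewrite !negb_and; rewrite mulr1 in hnr *; rewrite hnr !orbT.
Qed.

Lemma c1_expansion : fourier_jacobi_expansion 1 (c 1) (fun n r => a n r 1).
Proof. by move=> tau z y0; apply/hsum_totally; have [_ _ h] := te; exact: h. Qed.

End JacobiCoefficients.

(** * The index-shift operators on coefficients *)

Section IndexShift.
Variables (R : realType) (k N : nat) (chi : int -> R[i]).
Local Notation C := R[i].
Local Notation e := (@cexp2pi R).
Hypothesis hN : (0 < N)%N.
Hypothesis hchi : dirichlet_char N chi.

Definition lift2 (c : int -> int -> C) (T : int * (int * int)) : C := c T.2.1 T.2.2.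

Lemma limn_hsum (f : nat -> C) (s : C) : hsum f s ->
  limn (fun n => \sum_(1 <= m < n) f m) = s - f 0%N.
Proof.
move=> hf; apply: cvg_lim; first exact: norm_hausdorff.
move=> P /nbhs_nm[d [d0 hP]].
have d2 : 0 < d / 2 by rewrite divr_gt0.
have [n0 hn] := hsum_nat_cvg hf d2.
exists n0.+1 => // n /= nn; apply: hP.
have n1 : (0 < n)%N by exact: leq_ltn_trans nn.
have := hn n (ltnW nn); rewrite -(big_mkord xpredT f) big_ltn// => h.
rewrite (_ : _ - _ = f 0%N + \sum_(1 <= m < n) f m - s); last by ring.
by apply: (le_lt_trans h); rewrite ltr_pdivrMr// ltr_pMr// ltr1n.
Qed.

Variables (Phi : C -> C -> C) (c : int -> int -> C).
Hypothesis Plaw : forall g, Gamma0 N g -> forall tau z : C, 0 < complex.Im tau ->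
  jacobi_slash k 1 Phi g tau z = chi (g 1 1) * Phi tau z.
Hypothesis Pexp : fourier_jacobi_expansion 1 Phi c.

Lemma Phi_hsum tau z : 0 < complex.Im tau -> hsum (fun p => c p.1 p.2 * fj 1 p.1 p.2 tau z) (Phi tau z).
Proof. by move=> y0; apply/hsum_totally; exact: Pexp. Qed.

(** With the factor e(t2) the Jacobi form obeys, under the upward embedding, the law of a form in
    three variables, so that [Op] computes V_l as well. *)
Definition PhiE (t1 z t2 : C) : C := Phi t1 z * e t2.
Definition only1 (T : int * (int * int)) : C := if T.1 == 1 then lift2 c T else 0.

Lemma PhiE_hsum t1 z t2 : 0 < complex.Im t1 ->
  hsum (fun T => only1 T * fj3 1 T t1 z t2) (PhiE t1 z t2).
Proof.
move=> y0; have := hsumZr (e t2) (Phi_hsum z y0).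
apply: (@hsum_reindex R _ _ predT (fun T : int * (int * int) => T.1 == 1) (fun p => (1, p)) snd) => //=.
- by move=> T /negbTE h; rewrite /only1 h mul0r.
- move=> [n r] _; split => //; rewrite /only1 eqxx /lift2 /fj3/= mulrA; congr (_ * _).
  by rewrite mul1r.
- by move=> [m p] /= /eqP ->.
Qed.

Lemma index_shift_Op l tau z : (0 < l)%N -> 0 < complex.Im tau ->
  index_shift k N chi l Phi tau z = l%:R ^+ k.-1 * Op k N chi l PhiE tau z 0.
Proof.
move=> l0 y0; congr (_ * _); set s := (Num.sqrt (l%:R : R))%:C.
have ss : s ^+ 2 = l%:R by rewrite /s -rmorphXn sqr_sqrtr ?ler0n// rmorph_nat.
rewrite -(@coset_sum_Op R k N chi hN hchi (fun t1 _ _ => 0 < complex.Im t1) PhiE s l tau z 0 l0 ss) //.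
- apply: coset_sum_ext => // g hg; congr (_ * _).
  have j0 := Delta_j0 l0 hg y0; have [hd _ _] := hg.
  rewrite /jacobi_slash hd /HG /PhiE; set j := _ + _ in j0 *.
  rewrite -pmulrn (_ : s * (s * z) / j = l%:R * z / j); last by rewrite mulrA -expr2 ss.
  rewrite exprMn ss sub0r mul1r -[LHS]mulrA; congr (_ * _); rewrite mulrC; congr (_ * e (- _)).
  by field.
- move=> gam t1 w t2 hg y1; have := Plaw hg w y1.
  rewrite /jacobi_slash /HG /PhiE; case: (hg) => -> _ _; set j := _ + _.
  rewrite !mul1r => h; rewrite mulrA -h eD.
  by move: (Phi _ _) (e _) (e _) (j ^- k) => E1 E2 E3 E4; ring.
- move=> g hg; have [t2 dm] := dom_ex z y0.
  by have [] := dom_Delta l0 hg (_ : Num.sqrt (l%:R : R) ^+ 2 = l%:R) dm; rewrite ?sqr_sqrtr ?ler0n.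
Qed.

Lemma index_shift_hsum l tau z : (0 < l)%N -> 0 < complex.Im tau ->
  hsum (fun p => l%:R ^+ k.-1 * W k N chi l (lift2 c) (1, p) * fj 1 p.1 p.2 tau z)
    (index_shift k N chi l Phi tau z).
Proof.
move=> l0 y0; rewrite index_shift_Op//.
have h : hsum (fun T => W k N chi l only1 T * fj3 1 T tau z 0) (Op k N chi l PhiE tau z 0).
  apply: Op_expansion => // x b xl _; apply: PhiE_hsum.
  have x0 : (0 < x)%N by exact: dvdn_gt0 xl.
  have d0 : (0 < l %/ x)%N by rewrite divn_gt0// dvdn_leq.
  by rewrite Im_divn ImD Im_natM natC/= addr0 divr_gt0 ?mulr_gt0 ?ltr0n.
have := hsumZ (l%:R ^+ k.-1) h.
apply: (@hsum_reindex R _ _ (fun T : int * (int * int) => T.1 == 1) predT snd (fun p => (1, p))) => //=.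
- move=> T /negbTE hT; rewrite /W big1 ?mul0r ?mulr0// => x _.
  by rewrite /Wterm /only1/= hT mulr0 if_same !mulr0.
- move=> [m p] /= /eqP ->; split => //; rewrite -mulrA; congr (_ * (_ * _)).
  by rewrite /fj3/= mulr0 e0 mulr1.
Qed.

End IndexShift.

(** * From the symmetry relations to the lift *)

Section SymmetricImpliesLift.
Variables (R : realType) (k N : nat) (chi : int -> R[i]) (F : 'M[R[i]]_2 -> R[i]).
Local Notation C := R[i].
Local Notation e := (@cexp2pi R).
Hypothesis hk : (0 < k)%N.
Hypothesis hN : (0 < N)%N.
Hypothesis hchi : dirichlet_char N chi.
Hypothesis hpar : chi (-1) = (-1) ^+ k.
Hypothesis hF : siegel_form k N chi F.
Variables (a : int -> int -> int -> C) (c : int -> C -> C -> C).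
Hypothesis te : tube_expansion 1 (F3 F) a c.
Local Notation A := (A3 a).

Lemma c_neg m t1 z : m < 0 -> 0 < complex.Im t1 -> c m t1 z = 0.
Proof.
move=> m0 y0; have [_ _ h] := te; apply: (hsum_uniq (h m t1 z y0)).
apply: (@hsum_ext _ R (fun=> 0)); last exact: hsum0.
move=> p; rewrite (F3_koecher hN hchi hF te) ?mul0r//.
by rewrite !negb_and -(ltNge m) m0 orbT.
Qed.

Lemma c_nat_hsum t1 z t2 : dom t1 z t2 -> hsum (fun m : nat => c m%:Z t1 z * e (m%:R * t2)) (F3 F t1 z t2).
Proof.
move=> dm; have [y0 _] := dm; have [_ h _] := te.
apply: (@hsum_reindex R _ _ (fun m : int => 0 <= m) predT (fun m => `|m|%N) Posz _ _ _ _ _ _ _ (h _ _ _ dm)) => //=.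
- by move=> m; rewrite -ltNge => m0; rewrite c_neg ?mul0r.
- by case=> m // _; split => //; rewrite -pmulrn.
Qed.

Lemma F3_limn t1 z t2 : dom t1 z t2 ->
  F3 F t1 z t2 = c 0 t1 z + limn (fun n => \sum_(1 <= m < n) c m%:Z t1 z * e (m%:R * t2)).
Proof. by move=> dm; rewrite (limn_hsum (c_nat_hsum dm)) mul0r e0 mulr1 addrC subrK. Qed.

Lemma c0_hsum t1 z : 0 < complex.Im t1 -> hsum (fun n : nat => a n%:Z 0 0 * e (n%:R * t1)) (c 0 t1 z).
Proof.
move=> y0; have [_ _ h] := te.
apply: (@hsum_reindex R _ _ (fun p : int * int => (0 <= p.1) && (p.2 == 0)) predT
   (fun p => `|p.1|%N) (fun n => (n%:Z, 0)) _ _ _ _ _ _ _ (h 0 t1 z y0)) => //=.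
- move=> [n r] /= hnr; rewrite (F3_koecher hN hchi hF te) ?mul0r//.
  apply: contra hnr => /and3P[-> _]; rewrite mulr0 => r2 /=.
  by rewrite -sqrf_eq0; apply/eqP/le_anti; rewrite r2 sqr_ge0.
- move=> [[n|n] r] //= /eqP ->; split => //; congr (_ * _).
  by rewrite /fj divr1 mul0r addr0 -pmulrn.
Qed.

(** For n = 1 only the divisor 1 of l contributes, since every other one fails to divide n; W_l A is
    then a single coefficient of F. *)
Lemma W_row1 l m r : (0 < l)%N -> l%:R ^+ k.-1 * W k N chi l A (m, (1, r)) = a l%:Z r m.
Proof.
move=> l0; have lC : l%:R != 0 :> C by rewrite pnatr_eq0 -lt0n.
rewrite /W big_mkcond (bigD1_seq 1%N) ?divisors_uniq//=; last by rewrite -dvdn_divisors// dvd1n.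
rewrite coprime1n big1_seq ?addr0; last first.
  move=> x /andP[x1 _]; rewrite /Wterm/=.
  suff -> : (x%:Z %| 1)%Z = false by rewrite !mulr0 if_same.
  by apply/negbTE; apply: contra x1; rewrite dvdzE/= dvdn1.
rewrite (chi1 hchi) mul1r divn1 /Wterm/= !dvd1z/= !divz1 mul1r /A3/=.
have -> : l%:R ^- k = (l%:R ^+ k.-1 * l%:R)^-1 :> C by rewrite -exprSr prednK.
have lk : l%:R ^+ k.-1 != 0 :> C by rewrite expf_neq0.
by field; rewrite lC lk.
Qed.

Hypothesis sym : forall l, (0 < l)%N -> forall T, W k N chi l A (swap3 T) = W k N chi l A T.

Lemma coef_W l n r : (0 < l)%N -> a n r l%:Z = l%:R ^+ k.-1 * W k N chi l A (1, (n, r)).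
Proof.
move=> l0; rewrite -(sym l0) /swap3/= W_row1//.
by have := A3_swap hchi hpar hF te (n, (l%:Z, r)); rewrite /A3/=.
Qed.

Lemma c_index_shift l t1 z : (0 < l)%N -> 0 < complex.Im t1 ->
  index_shift k N chi l (c 1) t1 z = c l%:Z t1 z.
Proof.
move=> l0 y0; have [_ _ h] := te.
have [_ law _ _] := c1_jacobi_form hN hchi hpar hF te.
have h1 := index_shift_hsum hN hchi law (c1_expansion te) z l0 y0.
apply: (hsum_uniq h1); apply: hsum_ext (h l%:Z t1 z y0) => -[n r] /=.
by rewrite coef_W.
Qed.

Lemma coef_sigma n : (0 < n)%N -> a n%:Z 0 0 = a 0 0 1 * sigma_char k chi n.
Proof.
move=> n0; have -> : a n%:Z 0 0 = a 0 0 n%:Z.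
  by have := A3_swap hchi hpar hF te (n%:Z, (0, 0)); rewrite /A3/=.
rewrite coef_W// /W /sigma_char !mulr_sumr big_mkcond big_seq [RHS]big_seq.
apply: eq_bigr => x; rewrite -dvdn_divisors// => xn.
have x0 : (0 < x)%N by exact: dvdn_gt0 xn.
have d0 : (0 < n %/ x)%N by rewrite divn_gt0// dvdn_leq.
case: ifPn => cop; last first.
  have /eqP -> : chi x%:Z == 0 by rewrite (chi_eq0 hchi).
  by rewrite mul0r mulr0.
rewrite /Wterm/= !dvdz0/= !div0z mul0r /A3/=.
have dC : (n %/ x)%:R != 0 :> C by rewrite pnatr_eq0 -lt0n.
have nE : n%:R = x%:R * (n %/ x)%:R :> C by rewrite -natrM mulnC divnK.
have -> : (n %/ x)%:R ^- k = ((n %/ x)%:R ^+ k.-1 * (n %/ x)%:R)^-1 :> C by rewrite -exprSr prednK.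
rewrite nE exprMn.
have dk : (n %/ x)%:R ^+ k.-1 != 0 :> C by rewrite expf_neq0.
by field; rewrite dC dk.
Qed.

Lemma symmetric_lift : a 0 0 0 = a 0 0 1 * (- gen_bernoulli k N chi / (2 * k%:R)) ->
  is_sk_lift k N chi F.
Proof.
move=> ha; exists (c 1), (fun n r => a n r 1); split.
- exact: c1_jacobi_form te.
- exact: c1_expansion te.
move=> t1 z t2 /siegel_upperE dm; have [y0 _] := dm.
rewrite -[LHS]/(F3 F t1 z t2) F3_limn// /sk_lift; congr (_ + _); last first.
  congr (limn _); apply: funext => n; rewrite big_nat_cond [RHS]big_nat_cond.
  by apply: eq_bigr => m /andP[/andP[m0 _] _]; rewrite c_index_shift.
rewrite /eisenstein mulrDr -ha; have hc0 := c0_hsum z y0.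
have := limn_hsum hc0; rewrite mul0r e0 mulr1 => h.
transitivity (a 0 0 0 + (c 0 t1 z - a 0%:Z 0 0)); first by rewrite addrC subrK.
rewrite -h; congr (_ + _).
have E n : \sum_(1 <= m < n) a m%:Z 0 0 * e (m%:R * t1) =
    a 0 0 1 * \sum_(1 <= m < n) sigma_char k chi m * e (m%:R * t1).
  rewrite mulr_sumr big_nat_cond [RHS]big_nat_cond; apply: eq_bigr => m /andP[/andP[m0 _] _].
  by rewrite coef_sigma// mulrA.
(* For a(0, 0, 1) != 0 the divisor series converges because c_0 does, and its limit is read off
   after division. Otherwise both sides are 0, whatever value [limn] takes. *)
have [a0|a0] := eqVneq (a 0 0 1) 0.
  rewrite a0 mul0r; rewrite (_ : (fun n => _) = fun=> 0); first by rewrite lim_cst//; exact: norm_hausdorff.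
  by apply: funext => n; rewrite E a0 mul0r.
have hs : hsum (fun n : nat => (a 0 0 1)^-1 * (a n%:Z 0 0 * e (n%:R * t1))) ((a 0 0 1)^-1 * c 0 t1 z).
  exact: hsumZ.
have := limn_hsum hs; rewrite mul0r e0 mulr1 -mulrBr -h => h'.
apply: (mulfI (_ : (a 0 0 1)^-1 != 0)); first by rewrite invr_eq0.
rewrite mulKf// -h'; congr (limn _); apply: funext => n.
by rewrite -mulr_sumr E mulKf.
Qed.

End SymmetricImpliesLift.

(** * The Maass relation implies the symmetry *)

Section DivisorPairs.
Local Open Scope nat_scope.
Variables (l rho : nat).
Hypothesis l0 : 0 < l.

(** The index set of W_l A after substitution of the Maass relation: a = p.1 comes from W_l, and x =
    p.2 from the relation for the coefficient at ((n / a) (l / a), r / a, m). Here rho is |r|, and a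
    x | rho encodes that x divides r / a. *)
Definition dpair (n m : nat) (p : nat * nat) : bool :=
  [&& p.1 %| l, p.1 %| n, p.2 %| (n %/ p.1) * (l %/ p.1), p.2 %| m & p.1 * p.2 %| rho].

Definition dflip (n m : nat) (p : nat * nat) : nat * nat :=
  let E := p.1 * p.2 in let a0 := gcdn E m %/ p.2 in (a0 * (E %/ gcdn E n), gcdn E n %/ a0).

Lemma dpair_pos n m p : 0 < n + m -> dpair n m p -> 0 < p.1 /\ 0 < p.2.
Proof.
move=> nm0 /and5P[h1 h2 h3 h4 _]; have a0 : 0 < p.1 by exact: dvdn_gt0 h1.
split=> //; rewrite lt0n; apply/eqP => x0; move: h3 h4; rewrite x0 !dvd0n => h3 /eqP m0.
move: nm0; rewrite m0 addn0 => n0.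
have h5 : 0 < n %/ p.1 by rewrite divn_gt0//; exact: dvdn_leq.
have h6 : 0 < l %/ p.1 by rewrite divn_gt0//; exact: dvdn_leq.
by move: h3; rewrite eqn0Ngt muln_gt0 h5 h6.
Qed.

Lemma dvdn_mul_gcd (u v x y : nat) : (u %| v * gcdn x y) = (u %| v * x) && (u %| v * y).
Proof. by rewrite muln_gcdr dvdn_gcd. Qed.

(* With E = ax fixed, write x = gcd(E, m) / a0 and a = a0 E / gcd(E, m): the
   conditions on (a, x) become a0 | n, m, l, E and a0 E | nm, lm, nl and
   a0 E^2 | nml, which are symmetric in n and m. *)
Lemma dflipP n m p : 0 < n + m -> dpair n m p ->
  [/\ dpair m n (dflip n m p), (dflip n m p).1 * (dflip n m p).2 = p.1 * p.2
    & dflip m n (dflip n m p) = p].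
Proof.
move=> nm0 hp; have [a_gt0 x_gt0] := dpair_pos nm0 hp; case: p hp a_gt0 x_gt0 => a x.
rewrite /dpair /dflip /= => /and5P[al an xnl xm axr] a_gt0 x_gt0.
set E := a * x; have E0 : 0 < E by rewrite muln_gt0 a_gt0.
set gm := gcdn E m; set gn := gcdn E n.
have gm0 : 0 < gm by rewrite gcdn_gt0 E0.
have gn0 : 0 < gn by rewrite gcdn_gt0 E0.
have xgm : x %| gm by rewrite dvdn_gcd xm dvdn_mull.
set a0 := gm %/ x; have gmE : gm = a0 * x by rewrite /a0 divnK.
have a00 : 0 < a0 by rewrite divn_gt0//; exact: dvdn_leq.
have gmdE : gm %| E by exact: dvdn_gcdl.
have gndE : gn %| E by exact: dvdn_gcdl.
set mu := E %/ gm; have muE : E = mu * gm by rewrite /mu divnK.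
have amu : a = mu * a0.
  by apply/eqP; rewrite -(eqn_pmul2r x_gt0) -mulnA -gmE -muE.
have a0E : a0 %| E by rewrite (dvdn_trans _ gmdE)// gmE dvdn_mulr.
have a0m : a0 %| m by rewrite (dvdn_trans _ (dvdn_gcdr E m))// -/gm gmE dvdn_mulr.
have a0a : a0 %| a by rewrite amu dvdn_mull.
have a0n : a0 %| n by exact: dvdn_trans an.
have a0gn : a0 %| gn by rewrite dvdn_gcd a0E.
have dE (v : nat) : (a %| v) = (a0 * E %| v * gm).
  by rewrite muE mulnA dvdn_pmul2r// amu mulnC.
have aEnl : a * E %| n * l.
  move: xnl; rewrite -(dvdn_pmul2r a_gt0) -(dvdn_pmul2r a_gt0) /E mulnA.
  rewrite (_ : x * a * a = a * a * x); last by ring.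
  rewrite (_ : n %/ a * (l %/ a) * a * a = (n %/ a * a) * (l %/ a * a)); last by ring.
  by rewrite !divnK.
have := dE n; rewrite an dvdn_mul_gcd => /esym/andP[_ h_nm].
have := dE l; rewrite al dvdn_mul_gcd => /esym/andP[_ h_lm].
have h_nlm : a0 * E * E %| n * l * m.
  have : a * E * gm %| n * l * gm by rewrite dvdn_pmul2r.
  rewrite dvdn_mul_gcd => /andP[_ h].
  by rewrite (dvdn_trans _ h)// {1}muE amu; apply/dvdnP; exists 1; ring.
set a' := a0 * (E %/ gn); set x' := gn %/ a0.
have a'x' : a' * x' = E by rewrite /a' /x' mulnAC [a0 * _]mulnC divnK// mulnC divnK.
have a'gn : a' * gn = a0 * E by rewrite /a' -mulnA divnK.
have d'E (v : nat) : (a' %| v) = (a0 * E %| v * gn) by rewrite -(dvdn_pmul2r gn0) a'gn.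
have a'0 : 0 < a' by rewrite muln_gt0 a00 divn_gt0//; exact: dvdn_leq.
have a'l : a' %| l.
  rewrite d'E dvdn_mul_gcd dvdn_mul ?(dvdn_trans a0a al)//=.
  by rewrite (mulnC l) (dvdn_trans _ aEnl)// dvdn_mul.
have a'm : a' %| m by rewrite d'E dvdn_mul_gcd dvdn_mul//= (mulnC m).
have x'n : x' %| n.
  by rewrite (dvdn_trans _ (dvdn_gcdr E n))//; apply/dvdnP; exists a0; rewrite mulnC divnK.
have x'ml : x' %| m %/ a' * (l %/ a').
  rewrite -(dvdn_pmul2r a'0) -(dvdn_pmul2r a'0).
  rewrite (_ : x' * a' * a' = a' * (a' * x')); last by ring.
  rewrite (_ : m %/ a' * (l %/ a') * a' * a' = (m %/ a' * a') * (l %/ a' * a')); last by ring.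
  rewrite !divnK// a'x' -(dvdn_pmul2r gn0) mulnAC a'gn dvdn_mul_gcd; apply/andP; split.
    by rewrite dvdn_mul// (_ : m * l = l * m) // mulnC.
  by rewrite (_ : m * l * n = n * l * m)//; ring.
have a0' : gn %/ x' = a0.
  by rewrite -{1}(divnK a0gn) -/x' mulKn// divn_gt0//; exact: dvdn_leq.
split=> //; first by rewrite a'l a'm x'ml x'n a'x' axr.
rewrite a'x' -/gn -/gm a0' -/mu mulnC -amu; congr (_, _).
by rewrite gmE mulKn.
Qed.

(** One box serves both orders: the bound l (n + m) imposed on B is symmetric in n and m. *)
Definition dpairs (B n m : nat) : seq (nat * nat) :=
  [seq p <- [seq (a, x) | a <- iota 1 B, x <- iota 1 B] | dpair n m p].

Lemma dpairs_uniq B n m : uniq (dpairs B n m).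
Proof.
apply: filter_uniq; apply: allpairs_uniq; rewrite ?iota_uniq//.
by move=> [? ?] [? ?] _ _ /= [-> ->].
Qed.

Lemma mem_dpairs B n m p : 0 < n + m -> l * (n + m) <= B -> (p \in dpairs B n m) = dpair n m p.
Proof.
move=> nm0 hB; rewrite mem_filter andbC; case hp : (dpair n m p); last by rewrite andbF.
rewrite andbT; have [a0 x0] := dpair_pos nm0 hp; case: p hp a0 x0 => a x hp a0 x0.
have /and5P[/= h1 h2 h3 h4 _] := hp.
have aB : a <= B by rewrite (leq_trans _ hB)// (leq_trans (dvdn_leq l0 h1))// leq_pmulr.
have xB : x <= B.
  case: (posnP m) => [m0|m0].
    have n0 : 0 < n by rewrite m0 addn0 in nm0.
    have h5 : 0 < n %/ a by rewrite divn_gt0//; exact: dvdn_leq.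
    have h6 : 0 < l %/ a by rewrite divn_gt0//; exact: dvdn_leq.
    have := dvdn_leq _ h3; rewrite muln_gt0 h5 h6 => /(_ isT) h.
    rewrite (leq_trans h)// (leq_trans _ hB)// m0 addn0 mulnC.
    by apply: leq_mul; exact: leq_div.
  rewrite (leq_trans (dvdn_leq m0 h4))// (leq_trans _ hB)// (leq_trans (leq_addl n m))// leq_pmull//.
by apply/allpairsP; exists (a, x); rewrite /= !mem_iota a0 x0 !add1n !ltnS aB xB.
Qed.

Lemma dpairs_flip B n m : 0 < n + m -> l * (n + m) <= B ->
  perm_eq [seq dflip n m p | p <- dpairs B n m] (dpairs B m n).
Proof.
move=> nm0 hB; have mn0 : 0 < m + n by rewrite addnC.
have hB' : l * (m + n) <= B by rewrite addnC.
apply: uniq_perm; rewrite ?dpairs_uniq//.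
  rewrite map_inj_in_uniq ?dpairs_uniq// => p q; rewrite !mem_dpairs// => hp hq e.
  by have [_ _ <-] := dflipP nm0 hp; have [_ _ <-] := dflipP nm0 hq; rewrite e.
move=> p; rewrite mem_dpairs//; apply/mapP/idP => [[q]|hp].
  by rewrite mem_dpairs// => hq ->; have [] := dflipP nm0 hq.
have [h1 h2 h3] := dflipP mn0 hp; exists (dflip m n p) => //.
by rewrite mem_dpairs.
Qed.

Lemma sum_dpairs_swap (V : nmodType) (w : nat -> V) B n m : 0 < n + m -> l * (n + m) <= B ->
  (\sum_(p <- dpairs B n m) w (p.1 * p.2)%N = \sum_(p <- dpairs B m n) w (p.1 * p.2)%N)%R.
Proof.
move=> nm0 hB; rewrite -(perm_big _ (dpairs_flip nm0 hB)) big_map big_seq [RHS]big_seq.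
apply: eq_bigr => p; rewrite mem_dpairs// => hp.
by have [_ -> _] := dflipP nm0 hp.
Qed.

End DivisorPairs.

(** * From the Maass relation to the symmetry of W *)

Section MaassSymmetry.
Variables (R : realType) (k N : nat) (chi : int -> R[i]).
Local Notation C := R[i].
Hypothesis hk : (0 < k)%N.
Hypothesis hN : (0 < N)%N.
Hypothesis hchi : dirichlet_char N chi.
Local Notation Wl := (W k N chi).

Lemma big_divisors (V : nmodType) l B (f : nat -> V) : (0 < l <= B)%N ->
  \sum_(x <- divisors l) f x = \sum_(x <- iota 1 B | (x %| l)%N) f x.
Proof.
move=> /andP[l0 lB]; rewrite -[RHS]big_filter; apply: perm_big; apply: uniq_perm.
- exact: divisors_uniq.
- by rewrite filter_uniq// iota_uniq.
move=> x; rewrite -dvdn_divisors// mem_filter mem_iota add1n ltnS.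
case h : (x %| l)%N => //=; rewrite (dvdn_gt0 l0 h) (leq_trans _ lB)//; exact: dvdn_leq.
Qed.

Lemma W_scaled l B (A : int * (int * int) -> C) T : (0 < l <= B)%N ->
  l%:R ^+ k.-1 * Wl l A T = \sum_(x <- iota 1 B | (x %| l)%N) chi x%:Z * x%:R ^+ k.-1 *
    (if (x%:Z %| T.2.1)%Z && (x%:Z %| T.2.2)%Z then
       A (T.1, ((T.2.1 %/ x%:Z)%Z * (l %/ x)%N%:Z, (T.2.2 %/ x%:Z)%Z)) else 0).
Proof.
move=> lB; have /andP[l0 _] := lB; rewrite -(big_divisors _ lB) /W mulr_sumr big_mkcond.
rewrite big_seq [RHS]big_seq; apply: eq_bigr => x; rewrite -dvdn_divisors// => xl.
have x0 : (0 < x)%N by exact: dvdn_gt0 xl.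
have d0 : (0 < l %/ x)%N by rewrite divn_gt0//; exact: dvdn_leq.
case: ifPn => cop; last first.
  have /eqP -> : chi x%:Z == 0 by rewrite (chi_eq0 hchi).
  by rewrite !mul0r.
rewrite /Wterm; case: ifP => _; last by rewrite !mulr0.
have dC : (l %/ x)%:R != 0 :> C by rewrite pnatr_eq0 -lt0n.
have lE : l%:R = x%:R * (l %/ x)%:R :> C by rewrite -natrM mulnC divnK.
have -> : (l %/ x)%:R ^- k = ((l %/ x)%:R ^+ k.-1 * (l %/ x)%:R)^-1 :> C by rewrite -exprSr prednK.
rewrite lE exprMn.
have dk : (l %/ x)%:R ^+ k.-1 != 0 :> C by rewrite expf_neq0.
by move: (A _) => u; field; rewrite dC dk.
Qed.

Variable a : int -> int -> int -> C.
Hypothesis a_neg : forall n r m, n < 0 \/ m < 0 -> a n r m = 0.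
Hypothesis a_swap : forall n r m, a n r m = a m r n.
Local Notation A := (A3 a).

Lemma W_neg l m n r : (0 < l)%N -> n < 0 \/ m < 0 -> Wl l A (m, (n, r)) = 0.
Proof.
move=> l0 nm; rewrite /W big_seq_cond big1// => x /andP[]; rewrite -dvdn_divisors// => xl _.
rewrite /Wterm/=; case: ifP => [/andP[/dvdzP[q hq] _]|_]; last by rewrite !mulr0.
have x0 : (0 < x)%N by exact: dvdn_gt0 xl.
have d0 : (0 < l %/ x)%N by rewrite divn_gt0//; exact: dvdn_leq.
rewrite /A3/= a_neg ?mulr0//; case: nm => [n0|]; last by right.
left; rewrite hq mulzK -?lt0n// pmulr_llt0//; move: n0; rewrite hq pmulr_llt0//.
Qed.

Section Trivial.
Hypothesis a_triv : forall n r m, a n r m != 0 -> [/\ n = 0, r = 0 & m = 0].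

(** This covers a form F reduced to its constant term, for which no nonvanishing coefficient of
    positive index is available to exclude divergence of the lift. *)
Lemma W_trivial l T : (0 < l)%N -> Wl l A (swap3 T) = Wl l A T.
Proof.
move=> l0; have E m n r : (m, (n, r)) != (0, (0, 0)) -> Wl l A (m, (n, r)) = 0.
  move=> h; rewrite /W big_seq_cond big1// => x /andP[]; rewrite -dvdn_divisors// => xl _.
  rewrite /Wterm/=; case: ifP => [/andP[/dvdzP[q hq] /dvdzP[s hs]]|_]; last by rewrite !mulr0.
  have x0 : (0 < x)%N by exact: dvdn_gt0 xl.
  have d0 : (0 < l %/ x)%N by rewrite divn_gt0//; exact: dvdn_leq.
  have xZ : x%:Z != 0 by rewrite -lt0n.
  rewrite /A3/=; have [->|/a_triv[h1 h2 h3]] := eqVneq (a ((n %/ x%:Z)%Z * (l %/ x)%N%:Z) (r %/ x%:Z)%Z m) 0; first by rewrite !mulr0.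
  move: h; rewrite h3; move: h1 h2; rewrite hq hs !mulzK// => /eqP; rewrite mulf_eq0 => /orP[/eqP ->|].
    by move=> ->; rewrite !mul0r eqxx.
  by rewrite -[_ == 0]/(_ == 0%N) eqn0Ngt d0.
case: T => m [n r]; rewrite /swap3/=.
have [[-> -> ->//]|h] := eqVneq (m, (n, r)) (0, (0, 0)); rewrite !E//.
by apply: contra h => /eqP[-> -> ->].
Qed.

End Trivial.

Variable c' : int -> int -> C.
Hypothesis a_rel : forall l n r, (0 < l)%N -> a n r l%:Z = l%:R ^+ k.-1 * Wl l (lift2 c') (1, (n, r)).

Lemma maass_relation (B n m : nat) (r : int) : (0 < n + m)%N -> (n + m <= B)%N ->
  a n%:Z r m%:Z = \sum_(x <- iota 1 B | [&& x %| n, x %| m & x %| `|r|]%N)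
    chi x%:Z * x%:R ^+ k.-1 * c' ((n * m) %/ x ^ 2)%N%:Z (r %/ x%:Z)%Z.
Proof.
(* The relation is symmetric in n and m, while [a_rel] speaks of positive index only. *)
move=> nm0 nmB; wlog m0 : n m nm0 nmB / (0 < m)%N.
  move=> H; case: (posnP m) => [m0|]; last exact: H.
  rewrite a_swap H; [| by rewrite addnC | by rewrite addnC | by move: nm0; rewrite m0 addn0].
  by apply: eq_big => [x|x _]; rewrite 1?andbCA// mulnC.
rewrite a_rel// (@W_scaled m B); last by rewrite m0 (leq_trans (leq_addl n m)).
rewrite big_mkcond [RHS]big_mkcond big_seq [RHS]big_seq; apply: eq_bigr => x.
rewrite mem_iota => /andP[x0 _]; rewrite /= !dvdzE/=.
case h2 : (x %| m)%N; last by rewrite andbF.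
case h1 : (x %| n)%N; last by rewrite /= mulr0.
case h3 : (x %| `|r|)%N; last by rewrite /= mulr0.
rewrite /=; congr (_ * c' _ _).
rewrite /= divz_nat -PoszM; congr Posz.
by rewrite muln_divA// divn_mulAC// expnS expn1 divnMA.
Qed.

(** The characters, powers and arguments of c' combine into functions of the product a x, which the
    involution [dflip] preserves. *)
Lemma W_dpairs l (n m : nat) (r : int) : (0 < l)%N -> (0 < n + m)%N ->
  l%:R ^+ k.-1 * Wl l A (m%:Z, (n%:Z, r)) =
  \sum_(p <- dpairs l `|r| (l * (n + m)) n m)
     (chi (p.1 * p.2)%N%:Z * (p.1 * p.2)%N%:R ^+ k.-1 *
      c' ((n * m * l) %/ (p.1 * p.2) ^ 2)%N%:Z (r %/ (p.1 * p.2)%N%:Z)%Z).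
Proof.
move=> l0 nm0; set B := (l * (n + m))%N.
have lB : (0 < l <= B)%N by rewrite l0 leq_pmulr.
rewrite (W_scaled _ _ lB) /dpairs big_filter [RHS]big_mkcond big_allpairs_dep/=.
rewrite big_mkcond big_seq [RHS]big_seq; apply: eq_bigr => x; rewrite mem_iota => /andP[x0 _].
case: ifPn => xl; last first.
  by rewrite big1// => y _; rewrite /dpair/= (negbTE xl).
rewrite !dvdzE/=; case: ifPn => [/andP[xn xr]|h]; last first.
  rewrite mulr0 big1// => y _; rewrite /dpair/=; case: ifP => // /and5P[_ h1 _ _ h2].
  by move: h; rewrite h1 (dvdn_trans _ h2)// dvdn_mulr.
have d0 : (0 < l %/ x)%N by rewrite divn_gt0//; exact: dvdn_leq.
have xZ : x%:Z != 0 by rewrite -lt0n.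
rewrite /A3/= divz_nat -PoszM (@maass_relation B); last first.
- rewrite /B mulnDr leq_add ?leq_pmull// mulnC leq_mul//; exact: leq_div.
- case: (posnP m) => [m0|m0]; last by rewrite addn_gt0 m0 orbT.
  have n0 : (0 < n)%N by move: nm0; rewrite m0 addn0.
  by rewrite addn_gt0 muln_gt0 d0 andbT divn_gt0// (dvdn_leq n0 xn).
rewrite mulr_sumr big_mkcond; apply: eq_bigr => y _; rewrite /dpair/= xl xn/=.
have -> : (y %| `|(r %/ x%:Z)%Z|)%N = (x * y %| `|r|)%N.
  have /dvdzP[q ->] : (x%:Z %| r)%Z by rewrite dvdzE.
  by rewrite mulzK// abszM/= mulnC dvdn_pmul2r.
case: ifP => // _.
rewrite [chi (x * y)%N%:Z](_ : _ = chi x%:Z * chi y%:Z); last by rewrite PoszM (chiM hchi).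
rewrite natrM exprMn; have eC (x1 x2 y1 y2 u v : C) : u = v -> x1 * x2 * (y1 * y2 * u) = x1 * y1 * (x2 * y2) * v.
  by move=> ->; ring.
apply: eC; congr (c' _ _); last by rewrite PoszM divzMA_ge0.
congr Posz; rewrite expnMn (_ : n * m * l = x ^ 2 * (n %/ x * (l %/ x) * m))%N ?divnMl ?expn_gt0 ?x0//.
by rewrite -{1}(divnK xn) -{1}(divnK xl) expnS expn1; ring.
Qed.

Lemma W_maass l T : (0 < l)%N -> Wl l A (swap3 T) = Wl l A T.
Proof.
move=> l0; have lk : l%:R ^+ k.-1 != 0 :> C by rewrite expf_neq0// pnatr_eq0 -lt0n.
case: T => m [n r]; rewrite /swap3/=.
case: m => [m|m]; last by rewrite !W_neg//; [right|left].
case: n => [n|n]; last by rewrite !W_neg//; [left|right].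
case: (posnP (n + m)%N) => [/eqP|nm0].
  by rewrite addn_eq0 => /andP[/eqP -> /eqP ->].
apply: (mulfI lk); rewrite (W_dpairs _ l0 nm0) W_dpairs//; last by rewrite addnC.
rewrite [in LHS]addnC (mulnC m n).
have := @sum_dpairs_swap l `|r| l0 C (fun E => chi E%:Z * E%:R ^+ k.-1 *
  c' ((n * m * l) %/ E ^ 2)%N%:Z (r %/ E%:Z)%Z) (l * (n + m)) n m nm0 (leqnn _).
by move=> ->.
Qed.

End MaassSymmetry.

(** * From the lift to the symmetry relations *)

Section LiftImpliesSymmetric.
Variables (R : realType) (k N : nat) (chi : int -> R[i]) (F : 'M[R[i]]_2 -> R[i]).
Local Notation C := R[i].
Local Notation e := (@cexp2pi R).
Hypothesis hk : (0 < k)%N.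
Hypothesis hN : (0 < N)%N.
Hypothesis hchi : dirichlet_char N chi.
Hypothesis hpar : chi (-1) = (-1) ^+ k.
Hypothesis hF : siegel_form k N chi F.
Variables (a : int -> int -> int -> C) (c : int -> C -> C -> C).
Hypothesis te : tube_expansion 1 (F3 F) a c.

Lemma coef_uniq_nat_at (g : R -> C) (p q : nat -> C) (t : C) :
  (forall x : R, hsum (fun m => p m * e (m%:R * (t + x%:C))) (g x)) ->
  (forall x : R, hsum (fun m => q m * e (m%:R * (t + x%:C))) (g x)) ->
  forall m, p m = q m.
Proof.
move=> hp hq m; pose ext (f : nat -> C) (n : int) := if n is Posz n then f n else 0.
have H (f : nat -> C) : (forall x : R, hsum (fun m => f m * e (m%:R * (t + x%:C))) (g x)) ->
    forall x : R, hsum (fun m => ext f m * e (m%:~R * (t + x%:C))) (g x).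
  move=> hf x; apply: (@hsum_reindex R _ _ predT (fun n : int => 0 <= n) Posz (fun n => `|n|%N) _ _ _ _ _ _ _ (hf x)) => //=.
  - by case=> // n _; rewrite mul0r.
  - by case.
exact: (coef_uniq1_at (H p hp) (H q hq) m%:Z).
Qed.

Definition term (V : nat -> C) (t2 : C) (n : nat) : C := \sum_(1 <= m < n) V m * e (m%:R * t2).

Lemma cvgn_term_bound V t2 : cvgn (term V t2) ->
  exists B, forall m, (0 < m)%N -> nm (V m * e (m%:R * t2)) <= B.
Proof.
move=> /cvg_ex[s hs].
have hnb : nbhs s [set w | nm (w - s) < 2^-1] by apply/nbhs_nm; exists 2^-1; rewrite invr_gt0.
have [n0 _ hn] := hs _ hnb.
have hn' n : (n0 <= n)%N -> nm (term V t2 n - s) < 2^-1 by move=> h; exact: (hn n h).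
  exists (1 + \sum_(m < n0) nm (V m * e (m%:R * t2))) => m m0.
  have s0 : 0 <= \sum_(m < n0) nm (V m * e (m%:R * t2)) by rewrite sumr_ge0// => i _; exact: nm_ge0.
  have [mn|mn] := leqP n0 m; last first.
    rewrite (bigD1 (Ordinal mn))//= addrCA lerDl addr_ge0// sumr_ge0// => i _; exact: nm_ge0.
  have -> : V m * e (m%:R * t2) = (term V t2 m.+1 - s) - (term V t2 m - s).
    by rewrite /term big_nat_recr//=; ring.
  apply: (@le_trans _ _ 1); last by rewrite lerDl.
  have := nmD (term V t2 m.+1 - s) (- (term V t2 m - s)); rewrite nmN.
  by have := hn' _ mn; have := hn' _ (leqW mn); lra.
Qed.

Lemma dom_up_i (t1 z t2 : C) (x : R) : dom t1 z t2 -> dom t1 z (t2 + (0 +i* 1) + x%:C).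
Proof.
move=> [y0 hv]; split=> //; rewrite !ImD/= addr0 mulrDr mulr1.
by rewrite (lt_trans hv)// ltrDl.
Qed.

Variables (Phi : C -> C -> C) (c' : int -> int -> C).
Hypothesis hJ : jacobi_form k 1 N chi Phi.
Hypothesis hE : fourier_jacobi_expansion 1 Phi c'.
Hypothesis hL : forall t1 z t2 : C, dom t1 z t2 -> F3 F t1 z t2 = sk_lift k N chi (c' 0 0) Phi t1 z t2.

(* If the series of the lift converges for no t2, limn is a constant junk value
   and F does not depend on t2 at (t1, z). *)
Lemma lift_pointwise t1 z : 0 < complex.Im t1 ->
  (forall l, (0 < l)%N -> c l%:Z t1 z = index_shift k N chi l Phi t1 z) \/
  (forall l, (0 < l)%N -> c l%:Z t1 z = 0).
Proof.
move=> y0; pose V l := index_shift k N chi l Phi t1 z; pose E0 := c' 0 0 * eisenstein k N chi t1.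
have [[t2 [dm cv]]|ncv] := pselect (exists t2, dom t1 z t2 /\ cvgn (term V t2)).
  (* Convergence at t2 bounds the terms, and raising t2 by i multiplies the m-th one by exp(-2 pi
     m). The series thus converges absolutely on all real translates of t2 + i. *)
  left=> l l0; have [B hB] := cvgn_term_bound cv.
  pose p m := if m == 0%N then E0 else V m.
  have -> : index_shift k N chi l Phi t1 z = p l by rewrite /p; case: eqP l0 => // ->.
  apply: (@coef_uniq_nat_at (fun x => F3 F t1 z (t2 + (0 +i* 1) + x%:C)) (fun l => c l%:Z t1 z) p (t2 + (0 +i* 1))) => x.
    exact: (c_nat_hsum hN hchi hF te (dom_up_i x dm)).
  rewrite hL; last exact: dom_up_i.
  set t2' := _ + x%:C; pose f m := (if m == 0%N then 0 else V m) * e (m%:R * t2').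
  have fa : asum f.
    have q0 : 0 <= (expR (- (2 * pi)) : R) < 1.
      by rewrite expR_ge0/= -expR0 ltr_expR oppr_lt0 mulr_gt0 ?pi_gt0.
    have B0 : 0 <= B by apply: le_trans (hB 1%N isT); exact: nm_ge0.
    apply: (bsum_le _ (bsumZ B0 (bsum_geo_nat q0))) => m; rewrite /f.
    case: eqP => [->|/eqP m0]; first by rewrite mul0r nm0 mulr_ge0// exprn_ge0// expR_ge0.
    have n1 : nm (e (m%:R * (0 +i* 1))) = expR (- (2 * pi)) ^+ m.
      by rewrite nm_e Im_natM/= mulr1 -expRM_natl; congr expR; ring.
    have n2 : nm (e (m%:R * x%:C)) = 1 by rewrite nm_e Im_natM/= !mulr0 oppr0 expR0.
    have E : nm (V m * e (m%:R * t2')) = nm (V m * e (m%:R * t2)) * expR (- (2 * pi)) ^+ m.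
      rewrite (nmM (V m)) (nmM (V m)) -[RHS]mulrA; congr (_ * _).
      have -> : m%:R * t2' = m%:R * t2 + m%:R * (0 +i* 1) + m%:R * x%:C by rewrite /t2' !mulrDr.
      by rewrite eD (nmM (e _)) n2 mulr1 eD (nmM (e _)) n1.
    rewrite E; apply: ler_pM; rewrite ?nm_ge0 ?exprn_ge0 ?expR_ge0//.
    by apply: hB; rewrite lt0n.
  have [s hs] := asum_hsum fa; have := limn_hsum hs; rewrite {2}/f mul0r subr0 => h1.
  rewrite /sk_lift -/E0 (_ : limn _ = s); last first.
    rewrite -h1; congr (limn _); apply: funext => n; rewrite big_nat_cond [RHS]big_nat_cond.
    by apply: eq_bigr => m /andP[/andP[m0 _] _]; rewrite /f; case: eqP m0 => // ->.
  have h0 : hsum (fun m : nat => if m == 0%N then E0 else 0) E0.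
    by have := @hsum_one nat R (fun m => if m == 0%N then E0 else 0) 0%N; apply => i /negbTE ->.
  have := hsumD h0 hs; apply: hsum_ext => m; rewrite /f /p.
  by case: eqP => [->|_]; rewrite ?mul0r ?e0 ?mulr1 ?addr0 ?add0r.
right=> l l0; have [t2 dm] := dom_ex z y0.
pose K : C := E0 + point.
have -> : 0 = (if l == 0%N then K else 0) by case: eqP l0 => // ->.
apply: (@coef_uniq_nat_at (fun=> K) (fun l => c l%:Z t1 z) (fun l => if l == 0%N then K else 0) t2) => x.
  have dmx := dom_shift3 x dm; have := c_nat_hsum hN hchi hF te dmx.
  rewrite hL// /sk_lift -/E0; have -> // : limn (term V (t2 + x%:C)) = point.
  by apply: dvgP => cv; apply: ncv; exists (t2 + x%:C).
have : hsum (fun m : nat => if m == 0%N then K else 0) K.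
  by have := @hsum_one nat R (fun m => if m == 0%N then K else 0) 0%N; apply => i /negbTE ->.
by apply: hsum_ext => m; case: eqP => [->|_]; rewrite ?mul0r ?e0 ?mulr1.
Qed.

(** The lexicographically least exponent of the support. At fixed n the bound r^2 <= 4 n m = b gives
    r >= -b, so that r + b has a least value among the naturals. *)
Lemma lead_index (m : nat) : (exists n r, a n r m%:Z != 0) -> exists n0 r0 : int,
  [/\ a n0 r0 m%:Z != 0, 0 <= n0 & forall n r, a n r m%:Z != 0 ->
     (n, r) = (n0, r0) \/ n = n0 /\ r0 < r \/ n0 < n].
Proof.
move=> ex; have supp n r : a n r m%:Z != 0 -> 0 <= n /\ r ^+ 2 <= 4 * n * m%:Z.
  move=> h; have [] := boolP [&& 0 <= n, 0 <= m%:Z & r ^+ 2 <= 4 * n * m%:Z]; first by case/and3P.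
  by move=> /(F3_koecher hN hchi hF te) h'; rewrite h' eqxx in h.
pose P (n : nat) := `[< exists r, a n%:Z r m%:Z != 0 >].
have exP : exists n, P n.
  have [n [r h]] := ex; have [n0 _] := supp _ _ h.
  by exists `|n|%N; apply/asboolP; exists r; rewrite gez0_abs.
case: (ex_minnP exP) => n0 /asboolP[r1 hr1] minP.
pose b : int := 4 * n0%:Z * m%:Z.
have bnd r : a n0%:Z r m%:Z != 0 -> 0 <= r + b.
  move=> h; have [_ h2] := supp _ _ h; rewrite -/b in h2.
  by have : 0 <= b by [exact: le_trans (sqr_ge0 r) h2]; nia.
pose Q (s : nat) := a n0%:Z (s%:Z - b) m%:Z != 0.
have exQ : exists s, Q s.
  by exists (absz (r1 + b)%R); rewrite /Q gez0_abs ?bnd// addrK.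
case: (ex_minnP exQ) => s0 hq minQ.
exists n0%:Z, (s0%:Z - b); split=> // n r h.
have [n1 _] := supp _ _ h.
have hn : (n0 <= `|n|)%N by apply: minP; apply/asboolP; exists r; rewrite gez0_abs.
have [e1|e1] := eqVneq n n0%:Z; last by right; right; lia.
rewrite e1 in h *.
have hs : (s0 <= absz (r + b)%R)%N by apply: minQ; rewrite /Q gez0_abs ?bnd// addrK.
have := bnd _ h => h3.
have [e2|e2] := eqVneq r (s0%:Z - b); first by left; rewrite e2.
by right; left; split=> //; move: e2 => /eqP; lia.
Qed.

(* With Im t = K v, Im z = v and K, v large, one term of the expansion dominates. *)
Lemma c_nonvanishing (m : nat) : (0 < m)%N -> (exists n r, a n r m%:Z != 0) ->
  exists t z : C, 0 < complex.Im t /\ forall x1 x2 : R, c m%:Z (t + x1%:C) (z + x2%:C) != 0.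
Proof.
move=> m0 /lead_index[n0 [r0 [h0 n00 hlead]]].
(* With this K the weight n K + r of any other exponent exceeds that of (n0, r0) by at least 1. For
   n > n0 this uses r >= -(n + m), which follows from r^2 <= 4 n m <= (n + m)^2. *)
pose K : int := n0 + m%:Z + `|r0| + 2.
have K0 : 0 < K by rewrite /K; lia.
have hK n r : a n r m%:Z != 0 -> (n, r) = (n0, r0) \/ n0 * K + r0 + 1 <= n * K + r.
  move=> h; have [->|[[-> h2]|h2]] := hlead _ _ h; first by left.
    by right; lia.
  right; have : - (n + m%:Z) <= r.
    have [] := boolP [&& 0 <= n, 0 <= m%:Z & r ^+ 2 <= 4 * n * m%:Z]; last first.
      by move=> /(F3_koecher hN hchi hF te) h'; rewrite h' eqxx in h.
    move=> /and3P[n1 _ h3]; have h4 : r ^+ 2 <= (n + m%:Z) ^+ 2.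
      apply: (le_trans h3); rewrite -subr_ge0 (_ : _ - _ = (n - m%:Z) ^+ 2) ?sqr_ge0//; ring.
    by rewrite leNgt; apply/negP => h5; move: h4; rewrite leNgt => /negP; apply; nia.
  by move=> h5; rewrite /K in K0 *; nia.
have [dec _ hc] := te.
pose tv (v : R) : C := 0 +i* (K%:~R * v); pose zv (v : R) : C := 0 +i* v.
pose om (p : int * int) : R := p.1%:~R * K%:~R + p.2%:~R.
have nmf (p : int * int) v x1 x2 : nm (a p.1 p.2 m%:Z * fj 1 p.1 p.2 (tv v + x1%:C) (zv v + x2%:C)) =
    nm (a p.1 p.2 m%:Z) * expR (- (2 * pi * (om p * v))).
  rewrite nmM nm_fj !ImD/= !addr0 divr1; congr (_ * expR (- (_ * _))).
  by rewrite /om; ring.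
have KR : 0 < K%:~R :> R by rewrite ltr0z.
have y1 : 0 < complex.Im (tv 1) by rewrite /tv/= mulr1.
have [S hS] := decays_asum2' m%:Z (zv 1) dec y1.
have S0 : 0 <= S by have := hS fset0; rewrite big_seq_fset0.
pose w0 : int := n0 * K + r0.
have w0E : w0%:~R = n0%:~R * K%:~R + r0%:~R :> R by rewrite -intrM -intrD.
pose del := nm (a n0 r0 m%:Z) * expR (- (2 * pi * w0%:~R)).
have del0 : 0 < del by rewrite mulr_gt0 ?expR_gt0 ?nm_gt0.
(* Going from height 1 to v = 1 + s shrinks the other terms against the leading one by exp(-2 pi s)
   at least. S bounds the sum of all moduli at height 1 and del is the leading one; s = S / del
   brings S exp(-2 pi s) below del. *)
pose s : R := S / del; have s0 : 0 <= s by rewrite divr_ge0// ltW.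
have p0 : 0 < pi :> R := pi_gt0 R.
pose v := 1 + s; have v0 : 0 < v by rewrite /v; lra.
exists (tv v), (zv v); split; first by rewrite /tv/= mulr_gt0.
move=> x1 x2; have y2 : 0 < complex.Im (tv v + x1%:C) by rewrite ImD/= addr0 mulr_gt0.
have := hc m%:Z _ (zv v + x2%:C) y2; set f := (fun p => _) => hf.
have h1 := @hsum_one _ R (fun p => if p == (n0, r0) then f (n0, r0) else 0) (n0, r0).
have {}h1 : hsum (fun p => if p == (n0, r0) then f (n0, r0) else 0) (f (n0, r0)).
  by move: h1; rewrite eqxx; apply => i /negbTE ->.
have h2 := hsumB hf h1.
have h3 : nm (c m%:Z (tv v + x1%:C) (zv v + x2%:C) - f (n0, r0)) <=
    expR (- (2 * pi * ((w0 + 1)%:~R * s))) * S.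
  apply: (hsum_nm h2) => B; apply: (@le_trans _ _ (expR (- (2 * pi * ((w0 + 1)%:~R * s))) *
      \sum_(p <- B) nm (a p.1 p.2 m%:Z * fj 1 p.1 p.2 (tv 1) (zv 1)))); last first.
    by rewrite ler_wpM2l ?expR_ge0.
  rewrite mulr_sumr; apply: ler_sum => -[n r] _.
  have -> : nm (a n r m%:Z * fj 1 n r (tv 1) (zv 1)) = nm (a n r m%:Z) * expR (- (2 * pi * om (n, r))).
    have := nmf (n, r) 1 0 0; rewrite !addr0 mulr1; exact.
  have P0 : 0 <= expR (- (2 * pi * ((w0 + 1)%:~R * s))) * (nm (a n r m%:Z) * expR (- (2 * pi * om (n, r)))).
    by rewrite !mulr_ge0 ?expR_ge0 ?nm_ge0.
  case: eqP => [[en er]|/eqP ne]; first by subst n r; rewrite subrr nm0.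
  rewrite subr0 /f nmf/=; have [->|an] := eqVneq (a n r m%:Z) 0; first by rewrite nm0 mul0r mul0r mulr0.
  rewrite [leRHS]mulrCA; apply: ler_wpM2l; rewrite ?nm_ge0// -expRD ler_expR /v.
  have {}ne : w0 + 1 <= n * K + r by case: (hK _ _ an) => // e1; rewrite e1 eqxx in ne.
  have h4 : (w0 + 1)%:~R <= om (n, r) by rewrite /om/= -intrM -intrD ler_int.
  have h5 : (w0 + 1)%:~R * s <= om (n, r) * s by rewrite ler_wpM2r.
  by have : 2 * pi * ((w0 + 1)%:~R * s) <= 2 * pi * (om (n, r) * s); [rewrite ler_pM2l// mulr_gt0|lra].
have h4 : nm (f (n0, r0)) = expR (- (2 * pi * (w0%:~R * s))) * del.
  rewrite /f nmf/= /del [RHS]mulrCA; congr (_ * _); rewrite -expRD /v /om/= w0E; congr expR; ring.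
apply/eqP => cz; move: h3; rewrite cz sub0r nmN h4.
have -> : expR (- (2 * pi * ((w0 + 1)%:~R * s))) = expR (- (2 * pi * (w0%:~R * s))) * expR (- (2 * pi * s)).
  by rewrite -expRD intrD; congr expR; ring.
rewrite -[leRHS]mulrA ler_pM2l ?expR_gt0// expRN [leRHS]mulrC ler_pdivlMr ?expR_gt0//.
have h5 : 1 + 2 * pi * s <= expR (2 * pi * s) by exact: expR_ge1Dx.
have h6 : del * (1 + 2 * pi * s) <= del * expR (2 * pi * s) by rewrite ler_pM2l.
have h7 : del * s = S by rewrite /s mulrC divfK// gt_eqF.
have h8 : S <= pi * S by rewrite ler_peMl//; have := pi_ge2 R; lra.
have h9 : del * (1 + 2 * pi * s) = del + 2 * (pi * S) by rewrite -h7; ring.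
rewrite h9 in h6; lra.
Qed.

Lemma lift_symmetric l : (0 < l)%N -> symmetry_relation k N chi F l.
Proof.
move=> l0; apply/(symmetry_W hN hchi hpar hF te l0) => T.
have a_neg n r m : n < 0 \/ m < 0 -> a n r m = 0.
  move=> h; apply: (F3_koecher hN hchi hF te); rewrite !negb_and -!ltNge.
  by case: h => ->; rewrite ?orbT.
have a_swap n r m : a n r m = a m r n.
  by have := A3_swap hchi hpar hF te (n, (m, r)); rewrite /A3/=.
(* A nonzero coefficient of positive index yields a point (t, z) on whose real translates the
   vanishing alternative of [lift_pointwise] is impossible; otherwise F is constant. *)
have [[m [m0 hm]]|hno] := pselect (exists m : nat, (0 < m)%N /\ exists n r, a n r m%:Z != 0).
  have [t [z [y0 hnz]]] := c_nonvanishing m0 hm.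
  have [_ law _ _] := hJ; have [_ _ hc] := te.
  apply: (W_maass hk hchi a_neg a_swap (c' := c')) => // {l l0 T} l n r l0.
  have yx (x : R) : 0 < complex.Im (t + x%:C) by rewrite ImD/= addr0.
  apply: (@coef_uniq2_at R (fun x1 x2 => c l%:Z (t + x1%:C) (z + x2%:C)) (fun p => a p.1 p.2 l%:Z)
    (fun p => l%:R ^+ k.-1 * W k N chi l (lift2 c') (1, p)) t z _ _ (n, r)) => x1 x2.
    exact: hc.
  have [->//|h0] := lift_pointwise (z + x2%:C) (yx x1); last by have := hnz x1 x2; rewrite h0 ?eqxx.
  exact: (index_shift_hsum hN hchi law hE).
apply: W_trivial => // n r m h.
have hm : m = 0.
  case: m h => [m|m] h; last by rewrite a_neg ?eqxx// in h; right.
  by case: (posnP m) => [->//|m0]; exfalso; apply: hno; exists m; split=> //; exists n, r.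
have hn : n = 0.
  rewrite a_swap in h; case: n h => [n|n] h; last by rewrite a_neg ?eqxx// in h; right.
  by case: (posnP n) => [->//|n0]; exfalso; apply: hno; exists n; split=> //; exists m, r.
split=> //; subst m n.
have [] := boolP [&& (0 : int) <= 0, (0 : int) <= 0 & r ^+ 2 <= 4 * 0 * 0]; last first.
  by move=> /(F3_koecher hN hchi hF te) h'; rewrite h' eqxx in h.
by rewrite mulr0 /= => r2; apply/eqP; rewrite -sqrf_eq0; apply/eqP/le_anti; rewrite r2 sqr_ge0.
Qed.

End LiftImpliesSymmetric.

(** * The constant term of the Eisenstein series *)

Section QRegular.
Variable R : realType.
Local Notation C := R[i].

(* First- and second-order regularity for multiplicative steps, uniform up to
   x = 1; this is what the summation of sum_m (-1)^m f(q^m) needs. *)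
Definition qregular (f : R -> C) := exists K : R, 0 <= K /\
  forall x q : R, 0 <= x < 1 -> 0 <= q <= 1 ->
  [/\ nm (f x) <= K, nm (f (q * x) - f x) <= K * ((1 - q) * x)
    & nm (f (q * (q * x)) - 2 * f (q * x) + f x) <= K * ((1 - q) ^+ 2 * x)].

Lemma qmul_itv (x q : R) : 0 <= x < 1 -> 0 <= q <= 1 -> 0 <= q * x < 1.
Proof.
move=> /andP[x0 x1] /andP[q0 q1]; rewrite mulr_ge0//=.
by apply: le_lt_trans x1; rewrite ler_piMl.
Qed.

Lemma qregular_ext f g : (forall x : R, 0 <= x < 1 -> f x = g x) -> qregular f -> qregular g.
Proof.
move=> fg [K [K0 hK]]; exists K; split=> // x q hx hq; have := hK x q hx hq.
by rewrite !fg//; do ?[apply: qmul_itv].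
Qed.

Lemma qregular_cst c : qregular (fun=> c).
Proof.
exists (nm c); split=> [|x q /andP[x0 _] /andP[q0 q1]]; first exact: nm_ge0.
have y0 : 0 <= 1 - q by rewrite subr_ge0.
have -> : c - 2 * c + c = 0 by ring.
by rewrite subrr nm0; split; rewrite ?lexx ?mulr_ge0 ?nm_ge0 ?exprn_ge0.
Qed.

Lemma qregular_id : qregular (fun x => x%:C).
Proof.
exists 1; split=> [|x q /andP[x0 x1] /andP[q0 q1]]; first exact: ler01.
have y0 : 0 <= 1 - q by rewrite subr_ge0.
split; rewrite ?mul1r.
- by rewrite nm_pos// ltW.
- have -> : (q * x)%:C - x%:C = - ((1 - q) * x)%:C by rewrite -rmorphB -rmorphN; congr (_%:C); ring.
  by rewrite nmN nm_pos// mulr_ge0.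
- have -> : (q * (q * x))%:C - 2 * (q * x)%:C + x%:C = ((1 - q) ^+ 2 * x)%:C.
    by rewrite -(rmorph_nat (real_complex R)) -rmorphM -rmorphB -rmorphD; congr (_%:C); ring.
  by rewrite nm_pos// mulr_ge0// exprn_ge0.
Qed.

Lemma qregularD f g : qregular f -> qregular g -> qregular (fun x => f x + g x).
Proof.
move=> [K [K0 hK]] [M [M0 hM]]; exists (K + M); split=> [|x q hx hq]; first exact: addr_ge0.
have [a1 a2 a3] := hK x q hx hq; have [b1 b2 b3] := hM x q hx hq; split.
- exact: le_trans (nmD _ _) (lerD a1 b1).
- rewrite [leRHS]mulrDl (_ : _ - _ = (f (q * x) - f x) + (g (q * x) - g x)); last by ring.
  exact: le_trans (nmD _ _) (lerD a2 b2).
- rewrite [leRHS]mulrDl (_ : _ - _ + _ = (f (q * (q * x)) - 2 * f (q * x) + f x) +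
    (g (q * (q * x)) - 2 * g (q * x) + g x)); last by ring.
  exact: le_trans (nmD _ _) (lerD a3 b3).
Qed.

(** The Leibniz rule for second differences. *)
Let diff2M (f0 f1 f2 g0 g1 g2 : C) : f2 * g2 - 2 * (f1 * g1) + f0 * g0 =
  (f2 - 2 * f1 + f0) * g2 + 2 * ((f1 - f0) * (g2 - g1)) + f0 * (g2 - 2 * g1 + g0).
Proof. by ring. Qed.

Let cross (x q K M : R) (u v : C) : 0 <= x < 1 -> 0 <= q <= 1 -> 0 <= K -> 0 <= M ->
  nm u <= K * ((1 - q) * x) -> nm v <= M * ((1 - q) * (q * x)) ->
  nm (2 * (u * v)) <= 2 * (K * M) * ((1 - q) ^+ 2 * x).
Proof.
move=> /andP[x0 x1] /andP[q0 q1] K0 M0 hu hv.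
have y0 : 0 <= 1 - q by rewrite subr_ge0.
have hv' : nm v <= M * (1 - q).
  apply: (le_trans hv); apply: ler_wpM2l => //; apply: ler_piMr => //.
  by apply: (le_trans (ler_piMl x0 q1)); exact: ltW.
rewrite nmM nm_nat nmM -mulrA ler_wpM2l//.
apply: (le_trans (ler_pM (nm_ge0 _) (nm_ge0 _) hu hv')).
rewrite le_eqVlt; apply/orP; left; apply/eqP; ring.
Qed.

Lemma qregularM f g : qregular f -> qregular g -> qregular (fun x => f x * g x).
Proof.
move=> [K [K0 hK]] [M [M0 hM]]; exists (4 * (K * M)); split=> [|x q hx hq]; first by rewrite !mulr_ge0.
have [a1 a2 a3] := hK x q hx hq; have [b1 b2 b3] := hM x q hx hq.
have hqx := qmul_itv hx hq; have hqqx := qmul_itv hqx hq.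
have [b1' b2' _] := hM (q * x) q hqx hq; have [b1'' _ _] := hM (q * (q * x)) q hqqx hq.
have [x0 _] := andP hx; have [q0 q1] := andP hq.
have y0 : 0 <= 1 - q by rewrite subr_ge0.
have KM : 0 <= K * M by exact: mulr_ge0.
have bound (u v : C) (A B : R) : nm u <= A -> nm v <= B -> nm (u * v) <= A * B.
  by move=> hu hv; rewrite nmM; exact: ler_pM (nm_ge0 _) (nm_ge0 _) hu hv.
split.
- by apply: (le_trans (bound _ _ _ _ a1 b1)); lra.
- rewrite (_ : _ - _ = (f (q * x) - f x) * g (q * x) + f x * (g (q * x) - g x)); last by ring.
  apply: (le_trans (nmD _ _)); apply: (le_trans (lerD (bound _ _ _ _ a2 b1') (bound _ _ _ _ a1 b2))).
  have : 0 <= K * M * ((1 - q) * x) by rewrite mulr_ge0// mulr_ge0.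
  lra.
- rewrite diff2M; apply: (le_trans (nmD _ _)).
  have h1 := le_trans (nmD ((f (q * (q * x)) - 2 * f (q * x) + f x) * g (q * (q * x))) _)
    (lerD (bound _ _ _ _ a3 b1'') (cross hx hq K0 M0 a2 b2')).
  apply: (le_trans (lerD h1 (bound _ _ _ _ a1 b3))); rewrite le_eqVlt; apply/orP; left; apply/eqP; ring.
Qed.

(** The Leibniz rule for f d = p is solved for the differences of f; as |d| >= 1, a bound on the
    product with d is a bound on the factor. *)
Lemma qregular_div f d p : (forall x : R, 0 <= x < 1 -> f x * d x = p x) ->
  (forall x : R, 0 <= x < 1 -> 1 <= nm (d x)) -> qregular d -> qregular p -> qregular f.
Proof.
move=> fd d1 [M [M0 hM]] [P [P0 hP]].
have le1 x (u : C) : 0 <= x < 1 -> nm u <= nm (u * d x).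
  by move=> /d1 h; rewrite nmM ler_peMr ?nm_ge0.
have bf x : 0 <= x < 1 -> nm (f x) <= P.
  move=> hx; apply: (le_trans (le1 x _ hx)); rewrite fd//.
  by have [] := hP x 0 hx; rewrite ?lexx ?ler01.
have bound (u v : C) (A B : R) : nm u <= A -> nm v <= B -> nm (u * v) <= A * B.
  by move=> hu hv; rewrite nmM; exact: ler_pM (nm_ge0 _) (nm_ge0 _) hu hv.
pose K1 := P + P * M; have K10 : 0 <= K1 by rewrite addr_ge0 ?mulr_ge0.
have PM : 0 <= P * M by exact: mulr_ge0.
have KM : 0 <= K1 * M by exact: mulr_ge0.
have bd x q : 0 <= x < 1 -> 0 <= q <= 1 -> nm (f (q * x) - f x) <= K1 * ((1 - q) * x).
  move=> hx hq; have hqx := qmul_itv hx hq; apply: (le_trans (le1 _ _ hqx)).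
  rewrite (_ : _ * _ = (p (q * x) - p x) - f x * (d (q * x) - d x)); last first.
    by rewrite -!fd//; ring.
  have [_ p2 _] := hP x q hx hq; have [_ m2 _] := hM x q hx hq.
  apply: (le_trans (nmD _ _)); rewrite nmN.
  apply: (le_trans (lerD p2 (bound _ _ _ _ (bf _ hx) m2))).
  by rewrite /K1 [leRHS]mulrDl mulrA.
exists (K1 + 2 * (K1 * M)); split=> [|x q hx hq]; first by rewrite addr_ge0// mulr_ge0.
have [x0 _] := andP hx; have [q0 q1] := andP hq.
have y0 : 0 <= 1 - q by rewrite subr_ge0.
have hqx := qmul_itv hx hq; have hqqx := qmul_itv hqx hq; split.
- by apply: (le_trans (bf x hx)); rewrite /K1 in KM *; lra.
- apply: (le_trans (bd x q hx hq)); have : 0 <= K1 * M * ((1 - q) * x) by rewrite mulr_ge0// mulr_ge0.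
  lra.
- apply: (le_trans (le1 _ _ hqqx)).
  rewrite (_ : _ * _ = (p (q * (q * x)) - 2 * p (q * x) + p x) - 2 * ((f (q * x) - f x) *
     (d (q * (q * x)) - d (q * x))) - f x * (d (q * (q * x)) - 2 * d (q * x) + d x)); last first.
    by rewrite -!fd//; ring.
  have [_ _ p3] := hP x q hx hq; have [_ _ m3] := hM x q hx hq; have [_ m2 _] := hM (q * x) q hqx hq.
  apply: (le_trans (nmD _ _)); rewrite nmN.
  have h1 : nm (p (q * (q * x)) - 2 * p (q * x) + p x - 2 * ((f (q * x) - f x) *
     (d (q * (q * x)) - d (q * x)))) <= P * ((1 - q) ^+ 2 * x) + 2 * (K1 * M) * ((1 - q) ^+ 2 * x).
    apply: (le_trans (nmD _ _)); rewrite nmN; apply: lerD p3 _.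
    exact: cross hx hq K10 M0 (bd x q hx hq) m2.
  apply: (le_trans (lerD h1 (bound _ _ _ _ (bf _ hx) m3))).
  rewrite le_eqVlt; apply/orP; left; apply/eqP; rewrite /K1; ring.
Qed.

Lemma qregular_sum (I : Type) (r : seq I) (f : I -> R -> C) :
  (forall i, qregular (f i)) -> qregular (fun x => \sum_(i <- r) f i x).
Proof.
move=> h; elim: r => [|i r IH].
  by apply: qregular_ext (qregular_cst 0) => x _; rewrite big_nil.
by apply: qregular_ext (qregularD (h i) IH) => x _; rewrite big_cons.
Qed.

Lemma qregularX n : qregular (fun x => (x ^+ n)%:C).
Proof.
elim: n => [|n IH]; first by apply: qregular_ext (qregular_cst 1) => x _; rewrite expr0.
by apply: qregular_ext (qregularM qregular_id IH) => x _; rewrite exprS rmorphM.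
Qed.

(** One half of the exponential decay absorbs the polynomial. The midpoint x' of x and 1 replaces x
    so that its logarithm makes sense at x = 0. *)
Lemma bsum_poly_geo (j : nat) (x : R) : 0 <= x < 1 -> bsum (fun n : nat => n.+1%:R ^+ j * x ^+ n).
Proof.
move=> /andP[x0 x1]; pose x' := (1 + x) / 2.
have x'0 : 0 < x' by rewrite /x'; lra.
have x'1 : x' < 1 by rewrite /x'; lra.
pose t := - ln x'; have t0 : 0 < t by rewrite /t oppr_gt0 ln_lt0// x'0 x'1.
have xE n : x ^+ n <= expR (- (t * n%:R)).
  rewrite -mulNr mulrC expRM_natl /t opprK lnK ?posrE//.
  by rewrite lerXn2r ?nnegrE ?(ltW x'0)// /x'; lra.
pose s := t / (2 * j.+1%:R); have s0 : 0 < s by rewrite divr_gt0// mulr_gt0.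
have sj : s * j%:R <= t / 2.
  rewrite /s invfM mulrA -mulrA ler_piMr ?divr_ge0 ?(ltW t0)// mulrC ler_pdivrMr ?ltr0n//.
  by rewrite mul1r ler_nat.
have q01 : 0 <= expR (- (t / 2)) < 1 by rewrite expR_ge0 expR_lt1 oppr_lt0 divr_gt0.
have c0 : 0 <= s ^- j * expR (t / 2) by rewrite mulr_ge0 ?expR_ge0// invr_ge0 exprn_ge0// ltW.
apply: bsum_le (bsumZ c0 (bsum_geo_nat q01)) => n.
have h1 : n.+1%:R ^+ j <= s ^- j * expR (t / 2 * n.+1%:R).
  rewrite mulrC ler_pdivlMr ?exprn_gt0// -exprMn.
  have h2 : n.+1%:R * s <= expR (s * n.+1%:R).
    by apply: le_trans (expR_ge1Dx _); rewrite mulrC lerDr.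
  have h3 : (n.+1%:R * s) ^+ j <= expR (s * n.+1%:R) ^+ j.
    by rewrite lerXn2r ?nnegrE ?expR_ge0// mulr_ge0// ltW.
  apply: (le_trans h3); rewrite -expRM_natl ler_expR mulrA (mulrC j%:R) ler_wpM2r//.
apply: (le_trans (ler_pM _ _ h1 (xE n))); rewrite ?exprn_ge0//.
rewrite -!mulrA ler_wpM2l ?invr_ge0 ?exprn_ge0 ?(ltW s0)// -expRM_natl -!expRD ler_expR (_ : n.+1%:R = n%:R + 1) ?natr1//.
lra.
Qed.

Lemma horner_nat_bound (p : {poly C}) : exists B : R, 0 <= B /\
  forall n : nat, nm p.[n%:R] <= B * n.+1%:R ^+ size p.
Proof.
exists (\sum_(i < size p) nm p`_i); split=> [|n]; first by rewrite sumr_ge0// => i _; exact: nm_ge0.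
rewrite horner_coef mulr_suml; apply: (le_trans (nm_sum _ _ _)); apply: ler_sum => i _.
rewrite nmM nmX nm_nat ler_wpM2l ?nm_ge0//.
apply: (@le_trans _ _ (n.+1%:R ^+ i)); first by rewrite lerXn2r ?nnegrE// ler_nat.
by rewrite ler_weXn2l ?ler1n// ltnW.
Qed.

Lemma asum_poly (w : nat -> C) (p : {poly C}) (W x : R) : (forall n, nm (w n) <= W) -> 0 <= x < 1 ->
  asum (fun n : nat => w n * p.[n%:R] * (x ^+ n)%:C).
Proof.
move=> hW hx; have [B [B0 hB]] := horner_nat_bound p.
have W0 : 0 <= W by exact: le_trans (nm_ge0 _) (hW 0%N).
have [x0 _] := andP hx.
apply: bsum_le (bsumZ (mulr_ge0 W0 B0) (bsum_poly_geo (size p) hx)) => n.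
rewrite nmM nm_pos ?exprn_ge0// mulrA ler_wpM2r ?exprn_ge0// nmM -mulrA.
exact: ler_pM (nm_ge0 _) (nm_ge0 _) (hW n) (hB n).
Qed.

End QRegular.

(** * Power series with periodic coefficients of mean 0 *)

Section PeriodicSeries.
Variable R : realType.
Local Notation C := R[i].
Variable L : nat.
Hypothesis L0 : (0 < L)%N.

Lemma periodic_mod (w : nat -> C) : (forall n, w (n + L)%N = w n) -> forall n, w n = w (n %% L)%N.
Proof.
move=> h n; rewrite {1}(divn_eq n L) addnC; elim: (n %/ L)%N => [|q IH]; first by rewrite mul0n addn0.
by rewrite mulSn [(L + _)%N]addnC addnA h.
Qed.

Lemma periodic_bounded (w : nat -> C) : (forall n, w (n + L)%N = w n) ->
  forall n, nm (w n) <= \sum_(i < L) nm (w i).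
Proof.
move=> h n; rewrite periodic_mod// (bigD1 (Ordinal (ltn_pmod n L0)))//= lerDl sumr_ge0// => i _.
exact: nm_ge0.
Qed.

Lemma periodic_sum (w : nat -> C) (m : nat) : (forall n, w (n + L)%N = w n) ->
  \sum_(i < L) w (m + i)%N = \sum_(i < L) w i.
Proof.
move=> h; elim: m => [|m IH]; first by apply: eq_bigr.
rewrite -{}IH; case: L L0 h => // l _ h.
rewrite big_ord_recr [RHS]big_ord_recl/= addn0 addrC; congr (_ + _).
  by rewrite addSnnS h.
by apply: eq_bigr => i _; rewrite addSnnS.
Qed.

Lemma hsum_shift (b : nat -> C) (s : C) i : hsum b s -> hsum (fun n => if (i <= n)%N then b (n - i)%N else 0) s.
Proof.
apply: (@hsum_reindex R nat nat predT (fun n => i <= n)%N (fun n => (n + i)%N) (fun n => (n - i)%N)) => //.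
- by move=> j /negbTE ->.
- by move=> n _; rewrite leq_addl addnK.
- by move=> n hn; rewrite subnK.
Qed.

(** The leading coefficients of a polynomial and of its translate cancel. The strict drop in degree
    drives the induction in [periodic_series]. *)
Lemma size_shiftB (p : {poly C}) (c : C) : (size p <= (size (p \Po ('X - c%:P) - p)%R)%N)%N -> p = 0.
Proof.
move=> h; apply/eqP; rewrite -lead_coef_eq0; have [->//|p0] := eqVneq p 0; first by rewrite lead_coef0.
have sz : size (p \Po ('X - c%:P)) = size p by rewrite size_comp_poly2// size_XsubC.
set q := _ - p in h; have hq : (size q <= size p)%N by rewrite (leq_trans (size_polyD _ _))// size_polyN sz maxnn.
have sq : size q = size p by apply/eqP; rewrite eqn_leq hq h.
have : lead_coef q = 0.
  rewrite lead_coefE sq /q coefB; have := lead_coef_comp p (_ : (1 < size ('X - c%:P)%R)%N).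
  rewrite size_XsubC => /(_ isT); rewrite lead_coefXsubC expr1n mulr1 lead_coefE sz => ->.
  by rewrite subrr.
move=> /eqP; rewrite (lead_coef_eq0 q) => /eqP q0; exfalso; move: p0.
by rewrite -size_poly_eq0 -sq q0 size_poly0.
Qed.

(* Multiplication by 1 + x + ... + x^(L-1) lowers the degree of p modulo
   polynomials, because w has mean 0. *)
Lemma periodic_series (p : {poly C}) (w : nat -> C) : (forall n, w (n + L)%N = w n) ->
  \sum_(i < L) w i = 0 -> exists S : R -> C, qregular S /\
  forall x : R, 0 <= x < 1 -> hsum (fun n => w n * p.[n%:R] * (x ^+ n)%:C) (S x).
Proof.
have [s] := ubnP (size p); elim: s p w => // s IH p w ps wL w0.
have [S hS] : exists S : R -> C, forall x : R, 0 <= x < 1 -> hsum (fun n => w n * p.[n%:R] * (x ^+ n)%:C) (S x).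
  suff /(@choice R C)[S hS] : forall x : R, exists s, 0 <= x < 1 -> hsum (fun n => w n * p.[n%:R] * (x ^+ n)%:C) s.
    by exists S.
  move=> x.
  have [hx|hx] := pselect (0 <= x < 1); last by exists 0.
  by have [t ht] := asum_hsum (asum_poly p (periodic_bounded wL) hx); exists t.
exists S; split=> //; have [pz|p0] := eqVneq p 0.
  apply: qregular_ext (qregular_cst (0 : C)) => x hx; apply: hsum_uniq (hS x hx).
  by apply: (@hsum_ext nat R (fun=> 0)); [move=> n; rewrite pz horner0 mulr0 mul0r|exact: hsum0].
(* By periodicity [wi i n] is w(n - i), written without truncated subtraction; [pi' i] is p(X - i) -
   p, of smaller degree. *)
pose wi (i n : nat) := w (n + (L - i))%N; pose pi' (i : nat) := p \Po ('X - i%:R%:P) - p.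
have wiL i n : wi i (n + L)%N = wi i n by rewrite /wi addnAC wL.
have wi0 i : \sum_(j < L) wi i j = 0.
  by rewrite -[RHS]w0 -[RHS](periodic_sum (L - i) wL); apply: eq_bigr => j _; rewrite /wi addnC.
have /choice[T hT] : forall i : nat, exists T : R -> C, qregular T /\
    forall x : R, 0 <= x < 1 -> hsum (fun n => wi i n * (pi' i).[n%:R] * (x ^+ n)%:C) (T x).
  move=> i; apply: IH => //; apply: leq_trans (_ : size p <= s)%N => //.
  by rewrite ltnNge; apply: contra p0 => /size_shiftB ->.
(* The coefficients of S D minus those of the series T i. They vanish for n >= L, because the mean
   of w is 0, so that the correction is a polynomial. *)
pose cc n := \sum_(i < L) (if (i <= n)%N then w (n - i)%N * p.[(n - i)%:R] else 0) -
   \sum_(i < L) wi i n * (pi' i).[n%:R].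
have ccL n : (L <= n)%N -> cc n = 0.
  move=> Ln; rewrite /cc -sumrB.
  transitivity (\sum_(i < L) wi i n * p.[n%:R]).
    apply: eq_bigr => i _; have iL := ltn_ord i.
    rewrite (leq_trans (ltnW iL) Ln) /pi' hornerD hornerN horner_comp !hornerE.
    have -> : w (n - i)%N = wi i n by rewrite /wi -(wL (n - i)%N); congr w; lia.
    rewrite natrB ?(leq_trans (ltnW iL))//; ring.
  rewrite -mulr_suml (_ : \sum_(i < L) wi i n = 0) ?mul0r//.
  rewrite -[RHS]w0 -[RHS](periodic_sum n.+1 wL) [RHS](reindex_inj rev_ord_inj)/=; apply: eq_bigr => i _.
  by rewrite /wi; congr w; have := ltn_ord i; lia.
pose D x : C := \sum_(i < L) (x ^+ i)%:C.
apply: (@qregular_div R S D (fun x => \sum_(i < L) T i x + \sum_(n < L) cc n * (x ^+ n)%:C)).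
- move=> x hx; apply/eqP; rewrite -subr_eq0 opprD addrA subr_eq0; apply/eqP.
  apply: (@hsum_uniq nat R (fun n => cc n * (x ^+ n)%:C)); last first.
    rewrite -(big_fset_lt L (fun n => cc n * (x ^+ n)%:C)); apply: hsum_fin => n.
    by rewrite in_fset_lt -leqNgt => /ccL ->; rewrite mul0r.
  rewrite /D mulr_sumr.
  have h1 : hsum (fun n => \sum_(i < L) (if (i <= n)%N then w (n - i)%N * p.[(n - i)%:R] else 0) * (x ^+ n)%:C)
      (\sum_(i < L) S x * (x ^+ i)%:C).
    apply: (@hsum_sum _ _ _ _ _ (fun (i : 'I_L) n => (if (i <= n)%N then _ else 0) * (x ^+ n)%:C)) => i _.
    apply: hsum_ext (hsumZr (x ^+ i)%:C (hsum_shift i (hS x hx))) => n; case: leqP => [h|_]; last by rewrite !mul0r.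
    by rewrite -mulrA -rmorphM -exprD subnK.
  have h2 : hsum (fun n => \sum_(i < L) wi i n * (pi' i).[n%:R] * (x ^+ n)%:C) (\sum_(i < L) T i x).
    apply: (@hsum_sum _ _ _ _ _ (fun (i : 'I_L) n => wi i n * (pi' i).[n%:R] * (x ^+ n)%:C)) => i _.
    by have [_] := hT i; apply.
  apply: hsum_ext (hsumB h1 h2) => n.
  by rewrite /cc mulrBl !mulr_suml.
- move=> x /andP[x0 _]; rewrite /D -(big_mkord xpredT (fun i => (x ^+ i)%:C)) big_ltn// expr0.
  rewrite -rmorph_sum -rmorphD nm_pos ?addr_ge0 ?sumr_ge0// ?lerDl ?sumr_ge0// => *; exact: exprn_ge0.
- by apply: qregular_sum => i; exact: qregularX.
- apply: qregularD; first by apply: qregular_sum => i; have [] := hT i.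
  by apply: qregular_sum => i; apply: qregularM; [exact: qregular_cst|exact: qregularX].
Qed.

End PeriodicSeries.

(** * Bernoulli polynomials by umbral calculus *)

Section Bernoulli.

Local Notation B := bernoulli_number.

Lemma size_bernoulli_seq n : size (bernoulli_seq n) = n.+1.
Proof. by elim: n => //= n IH; rewrite size_rcons IH. Qed.

Lemma nth_bernoulli_seq n j : (j <= n)%N -> (bernoulli_seq n)`_j = B j.
Proof.
elim: n => [|n IH]; first by rewrite leqn0 => /eqP ->.
rewrite leq_eqVlt => /orP[/eqP -> //|]; rewrite ltnS => jn.
by rewrite /= nth_rcons size_bernoulli_seq ltnS jn IH.
Qed.

Lemma bernoulli_rec n : \sum_(j < n) 'C(n, j)%:R * B j = (n == 1%N)%:R.
Proof.
case: n => [|[|n]]; first by rewrite big_ord0.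
  by rewrite big_ord1 bin0 mul1r /B.
rewrite big_ord_recr/= {2}/bernoulli_number/= nth_rcons size_bernoulli_seq ltnn eqxx binSn.
have n0 : n.+2%:R != 0 :> rat by rewrite pnatr_eq0.
rewrite mulrA mulrN divff// mulN1r; apply/eqP; rewrite subr_eq0; apply/eqP.
apply: eq_bigr => j _; have := ltn_ord j; by rewrite ltnS => /nth_bernoulli_seq ->.
Qed.

(* umb is the only linear functional M with M(p(X + 1) - p(X)) = p'(0); both the
   difference equation and the duplication formula follow, as
   B_n(y) = umb((X + y)^n). *)
Definition umb (p : {poly rat}) : rat := \sum_(i < size p) p`_i * B i.

Lemma umbE m (p : {poly rat}) : (size p <= m)%N -> umb p = \sum_(i < m) p`_i * B i.
Proof.
move=> h; rewrite /umb -(big_mkord xpredT (fun i => p`_i * B i)).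
rewrite -(big_mkord xpredT (fun i => p`_i * B i)) [RHS](big_cat_nat (n := size p))//=.
rewrite [X in _ = _ + X]big_nat_cond [X in _ = _ + X]big1 ?addr0// => i /andP[/andP[hi _] _].
by rewrite nth_default ?mul0r.
Qed.

Lemma umbD p q : umb (p + q) = umb p + umb q.
Proof.
have h : (size (p + q)%R <= maxn (size p) (size q))%N by exact: size_polyD.
rewrite (umbE h) (umbE (leq_maxl (size p) (size q))) (umbE (leq_maxr (size p) (size q))) -big_split.
by apply: eq_bigr => i _; rewrite coefD mulrDl.
Qed.

Lemma umbZ c p : umb (c *: p) = c * umb p.
Proof.
rewrite (umbE (size_scale_leq c p)) /umb mulr_sumr.
by apply: eq_bigr => i _; rewrite coefZ mulrA.
Qed.

Lemma umbXn n : umb 'X^n = B n.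
Proof.
rewrite /umb size_polyXn big_ord_recr/= coefXn eqxx mul1r big1 ?add0r// => i _.
by rewrite coefXn (ltn_eqF (ltn_ord i)) mul0r.
Qed.

Section Functional.
Variable M : {poly rat} -> rat.
Hypothesis MD : forall p q, M (p + q) = M p + M q.
Hypothesis MZ : forall c p, M (c *: p) = c * M p.

Lemma functional_sum (I : Type) (r : seq I) (f : I -> {poly rat}) : M (\sum_(i <- r) f i) = \sum_(i <- r) M (f i).
Proof.
elim: r => [|i r IH]; last by rewrite !big_cons MD IH.
by rewrite !big_nil -(scale0r (0 : {poly rat})) MZ mul0r.
Qed.

Lemma functional_coef p : M p = \sum_(i < size p) p`_i * M 'X^i.
Proof.
rewrite -{1}(coefK p) poly_def -(big_mkord xpredT (fun i => p`_i *: 'X^i)) functional_sum big_mkord.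
by apply: eq_bigr => i _; rewrite MZ.
Qed.

Lemma functional_shift_Xn n : M (('X + 1) ^+ n - 'X^n) = \sum_(i < n) 'C(n, i)%:R * M 'X^i.
Proof.
rewrite exprD1n big_ord_recr/= binn mulr1n addrK.
rewrite -(big_mkord xpredT (fun i => 'X^i *+ 'C(n, i))) functional_sum big_mkord.
by apply: eq_bigr => i _; rewrite -scaler_nat MZ.
Qed.

Lemma functional_shift p : M (p \Po ('X + 1) - p) = \sum_(i < size p) p`_i * \sum_(j < i) 'C(i, j)%:R * M 'X^j.
Proof.
have -> : p \Po ('X + 1) - p = \sum_(i < size p) p`_i *: (('X + 1) ^+ i - 'X^i).
  transitivity (\sum_(i < size p) p`_i *: ('X + 1) ^+ i - \sum_(i < size p) p`_i *: 'X^i).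
    by rewrite comp_polyE; congr (_ - _); rewrite -{1}(coefK p) poly_def.
  by rewrite -sumrB; apply: eq_bigr => i _; rewrite scalerBr.
rewrite -(big_mkord xpredT (fun i => p`_i *: (('X + 1) ^+ i - 'X^i))) functional_sum big_mkord.
by apply: eq_bigr => i _; rewrite MZ functional_shift_Xn.
Qed.

End Functional.

Lemma umb_shift p : umb (p \Po ('X + 1) - p) = p`_1.
Proof.
rewrite (functional_shift umbD umbZ).
transitivity (\sum_(i < size p) p`_i * ((i : nat) == 1%N)%:R).
  apply: eq_bigr => i _; rewrite -bernoulli_rec; congr (_ * _); apply: eq_bigr => j _.
  by rewrite umbXn.
case: (ltnP 1 (size p)) => h.
  rewrite (bigD1 (Ordinal h))//= mulr1 big1 ?addr0// => i /negbTE hi.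
  by rewrite (_ : (i : nat) == 1%N = false) ?mulr0.
rewrite nth_default// big1// => i _; rewrite ltn_eqF ?mulr0// (leq_trans (ltn_ord i))//.
Qed.

(** On X^(n+1) the condition expresses (n + 1) M(X^n) through the M(X^i) with i < n. *)
Lemma umb_unique (M : {poly rat} -> rat) : (forall p q, M (p + q) = M p + M q) ->
  (forall c p, M (c *: p) = c * M p) -> (forall p, M (p \Po ('X + 1) - p) = p`_1) ->
  forall p, M p = umb p.
Proof.
move=> MD MZ MS p; rewrite (functional_coef MD MZ) (functional_coef umbD umbZ).
apply: eq_bigr => i _; congr (_ * _); elim/ltn_ind: {p i}(i : nat) => n IH.
have h (M' : {poly rat} -> rat) : (forall p q, M' (p + q) = M' p + M' q) ->
    (forall c p, M' (c *: p) = c * M' p) -> (forall p, M' (p \Po ('X + 1) - p) = p`_1) ->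
    \sum_(i < n.+1) 'C(n.+1, i)%:R * M' 'X^i = ('X^(n.+1) : {poly rat})`_1.
  move=> MD' MZ' MS'; rewrite -(functional_shift_Xn MD' MZ') -MS' comp_Xn_poly//.
have := h M MD MZ MS; rewrite -(h umb umbD umbZ umb_shift) !big_ord_recr/= binSn.
rewrite (eq_bigr (fun i : 'I_n => 'C(n.+1, i)%:R * umb 'X^i)) => [/addrI|i _]; last by rewrite IH.
by move/(mulfI _); apply; rewrite pnatr_eq0.
Qed.

Lemma bernoulli_umb n y : (bernoulli_poly n).[y] = umb (('X + y%:P) ^+ n).
Proof.
rewrite exprDn /bernoulli_poly horner_poly.
rewrite -(big_mkord xpredT (fun i => 'X^(n - i) * y%:P ^+ i *+ 'C(n, i))) (functional_sum umbD umbZ) big_mkord.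
apply: eq_bigr => i _; rewrite -polyC_exp (mulrC 'X^(n - i)) mul_polyC -scaler_nat !umbZ umbXn.
by rewrite -mulrA; congr (_ * _); exact: mulrC.
Qed.

Lemma bernoulli_diff n y : (bernoulli_poly n.+1).[y + 1] - (bernoulli_poly n.+1).[y] = n.+1%:R * y ^+ n.
Proof.
pose p := ('X + y%:P) ^+ n.+1; have := umb_shift p.
have -> : p \Po ('X + 1) = ('X + (y + 1)%:P) ^+ n.+1.
  by rewrite /p rmorphXn/= comp_polyD comp_polyX comp_polyC polyCD; congr (_ ^+ _); ring.
have -> : p`_1 = n.+1%:R * y ^+ n.
  have := coef_deriv p 0; rewrite mulr1n => <-; rewrite -horner_coef0 /p deriv_exp derivD derivX derivC addr0 mul1r/=.
  by rewrite hornerMn horner_exp !hornerE mulr_natl.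
by move=> <-; rewrite -scaleN1r umbD umbZ mulN1r -!bernoulli_umb.
Qed.

Lemma bernoulli_duplication n y :
  (bernoulli_poly n.+1).[2 * y] = 2 ^+ n * ((bernoulli_poly n.+1).[y] + (bernoulli_poly n.+1).[y + 2^-1]).
Proof.
pose q0 : {poly rat} := 2 *: 'X; pose q1 : {poly rat} := 2 *: 'X + 1.
(* The translation by 1 carries 2X to 2X + 1, and 2X + 1 to 2(X + 1). The two terms therefore
   telescope to one difference of p(2X), whose derivative at 0 is 2 p'(0), and M satisfies the
   characterisation of [umb]. *)
pose M p : rat := 2^-1 * (umb (p \Po q0) + umb (p \Po q1)).
have hM p : M p = umb p.
  apply: umb_unique p => [p q|c p|p]; rewrite /M.
  - by rewrite !comp_polyD !umbD; ring.
  - by rewrite !comp_polyZ !umbZ; ring.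
  rewrite !comp_polyB -!comp_polyA.
  have -> : ('X + 1) \Po q0 = q1 by rewrite comp_polyD comp_polyX -polyC1 comp_polyC.
  have -> : ('X + 1) \Po q1 = q0 \Po ('X + 1).
    rewrite comp_polyD comp_polyX -polyC1 comp_polyC /q0 comp_polyZ comp_polyX /q1 -polyC1 scalerDr.
    by rewrite -addrA; congr (_ + _); rewrite scale_polyC mulr1 -polyCD.
  transitivity (2^-1 * umb ((p \Po q0) \Po ('X + 1) - (p \Po q0))).
    by rewrite comp_polyA -umbD; congr (_ * umb _); ring.
  rewrite umb_shift.
  have := coef_deriv (p \Po q0) 0; rewrite mulr1n => <-; rewrite deriv_comp -horner_coef0 hornerM horner_comp.
  have -> : q0.[0] = 0 by rewrite /q0 !hornerE.
  have -> : q0^`().[0] = 2 by rewrite /q0 derivZ derivX !hornerE.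
  by rewrite horner_coef0 coef_deriv mulr1n mulrC -mulrA mulfV ?mulr1.
rewrite bernoulli_umb -hM /M !rmorphXn/= !comp_polyD !comp_polyX !comp_polyC.
have -> : q0 + (2 * y)%:P = 2 *: ('X + y%:P) by rewrite scalerDr scale_polyC.
have -> : q1 + (2 * y)%:P = 2 *: ('X + (y + 2^-1)%:P).
  rewrite /q1 scalerDr scale_polyC mulrDr mulfV// polyCD polyC1; ring.
by rewrite !exprZn !umbZ -!bernoulli_umb exprS; field.
Qed.

End Bernoulli.

(** * Bernoulli sums weighted by omega *)

Section OmegaSums.
Variables (R : realType) (k N : nat) (chi : int -> R[i]).
Local Notation C := R[i].
Hypothesis hk : (0 < k)%N.
Hypothesis hN : (0 < N)%N.
Hypothesis hchi : dirichlet_char N chi.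

(* The n-th coefficient of 2^k psi(q^2) - psi(q), where psi(q) is the sum of
   chi(d) d^(k-1) q^d, is omega(n) n^(k-1); unlike chi, omega always has mean 0. *)
Definition omega (n : nat) : C := (if odd n then 0 else 2 * chi n./2%:Z) - chi n%:Z.

Lemma big_even (n : nat) (g : nat -> C) :
  \sum_(i < n + n) (if odd i then 0 else g i./2) = \sum_(i < n) g i.
Proof.
elim: n => [|n IH]; first by rewrite !big_ord0.
rewrite addSn addnS 2!big_ord_recr [RHS]big_ord_recr/= IH.
by rewrite oddD addbb addnn doubleK/= addr0.
Qed.

Lemma omega_sum (P : nat -> C) : \sum_(i < N + N) omega i * P i =
  \sum_(i < N) chi i%:Z * (2 * P (i + i)%N - (P i + P (N + i)%N)).
Proof.
under eq_bigr do rewrite mulrBl; rewrite sumrB.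
have -> : \sum_(i < N + N) (if odd i then 0 else 2 * chi i./2%:Z) * P i =
    \sum_(i < N) 2 * chi i%:Z * P (i + i)%N.
  rewrite -(big_even N (fun i => 2 * chi i%:Z * P (i + i)%N)); apply: eq_bigr => i _.
  case: ifPn; rewrite ?mul0r// => ev; congr (_ * P _).
  by have := odd_double_half i; rewrite (negbTE ev) add0n -addnn.
rewrite big_split_ord/= -big_split -sumrB; apply: eq_bigr => i _ /=.
rewrite (@chi_mod R N chi hchi (N + i)%:Z i 1); last by rewrite PoszD mulr1 addrC.
ring.
Qed.

Lemma omega_periodic n : omega (n + (N + N)) = omega n.
Proof.
rewrite /omega oddD oddD addbb addbF; congr (_ - _).
  case: ifP => // _; congr (2 * _); apply: (chi_mod hchi (q := 1)).
  by rewrite addnn halfD odd_double andbF doubleK add0n PoszD mulr1.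
by apply: (chi_mod hchi (q := 2)); rewrite !PoszD; ring.
Qed.

Lemma omega_mean0 : \sum_(i < N + N) omega i = 0.
Proof.
transitivity (\sum_(i < N + N) omega i * 1); first by apply: eq_bigr => i _; rewrite mulr1.
rewrite (omega_sum (fun=> 1)) big1// => i _; ring.
Qed.

(** A discrete primitive of n^(k-1) for the step 2N, the period of [omega]; it rescales B_k(x + 1) -
    B_k(x) = k x^(k-1). *)
Definition bern_prim : {poly C} :=
  ((N + N)%:R ^+ k.-1 / k%:R) *: (map_poly ratr (bernoulli_poly k) \Po ((N + N)%:R^-1 *: 'X)).

Local Notation br x := (ratr (bernoulli_poly k).[x] : C).

Lemma bern_primE n : bern_prim.[n%:R] = (N + N)%:R ^+ k.-1 / k%:R * br (n%:R / (N + N)%:R).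
Proof.
rewrite /bern_prim hornerZ horner_comp hornerZ hornerX.
have -> : (N + N)%:R^-1 * n%:R = ratr (n%:R / (N + N)%:R) :> C by rewrite fmorph_div !rmorph_nat mulrC.
by rewrite horner_map.
Qed.

Let NN0 : (N + N)%:R != 0 :> C.
Proof. by rewrite pnatr_eq0 addn_eq0 negb_and -!lt0n hN. Qed.

Let NNq : (N + N)%:R != 0 :> rat.
Proof. by rewrite pnatr_eq0 addn_eq0 negb_and -!lt0n hN. Qed.

Let Nq : N%:R != 0 :> rat. Proof. by rewrite pnatr_eq0 -lt0n. Qed.

Let k0 : k%:R != 0 :> C. Proof. by rewrite pnatr_eq0 -lt0n. Qed.

Lemma br_diff (x : rat) : br (x + 1) - br x = k%:R * ratr x ^+ k.-1.
Proof.
by rewrite -rmorphB; case: k hk => // k' _; rewrite bernoulli_diff rmorphM rmorph_nat rmorphXn.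
Qed.

Lemma bern_prim_diff n : bern_prim.[(n + (N + N))%:R] - bern_prim.[n%:R] = n%:R ^+ k.-1.
Proof.
have e : (n + (N + N))%:R / (N + N)%:R = n%:R / (N + N)%:R + 1 :> rat.
  by rewrite (natrD _ n) mulrDl divff.
rewrite !bern_primE -mulrBr e br_diff fmorph_div !rmorph_nat exprMn exprVn.
by field; rewrite k0 expf_neq0.
Qed.

(** The duplication formula merges the residues i and N + i modulo 2N into one residue modulo N. The
    powers [0 ^+ k.-1] matter for k = 1: [gen_bernoulli] has a = N where the sum over residues has
    0, and B_1(1) - B_1(0) = 1. *)
Lemma bern_prim_omega : \sum_(i < N + N) omega i * bern_prim.[i%:R] + omega 0 * 0 ^+ k.-1 =
  (2 ^+ k - 1) * gen_bernoulli k N chi / k%:R.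
Proof.
pose G := \sum_(i < N) chi i%:Z * br (i%:R / N%:R).
have -> : gen_bernoulli k N chi = N%:R ^+ k.-1 * (G + chi 0 * (k%:R * 0 ^+ k.-1)).
  rewrite /gen_bernoulli; congr (_ * _); rewrite big_nat_recr//= divff//.
  have -> : br 1 = br 0 + k%:R * 0 ^+ k.-1 by have := br_diff 0; rewrite add0r rmorph0 => <-; rewrite addrC subrK.
  have -> : chi N%:Z = chi 0 by apply: (chi_mod hchi (q := 1)); rewrite add0r mulr1.
  rewrite mulrDr addrA; congr (_ + _).
  rewrite /G -(big_mkord xpredT (fun i => chi i%:Z * br (i%:R / N%:R))) (big_ltn hN) mul0r.
  by rewrite addrC.
have -> : \sum_(i < N + N) omega i * bern_prim.[i%:R] = (2 ^+ k - 1) * (N%:R ^+ k.-1 * G) / k%:R.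
  rewrite (omega_sum (fun i => bern_prim.[i%:R])) /G !mulr_sumr mulr_suml; apply: eq_bigr => i _.
  rewrite !bern_primE.
  have -> : (i + i)%:R / (N + N)%:R = i%:R / N%:R :> rat by rewrite !natrD; field; rewrite ?Nq -?natrD ?NNq.
  have : br (i%:R / N%:R) = 2 ^+ k.-1 * (br (i%:R / (N + N)%:R) + br ((N + i)%:R / (N + N)%:R)).
    rewrite -rmorphD -(rmorph_nat (@ratr C)) -rmorphXn -rmorphM; congr ratr.
    have -> : i%:R / N%:R = 2 * (i%:R / (N + N)%:R) :> rat by rewrite !natrD; field; rewrite ?Nq -?natrD ?NNq.
    have -> : (N + i)%:R / (N + N)%:R = i%:R / (N + N)%:R + 2^-1 :> rat.
      by rewrite !natrD; field; rewrite ?Nq -?natrD ?NNq.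
    by case: k hk => // k' _; rewrite bernoulli_duplication.
  move: (br (_ / (N + N)%:R)) (br ((N + i)%:R / _)) => u v ->.
  have -> : (N + N)%:R ^+ k.-1 = 2 ^+ k.-1 * N%:R ^+ k.-1 :> C by rewrite -exprMn mulr_natl mulr2n natrD.
  have -> : 2 ^+ k = 2 * 2 ^+ k.-1 :> C by rewrite -exprS prednK.
  by field.
rewrite /omega/= (_ : 2 * _ - _ = chi 0); last by ring.
case: k hk k0 => // -[|k'] _ k0'; last by rewrite /= !expr0n/=; ring.
by rewrite /= !expr0 expr1; field.
Qed.

End OmegaSums.

(** * Alternating sums of regular functions *)

Section Alternating.
Variable R : realType.
Local Notation C := R[i].

(** 2 G2 - G1 is the alternating sum of (-1)^m f(q^m). Twice its partial sums, plus f(q), are up to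
    a boundary term a sum of second differences, each at most K (1 - q)^2 times an odd power of q;
    the geometric series leaves K (1 - q). *)
Lemma qregular_alternating (f : R -> C) : qregular f -> exists K : R, 0 <= K /\
  forall (q : R) (G1 G2 : C), 0 <= q < 1 -> hsum (fun m => f (q ^+ m.+1)) G1 ->
  hsum (fun m => f ((q ^+ 2) ^+ m.+1)) G2 -> nm (2 * (2 * G2 - G1) + f q) <= K * (1 - q).
Proof.
move=> [K [K0 hK]]; exists K; split=> // q G1 G2 hq h1 h2.
have [q0 q1] := andP hq; have y0 : 0 <= 1 - q by lra.
have hX n : 0 <= q ^+ n.+1 < 1 by rewrite exprn_ge0//= exprn_ilt1.
pose s M := \sum_(i < M) f (q ^+ i.+1); pose u M := \sum_(i < M) f ((q ^+ 2) ^+ i.+1).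
have key M : nm (2 * (2 * u M - s (M + M)%N) + f q - f (q ^+ (M + M).+1)) <= K * ((1 - q) * (1 - q ^+ (M + M))).
  elim: M => [|M IH].
    rewrite /u /s !big_ord0 expr1 (_ : _ - _ = 0); last by ring.
    by rewrite nm0 expr0 subrr !mulr0.
  set d := nm _ in IH; rewrite addSn addnS.
  have -> : 2 * (2 * u M.+1 - s (M + M).+2) + f q - f (q ^+ (M + M).+3) =
      (2 * (2 * u M - s (M + M)%N) + f q - f (q ^+ (M + M).+1)) -
      (f (q * (q * q ^+ (M + M).+1)) - 2 * f (q * q ^+ (M + M).+1) + f (q ^+ (M + M).+1)).
    rewrite /u /s !big_ord_recr/= -exprM mulnC muln2 -addnn addSn addnS -!exprS; ring.
  have hq' : 0 <= q <= 1 by rewrite q0 ltW.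
  have [_ _ b] := hK (q ^+ (M + M).+1) q (hX _) hq'.
  apply: (le_trans (nmD _ _)); rewrite nmN; apply: (le_trans (lerD IH b)).
  have Q0 : 0 <= q ^+ (M + M) by exact: exprn_ge0.
  rewrite -mulrDr ler_wpM2l// expr2 -[(1 - q) * (1 - q) * _]mulrA -mulrDr ler_wpM2l//.
  rewrite !exprS; set Q := q ^+ (M + M) in Q0 *.
  have : 0 <= (1 - q) * Q by exact: mulr_ge0.
  lra.
apply/ler_addgt0Pr => eps e0; have e8 : 0 < eps / 8 by rewrite divr_gt0.
have [n1 c1] := hsum_nat_cvg h1 e8; have [n2 c2] := hsum_nat_cvg h2 e8.
pose M := (n1 + n2)%N.
have a1 : nm (s (M + M)%N - G1) <= eps / 8 by apply: c1; rewrite /M; lia.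
have a2 : nm (s (M + M).+1 - G1) <= eps / 8 by apply: c1; rewrite /M; lia.
have a3 : nm (u M - G2) <= eps / 8 by apply: c2; rewrite /M; lia.
have kM := key M.
have fE : f (q ^+ (M + M).+1) = s (M + M).+1 - s (M + M)%N by rewrite /s big_ord_recr/= addrAC subrr add0r.
have -> : 2 * (2 * G2 - G1) + f q = (2 * (2 * u M - s (M + M)%N) + f q - f (q ^+ (M + M).+1)) +
    (s (M + M).+1 - G1) + (s (M + M)%N - G1) + (-4) * (u M - G2) by rewrite fE; ring.
have a4 : nm ((-4) * (u M - G2)) <= 4 * (eps / 8) by rewrite nmM nmN nm_nat ler_wpM2l.
have kM' : nm (2 * (2 * u M - s (M + M)%N) + f q - f (q ^+ (M + M).+1)) <= K * (1 - q).
  apply: (le_trans kM); rewrite ler_wpM2l// ler_piMr//.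
  by rewrite lerBlDr lerDl exprn_ge0.
apply: (le_trans (nmD _ _)); apply: (le_trans (lerD (nmD _ _) a4)).
apply: (le_trans (lerD (lerD (nmD _ _) (lexx _)) (lexx _))).
apply: (le_trans (lerD (lerD (lerD kM' a2) a1) (lexx _))); lra.
Qed.

End Alternating.

(** * Lambert series and the limit of psi2 at 1 *)

Section DivisorSeries.
Variables (R : realType) (k N : nat) (chi : int -> R[i]).
Local Notation C := R[i].
Hypothesis hk : (0 < k)%N.
Hypothesis hN : (0 < N)%N.
Hypothesis hchi : dirichlet_char N chi.

(** The value at 0 is imposed: for k = 1 and N = 1 the formula would give 1 there. This is the
    origin of the correction [omega chi 0 * 0 ^+ k.-1] in [psi2_hsum]. *)
Definition chipow (n : nat) : C := if n == 0%N then 0 else chi n%:Z * n%:R ^+ k.-1.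

Lemma chipow0 : chipow 0 = 0. Proof. by []. Qed.

Lemma nm_chi_le1 (n : int) : nm (chi n) <= 1.
Proof.
have [h|h] := boolP (coprimez n N); first by rewrite (nm_chi hN hchi h).
by move: h; rewrite -(chi_eq0 hchi) => /eqP ->; rewrite nm0.
Qed.

Lemma chipow_asum (x : R) : 0 <= x < 1 -> asum (fun n => chipow n * (x ^+ n)%:C).
Proof.
move=> hx; have := asum_poly ('X^(k.-1)) (fun n : nat => nm_chi_le1 n%:Z) hx.
apply: bsum_le => n; by rewrite /chipow hornerXn; case: eqP => // _; rewrite mul0r nm0 nm_ge0.
Qed.

Lemma psi_ex : exists psi : R -> C, forall x : R, 0 <= x < 1 -> hsum (fun n => chipow n * (x ^+ n)%:C) (psi x).
Proof.
suff /(@choice R C)[S hS] : forall x : R, exists s, 0 <= x < 1 -> hsum (fun n => chipow n * (x ^+ n)%:C) s.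
  by exists S.
move=> x; have [hx|hx] := pselect (0 <= x < 1); last by exists 0.
by have [t ht] := asum_hsum (chipow_asum hx); exists t.
Qed.

Variable psi : R -> C.
Hypothesis hpsi : forall x : R, 0 <= x < 1 -> hsum (fun n => chipow n * (x ^+ n)%:C) (psi x).

Lemma sum_dvdn_divisors (n : nat) (g : nat -> C) : (0 < n)%N ->
  \sum_(d < n.+1 | (d %| n)%N) g d = \sum_(d <- divisors n) g d.
Proof.
move=> n0; rewrite -(big_mkord (fun d => d %| n)%N) -big_filter; apply: perm_big; apply: uniq_perm.
- by rewrite filter_uniq// iota_uniq.
- exact: divisors_uniq.
- move=> d; rewrite mem_filter mem_index_iota -dvdn_divisors//; case h : (d %| n)%N => //=.
  by rewrite ltnS; exact: dvdn_leq.
Qed.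

(** A Lambert series: one absolutely convergent double sum over m and d of chi(d) d^(k-1) q^(d m), m
    >= 1, is summed once over d for each m and once along n = d m. *)
Lemma divisor_series (q : R) : 0 <= q < 1 -> exists t, hsum (fun m => psi (q ^+ m.+1)) t /\
  hsum (fun n => if n == 0%N then 0 else sigma_char k chi n * (q ^+ n)%:C) t.
Proof.
move=> hq; have [q0 q1] := andP hq.
pose u (p : nat * nat) : C := chipow p.2 * (q ^+ (p.2 * p.1.+1))%:C.
have au : asum u.
  have := bsum_prod (fun m => exprn_ge0 m q0) (fun d => nm_ge0 _) (bsum_geo_nat hq) (chipow_asum hq).
  apply: bsum_le => -[m d]; rewrite /u /= nmM nm_pos ?exprn_ge0//.
  have [->|d0] := posnP d; first by rewrite chipow0 !(mul0r, nm0) mulr0.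
  rewrite nmM (nm_pos (exprn_ge0 d q0)) mulrCA ler_wpM2l ?nm_ge0// -exprD ler_wiXn2l ?(ltW q1)//.
  by nia.
have [t ht] := asum_hsum au; exists t; split.
  apply: hsum_rows ht => m; rewrite /u/=.
  have hm : 0 <= q ^+ m.+1 < 1 by rewrite exprn_ge0//= exprn_ilt1.
  by apply: hsum_ext (hpsi hm) => d; rewrite -exprM mulnC.
apply: hsum_rows (hsum_graph (fun p => (p.2 * p.1.+1)%N) ht) => n /=.
have [->|n0] := posnP n.
  apply: (@hsum_ext _ R (fun=> 0)); last exact: hsum0.
  by move=> [m d]; rewrite /u/= muln_eq0 orbF; case: eqP => // ->; rewrite /chipow eqxx mul0r.
have h : hsum (fun d : nat => if (d %| n)%N then chipow d * (q ^+ n)%:C else 0) (sigma_char k chi n * (q ^+ n)%:C).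
  have -> : sigma_char k chi n * (q ^+ n)%:C =
      \sum_(d <- fset_lt n.+1) (if (d %| n)%N then chipow d * (q ^+ n)%:C else 0).
    rewrite big_fset_lt -big_mkcond (sum_dvdn_divisors (fun d => chipow d * (q ^+ n)%:C))// /sigma_char mulr_suml.
    rewrite !big_seq; apply: eq_bigr => d; rewrite -dvdn_divisors// => dn.
    by rewrite /chipow gtn_eqF// (dvdn_gt0 n0).
  apply: hsum_fin => d; rewrite in_fset_lt -leqNgt => nd.
  by case: ifP => // /(dvdn_leq n0); rewrite leqNgt nd.
apply: (@hsum_reindex R nat (nat * nat)%type (fun d => d %| n)%N (fun p => (p.2 * p.1.+1 == n)%N)
  (fun d => ((n %/ d).-1, d)) snd _ _ _ _ _ _ _ h) => //.
- by move=> d /negbTE ->.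
- by move=> p /negbTE ->.
- move=> d dn /=; have d0 : (0 < d)%N by exact: dvdn_gt0 dn.
  have dE : (d * (n %/ d).-1.+1)%N = n by rewrite prednK ?divn_gt0 ?(dvdn_leq n0 dn)// mulnC divnK.
  by rewrite dE eqxx dn /u /= dE.
- move=> [m d] /= /eqP nE; have d0 : (0 < d)%N by move: n0; rewrite -nE muln_gt0 => /andP[].
  by split; rewrite -nE ?dvdn_mulr// mulKn.
Qed.

Definition psi2 (x : R) : C := 2 ^+ k * psi (x ^+ 2) - psi x.

Lemma psi2_hsum (x : R) : 0 <= x < 1 ->
  hsum (fun n => omega chi n * ('X^(k.-1)).[n%:R] * (x ^+ n)%:C) (psi2 x + omega chi 0 * 0 ^+ k.-1).
Proof.
move=> hx; have [x0 x1] := andP hx.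
have hx2 : 0 <= x ^+ 2 < 1 by rewrite exprn_ge0//= exprn_ilt1.
have h2 : hsum (fun n => if odd n then 0 else 2 ^+ k * (chipow n./2 * (x ^+ n)%:C)) (2 ^+ k * psi (x ^+ 2)).
  have := hsumZ (2 ^+ k) (hpsi hx2).
  apply: (@hsum_reindex R nat nat predT (fun n => ~~ odd n) double half) => //.
  - by move=> n /negPn ->.
  - by move=> n _; rewrite odd_double doubleK -exprM mul2n.
  - by move=> n ev; have := odd_double_half n; rewrite (negbTE ev) add0n.
have h0 := @hsum_one _ R (fun n : nat => if n == 0%N then omega chi 0 * 0 ^+ k.-1 else 0) 0%N.
have {}h0 : hsum (fun n : nat => if n == 0%N then omega chi 0 * 0 ^+ k.-1 else 0) (omega chi 0 * 0 ^+ k.-1).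
  by apply: h0 => i /negbTE ->.
apply: hsum_ext (hsumD (hsumB h2 (hpsi hx)) h0) => n; rewrite hornerXn.
have [->|n0] := posnP n; first by rewrite /chipow/= mul0r !mulr0 subr0 add0r expr0 mulr1.
rewrite addr0 /omega /chipow (gtn_eqF n0).
case: ifPn => ev; first by ring.
have n2 : n./2 == 0%N = false.
  by apply/negbTE; have := odd_double_half n; rewrite (negbTE ev) add0n => h; apply: contraL n0 => /eqP h'; rewrite -h h'.
rewrite n2.
have -> : n%:R = 2 * n./2%:R :> C.
  by rewrite -{1}(odd_double_half n) (negbTE ev) add0n -mul2n natrM.
have -> : 2 ^+ k = 2 * 2 ^+ k.-1 :> C by rewrite -exprS prednK.
rewrite exprMn; ring.
Qed.

Lemma psi2_qregular : qregular psi2.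
Proof.
have NN0 : (0 < N + N)%N by rewrite addn_gt0 hN.
have [S [rS hS]] := periodic_series NN0 ('X^(k.-1)) (omega_periodic hchi) (omega_mean0 hchi).
apply: qregular_ext (qregularD rS (qregular_cst (- (omega chi 0 * 0 ^+ k.-1)))) => x hx.
by rewrite (hsum_uniq (hS x hx) (psi2_hsum hx)) addrK.
Qed.

(* Abel summation with the polynomial P such that P(n + 2N) - P(n) = n^(k-1). *)
Lemma psi2_limit : exists K : R, 0 <= K /\ forall x : R, 0 <= x < 1 ->
  nm (psi2 x + (2 ^+ k - 1) * gen_bernoulli k N chi / k%:R) <= K * (1 - x).
Proof.
have NN0 : (0 < N + N)%N by rewrite addn_gt0 hN.
set P := bern_prim R k N; set om := omega chi.
have [T [[KT [KT0 hKT]] hT]] := periodic_series NN0 P (omega_periodic hchi) (omega_mean0 hchi).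
have [KS [KS0 hKS]] := qregularD psi2_qregular (qregular_cst (om 0%N * 0 ^+ k.-1)).
pose L := (N + N)%N; pose Q := \sum_(i < L) nm (om i * P.[i%:R]) * i%:R.
have Q0 : 0 <= Q by apply: sumr_ge0 => i _; rewrite mulr_ge0 ?nm_ge0.
exists ((KS + KT) * L%:R + Q); split=> [|x hx]; first by rewrite addr_ge0// mulr_ge0// addr_ge0.
have [x0 x1] := andP hx.
have pow n : nm (1 - (x ^+ n)%:C) <= n%:R * (1 - x).
  rewrite -(rmorph1 (real_complex R)) -rmorphB nm_pos; last by rewrite subr_ge0 exprn_ile1// ltW.
  elim: n => [|n IH]; first by rewrite expr0 subrr mul0r.
  rewrite -natr1 mulrDl mul1r exprS.
  have : 0 <= (1 - x) * (1 - x ^+ n) by rewrite mulr_ge0 ?subr_ge0 ?exprn_ile1// ltW.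
  lra.
set S := psi2 x + om 0%N * 0 ^+ k.-1.
have bS : nm S <= KS by have [] := hKS x 0 hx; rewrite ?lexx ?ler01.
have bT : nm (T x) <= KT by have [] := hKT x 0 hx; rewrite ?lexx ?ler01.
rewrite -(bern_prim_omega hk hN hchi) -/P -/om -/L.
(* Subtracting a series shifted by L cancels every term from index L on, by [bern_prim_diff] and the
   period L of [omega]; the terms below L remain. *)
have E : (x ^+ L)%:C * S = T x - (x ^+ L)%:C * T x - \sum_(i < L) om i * P.[i%:R] * (x ^+ i)%:C.
  have h1 := hT x hx; have h2 := hsumZ (x ^+ L)%:C (hsum_shift L (hsumD h1 (psi2_hsum hx))).
  have h3 := hsumB h1 h2.
  have <- : T x - (x ^+ L)%:C * (T x + S) = \sum_(i < L) om i * P.[i%:R] * (x ^+ i)%:C.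
    apply: (hsum_uniq h3); rewrite -(big_fset_lt L (fun i => om i * P.[i%:R] * (x ^+ i)%:C)).
    have h4 := @hsum_fin _ R (fun n => if (L <= n)%N then 0 else om n * P.[n%:R] * (x ^+ n)%:C) (fset_lt L).
    rewrite (eq_big_seq (fun n => if (L <= n)%N then 0 else om n * P.[n%:R] * (x ^+ n)%:C)); last first.
      by move=> n; rewrite in_fset_lt => nL; rewrite leqNgt nL.
    apply: hsum_ext (h4 _); last by move=> n; rewrite in_fset_lt -leqNgt => ->.
    move=> n; case: leqP => [Ln|_]; last by rewrite mulr0 subr0.
    have nE : n = (n - L + L)%N by rewrite subnK.
    rewrite hornerXn {1 2 3}nE exprD rmorphM /= (omega_periodic hchi).
    have := bern_prim_diff R hk hN (n - L)%N; rewrite -/P -/L -/om => <-; ring.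
  ring.
have -> : psi2 x + (\sum_(i < L) om i * P.[i%:R] + om 0%N * 0 ^+ k.-1) =
    (1 - (x ^+ L)%:C) * (S + T x) + \sum_(i < L) om i * P.[i%:R] * (1 - (x ^+ i)%:C).
  have -> : \sum_(i < L) om i * P.[i%:R] * (1 - (x ^+ i)%:C) =
      \sum_(i < L) om i * P.[i%:R] - \sum_(i < L) om i * P.[i%:R] * (x ^+ i)%:C.
    by rewrite -sumrB; apply: eq_bigr => i _; rewrite mulrBr mulr1.
  transitivity (S + \sum_(i < L) om i * P.[i%:R]); first by rewrite /S; ring.
  have -> : \sum_(i < L) om i * P.[i%:R] * (x ^+ i)%:C = T x - (x ^+ L)%:C * T x - (x ^+ L)%:C * S by rewrite E; ring.
  ring.
apply: (le_trans (nmD _ _)); rewrite [leRHS]mulrDl; apply: lerD.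
  rewrite nmM [leLHS]mulrC -[leRHS]mulrA; apply: ler_pM (nm_ge0 _) (nm_ge0 _) _ (pow L).
  exact: le_trans (nmD _ _) (lerD bS bT).
rewrite /Q mulr_suml; apply: (le_trans (nm_sum _ _ _)); apply: ler_sum => i _.
by rewrite nmM -mulrA ler_wpM2l ?nm_ge0.
Qed.

End DivisorSeries.

(** * Evaluation of the constant term *)

Section EisensteinConstant.
Variables (R : realType) (k N : nat) (chi : int -> R[i]) (F : 'M[R[i]]_2 -> R[i]).
Local Notation C := R[i].
Local Notation e := (@cexp2pi R).
Hypothesis hk : (0 < k)%N.
Hypothesis hN : (0 < N)%N.
Hypothesis hchi : dirichlet_char N chi.
Hypothesis hpar : chi (-1) = (-1) ^+ k.
Hypothesis hF : siegel_form k N chi F.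
Variables (a : int -> int -> int -> C) (c : int -> C -> C -> C).
Hypothesis te : tube_expansion 1 (F3 F) a c.

Let iy (y : R) : C := 0 +i* y.
Let f0 (y : R) : C := c 0 (iy y) 0.

Lemma e_iy (n : nat) (y : R) : e (n%:R * iy y) = (expR (- (2 * pi * y)) ^+ n)%:C.
Proof.
rewrite eX rmorphXn; congr (_ ^+ _).
rewrite /cexp2pi/= mulr0 cos0 sin0; exact: mulr1.
Qed.

(** The inversion tau -> -1 / tau moves the cusp 0 to infinity, where the slice is a power series in
    q(u) = exp(-2 pi u / N) by the Koecher principle. For u >= 1 the estimate q(u)^n <= q(u)
    q(1)^(n-1) compares its tail with the series at u = 1, which is the source of M. *)
Lemma cusp0_slice : exists (h : R -> C) (b0 : C) (M : R), [/\ 0 <= M,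
  forall y : R, 0 < y -> f0 y = iy y^-1 ^+ k * h y^-1
  & forall u : R, 1 <= u -> nm (h u - b0) <= M * expR (- (2 * pi * (u / N%:R)))].
Proof.
pose S : 'M[int]_2 := mk2 0 (-1) 1 0; have hS : \det S = 1 by rewrite /S det_mk2; ring.
have [aS [cS teS]] := GM_expansion hN hchi hF hS.
pose h u := cS 0 (iy u) 0; pose b (n : nat) := aS n%:Z 0 0; pose q (u : R) : R := expR (- (2 * pi * (u / N%:R))).
have NR : 0 < N%:R :> R by rewrite ltr0n.
have hh (u : R) : 0 < u -> hsum (fun n : nat => b n * (q u ^+ n)%:C) (h u).
  move=> u0; have [_ _ hs] := teS.
  apply: (@hsum_reindex R _ _ (fun p : int * int => (0 <= p.1) && (p.2 == 0)) predT
     (fun p => `|p.1|%N) (fun n => (n%:Z, 0)) _ _ _ _ _ _ _ (hs 0 (iy u) 0 u0)) => //=.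
  - move=> [n r] /= hnr; rewrite (koecher hN hchi hF hS teS) ?mul0r//.
    apply: contra hnr => /and3P[-> _]; rewrite mulr0 => r2 /=.
    rewrite -sqrf_eq0; apply/eqP/le_anti; rewrite sqr_ge0 andbT.
    by rewrite -(ler_pM2l (_ : 0 < N%:Z)) ?mulr0// ltz_nat.
  - move=> [[n|n] r] //= /eqP ->; split => //; congr (_ * _).
    rewrite /q -e_iy /fj mul0r addr0 -pmulrn -[n%:R * iy u / N%:R]mulrA; congr (e (_ * _)).
    rewrite /iy natC -fmorphV -[LHS]/(0 +i* (u / N%:R)); apply: complexP; rewrite ?ReM ?ImM/=; ring.
have [B hB] := hsum_asum (hh 1 ltr01).
have B0 : 0 <= B by have := hB fset0; rewrite big_seq_fset0.
have q1 : 0 < q 1 by exact: expR_gt0.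
exists h, (b 0%N), (B / q 1); split; first by rewrite divr_ge0// ltW.
  move=> y y0; have yi : 0 < y^-1 by rewrite invr_gt0.
  have := GM_slice te hS teS 0 0 (yi : 0 < complex.Im (iy y^-1)); rewrite /S !mk2E.
  set j := _ + _; have jE : j = iy y^-1 by rewrite /j mulr0z mulr1z mul1r addr0.
  have j0 : iy y^-1 != 0 by rewrite -nm_gt0; apply: lt_le_trans (nm_Im _); rewrite /= gtr0_norm.
  rewrite jE !mul0r oppr0 e0 mulr1 /f0 /h => ->.
  have -> : (0 + (-1)%:~R) / iy y^-1 = iy y.
    apply: (mulIf j0); rewrite divfK// add0r mulrN1z; apply: complexP; rewrite ?ReM ?ImM/=; last by ring.
    by rewrite mul0r add0r mulfV ?gt_eqF.
  by rewrite mulrA mulfV ?mul1r// expf_neq0.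
move=> u u1; have u0 : 0 < u by lra.
have h0 := @hsum_one _ R (fun n : nat => if n == 0%N then b 0%N else 0) 0%N.
have {}h0 : hsum (fun n : nat => if n == 0%N then b 0%N else 0) (b 0%N).
  by apply: h0 => i /negbTE ->.
have qr : q u <= q 1 by rewrite ler_expR lerN2 ler_pM2l ?mulr_gt0 ?pi_gt0// ler_pM2r ?invr_gt0.
have qu : 0 < q u by exact: expR_gt0.
apply: (hsum_nm (hsumB (hh u u0) h0)) => A.
apply: (@le_trans _ _ (\sum_(i <- A) (q 1)^-1 * q u * nm (b i * (q 1 ^+ i)%:C))); last first.
  rewrite -mulr_sumr (_ : B / q 1 * _ = (q 1)^-1 * q u * B); last by rewrite -/(q u); ring.
  by rewrite ler_wpM2l// mulr_ge0 ?invr_ge0 ?(ltW q1) ?(ltW qu).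
apply: ler_sum => -[|n] _.
  by rewrite /= expr0 mulr1 subrr nm0 !mulr_ge0 ?nm_ge0 ?invr_ge0 ?(ltW q1) ?(ltW qu).
rewrite /= subr0 !nmM !nm_pos ?exprn_ge0 ?(ltW q1) ?(ltW qu)// mulrCA ler_wpM2l ?nm_ge0//.
rewrite exprS [q 1 ^+ _]exprS mulrACA mulVf ?gt_eqF// mul1r ler_wpM2l ?(ltW qu)//.
by rewrite lerXn2r ?nnegrE ?(ltW q1) ?(ltW qu).
Qed.

Lemma exprn_le_expR (d : R) (j : nat) : 0 < d -> exists K : R, 0 <= K /\
  forall u, 0 <= u -> u ^+ j <= K * expR (d * u).
Proof.
move=> d0; pose s := d / j.+1%:R; have s0 : 0 < s by rewrite divr_gt0.
have sj : j%:R * s <= d.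
  by rewrite /s mulrCA ler_piMr ?(ltW d0)// ler_pdivrMr ?ltr0n// mul1r ler_nat.
exists (s ^- j); split=> [|u u0]; first by rewrite invr_ge0 exprn_ge0// ltW.
rewrite [leRHS]mulrC ler_pdivlMr ?exprn_gt0// -exprMn.
apply: (@le_trans _ _ (expR (s * u) ^+ j)).
  rewrite lerXn2r ?nnegrE ?expR_ge0//; first by rewrite mulr_ge0// ltW.
  by apply: le_trans (expR_ge1Dx _); rewrite mulrC lerDr.
by rewrite -expRM_natl ler_expR mulrA ler_wpM2r.
Qed.

(* The weight-k factors cancel in this combination, so that it inherits the
   decay of h(1/(2y)) - h(1/y). *)
Lemma cusp0_decay : exists K : R, 0 <= K /\ forall y, 0 < y <= 2^-1 -> nm (2 ^+ k * f0 (2 * y) - f0 y) <= K * y.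
Proof.
have [h [b0 [M [M0 hf hb]]]] := cusp0_slice.
have NR : 0 < N%:R :> R by rewrite ltr0n.
have d0 : 0 < pi / N%:R :> R by rewrite divr_gt0 ?pi_gt0.
(* The exponent k + 1 pays for the weight factor u^k and for the factor y = 1 / u of the bound. *)
have [K [K0 hK]] := exprn_le_expR k.+1 d0.
exists (2 * M * K); split=> [|y /andP[y0 y2]]; first by rewrite !mulr_ge0.
have y20 : 0 < 2 * y by rewrite mulr_gt0.
pose u := y^-1; have u0 : 0 < u by rewrite invr_gt0.
have u2 : 2 <= u by rewrite -[2]invrK lef_pV2 ?posrE.
have uE : (2 * y)^-1 = u / 2 by rewrite invfM mulrC.
have -> : 2 ^+ k * f0 (2 * y) - f0 y = iy u ^+ k * (h (u / 2) - h u).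
  have := hf _ y20; have := hf _ y0; rewrite uE -/u => -> ->.
  have -> : iy u = 2 * iy (u / 2) by apply: complexP; rewrite ?ReM ?ImM/=; field.
  by rewrite exprMn; ring.
have h1 : nm (h (u / 2) - b0) <= M * expR (- (pi / N%:R * u)).
  apply: le_trans (hb _ _) _; first by lra.
  by rewrite ler_wpM2l// ler_expR lerN2 le_eqVlt; apply/orP; left; apply/eqP; field; rewrite gt_eqF.
have h2 : nm (h u - b0) <= M * expR (- (pi / N%:R * u)).
  apply: le_trans (hb _ _) _; first by lra.
  rewrite ler_wpM2l// ler_expR lerN2 (_ : 2 * pi * (u / N%:R) = pi / N%:R * u * 2); last by ring.
  by rewrite ler_peMr ?ler1n// mulr_ge0// ltW.
have h3 : nm (h (u / 2) - h u) <= 2 * M * expR (- (pi / N%:R * u)).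
  by apply: (le_trans (nm_subD _ b0 _)); rewrite (nmB b0); lra.
have nu : nm (iy u) = u by rewrite nm_def/= expr0n add0r sqrtr_sqr gtr0_norm.
rewrite nmM nmX nu; have hu := hK u (ltW u0).
apply: (le_trans (ler_wpM2l (exprn_ge0 _ (ltW u0)) h3)).
rewrite expRN mulrCA -[leRHS]mulrA ler_wpM2l ?mulr_ge0// ler_pdivrMr ?expR_gt0//.
rewrite mulrAC -(ler_pM2r u0) -exprSr (_ : _ * y * u = K * expR (pi / N%:R * u))//.
by rewrite -mulrA /u mulfV ?mulr1// gt_eqF.
Qed.

Hypothesis sym : forall l, (0 < l)%N -> forall T, W k N chi l (A3 a) (swap3 T) = W k N chi l (A3 a) T.

Lemma f0_divisor_series (y : R) t : 0 < y ->
  hsum (fun n => if n == 0%N then 0 else sigma_char k chi n * (expR (- (2 * pi * y)) ^+ n)%:C) t ->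
  f0 y = a 0 0 0 + a 0 0 1 * t.
Proof.
move=> y0 ht; have h1 := c0_hsum hN hchi hF te 0 (y0 : 0 < complex.Im (iy y)).
have h0 := @hsum_one _ R (fun n : nat => if n == 0%N then a 0 0 0 else 0) 0%N.
have {}h0 : hsum (fun n : nat => if n == 0%N then a 0 0 0 else 0) (a 0 0 0).
  by apply: h0 => i /negbTE ->.
apply: (hsum_uniq h1); apply: hsum_ext (hsumD h0 (hsumZ (a 0 0 1) ht)) => n.
have [->|n0] := posnP n; first by rewrite mulr0 addr0 e_iy expr0 mulr1.
by rewrite add0r (coef_sigma hk hchi hpar hF te sym)// e_iy mulrA.
Qed.

Lemma eisenstein_constant : a 0 0 0 = a 0 0 1 * (- gen_bernoulli k N chi / (2 * k%:R)).
Proof.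
have [psi hpsi] := psi_ex k hN hchi.
have [K1 [K10 alt]] := qregular_alternating (psi2_qregular hk hN hchi hpsi).
have [K2 [K20 lim]] := psi2_limit hk hN hchi hpsi.
have [K3 [K30 dec]] := cusp0_decay.
pose q (y : R) := expR (- (2 * pi * y)).
have hq y : 0 < y -> 0 <= q y < 1 by move=> y0; rewrite expR_ge0 expR_lt1 oppr_lt0 !mulr_gt0 ?pi_gt0.
have q2 y : q (2 * y) = q y ^+ 2 by rewrite /q -expRM_natl; congr expR; ring.
set B := (2 ^+ k - 1) * gen_bernoulli k N chi / k%:R in lim.
(* For g(y) = 2^k f0(2y) - f0(y), the quantity 2 (2 g(2y) - g(y)) is 2 (2^k - 1) a(0, 0, 0) plus
   a(0, 0, 1) times twice the alternating sum of psi2, and the latter tends to B. X is this limit,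
   which is 0 because g tends to 0. *)
pose X := 2 * (2 ^+ k - 1) * a 0 0 0 + a 0 0 1 * B.
pose D := 2 * (5 * K3) + nm (a 0 0 1) * ((K1 + K2) * (2 * pi)).
have bound y : 0 < y <= 4^-1 -> nm X <= D * y.
  move=> /andP[y0 y4].
  have y20 : 0 < 2 * y by lra. have y40 : 0 < 2 * (2 * y) by lra.
  have [t1 [s1 d1]] := divisor_series hk hN hchi hpsi (hq _ y0).
  have [t2 [s2 d2]] := divisor_series hk hN hchi hpsi (hq _ y20).
  have [t4 [s4 d4]] := divisor_series hk hN hchi hpsi (hq _ y40).
  have g1 := dec y; rewrite (f0_divisor_series y0 d1) (f0_divisor_series y20 d2) in g1.
  have g2 := dec (2 * y); rewrite (f0_divisor_series y20 d2) (f0_divisor_series y40 d4) in g2.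
  have {}g1 : nm (2 ^+ k * (a 0 0 0 + a 0 0 1 * t2) - (a 0 0 0 + a 0 0 1 * t1)) <= K3 * y.
    by apply: g1; rewrite y0/=; lra.
  have {}g2 : nm (2 ^+ k * (a 0 0 0 + a 0 0 1 * t4) - (a 0 0 0 + a 0 0 1 * t2)) <= K3 * (2 * y).
    by apply: g2; rewrite y20/=; lra.
  have G1 : hsum (fun m => psi2 k psi (q y ^+ m.+1)) (2 ^+ k * t2 - t1).
    apply: hsum_ext (hsumB (hsumZ (2 ^+ k) s2) s1) => m.
    by rewrite /psi2 q2 -!exprM mulnC.
  have G2 : hsum (fun m => psi2 k psi ((q y ^+ 2) ^+ m.+1)) (2 ^+ k * t4 - t2).
    apply: hsum_ext (hsumB (hsumZ (2 ^+ k) s4) s2) => m.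
    by rewrite /psi2 !q2 -!exprM; congr (_ * psi (_ ^+ _) - psi (_ ^+ _)); lia.
  have b1 := alt _ _ _ (hq _ y0) G1 G2; have b2 := lim _ (hq _ y0).
  have q1 : 1 - q y <= 2 * pi * y by have := expR_ge1Dx (- (2 * pi * y)); rewrite /q; lra.
  set u := 2 * (_ - _) + _ in b1; set v := _ + B in b2.
  have -> : X = 2 * (2 * (2 ^+ k * (a 0 0 0 + a 0 0 1 * t4) - (a 0 0 0 + a 0 0 1 * t2))
       - (2 ^+ k * (a 0 0 0 + a 0 0 1 * t2) - (a 0 0 0 + a 0 0 1 * t1))) - a 0 0 1 * (u - v).
    by rewrite /X /u /v; ring.
  move: g1 g2; set g1 := (2 ^+ k * (a 0 0 0 + a 0 0 1 * t2) - _); set g2 := _ - (a 0 0 0 + _) => b3 b4.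
  have b5 : nm (2 * (2 * g2 - g1)) <= 2 * (5 * K3) * y.
    rewrite nmM nm_nat -mulrA ler_wpM2l//; apply: (le_trans (nmD _ _)); rewrite nmN nmM nm_nat.
    by move: b3 b4; move: (nm g1) (nm g2) => x1 x2; lra.
  have b6 : nm (u - v) <= (K1 + K2) * (2 * pi) * y.
    apply: (le_trans (nmD _ _)); rewrite nmN; apply: (le_trans (lerD b1 b2)).
    by rewrite -mulrDl -mulrA ler_wpM2l// addr_ge0.
  apply: (le_trans (nmD _ _)); rewrite nmN /D [leRHS]mulrDl; apply: lerD => //.
  by rewrite nmM -mulrA ler_wpM2l ?nm_ge0.
have D0 : 0 <= D.
  apply: addr_ge0; first by rewrite !mulr_ge0.
  apply: mulr_ge0; first exact: nm_ge0.
  by rewrite mulr_ge0 ?addr_ge0// mulr_ge0// pi_ge0.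
have X0 : X = 0.
  apply/eqP; rewrite -nm_eq0; apply/eqP/le_anti; rewrite nm_ge0 andbT.
  apply/ler_addgt0Pr => eps e0; rewrite add0r.
  pose y := Num.min 4^-1 (eps / (D + 1)).
  have y0 : 0 < y by rewrite lt_min !divr_gt0 ?invr_gt0//; lra.
  have yy : y <= 4^-1 by rewrite ge_min lexx.
  have ye : y <= eps / (D + 1) by rewrite ge_min lexx orbT.
  apply: (le_trans (bound y _)); first by rewrite y0.
  apply: (le_trans (ler_wpM2l D0 ye)); rewrite mulrCA ler_piMr ?(ltW e0)// ler_pdivrMr; lra.
have k0 : k%:R != 0 :> C by rewrite pnatr_eq0 -lt0n.
have k2 : 2 ^+ k - 1 != 0 :> C.
  rewrite subr_eq0 -natrX -[1]/(1%:R) eqr_nat; case: k hk => // k' _; rewrite expnS.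
  by have := expn_gt0 2 k'; case: (2 ^ k')%N => // m; rewrite mul2n doubleS.
have k3 : 2 * (2 ^+ k - 1) != 0 :> C by rewrite mulf_neq0// pnatr_eq0.
apply: (mulfI k3); apply/eqP; rewrite -subr_eq0; apply/eqP; rewrite -[RHS]X0 /X /B.
by field.
Qed.

End EisensteinConstant.

Theorem theorem4p1 (R : realType) (k N : nat) (hk : (0 < k)%N) (hN : (0 < N)%N)
    (chi : int -> R[i]) (hchi : dirichlet_char N chi)
    (hpar : chi (-1) = (-1) ^+ k)
    (F : 'M[R[i]]_2 -> R[i]) (hF : siegel_form k N chi F) :
  is_sk_lift k N chi F <->
  forall l : nat, (0 < l)%N -> symmetry_relation k N chi F l.
Proof.
have [a [c te]] := F3_expansion hN hchi hF; split.
  move=> [Phi [c' [hJ hE hL]]] l l0; apply: (lift_symmetric hk hN hchi hpar hF te hJ hE _ l0).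
  by move=> t1 z t2 dm; apply: hL; apply/siegel_upperE.
move=> sym; have symW l : (0 < l)%N -> forall T, W k N chi l (A3 a) (swap3 T) = W k N chi l (A3 a) T.
  by move=> l0; apply/(symmetry_W hN hchi hpar hF te l0)/sym.
exact: symmetric_lift te symW (eisenstein_constant hk hN hchi hpar hF te symW).
Qed.
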